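(* Let $\Omega \subseteq \mathbb{R}^N$ be an open and bounded Lipschitz domain and let $U \subseteq \mathbb{R}^N$ be an open set with $\Omega \Subset U$. Let $1 \le p \le q < \infty$ with $q>1$, and let $a$ be a non-negative function satisfying $a = \sigma\omega$, where $\omega \in A_q(U) \cap L^\infty(\Omega)$ and $\sigma : U \to [0,\infty)$. Set $$\mathcal{F}[v;\Omega] = \int_\Omega \left(|\nabla v|^p + a(x)|\nabla v|^q\right)\,dx .$$ Let $u \in W^{1,1}_0(\Omega)$ be such that $\mathcal{F}[u;\Omega] < \infty$. Suppose that either (i) $\sigma \in \mathcal{Z}^{\varkappa}(\Omega)$ for some $\varkappa > 0$ such that $q \le p + \varkappa\max(1, p/N)$; or (ii) $u \in C^{0,\gamma}(\Omega)$ and $\sigma \in \mathcal{Z}^{\varkappa}(\Omega)$ for some $\gamma \in (0,1)$ and $\varkappa > 0$ such that $q \le p + \frac{\varkappa}{1-\gamma}$. Then there exists a sequence $\{u_n\}_n \subset C_c^\infty(\Omega)$ such that $$\mathcal{F}[u_n;\Omega] \xrightarrow{n\to\infty} \mathcal{F}[u;\Omega] \quad\text{and}\quad \|u-u_n\|_{W^{1,1}(\Omega)} \xrightarrow{n\to\infty} 0 .$$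
   Context: $\Omega \Subset U$ means that $\overline{\Omega}$ is a compact subset of $U$. For an open set $V\subseteq\mathbb{R}^N$ and $\varkappa>0$, a non-negative function $\sigma$ belongs to $\mathcal{Z}^{\varkappa}(V)$ if there is a constant $C$ such that $\sigma(x) \le C\left(\sigma(y) + |x-y|^{\varkappa}\right)$ for all $x,y \in V$. For $r \in (1,\infty)$ and an open set $V\subseteq\mathbb{R}^N$, a function $\omega : V \to [0,\infty)$ belongs to the local Muckenhoupt class $A_r(V)$ if $$\sup_{B \subseteq V} \left(\frac{1}{|B|}\int_B \omega \,dz\right)\left(\frac{1}{|B|}\int_B \omega^{-\frac{1}{r-1}}\,dz\right)^{r-1} < \infty,$$ where the supremum is over all balls $B$ contained in $V$ (and $\omega^{-1/(r-1)}=+\infty$ where $\omega=0$). $\omega\in L^\infty(\Omega)$ means that the restriction of $\omega$ to $\Omega$ is essentially bounded. $C^{0,\gamma}(\Omega)$ denotes the $\gamma$-Hölder continuous functions on $\Omega$. *)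

(* Defs.v *)
From HB Require Import structures.
From mathcomp Require Import all_boot all_order all_algebra.
From mathcomp Require Import all_classical all_reals all_analysis.

Set Implicit Arguments.
Unset Strict Implicit.
Unset Printing Implicit Defensive.

Import Order.TTheory GRing.Theory Num.Theory.
Import numFieldNormedType.Exports.

Local Open Scope classical_set_scope.
Local Open Scope ring_scope.

(* The ambient space R^N with N = n.+1 >= 1 is
   'rV[R]_n.+1.  Its library norm is the sup norm, which is only used for the
   (norm-independent) topological notions; distances, balls and the length of
   gradients are taken with the Euclidean norm below. *)

Section Euclidean.
Context {R : realType} {n : nat}.
Implicit Types x y : 'rV[R]_n.

Definition enorm x : R := Num.sqrt (\sum_(i < n) x ord0 i ^+ 2).

Definition eball x (r : R) : set 'rV[R]_n := [set y | enorm (y - x) < r].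

End Euclidean.

Section LebesgueMeasure.
Context {R : realType} {n : nat}.
Local Notation V := 'rV[R]_n.+1.

Definition box (c : V * V) : set V :=
  [set x | forall i, c.1 ord0 i <= x ord0 i <= c.2 ord0 i].

Definition box_vol (c : V * V) : R :=
  \prod_(i < n.+1) Num.max 0 (c.2 ord0 i - c.1 ord0 i).

Local Open Scope ereal_scope.

Definition lebesgue_outer (A : set V) : \bar R :=
  ereal_inf [set \sum_(k <oo) (box_vol (c k))%:E |
              c in [set c : nat -> V * V | A `<=` \bigcup_k box (c k)]].

Let vol_ge0 c : 0 <= (box_vol c)%:E.
Proof. by rewrite lee_fin; apply: prodr_ge0 => i _; rewrite le_max lexx. Qed.

Let outer_ge0 A : 0 <= lebesgue_outer A.
Proof.
by apply: le_ereal_inf_tmp => x [c _ <-]; apply: nneseries_ge0 => k _ _.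
Qed.

Let outer0 : lebesgue_outer set0 = 0.
Proof.
apply/eqP; rewrite eq_le outer_ge0 andbT.
apply: ereal_inf_lbound; exists (fun=> (0%R, 0%R)) => //=.
apply: eseries0 => k _ _; congr EFin.
by rewrite /box_vol big_ord_recl /= subrr maxxx mul0r.
Qed.

Let outer_le : {homo lebesgue_outer : A B / A `<=` B >-> A <= B}.
Proof.
move=> A B AB; apply/ereal_inf_le_tmp => x [c Bc <-].
by exists c => //; apply: subset_trans AB Bc.
Qed.

Let outer_sigma_subadditive : sigma_subadditive lebesgue_outer.
Proof.
move=> A; have [[i ioo]|] := pselect (exists i, lebesgue_outer (A i) = +oo).
  rewrite (eseries_pinfty _ _ ioo) ?leey// => k _.
  by rewrite -ltNye (lt_le_trans _ (outer_ge0 _)).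
rewrite -forallNE => Aoo.
suff add2e (e : {posnum R}) : lebesgue_outer (\bigcup_k A k) <=
    \sum_(i <oo) lebesgue_outer (A i) + e%:num%:E.
  by apply/lee_addgt0Pr => _/posnumP[].
rewrite (le_trans _ (epsilon_trick _ _ _))//.
pose P k (c : nat -> V * V) := A k `<=` \bigcup_j box (c j) /\
  \sum_(j <oo) (box_vol (c j))%:E <=
    lebesgue_outer (A k) + (e%:num / (2 ^ k.+1)%:R)%:E.
have [G PG] : {G : nat -> nat -> V * V & forall k, P k (G k)}.
  apply: (@choice _ _ P) => k.
  have en1 : (0 < e%:num / (2 ^ k.+1)%:R)%R by [].
  have fk : lebesgue_outer (A k) \is a fin_num.
    by rewrite ge0_fin_numE// ltey; apply/eqP/Aoo.
  have [x [c Ac <-] cx] := lb_ereal_inf_adherent en1 fk.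
  by exists c; split => //; exact/ltW.
pose v := fun ij : nat * nat => (box_vol (G ij.1 ij.2))%:E.
apply: (@le_trans _ _ (\esum_(ij in setT) v ij)).
  have /card_esym/ppcard_eqP[f] := card_nat2.
  apply: ereal_inf_lbound => /=.
  exists (fun k => G (f k).1 (f k).2).
    move=> t [i _ /(PG i).1 [j _ Gt]].
    by exists (f^-1%FUN (i, j)) => //=; rewrite invK ?inE.
  rewrite -[LHS](esum_pred_image v f xpredT) ?[fun=> _]set_true//; last first.
    by move=> k _; exact: vol_ge0.
  by rewrite image_eq.
rewrite (_ : esum _ _ = \sum_(i <oo) \sum_(j <oo) v (i, j)); last first.
  pose J : nat -> set (nat * nat) := fun i => [set (i, j) | j in setT].
  rewrite (_ : setT = \bigcup_k J k); last first.
    by rewrite predeqE => -[a b]; split => // _; exists a => //; exists b.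
  rewrite esum_bigcupT /=; last 2 first.
    - apply/trivIsetP => i j _ _ ij.
      rewrite predeqE => -[k m] /=; split => //= -[] [_] _ [<-{k} _].
      by move=> [m' _] [] /esym/eqP; rewrite (negbTE ij).
    - by move=> ij; exact: vol_ge0.
  rewrite -(image_id [set: nat]) -fun_true esum_pred_image//; last first.
    by move=> k _; apply: esum_ge0 => *; exact: vol_ge0.
  apply: eq_eseriesr => /= j _.
  rewrite -(esum_pred_image v (pair j) predT) /=; last 2 first.
  - by move=> *; exact: vol_ge0.
  - by move=> ? ? _ _; exact: (@can_inj _ _ _ snd).
  by congr esum; rewrite predeqE => -[a b]; split; move=> [i _ <-]; exists i.
apply: lee_nneseries => k *.
  by apply: nneseries_ge0 => *; exact: vol_ge0.
exact: (PG k).2.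
Qed.

HB.instance Definition _ := isOuterMeasure.Build R V lebesgue_outer
  outer0 outer_ge0 outer_le outer_sigma_subadditive.

End LebesgueMeasure.

(* R^N equipped with the (complete) sigma-algebra of Lebesgue measurable sets,
   and the Lebesgue measure on it. *)
Definition leb_space (R : realType) (n : nat) :=
  caratheodory_type (@lebesgue_outer R n).

HB.instance Definition _ (R : realType) (n : nat) :=
  Measurable.on (leb_space R n).

Definition leb (R : realType) (n : nat) : set (leb_space R n) -> \bar R :=
  @lebesgue_outer R n.

HB.instance Definition _ (R : realType) (n : nat) :=
  isMeasure.Build _ (leb_space R n) R (@leb R n)
    (@caratheodory_measure0 R _ (@lebesgue_outer R n))
    (@caratheodory_measure_ge0 R _ (@lebesgue_outer R n))
    (@caratheodory_measure_sigma_additive R _ (@lebesgue_outer R n)).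

Arguments leb {R n}.

Section Domains.
Context {R : realType} {n : nat}.
Local Notation V := 'rV[R]_n.+1.
Implicit Types Om U : set V.

Definition compactly_contained Om U :=
  compact (closure Om) /\ closure Om `<=` U.

(* Near each boundary point x0, in the Cartesian coordinates
   y = (x - x0) *m Q with Q orthogonal, Om is the set of points lying strictly
   above the graph of a Lipschitz function of the first N - 1 coordinates. *)
Definition lipschitz_boundary Om :=
  forall x0, (closure Om `\` Om) x0 ->
  exists (Q : 'M[R]_n.+1) (g : 'rV[R]_n -> R^o) (r : R),
    [/\ Q *m Q^T = 1%:M, lipschitz g, 0 < r &
     forall x, eball x0 r x ->
       let y := (x - x0) *m Q in
       Om x <-> g (col' ord_max y) < y ord0 ord_max].

Definition lipschitz_domain Om :=
  [/\ open Om, connected Om & lipschitz_boundary Om].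

End Domains.

Section FunctionClasses.
Context {R : realType} {n : nat}.
Local Notation V := 'rV[R]_n.+1.
Implicit Types (Om : set V) (f s w : V -> R).

Definition class_Z (k : R) Om s :=
  (forall x, Om x -> 0 <= s x) /\
  exists C : R, forall x y, Om x -> Om y ->
    s x <= C * (s y + enorm (x - y) `^ k).

Definition holder (g : R) Om f :=
  exists C : R, forall x y, Om x -> Om y ->
    `|f x - f y| <= C * enorm (x - y) `^ g.

Definition Linfty Om f :=
  measurable_fun (Om : set (leb_space R n)) f /\
  exists M : R, {ae @leb R n, forall x, Om x -> `|f x| <= M}.

Local Open Scope ereal_scope.

(* Averages are only taken over balls, whose measure is finite and positive. *)
Definition average (B : set V) (f : V -> \bar R) : \bar R :=
  ((fine (leb B))^-1)%:E * \int[leb]_(x in B) f x.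

(* w `^ (- 1 / (r - 1)), with value +oo where w vanishes. *)
Definition dual_weight (r : R) w (x : V) : \bar R :=
  if w x == 0%R then +oo else (w x `^ (- (r - 1)^-1))%:E.

(* The product of averages uses the usual convention 0 * +oo = 0. *)
Definition muckenhoupt (r : R) Om w :=
  [/\ forall x, Om x -> (0 <= w x)%R,
      measurable_fun (Om : set (leb_space R n)) w &
      ereal_sup [set average B (EFin \o w) *
                     poweR (average B (dual_weight r w)) (r - 1) |
                 B in [set B | B `<=` Om /\
                        exists x rho, (0 < rho)%R /\ B = eball x rho]] < +oo].

End FunctionClasses.

Section Sobolev.
Context {R : realType} {n : nat}.
Local Notation V := 'rV[R]_n.+1.
Implicit Types (Om : set V) (f v phi : V -> R) (G : V -> V).

Definition partial (i : 'I_n.+1) f : V -> R :=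
  fun x => 'D_(delta_mx ord0 i) (f : V -> R^o) x.

Definition iter_partial (s : seq 'I_n.+1) f : V -> R := foldr partial f s.

Definition smooth f := forall s : seq 'I_n.+1,
  continuous (iter_partial s f : V -> R^o) /\
  forall (i : 'I_n.+1) (x : V),
    derivable (iter_partial s f : V -> R^o) x (delta_mx ord0 i).

(* Test functions on Om are extended by zero to the whole space. *)
Definition Ccinfty Om phi :=
  smooth phi /\ compactly_contained [set x | phi x != 0] Om.

Definition L1 Om f := leb.-integrable (Om : set (leb_space R n)) (EFin \o f).

Definition is_weak_gradient Om v G :=
  forall i : 'I_n.+1,
    L1 Om (fun x => G x ord0 i) /\
    forall phi, Ccinfty Om phi ->
      \int[leb]_(x in Om) (v x * partial i phi x) =
      - \int[leb]_(x in Om) (G x ord0 i * phi x).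

Definition W11 Om v := L1 Om v /\ exists G, is_weak_gradient Om v G.

(* A representative of the weak gradient, which is unique up to equality
   almost everywhere on Om. *)
Definition wgrad Om v : V -> V :=
  xget (fun=> 0) [set G | is_weak_gradient Om v G].

Local Open Scope ereal_scope.

Definition W11_norm Om v : \bar R :=
  \int[leb]_(x in Om) (`|v x|%R)%:E +
  \int[leb]_(x in Om) (enorm (wgrad Om v x))%:E.

Definition W11_0 Om v :=
  W11 Om v /\
  exists phi : nat -> V -> R, (forall k, Ccinfty Om (phi k)) /\
    W11_norm Om (fun x => v x - phi k x)%R @[k --> \oo] --> 0.

Definition double_phase (p q : R) (a : V -> R) Om v : \bar R :=
  \int[leb]_(x in Om)
    (enorm (wgrad Om v x) `^ p + a x * enorm (wgrad Om v x) `^ q)%:E.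

End Sobolev.

(* Main.v *)
(* Near each point of the closure of Om there are a direction e and c > 0 such that
   x + t e + z belongs to Om for |z| <= c t, by the Lipschitz condition.  Averaging u
   over x + t e + B(0, c t) therefore gives a smooth S_t u with compact support
   in Om, and a partition of unity reduces the theorem to functions supported in one chart.

   What remains is that S_t (grad u) tends to grad u in the modular of t^p + a t^q.  This is
   clear for bounded continuous functions, so it suffices to bound the modular of S_t f by that of f,
   with f a component of grad u.  On a ball of radius c t either sigma <= C t^k, so that
   a |S_t f|^q <= C t^k M^(q-p) omega |S_t f|^p with M = sup |S_t f|, or sigma is comparable to its
   value at the centre, and the Muckenhoupt condition bounds the averages of a |f|^q.
   The first case is harmless if M <= C t^(-th) with th (q - p) <= k: th = 1 for bounded u
   (a truncation reduces to these), th = N/p since f is in L^p, and th = 1 - g for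
   g-Hoelder u, because the gradient of the kernel has mean zero.

   In the Hoelder case the extension of u by zero must be Hoelder continuous, that is, u must vanish
   on the boundary.  If |u| >= al near a boundary point, then composing u with functions vanishing
   at 0 shows that the constant 1 has zero trace there too, which contradicts the geometry of the chart. *)
Require Import Defs.
From HB Require Import structures.
From mathcomp Require Import all_boot all_order all_algebra.
From mathcomp Require Import all_classical all_reals all_analysis measurable_realfun.
From mathcomp Require Import ring lra.
Set Implicit Arguments.
Unset Strict Implicit.
Unset Printing Implicit Defensive.
Import Order.TTheory GRing.Theory Num.Theory.
Import numFieldNormedType.Exports.
Local Open Scope classical_set_scope.
Local Open Scope ring_scope.

(** * Lebesgue measure *)

(** The obstacle is that the modular of S_t f is not bounded by a fixed multiple of that of f: the
    constant depends on a number B with |S_t f| <= B t^(-th). The density argument survives because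
    f is replaced by f - h with h bounded: S_t h stays bounded while t^(-th) tends to infinity, so B
    becomes B + 1 for all small t, whichever h is chosen.

    The dual weight is +oo at the zeros of omega, and 0 times +oo is 0, so a product of integrals
    may vanish for the wrong reason. A small constant eps added to the integrand keeps one factor
    positive and is removed at the end. Hölder's inequality is replaced by a Young inequality with a
    free parameter, which is linear and can be integrated against infinite weights.

    Zero boundary values are recorded as an integration by parts formula against all C1 functions on
    the space. It gives grad (S_t u) = S_t (grad u) up to the boundary, where the translated kernel
    is no test function on Om. Truncations must preserve this formula and are therefore taken C1. *)

Section LebesgueBasics.
Context {R : realType} {n : nat}.
Local Notation V := 'rV[R]_n.+1.
Local Notation T := (leb_space R n).
Local Notation leb := (@leb R n).
Local Open Scope ereal_scope.

Lemma lebesgue_outer_le (A : set V) (c : nat -> V * V) :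
  A `<=` \bigcup_k box (c k) ->
  lebesgue_outer A <= \sum_(k <oo) (box_vol (c k))%:E.
Proof. by move=> Ac; apply: ereal_inf_lbound; exists c. Qed.

Lemma box_vol_ge0 (c : V * V) : (0 <= box_vol c)%R.
Proof. by apply: prodr_ge0 => i _; rewrite le_max lexx. Qed.

Lemma box_volE_ge0 (c : V * V) : 0 <= (box_vol c)%:E.
Proof. by rewrite lee_fin box_vol_ge0. Qed.

(** The hyperplane cuts each box of a cover into two boxes whose volumes add up to at most its own.
    Covers of the two pieces of a set therefore cost no more than a cover of the set, which is
    Carathéodory's condition. *)
Lemma measurable_halfspace (i : 'I_n.+1) (t : R) :
  measurable ([set x : V | (x ord0 i <= t)%R] : set T).
Proof.
apply: le_caratheodory_measurable => X.
rewrite [leRHS]/=; apply: le_ereal_inf_tmp => _ [b Xb <-].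
pose b1 k : V * V := ((b k).1,
  \row_j if j == i then Num.min ((b k).2 ord0 j) t else (b k).2 ord0 j).
pose b2 k : V * V :=
  (\row_j if j == i then Num.max ((b k).1 ord0 j) t else (b k).1 ord0 j, (b k).2).
have X1 : X `&` [set x : V | (x ord0 i <= t)%R] `<=` \bigcup_k box (b1 k).
  move=> x [/Xb [k _ xk] xt]; exists k => // j; rewrite /= mxE.
  have /andP[h1 h2] := xk j; rewrite h1 /=.
  by case: eqP => // ->; rewrite le_min xt (andP (xk i)).2.
have X2 : X `&` ~` [set x : V | (x ord0 i <= t)%R] `<=` \bigcup_k box (b2 k).
  move=> x [/Xb [k _ xk] /= /negP]; rewrite -ltNge => xt; exists k => // j; rewrite /= mxE.
  have /andP[h1 h2] := xk j; rewrite h2 andbT.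
  by case: eqP => // ->; rewrite ge_max (ltW xt) (andP (xk i)).1.
apply: le_trans (leeD (lebesgue_outer_le X1) (lebesgue_outer_le X2)) _.
rewrite -nneseriesD; try by move=> *; exact: box_volE_ge0.
apply: lee_nneseries => [k _ _|k _]; first by rewrite -EFinD lee_fin addr_ge0 ?box_vol_ge0.
rewrite -EFinD lee_fin /box_vol (bigD1 i)//= [X in (_ + X <= _)%R](bigD1 i)//= [leRHS](bigD1 i)//=.
rewrite !mxE eqxx.
have e1 : (\prod_(j < n.+1 | j != i) Num.max 0 ((b1 k).2 ord0 j - (b k).1 ord0 j) =
   \prod_(j < n.+1 | j != i) Num.max 0 ((b k).2 ord0 j - (b k).1 ord0 j))%R.
  by apply: eq_bigr => j ji; rewrite mxE (negbTE ji).
have e2 : (\prod_(j < n.+1 | j != i) Num.max 0 ((b k).2 ord0 j - (b2 k).1 ord0 j) =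
   \prod_(j < n.+1 | j != i) Num.max 0 ((b k).2 ord0 j - (b k).1 ord0 j))%R.
  by apply: eq_bigr => j ji; rewrite mxE (negbTE ji).
move: e1 e2 => /= -> ->; rewrite -mulrDl; apply: ler_wpM2r.
  by apply: prodr_ge0 => j _; rewrite le_max lexx.
set u := (b k).1 _ _; set v := (b k).2 _ _.
have m0 (z : R) : (z <= 0)%R -> Num.max 0%R z = 0%R by move=> z0; rewrite max_l.
have m1 (z : R) : (z <= Num.max 0 z)%R by rewrite le_max lexx orbT.
have [vt|tv] := leP v t.
  by rewrite [X in (_ + X <= _)%R]m0 ?addr0// subr_le0 le_max vt orbT.
have [tu|ut] := leP t u.
  by rewrite [X in (X + _ <= _)%R]m0 ?add0r// subr_le0.
have mp (z : R) : (0 <= z)%R -> Num.max 0%R z = z by move=> z0; rewrite max_r.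
rewrite [X in (X + _ <= _)%R]mp ?subr_ge0 ?(ltW ut)// mp ?subr_ge0 ?(ltW tv)//.
by apply: le_trans (m1 _); rewrite addrC subrKA.
Qed.

Lemma measurable_coord (i : 'I_n.+1) : measurable_fun (setT : set T) (fun x : V => x ord0 i).
Proof.
apply: measurability (RGenOInfty.measurableE R) _ => //.
move=> _ [_ [t ->] <-]; rewrite setTI.
rewrite (_ : _ @^-1` _ = ~` [set x : V | (x ord0 i <= t)%R]).
  by apply: measurableC; exact: measurable_halfspace.
by apply/seteqP; split => x /=; rewrite in_itv/= andbT ltNge => /negP.
Qed.

Lemma measurable_box (c : V * V) : measurable (box c : set T).
Proof.
rewrite (_ : box c = \bigcap_(i in [set: 'I_n.+1])
   ((fun x : V => x ord0 i) @^-1` `[c.1 ord0 i, c.2 ord0 i])).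
  apply: fin_bigcap_measurable => // i _; rewrite -[X in measurable X]setTI.
  by apply: measurable_coord.
apply/seteqP; split => x /= xc.
  by move=> i _ /=; rewrite in_itv/=; exact: xc.
by move=> i; have := xc i I; rewrite /= in_itv.
Qed.

Lemma leb_box_le (c : V * V) : leb (box c) <= (box_vol c)%:E.
Proof.
pose d k : V * V := if k is 0%N then c else (0, 0)%R.
have cd : box c `<=` \bigcup_k box (d k) by move=> x xc; exists 0%N.
apply: le_trans (lebesgue_outer_le cd) _.
rewrite (nneseriesD1 (n := 0%N))//; last by move=> *; exact: box_volE_ge0.
rewrite /= eseries0 ?adde0// => -[|k] _ //= _.
by rewrite /box_vol big_ord_recl /= subrr maxxx mul0r.
Qed.

Lemma coord_le_norm (x : V) i : (`|x ord0 i| <= `|x|)%R.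
Proof.
rewrite [leRHS]mx_normrE; apply: (le_bigmax _ _ (ord0, i)).
Qed.

Lemma rV_norm_le (x : V) e : (0 <= e)%R -> (forall i, `|x ord0 i| <= e)%R -> (`|x| <= e)%R.
Proof.
move=> e0 H; rewrite [leLHS]mx_normrE; apply/bigmax_leP; split => // -[j i] _ /=.
by rewrite (ord1 j).
Qed.

Lemma rV_norm_lt (x : V) e : (0 < e)%R -> (forall i, `|x ord0 i| < e)%R -> (`|x| < e)%R.
Proof.
move=> e0 H; rewrite [ltLHS]mx_normrE; apply/bigmax_ltP; split => // -[j i] _ /=.
by rewrite (ord1 j).
Qed.

(** An open set is the union of the countably many boxes with rational corners that it contains. *)
Lemma measurable_open (A : set V) : open A -> measurable (A : set T).
Proof.
move=> oA.
pose rb (c : 'rV[rat]_n.+1 * 'rV[rat]_n.+1) : V * V := (map_mx ratr c.1, map_mx ratr c.2).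
rewrite (_ : A = \bigcup_c (if pselect (box (rb c) `<=` A) then box (rb c) else set0)).
  apply: countable_bigcupT_measurable => [|c]; first exact: countableP.
  by case: pselect => *; [exact: measurable_box | exact: measurable0].
apply/seteqP; split=> [x Ax|x [c _]]; last by case: pselect => // H /H.
have : nbhs x A by apply: open_nbhs_nbhs.
move/nbhs_ballP => [e /= e0 eA].
have q1 i : {q : rat | (x ord0 i - e < ratr q < x ord0 i)%R}.
  by apply: cid; have [|q] := @rat_in_itvoo R (x ord0 i - e) (x ord0 i);
    [rewrite ltrBlDr ltrDl | rewrite in_itv /= => ?; exists q].
have q2 i : {q : rat | (x ord0 i < ratr q < x ord0 i + e)%R}.
  by apply: cid; have [|q] := @rat_in_itvoo R (x ord0 i) (x ord0 i + e);
    [rewrite ltrDl | rewrite in_itv /= => ?; exists q].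
exists (\row_i sval (q1 i), \row_i sval (q2 i)) => //.
case: pselect => [_ i /=|[]].
  rewrite !mxE; have /andP[_ /ltW ->] := svalP (q1 i).
  by have /andP[/ltW -> _] := svalP (q2 i).
move=> y Hy; apply: eA; rewrite mx_norm_ball /ball_ /=; apply: rV_norm_lt => // i.
rewrite !mxE; have := Hy i; rewrite /= !mxE => /andP[h1 h2].
have /andP[h3 h4] := svalP (q1 i); have /andP[h5 h6] := svalP (q2 i).
by rewrite ltr_norml; apply/andP; split; lra.
Qed.

Lemma measurable_closed (A : set V) : closed A -> measurable (A : set T).
Proof.
by move=> cA; rewrite -[A]setCK; apply: measurableC; apply: measurable_open; rewrite openC.
Qed.

Lemma measurable_continuous (D : set T) (f : V -> R) : measurable D -> continuous (f : V -> R^o) ->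
  measurable_fun D (f : T -> R).
Proof.
move=> mD cf; apply: measurable_funS (measurableT) _ _ => //.
apply: measurability (RGenOInfty.measurableE R) _.
move=> _ [_ [t ->] <-]; rewrite setTI; apply: measurable_open.
move/continuousP : cf; apply; exact: interval_open.
Qed.

Lemma lebesgue_outer_shift_le (h : V) (A : set V) :
  lebesgue_outer ((fun x => (x + h)%R) @^-1` A) <= lebesgue_outer A.
Proof.
apply: le_ereal_inf_tmp => _ [c Ac <-].
rewrite (_ : \sum_(k <oo) _ = \sum_(k <oo) (box_vol ((c k).1 - h, (c k).2 - h)%R)%:E).
  apply: lebesgue_outer_le => x /Ac [k _ xk]; exists k => // i /=.
  by have := xk i; rewrite !mxE lerBlDr lerBrDr.
apply: eq_eseriesr => k _; congr (_%:E); apply: eq_bigr => i _ /=.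
by congr (Num.max _ _); rewrite !mxE; ring.
Qed.

Lemma lebesgue_outer_shift (h : V) (A : set V) :
  lebesgue_outer ((fun x => (x + h)%R) @^-1` A) = lebesgue_outer A.
Proof.
apply/eqP; rewrite eq_le lebesgue_outer_shift_le /=.
apply: le_trans (lebesgue_outer_shift_le (- h) _).
by rewrite le_outer_measure// => x /=; rewrite subrK.
Qed.

(** Carathéodory's condition for the translated set, tested on [X], is the condition for [A] tested
    on the translate of [X]. *)
Lemma measurable_shift (h : V) : measurable_fun (setT : set T) (fun x : V => (x + h)%R : T).
Proof.
move=> _ A mA; rewrite setTI; apply: le_caratheodory_measurable => X.
set S := fun x => _.
have XS : X = S @^-1` (S @` X).
  apply/seteqP; split => [x Xx|x [y Xy]]; first by exists x.
  by move/addIr => <-.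
change (lebesgue_outer (X `&` S @^-1` A) + lebesgue_outer (X `&` ~` (S @^-1` A)) <=
  lebesgue_outer X).
have -> : lebesgue_outer X = lebesgue_outer (S @` X) by rewrite {1}XS lebesgue_outer_shift.
rewrite [leRHS](mA (S @` X)) preimage_setC {1 2}XS -!preimage_setI.
by rewrite !lebesgue_outer_shift.
Qed.

Lemma leb_shift (h : V) (A : set T) : leb ((fun x : V => (x + h)%R) @^-1` A) = leb A.
Proof. exact: lebesgue_outer_shift. Qed.

(** Covers are scaled box by box. Used with s and with its inverse, this inequality yields the exact
    scaling of cubes in [leb_uball]. *)
Lemma lebesgue_outer_scale_le (s : R) (A : set V) : (0 < s)%R ->
  lebesgue_outer [set x | A (s^-1 *: x)%R] <= (s ^+ n.+1)%:E * lebesgue_outer A.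
Proof.
move=> s0; rewrite -lee_pdivrMl ?exprn_gt0//.
apply: le_ereal_inf_tmp => _ [c Ac <-]; rewrite lee_pdivrMl ?exprn_gt0//.
rewrite -nneseriesZl; last by move=> *; exact: box_volE_ge0.
rewrite (_ : \sum_(k <oo) _ = \sum_(k <oo) (box_vol (s *: (c k).1, s *: (c k).2)%R)%:E).
  apply: lebesgue_outer_le => x /= /Ac [k _ xk]; exists k => // i /=.
  by have := xk i; rewrite !mxE mulrC ler_pdivlMr// ler_pdivrMr// ![(s * _)%R]mulrC.
apply: eq_eseriesr => k _; rewrite -EFinM; congr (_%:E).
rewrite /box_vol -[X in (s ^+ X)%R](card_ord n.+1) -prodr_const -big_split /=.
apply: eq_bigr => i _; rewrite !mxE -mulrBr maxr_pMr ?mulr0//; exact: ltW.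
Qed.

(** Balls of the sup norm, that is, open cubes: they are compatible with the library topology and
    their measure scales exactly. Euclidean balls enter only through the hypotheses. *)
Definition uball (x : V) (r : R) : set V := [set y | (`|y - x| < r)%R].

Lemma measurable_uball x r : measurable (uball x r : set T).
Proof.
apply: measurable_open; rewrite /uball.
have := @ball_open _ V x r; case: (ltP 0%R r) => r0 => [|_].
  by rewrite (_ : ball x r = [set y | (`|y - x| < r)%R])//; apply/seteqP; split => y /=;
    rewrite -ball_normE /ball_ /= distrC.
rewrite (_ : mkset _ = set0); first exact: open0.
by apply/seteqP; split => y //=; apply/negP; rewrite -leNgt (le_trans r0).
Qed.

(* Whether the outer measure of a cube agrees with its volume is irrelevant here: by scaling
   everything is a multiple of uvol, and if uvol = 0 every integral vanishes. *)
Definition uvol : R := fine (leb (uball 0 1)).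

Lemma uball_box x r : uball x r `<=` box (x - const_mx r, x + const_mx r)%R.
Proof.
move=> y /= yr i; rewrite !mxE /=; have := le_lt_trans (coord_le_norm _ i) yr.
by rewrite !mxE ltr_norml => /andP[? ?]; apply/andP; split; lra.
Qed.

Lemma leb_uball_fin : leb (uball 0 1) = uvol%:E.
Proof.
rewrite fineK// ge0_fin_numE//.
apply: le_lt_trans (_ : leb (box (- const_mx 1, const_mx 1)%R) < +oo).
  apply: (@le_outer_measure _ _ (@lebesgue_outer R n)).
  by have := @uball_box 0 1; rewrite sub0r add0r.
exact: le_lt_trans (leb_box_le _) (ltry _).
Qed.

Lemma uvol_ge0 : (0 <= uvol)%R. Proof. exact: fine_ge0. Qed.

Lemma leb_uball x r : (0 < r)%R -> leb (uball x r) = (uvol * r ^+ n.+1)%:E.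
Proof.
move=> r0; rewrite -(leb_shift x).
rewrite (_ : _ @^-1` _ = uball 0 r); last first.
  by apply/seteqP; split => y /=; rewrite /uball /= addrK subr0.
have sc s t : (0 < s)%R -> uball 0 (s * t) = [set y | uball 0 t (s^-1 *: y)%R].
  move=> s0; apply/seteqP; split => y /=; rewrite /uball /= !subr0 normrZ gtr0_norm ?invr_gt0//.
    by rewrite [(s^-1 * _)%R]mulrC ltr_pdivrMr// [(t * _)%R]mulrC.
  by rewrite [(s^-1 * _)%R]mulrC ltr_pdivrMr// [(t * _)%R]mulrC.
rewrite EFinM -leb_uball_fin muleC; apply/eqP; rewrite eq_le; apply/andP; split.
  rewrite -[X in uball _ X](mulr1 r) sc//; exact: lebesgue_outer_scale_le.
rewrite -lee_pdivlMl ?exprn_gt0//.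
have -> : uball 0 1 = uball 0 (r^-1 * r) by rewrite mulVf ?gt_eqF.
rewrite sc ?invr_gt0//; apply: le_trans (lebesgue_outer_scale_le _ _) _; rewrite ?invr_gt0//.
by rewrite exprVn.
Qed.

Lemma uball_cover : \bigcup_k uball 0 k.+1%:R = setT.
Proof.
apply/seteqP; split => // x _; exists (Num.truncn `|x|) => //.
by rewrite /uball /= subr0 truncnS_gt.
Qed.

Lemma leb_sigma_finite : sigma_finite (setT : set T) leb.
Proof.
exists (fun k => uball 0 k.+1%:R); first by rewrite uball_cover.
move=> k; split; first exact: measurable_uball.
by rewrite [X in X < _]leb_uball ?ltry.
Qed.

(** The space is a countable union of cubes, all of measure 0 in this case. *)
Lemma leb_degenerate : uvol = 0%R -> forall A : set V, leb A = 0.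
Proof.
move=> u0 A; apply/eqP; rewrite -measure_le0.
have sT : A `<=` \bigcup_k uball 0 k.+1%:R by rewrite uball_cover.
apply: le_trans (le_outer_measure (@lebesgue_outer R n) _ _ sT) _.
apply: le_trans (outer_measure_sigma_subadditive _ _) _.
rewrite eseries0// => k _ _; rewrite [LHS]leb_uball// u0 mul0r//.
Qed.

Lemma bounded_leb (A : set V) : bounded_set A -> leb A < +oo.
Proof.
move=> [M [Mr MA]]; have [k kM] : exists k : nat, (M + 1 < k.+1%:R)%R.
  by exists (Num.truncn (M + 1)); exact: truncnS_gt.
apply: le_lt_trans (_ : leb (uball 0 k.+1%:R) < _).
  apply: (le_outer_measure (@lebesgue_outer R n)) => x Ax; rewrite /uball /= subr0.
  apply: le_lt_trans kM; apply: MA => //; lra.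
by rewrite leb_uball// ltry.
Qed.

End LebesgueBasics.

(** Sigma-finiteness makes Fubini's and Tonelli's theorems available for [leb]. *)
HB.instance Definition _ (R : realType) (n : nat) :=
  @Measure_isSigmaFinite.Build _ (leb_space R n) R (@leb R n) (@leb_sigma_finite R n).

(** * Extended real sequences tending to zero *)

Section EVanish.
Context {R : realType} {I : Type} {F : set_system I} {FF : Filter F}.
Implicit Type u : I -> \bar R.

Lemma cvge0_near u (e : R) : u k @[k --> F] --> 0%E -> 0 < e ->
  \forall k \near F, (u k < e%:E)%E.
Proof.
move=> u0 e0; apply: (u0 [set x | x < e%:E]%E).
by apply: open_ereal_lt'; rewrite lte_fin.
Qed.

Lemma cvge0P u : (forall k, (0 <= u k)%E) ->
  (forall e : R, 0 < e -> \forall k \near F, (u k <= e%:E)%E) -> u k @[k --> F] --> 0%E.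
Proof.
move=> u0 H; apply/fine_cvgP; split.
  by near=> k; rewrite ge0_fin_numE// (@le_lt_trans _ _ 1%:E) ?ltry//; near: k; exact: H.
apply/cvgrPdist_le => e e0; near=> k; rewrite sub0r normrN /=.
have ke : (u k <= e%:E)%E by near: k; exact: H.
rewrite ger0_norm ?fine_ge0// -lee_fin fineK// ge0_fin_numE//.
by apply: le_lt_trans ke _; rewrite ltry.
Unshelve. all: by end_near. Qed.

End EVanish.

(** * Integrals of absolute values *)

Section AbsIntegral.
Context {R : realType} d {T : measurableType d}.
Variable leb : {measure set T -> \bar R}.
Implicit Types (D : set T) (f g : T -> R).

Definition int1 D f := leb.-integrable D (EFin \o f).

(** The L1 seminorm with values in the extended reals, so that estimates can be stated before
    integrability is known. *)
Definition nint D f : \bar R := (\int[leb]_(x in D) `|f x|%:E)%E.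

Lemma measurable_norm D f : measurable_fun D f ->
  measurable_fun D (fun x => `|f x|).
Proof. by move=> mf; apply: measurableT_comp. Qed.

Lemma measurable_normE D f : measurable_fun D f ->
  measurable_fun D (fun x => `|f x|%:E).
Proof. by move=> mf; apply/measurable_EFinP/measurable_norm. Qed.

Lemma nint_ge0 D f : (0 <= nint D f)%E.
Proof. by apply: integral_ge0 => x _; rewrite lee_fin. Qed.

Lemma nint_le D f g : measurable D -> measurable_fun D f ->
  measurable_fun D g -> (forall x, D x -> `|f x| <= `|g x|) ->
  (nint D f <= nint D g)%E.
Proof.
move=> mD mf mg fg; by apply: ge0_le_integral => //; exact: measurable_normE.
Qed.

Lemma nint_le_ae D f g : measurable D -> measurable_fun D f ->
  measurable_fun D g -> {ae leb, forall x, D x -> `|f x| <= `|g x|} ->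
  (nint D f <= nint D g)%E.
Proof.
move=> mD mf mg fg; by apply: ae_ge0_le_integral => //; exact: measurable_normE.
Qed.

Lemma eq_nint D f g : (forall x, D x -> `|f x| = `|g x|) -> nint D f = nint D g.
Proof. by move=> fg; apply: eq_integral => x /set_mem Dx; rewrite fg. Qed.

Lemma nintD_ge0 D f g : measurable D -> measurable_fun D f ->
  measurable_fun D g -> (forall x, D x -> 0 <= f x) -> (forall x, D x -> 0 <= g x) ->
  nint D (fun x => f x + g x) = (nint D f + nint D g)%E.
Proof.
move=> mD mf mg f0 g0; rewrite /nint -ge0_integralD//; try exact: measurable_normE.
apply: eq_integral => x /set_mem Dx.
by rewrite -EFinD !ger0_norm ?addr_ge0 ?f0 ?g0.
Qed.

Lemma nintD D f g : measurable D -> measurable_fun D f ->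
  measurable_fun D g ->
  (nint D (fun x => f x + g x)%R <= nint D f + nint D g)%E.
Proof.
move=> mD mf mg; rewrite /nint -ge0_integralD//; try exact: measurable_normE.
apply: ge0_le_integral => //.
- apply: measurable_normE; exact: measurable_funD.
- apply: emeasurable_funD; exact: measurable_normE.
- by move=> x _; rewrite -EFinD lee_fin ler_normD.
Qed.

Lemma nintZ D f (k : R) : measurable D -> measurable_fun D f ->
  nint D (fun x => k * f x) = (`|k|%:E * nint D f)%E.
Proof.
move=> mD mf; rewrite /nint -ge0_integralZl_EFin//; last exact: measurable_normE.
by apply: eq_integral => x _; rewrite normrM.
Qed.

Lemma nintN D f : nint D (fun x => - f x) = nint D f.
Proof. by apply: eq_nint => x _; rewrite normrN. Qed.

Lemma nint_dist D f g : nint D (fun x => f x - g x) = nint D (fun x => g x - f x).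
Proof. by apply: eq_nint => x _; rewrite distrC. Qed.

Lemma nint_triangle D f g (h : T -> R) : measurable D -> measurable_fun D f ->
  measurable_fun D g -> measurable_fun D h ->
  (nint D (fun x => f x - h x)%R <= nint D (fun x => f x - g x)%R + nint D (fun x => g x - h x)%R)%E.
Proof.
move=> mD mf mg mh.
rewrite (eq_nint (g := fun x => (f x - g x) + (g x - h x))); last by move=> x _; rewrite subrKA.
by apply: nintD => //; apply: measurable_funB.
Qed.

Lemma int1P D f : int1 D f <-> (measurable_fun D f /\ (nint D f < +oo)%E).
Proof.
split=> [/integrableP[/measurable_EFinP mf fi]|[mf fi]].
  by split.
by apply/integrableP; split => //; apply/measurable_EFinP.
Qed.

Lemma int1_measurable D f : int1 D f -> measurable_fun D f.
Proof. by move/int1P => []. Qed.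

Lemma int1_fin D f : int1 D f -> (nint D f < +oo)%E.
Proof. by move/int1P => []. Qed.

Lemma nint_fin_num D f : (nint D f < +oo)%E -> nint D f \is a fin_num.
Proof. by move=> h; rewrite ge0_fin_numE// nint_ge0. Qed.

Lemma int1_le D f g : measurable D -> int1 D g -> measurable_fun D f ->
  (forall x, D x -> `|f x| <= `|g x|) -> int1 D f.
Proof.
move=> mD /int1P[mg gi] mf fg; apply/int1P; split => //.
by apply: le_lt_trans gi; apply: nint_le.
Qed.

Lemma int1D D f g : measurable D -> int1 D f -> int1 D g -> int1 D (fun x => f x + g x).
Proof.
move=> mD /int1P[mf fi] /int1P[mg gi]; apply/int1P; split; first exact: measurable_funD.
by apply: le_lt_trans (nintD _ _ _) _ => //; rewrite lte_add_pinfty.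
Qed.

Lemma int1N D f : int1 D f -> int1 D (fun x => - f x).
Proof.
move=> /int1P[mf fi]; apply/int1P; split; last by rewrite nintN.
exact: measurableT_comp.
Qed.

Lemma int1B D f g : measurable D -> int1 D f -> int1 D g -> int1 D (fun x => f x - g x).
Proof. by move=> mD fi gi; apply: int1D => //; apply: int1N. Qed.

Lemma int1Z D f k : measurable D -> int1 D f -> int1 D (fun x => k * f x).
Proof.
move=> mD /int1P[mf fi]; apply/int1P; split; last by rewrite nintZ// lte_mul_pinfty.
by apply: measurable_funM.
Qed.

Lemma int1Mbounded D f g (C : R) : measurable D -> int1 D f ->
  measurable_fun D g -> (forall x, D x -> `|g x| <= C) -> int1 D (fun x => g x * f x).
Proof.
move=> mD fi mg gC; apply: (@int1_le _ _ (fun x => C * f x)) => //; first exact: int1Z.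
  by apply: measurable_funM => //; exact: int1_measurable.
move=> x Dx; rewrite !normrM ler_wpM2r//.
exact: le_trans (gC _ Dx) (ler_norm _).
Qed.

Lemma int1_bounded D f (C : R) : measurable D -> (leb D < +oo)%E ->
  measurable_fun D f -> (forall x, D x -> `|f x| <= C) -> int1 D f.
Proof.
move=> mD fD mf fC; apply/int1P; split => //.
have -> : nint D f = nint D (fun x => f x * 1) by apply: eq_nint => x _; rewrite mulr1.
apply: le_lt_trans (_ : (\int[leb]_(x in D) (`|C|%:E) < _)%E).
  apply: ge0_le_integral => //.
    by apply: measurable_normE; apply: measurable_funM.
  move=> x Dx; rewrite lee_fin mulr1; exact: le_trans (fC _ Dx) (ler_norm _).
by rewrite integral_cst// lte_mul_pinfty.
Qed.

Lemma nint_bounded D f (C : R) : measurable D ->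
  measurable_fun D f -> 0 <= C -> (forall x, D x -> `|f x| <= C) ->
  (nint D f <= C%:E * leb D)%E.
Proof.
move=> mD mf C0 fC; rewrite -integral_cst//.
apply: ge0_le_integral => //.
- exact: measurable_normE.
Qed.

Lemma nint_subset D D' f : measurable D -> measurable D' ->
  D `<=` D' -> measurable_fun D' f -> (nint D f <= nint D' f)%E.
Proof.
move=> mD mD' DD' mf; apply: ge0_subset_integral => //; exact: measurable_normE.
Qed.

Lemma Rintegral_nint D f : measurable D -> int1 D f ->
  (`|\int[leb]_(x in D) f x|%:E <= nint D f)%E.
Proof.
move=> mD fi; have h := le_normr_Rintegral mD fi.
rewrite -[leRHS]fineK ?lee_fin//; exact/nint_fin_num/int1_fin.
Qed.

Lemma nint_Rintegral D f : int1 D f ->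
  nint D f = (\int[leb]_(x in D) `|f x|)%:E.
Proof. by move=> fi; rewrite /Rintegral fineK//; exact/nint_fin_num/int1_fin. Qed.

Lemma nint_eq0 D f : measurable D -> measurable_fun D f ->
  nint D f = 0%E -> {ae leb, forall x, D x -> f x = 0}.
Proof.
move=> mD mf f0.
have mfE : measurable_fun D (EFin \o f) by apply/measurable_EFinP.
have := (ae_eq_integral_abs leb mD mfE).1 f0.
by apply: filterS => x H Dx; apply: EFin_inj; exact: H.
Qed.

Lemma dominated_nint D (F : nat -> T -> R) g : measurable D ->
  (forall k, measurable_fun D (F k)) -> int1 D g ->
  (forall k x, D x -> `|F k x| <= g x) ->
  (forall x, D x -> F k x @[k --> \oo] --> 0) ->
  nint D (F k) @[k --> \oo] --> 0%E.
Proof.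
move=> mD mF gi Fg F0.
have [] := @dominated_convergence _ T R leb D mD (fun k x => (F k x)%:E) (cst 0%E)
   (EFin \o g) _ _ _ gi.
- by move=> k; apply/measurable_EFinP.
- exact: measurable_cst.
- by apply: aeW => x Dx; apply: cvg_EFin; [exact: nearW|exact: F0].
- by apply: aeW => x k Dx; rewrite /= lee_fin Fg.
move=> _ + _; rewrite (_ : [sequence _]_k = (fun k => nint D (F k)))//.
by apply/funext => k /=; apply: eq_integral => x _; rewrite subr0.
Qed.

(** Cut f at a height m: where |f| <= m the product is at most m |g|, and the rest costs at most C
    times the integral of |f| over the set |f| > m, which is small for m large. The point is that d
    depends only on f, C and e, not on g. *)
Lemma nint_mul_small D f (C e : R) : measurable D -> int1 D f -> 0 <= C -> 0 < e ->
  exists2 d : R, 0 < d & forall g, measurable_fun D g ->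
    (forall x, D x -> `|g x| <= C) -> (nint D g <= d%:E)%E ->
    (nint D (fun x => f x * g x)%R <= e%:E)%E.
Proof.
move=> mD fi C0 e0.
pose t (m : nat) x := if m%:R < `|f x| then f x else 0.
have mt m : measurable_fun D (t m).
  have mf := int1_measurable fi.
  apply: measurable_fun_if => //.
  - by apply: measurable_fun_ltr => //; apply: measurable_norm.
  - by apply: measurable_funS mf => // x [].
have tc : nint D (t m) @[m --> \oo] --> 0%E.
  apply: (@dominated_nint D t (fun x => `|f x|)) => //.
  - apply: (int1_le mD fi); first by apply: measurable_norm; exact: int1_measurable.
    by move=> x _; rewrite normr_id.
  - by move=> k x Dx; rewrite /t; case: ifP => // _; rewrite normr0.
  move=> x Dx; apply: cvg_near_cst; near=> m; rewrite /t ltNge.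
  suff -> : `|f x| <= m%:R by [].
  by near: m; exact: nbhs_infty_ger.
have [m Hm] : exists m, (nint D (t m) <= (e / 2 / (C + 1))%:E)%E.
  have e2 : 0 < e / 2 / (C + 1) by rewrite !divr_gt0//; lra.
  have [m _ /(_ m (leqnn _))] := cvge0_near tc e2.
  by exists m; exact: ltW.
exists (e / 2 / (m%:R + 1)); first by rewrite !divr_gt0// ltr_wpDl.
move=> g mg gC gd.
have mf := int1_measurable fi.
apply: (@le_trans _ _ (nint D (fun x => m%:R * g x)%R + nint D (fun x => C * t m x)%R)%E).
  rewrite -[leRHS]ge0_integralD//; try by apply: measurable_normE; apply: measurable_funM.
  apply: ge0_le_integral => //.
  - by apply: measurable_normE; apply: measurable_funM.
  - by apply: emeasurable_funD; apply: measurable_normE; apply: measurable_funM.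
  - move=> x Dx; rewrite -EFinD lee_fin !normrM /t normr_nat (ger0_norm C0).
    case: ltP => h; last by rewrite normr0 mulr0 addr0 ler_wpM2r.
    by rewrite ler_wpDl ?mulr_ge0// mulrC ler_wpM2r ?gC.
rewrite !nintZ// (ger0_norm C0) normr_nat.
apply: (@le_trans _ _ ((m%:R)%:E * (e / 2 / (m%:R + 1))%:E + C%:E * (e / 2 / (C + 1))%:E)%E).
  by apply: leeD; apply: lee_wpmul2l => //; rewrite lee_fin.
rewrite -!EFinM -EFinD lee_fin.
have h (z : R) : 0 <= z -> z * (e / 2 / (z + 1)) <= e / 2.
  by move=> z0; rewrite mulrA ler_pdivrMr ?ltr_wpDl// mulrC; apply: ler_wpM2l; lra.
by rewrite [leRHS](splitr e); apply: lerD; apply: h.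
Unshelve. all: by end_near. Qed.


End AbsIntegral.

(** * Continuous real functions *)

Section ContinuousReal.
Context {R : realType} {X : topologicalType}.
Implicit Types f g : X -> R.

Definition cont f := continuous (f : X -> R^o).

Lemma cont_cst (c : R) : cont (fun=> c). Proof. by move=> x; exact: cvg_cst. Qed.

Lemma contD f g : cont f -> cont g -> cont (fun x => f x + g x).
Proof. by move=> cf cg x; apply: cvgD; [exact: cf|exact: cg]. Qed.

Lemma contB f g : cont f -> cont g -> cont (fun x => f x - g x).
Proof. by move=> cf cg x; apply: cvgB; [exact: cf|exact: cg]. Qed.

Lemma contN f : cont f -> cont (fun x => - f x).
Proof. by move=> cf x; apply: cvgN; exact: cf. Qed.

Lemma contM f g : cont f -> cont g -> cont (fun x => f x * g x).
Proof. by move=> cf cg x; apply: cvgM; [exact: cf|exact: cg]. Qed.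

Lemma contZ f (c : R) : cont f -> cont (fun x => c * f x).
Proof. by apply: contM; exact: cont_cst. Qed.

Lemma cont_min f g : cont f -> cont g -> cont (fun x => Num.min (f x) (g x)).
Proof. by move=> cf cg x; apply: continuous_min; [exact: cf|exact: cg]. Qed.

Lemma cont_max f g : cont f -> cont g -> cont (fun x => Num.max (f x) (g x)).
Proof. by move=> cf cg x; apply: continuous_max; [exact: cf|exact: cg]. Qed.

Lemma cont_comp f (h : R -> R) : cont f -> continuous (h : R^o -> R^o) -> cont (fun x => h (f x)).
Proof. by move=> cf ch x; apply: (@continuous_comp _ R^o R^o f h); [exact: cf|exact: ch]. Qed.

Lemma contP f : cont f <-> forall x e, 0 < e -> \forall y \near x, `|f x - f y| <= e.
Proof.
split=> [cf x e e0|H x]; first by have /cvgrPdist_le/(_ e e0) := cf x.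
by apply/cvgrPdist_le => e e0; exact: H.
Qed.

Lemma cont_closed_ge f (c : R) : cont f -> closed [set x | c <= f x].
Proof.
move=> cf; apply: (@preimage_closed _ R^o f [set t | c <= t]); last exact: closed_ge.
by move=> x _; exact: cf.
Qed.

Lemma cont_closed_le f (c : R) : cont f -> closed [set x | f x <= c].
Proof.
move=> cf; apply: (@preimage_closed _ R^o f [set t | t <= c]); last exact: closed_le.
by move=> x _; exact: cf.
Qed.

Lemma cont_open_lt f (c : R) : cont f -> open [set x | f x < c].
Proof.
move=> cf; rewrite -[X in open X]setCK openC.
rewrite (_ : ~` _ = [set x | c <= f x]); first exact: cont_closed_ge.
by apply/seteqP; split => x /=; [move/negP; rewrite -leNgt|move=> h; apply/negP; rewrite -leNgt].
Qed.

End ContinuousReal.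

(* On leb_space the hints for measurability try to unify outer measures and do not terminate in
   practice, so measurability goals are only closed by the context or for constants. *)
Ltac library_done := trivial; hnf; intros; solve
 [ do ![solve [trivial | apply: sym_equal; trivial]
       | discriminate | contradiction | split]
 | match goal with H : ~ _ |- _ => solve [case H; trivial] end ].
Ltac done ::= lazymatch goal with
 | |- measurable_fun _ (fun _ => ?c) => solve [trivial with nocore | exact: (@measurable_cst _ _ _ _ _ c)]
 | |- measurable_fun _ (cst ?c) => solve [trivial with nocore | exact: (@measurable_cst _ _ _ _ _ c)]
 | |- measurable_fun _ _ => solve [trivial with nocore]
 | |- measurable _ => solve [trivial with nocore | exact: measurableT | exact: measurable0]
 | |- forall _, _ => first [assumption | intro; done]
 | _ => library_done
 end.

(** * Translation invariance, cutoffs, and density of continuous functions in L1 *)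

Section LebIntegral.
Context {R : realType} {n : nat}.
Local Notation V := 'rV[R]_n.+1.
Local Notation T := (leb_space R n).
Local Notation leb := (@leb R n).
Local Notation nint := (nint leb).
Implicit Types (D : set V) (f g : V -> R).

(** [leb] is its own pushforward under a translation, so this is the change of variables for
    pushforwards. *)
Lemma Rintegral_shift (h : V) f : L1 setT f ->
  \int[leb]_x f (x + h) = \int[leb]_x f x.
Proof.
move=> fi; rewrite /Rintegral; congr fine.
have mf := int1_measurable fi.
have mfE : measurable_fun (setT : set T) (EFin \o f) by exact/measurable_EFinP.
have hP (A : set T) : measurable A -> A `<=` setT ->
    leb A = pushforward leb (fun x : T => (x + h)%R : T) A.
  by move=> _ _; rewrite /pushforward leb_shift.
have mS := @measurable_shift R n h.
have fi' : leb.-integrable (setT : set T) (EFin \o f \o (fun x : V => (x + h)%R)).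
  apply/integrableP; split; first exact: (measurableT_comp mfE mS).
  have /integrableP[_] := fi.
  rewrite (eq_measure_integral _ hP)/= => H.
  apply: le_lt_trans H; rewrite ge0_integral_pushforward//=.
  exact: measurable_normE.
rewrite [in RHS](eq_measure_integral _ hP)/=.
by rewrite integral_pushforward//= preimage_setT.
Qed.

Definition Cc D f := cont f /\ compactly_contained [set x | f x != 0] D.

(** The distance to [A], capped at 1: adding 1 to the set keeps the infimum meaningful when [A] is
    empty. *)
Definition capped_dist (A : set V) (x : V) : R :=
  inf ([set `|x - y| | y in A] `|` [set 1]).

Let cd_lb (A : set V) (x : V) : has_lbound ([set `|x - y| | y in A] `|` [set 1]).
Proof. by exists 0 => _ /= [[y _ <-]|->]. Qed.

Let cd_ne (A : set V) (x : V) : [set `|x - y| | y in A] `|` [set 1] !=set0.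
Proof. by exists 1; right. Qed.

Lemma capped_dist_ge0 A x : 0 <= capped_dist A x.
Proof. by apply: lb_le_inf => // _ /= [[y _ <-]|->]. Qed.

Lemma capped_dist_le A x y : A y -> capped_dist A x <= `|x - y|.
Proof. by move=> Ay; apply: ge_inf => //; left; exists y. Qed.

Lemma capped_dist_lip A x y : capped_dist A x <= capped_dist A y + `|x - y|.
Proof.
rewrite -lerBlDr; apply: lb_le_inf => // _ /= [[z Az <-]|->].
  by rewrite lerBlDr addrC (le_trans (capped_dist_le _ Az))// -(subrKA y) ler_normD.
by rewrite lerBlDr ler_wpDr//; apply: ge_inf => //; right.
Qed.

Lemma lip_continuous f (L : R) : (forall x y, `|f x - f y| <= L * `|x - y|) ->
  cont f.
Proof.
move=> H; apply/contP => x e e0.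
have L0 : 0 < `|L| + 1 by rewrite ltr_wpDl.
near=> y; apply: le_trans (H _ _) _.
apply: (@le_trans _ _ ((`|L| + 1) * `|x - y|)).
  by apply: ler_wpM2r => //; rewrite ler_wpDr// ler_norm.
rewrite mulrC -ler_pdivlMr//; near: y.
apply/nbhs_ballP; exists (e / (`|L| + 1)) => /=; first by rewrite divr_gt0.
by move=> y; rewrite -ball_normE /= => /ltW.
Unshelve. all: by end_near. Qed.

Lemma capped_dist_continuous A : cont (capped_dist A).
Proof.
apply: (@lip_continuous _ 1) => x y; rewrite mul1r ler_norml; apply/andP; split.
  by have := capped_dist_lip A y x; rewrite distrC; lra.
by have := capped_dist_lip A x y; lra.
Qed.

Lemma capped_dist0 A x : A x -> capped_dist A x = 0.
Proof.
move=> Ax; apply/eqP; rewrite eq_le capped_dist_ge0 andbT.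
by apply: le_trans (capped_dist_le x Ax) _; rewrite subrr normr0.
Qed.

Lemma capped_dist_gt0 A x : closed A -> ~ A x -> 0 < capped_dist A x.
Proof.
move=> cA Ax; have : nbhs x (~` A).
  by apply: open_nbhs_nbhs; split => //; rewrite openC.
move/nbhs_ballP => [e /= e0 eA].
apply: (@lt_le_trans _ _ (Num.min e 1)); first by rewrite lt_min e0 ltr01.
apply: lb_le_inf => // _ /= [[y Ay <-]|->]; last by rewrite ge_min lexx orbT.
rewrite ge_min leNgt; apply/orP; left; apply/negP => xy.
by apply: (eA y) => //; rewrite -ball_normE.
Qed.

Lemma compactly_containedS A B D : A `<=` B -> compactly_contained B D ->
  compactly_contained A D.
Proof.
move=> AB [cB BD]; have h := closureS AB; split; last exact: subset_trans BD.
by apply: subclosed_compact cB h; exact: closed_closure.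
Qed.

Lemma bounded_compactly_contained A B D : bounded_set D -> A `<=` B -> closed B -> B `<=` D ->
  compactly_contained A D.
Proof.
move=> bD AB cB BD; apply: (compactly_containedS AB).
rewrite /compactly_contained -(closure_id B).1//; split => //.
apply: bounded_closed_compact => //.
by move: bD => [M [Mr MD]]; exists M; split => // x /MD H y /BD /H.
Qed.

(** It vanishes up to distance 1/k from the complement of [D], because of the -1, and this makes the
    support compactly contained in [D]. It is 1 from distance 2/k on, provided the cap on the
    distance allows it. *)
Definition interior_cutoff D (k : nat) (x : V) : R :=
  Num.min 1 (Num.max 0 (k%:R * capped_dist (~` D) x - 1)).

Lemma interior_cutoff_bounds D k x : 0 <= interior_cutoff D k x <= 1.
Proof. by rewrite /interior_cutoff ge_min le_min lexx ler01 /= le_max lexx. Qed.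

Lemma interior_cutoff_continuous D k : cont (interior_cutoff D k).
Proof.
apply: cont_min; first exact: cont_cst.
apply: cont_max; first exact: cont_cst.
apply: contB; last exact: cont_cst.
by apply: contZ; exact: capped_dist_continuous.
Qed.

Lemma interior_cutoff_Cc D k : bounded_set D -> Cc D (interior_cutoff D k).
Proof.
move=> bD; split; first exact: interior_cutoff_continuous.
apply: (@bounded_compactly_contained _ [set x | 1 <= k%:R * capped_dist (~` D) x]) => //.
- move=> x /=; apply: contra_neqP => /negP; rewrite -ltNge => h.
  by rewrite /interior_cutoff (max_l (y := _ - 1)) ?subr_le0 ?ltW// min_r.
- by apply: cont_closed_ge; apply: contZ; exact: capped_dist_continuous.
- move=> x /=; apply: contraPP => Dx; rewrite capped_dist0// mulr0.
  by apply/negP; rewrite -ltNge.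
Qed.

Lemma interior_cutoff_near D x : open D -> D x ->
  \forall k \near \oo, interior_cutoff D k x = 1.
Proof.
move=> oD Dx; have d0 : 0 < capped_dist (~` D) x.
  by apply: capped_dist_gt0; [rewrite closedC|move=> /(_ Dx)].
near=> k; rewrite /interior_cutoff min_l// le_max; apply/orP; right.
rewrite lerBrDr -ler_pdivrMr//; near: k; exact: nbhs_infty_ger.
Unshelve. all: by end_near. Qed.

Definition outer_cutoff (F : set V) (k : nat) (x : V) : R :=
  Num.max 0 (1 - k%:R * capped_dist F x).

Lemma outer_cutoff_bounds F k x : 0 <= outer_cutoff F k x <= 1.
Proof.
rewrite /outer_cutoff le_max lexx /= ge_max ler01 /= gerBl.
by rewrite mulr_ge0// capped_dist_ge0.
Qed.

Lemma outer_cutoff_continuous F k : cont (outer_cutoff F k).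
Proof.
apply: cont_max; first exact: cont_cst.
apply: contB; first exact: cont_cst.
by apply: contZ; exact: capped_dist_continuous.
Qed.

Lemma outer_cutoff_near F x : closed F -> \forall k \near \oo, outer_cutoff F k x = \1_F x.
Proof.
move=> cF; have [Fx|Fx] := pselect (F x).
  near=> k; rewrite /outer_cutoff capped_dist0// mulr0 subr0 indicE mem_set//.
  by rewrite max_r.
have d0 : 0 < capped_dist F x by exact: capped_dist_gt0.
near=> k; rewrite /outer_cutoff indicE memNset// max_l// subr_le0.
rewrite -ler_pdivrMr//; near: k; exact: nbhs_infty_ger.
Unshelve. all: by end_near. Qed.

Lemma CcM D f g : Cc D f -> cont g -> Cc D (fun x => f x * g x).
Proof.
move=> [cf sf] cg; split; first exact: contM.
apply: compactly_containedS sf => x /=; apply: contra_neq => ->; exact: mul0r.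
Qed.

Lemma CcZ D f (c : R) : Cc D f -> Cc D (fun x => c * f x).
Proof.
move=> [cf sf]; split; first exact: contZ.
apply: compactly_containedS sf => x /=; apply: contra_neq => ->; exact: mulr0.
Qed.

Lemma compactly_containedU A B D : compactly_contained A D -> compactly_contained B D ->
  compactly_contained (A `|` B) D.
Proof.
move=> [cA AD] [cB BD]; rewrite /compactly_contained closureU; split.
  exact: compactU.
by rewrite subUset.
Qed.

Lemma CcD D f g : Cc D f -> Cc D g -> Cc D (fun x => f x + g x).
Proof.
move=> [cf sf] [cg sg]; split; first exact: contD.
apply: compactly_containedS (compactly_containedU sf sg) => x /=.
apply: contra_neqP; rewrite not_orP => -[/negP/negPn/eqP -> /negP/negPn/eqP ->].
exact: addr0.
Qed.

Lemma Cc_measurable D D' f : measurable (D' : set T) -> Cc D f -> measurable_fun (D' : set T) f.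
Proof. by move=> mD [cf _]; exact: measurable_continuous. Qed.

Definition approxCc D f := forall e : R, 0 < e ->
  exists h, Cc D h /\ (nint D (fun x => f x - h x)%R <= e%:E)%E.

Section Density.
Variable D : set V.
Hypotheses (oD : open D) (bD : bounded_set D).

Let mD : measurable (D : set T). Proof. exact: measurable_open. Qed.

Let fD : (leb D < +oo)%E. Proof. exact: bounded_leb. Qed.

Lemma approxCc_lim f : measurable_fun (D : set T) f ->
  (forall e : R, 0 < e -> exists g, [/\ measurable_fun (D : set T) g, approxCc D g &
     (nint D (fun x => f x - g x)%R <= e%:E)%E]) -> approxCc D f.
Proof.
move=> mf H e e0; have e2 : 0 < e / 2 by rewrite divr_gt0.
have [g [mg ag fg]] := H _ e2; have [h [ch gh]] := ag _ e2.
exists h; split => //; apply: le_trans (@nint_triangle _ _ _ leb D f g h mD mf mg _) _.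
  exact: Cc_measurable ch.
by rewrite (splitr e) EFinD; apply: leeD.
Qed.

Lemma approxCcD f g : measurable_fun (D : set T) f -> measurable_fun (D : set T) g ->
  approxCc D f -> approxCc D g -> approxCc D (fun x => f x + g x).
Proof.
move=> mf mg af ag e e0; have e2 : 0 < e / 2 by rewrite divr_gt0.
have [h [ch fh]] := af _ e2; have [k [ck gk]] := ag _ e2.
exists (fun x => h x + k x); split; first exact: CcD.
have mh := Cc_measurable mD ch; have mk := Cc_measurable mD ck.
rewrite (@eq_nint _ _ _ leb D _ (fun x => (f x - h x) + (g x - k x))); last first.
  by move=> x _; rewrite opprD addrACA.
apply: le_trans (nintD _ _ _ _) _ => //; try exact: measurable_funB.
by rewrite (splitr e) EFinD; apply: leeD.
Qed.

Lemma approxCcZ f (c : R) : measurable_fun (D : set T) f ->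
  approxCc D f -> approxCc D (fun x => c * f x).
Proof.
move=> mf af e e0; have c1 : 0 < `|c| + 1 by rewrite ltr_wpDl.
have [h [ch fh]] := af (e / (`|c| + 1)) ltac:(by rewrite divr_gt0).
exists (fun x => c * h x); split; first exact: CcZ.
have mh := Cc_measurable mD ch.
rewrite (@eq_nint _ _ _ leb D _ (fun x => c * (f x - h x))); last by move=> x _; rewrite mulrBr.
rewrite nintZ//; last exact: measurable_funB.
apply: le_trans (lee_wpmul2l _ fh) _; first by rewrite lee_fin.
rewrite -EFinM lee_fin mulrA ler_pdivrMr// mulrC; apply: ler_wpM2l; first exact: ltW.
by rewrite lerDl.
Qed.

(** The product of the inner and the outer cutoff is eventually equal to the indicator at each point
    of [D], and dominated convergence applies. *)
Lemma approxCc_closed (F : set V) : closed F -> approxCc D \1_F.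
Proof.
move=> cF e e0.
pose h k x := interior_cutoff D k x * outer_cutoff F k x.
have ch k : Cc D (h k).
  by apply: CcM; [exact: interior_cutoff_Cc|exact: outer_cutoff_continuous].
have hb k x : 0 <= h k x <= 1.
  have /andP[a0 a1] := interior_cutoff_bounds D k x.
  have /andP[b0 b1] := outer_cutoff_bounds F k x.
  by rewrite mulr_ge0//= mulr_ile1.
have mF : measurable_fun (D : set T) (\1_F : V -> R).
  exact: measurable_indic (measurable_closed cF).
have : nint D (fun x => \1_F x - h k x) @[k --> \oo] --> 0%E.
  apply: (@dominated_nint _ _ _ _ _ _ (cst 2)) => //.
  - by move=> k; apply: measurable_funB => //; exact: Cc_measurable (ch k).
  - by apply: (@int1_bounded _ _ _ _ _ _ 2) => // x _; rewrite ger0_norm.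
  - move=> k x Dx /=; have /andP[h0 h1] := hb k x.
    rewrite indicE; case: (x \in F) => /=; rewrite ler_norml; apply/andP; split; lra.
  - move=> x Dx; apply: cvg_near_cst; near=> k.
    rewrite /h; have -> : interior_cutoff D k x = 1 by near: k; exact: interior_cutoff_near.
    by rewrite mul1r; apply/eqP; rewrite subr_eq0 eq_sym; apply/eqP; near: k; exact: outer_cutoff_near.
move=> /cvge0_near/(_ e0)[k _ /(_ k (leqnn _))] ke.
by exists (h k); split => //; exact: ltW.
Unshelve. all: by end_near. Qed.

Lemma closed_box (c : V * V) : closed (box c).
Proof.
rewrite (_ : box c = \bigcap_(i in [set: 'I_n.+1])
   ((fun x : V => x ord0 i : R^o) @^-1` `[c.1 ord0 i, c.2 ord0 i])).
  apply: closed_bigI => i _; apply: preimage_closed; last exact: interval_closed.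
  by move=> x _; exact: coord_continuous.
apply/seteqP; split => x /= xc.
  by move=> i _ /=; rewrite in_itv/=; exact: xc.
by move=> i; have := xc i I; rewrite /= in_itv.
Qed.

(** By definition of the outer measure there is a countable family of boxes whose union [O] contains
    E and D in common and exceeds their intersection by at most e in measure. The finite subunions
    are closed, and their indicators converge to that of [O]. *)
Lemma approxCc_indic (E : set V) : measurable (E : set T) -> approxCc D \1_E.
Proof.
move=> mE; have mED : measurable (E `&` D : set T) by exact: measurableI.
have fED : leb (E `&` D) \is a fin_num.
  rewrite ge0_fin_numE//; apply: le_lt_trans fD.
  by apply: (le_outer_measure (@lebesgue_outer R n)); exact: subIsetr.
apply: approxCc_lim => [|e e0]; first exact: measurable_indic.
have [_ [c Ec <-] ce] := lb_ereal_inf_adherent e0 fED.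
pose O := \bigcup_k box (c k).
have mO : measurable (O : set T) by apply: bigcupT_measurable => k; exact: measurable_box.
exists \1_O; split; first exact: measurable_indic.
  apply: approxCc_lim => [|e' e'0]; first exact: measurable_indic.
  pose F k := \bigcup_(i in `I_k) box (c i).
  have cF k : closed (F k).
    by apply: closed_bigcup => // i _; exact: closed_box.
  have mF k : measurable_fun (D : set T) (\1_(F k) : V -> R).
    exact: measurable_indic (measurable_closed (cF k)).
  have : nint D (fun x => \1_O x - \1_(F k) x) @[k --> \oo] --> 0%E.
    apply: (@dominated_nint _ _ _ _ _ _ (cst 1)) => //.
    - by move=> k; apply: measurable_funB => //; exact: measurable_indic.
    - by apply: (@int1_bounded _ _ _ _ _ _ 1) => // x _; rewrite ger0_norm.
    - move=> k x Dx /=; rewrite !indicE.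
      by case: (x \in O); case: (x \in F k); rewrite /= ?subrr ?subr0 ?sub0r ?normrN ?normr0 ?normr1.
    - move=> x Dx; have [[i _ xi]|Ox] := pselect (O x).
        apply: cvg_near_cst; exists i.+1 => //= k ik; rewrite !indicE !mem_set ?subrr//.
          by exists i.
        by exists i.
      apply: cvg_near_cst; apply: nearW => k; rewrite !indicE !memNset ?subrr// => -[i _ xi].
      by apply: Ox; exists i.
  move=> /cvge0_near/(_ e'0)[k _ /(_ k (leqnn _))] ke.
  exists \1_(F k); split => //; [exact: approxCc_closed|exact: ltW].
have EO : E `&` D `<=` O by [].
rewrite (_ : nint D _ = leb ((O `\` (E `&` D)) `&` D)).
  apply: (@le_trans _ _ (leb (O `\` (E `&` D)))).
    by apply: (le_outer_measure (@lebesgue_outer R n)); exact: subIsetl.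
  have mOE : measurable (O `\` (E `&` D) : set T) by exact: measurableD.
  have : (leb (E `&` D) + leb (O `\` (E `&` D)) <= leb (E `&` D) + e%:E)%E.
    rewrite -measureU//; last by rewrite setDE setICA setICr setI0.
    rewrite setDUK//; apply: le_trans (ltW ce).
    apply: le_trans (outer_measure_sigma_subadditive (@lebesgue_outer R n) _) _.
    by apply: lee_nneseries => k _; rewrite ?outer_measure_ge0//; exact: leb_box_le.
  by rewrite leeD2lE.
rewrite -integral_indic//; last exact: measurableD.
apply: eq_integral => x /set_mem Dx; congr (_%:E); rewrite !indicE.
have [Ex|Ex] := pselect (E x).
  have Ox : O x by apply: EO.
  rewrite (mem_set Ex) (mem_set Ox) memNset ?subrr ?normr0// => -[_ []].
  by split.
have [Ox|Ox] := pselect (O x).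
  rewrite (memNset Ex) (mem_set Ox) mem_set ?sub0r ?normrN ?normr1//.
  by split => // -[].
by rewrite (memNset Ex) (memNset Ox) memNset ?subrr ?normr0// => -[].
Qed.

Lemma approxCc_sum (I : Type) (s : seq I) (F : I -> V -> R) :
  (forall i, measurable_fun (D : set T) (F i)) -> (forall i, approxCc D (F i)) ->
  approxCc D (fun x => \sum_(i <- s) F i x).
Proof.
move=> mF aF; elim: s => [|i s IH].
  rewrite (_ : (fun _ => _) = (fun x => 0 * \1_set0 x)).
    by apply: approxCcZ; [exact: measurable_indic|apply: approxCc_indic; exact: measurable0].
  by apply/funext => x; rewrite big_nil mul0r.
under [X in approxCc D X]eq_fun do rewrite big_cons.
apply: approxCcD => //; exact: measurable_sum.
Qed.

Import HBSimple.

Lemma L1_approxCc f : L1 D f -> approxCc D f.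
Proof.
move=> fi; have mf := int1_measurable fi.
have [g [gi _ gf]] := approximation_sfun_integrable mD fi.
apply: approxCc_lim => // e e0.
have [k _ /(_ k (leqnn _))] := cvge0_near gf e0 => ke.
exists (g k : T -> R); split; last exact: ltW ke.
  exact: int1_measurable (gi k).
have [s sE] : exists s : seq R, (g k : T -> R) =
    (fun x => \sum_(y <- s) y * \1_(g k @^-1` [set y]) x).
  by eexists; apply/funext => x; rewrite {1}fimfunE fsbig_finite.
have mi (y : R) : measurable (g k @^-1` [set y] : set T).
  by apply: measurable_funPTI; exact: measurable_set1.
rewrite sE; apply: approxCc_sum => y.
  by apply: measurable_funM => //; exact: measurable_indic.
by apply: approxCcZ; [exact: measurable_indic|exact: approxCc_indic].
Qed.

End Density.

End LebIntegral.

(** * Partial derivatives and correlations *)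

Section Partials.
Context {R : realType} {n : nat}.
Local Notation V := 'rV[R]_n.+1.
Implicit Types (f g : V -> R) (x : V) (i : 'I_n.+1).

Definition ev i : V := delta_mx ord0 i.

Lemma norm_ev i : `|ev i| <= 1.
Proof.
apply: rV_norm_le => // j; rewrite mxE eqxx /=.
by case: eqP => _; rewrite ?normr0 ?normr1.
Qed.

Definition has_partial f i x (d : R) := is_derive x (ev i) (f : V -> R^o) (d : R^o).

Lemma has_partial_partial f i x d : has_partial f i x d -> partial i f x = d.
Proof. by move=> H; exact: derive_val. Qed.

Lemma derivable_hasp f i x : derivable (f : V -> R^o) x (ev i) -> has_partial f i x (partial i f x).
Proof. by move=> H; split. Qed.

(** Reduces a partial derivative to a derivative in one real variable, so that the chain rule in one
    variable applies. *)
Lemma has_partialP f i x d : has_partial f i x d <-> is_derive (0 : R) 1 (fun h : R => f (h *: ev i + x) : R^o) d.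
Proof.
have E : (fun h : R => h^-1 *: (((f : V -> R^o) \o shift x) (h *: ev i) - f x)) =
    (fun h : R => h^-1 *: (((fun h : R => f (h *: ev i + x) : R^o) \o shift 0) (h *: 1) -
       f ((0 : R) *: ev i + x))).
  by apply/funext => h /=; rewrite scale0r add0r addr0 [h *: 1]mulr1.
by split=> -[h1 h2]; split; move: h1 h2; rewrite /derivable /derive E.
Qed.

Lemma has_partial_cst c i x : has_partial (fun=> c) i x 0.
Proof. exact: is_derive_cst. Qed.

Lemma has_partialD f g i x df dg : has_partial f i x df -> has_partial g i x dg ->
  has_partial (fun y => f y + g y) i x (df + dg).
Proof. exact: is_deriveD. Qed.

Lemma has_partialN f i x df : has_partial f i x df -> has_partial (fun y => - f y) i x (- df).
Proof. exact: is_deriveN. Qed.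

Lemma has_partialB f g i x df dg : has_partial f i x df -> has_partial g i x dg ->
  has_partial (fun y => f y - g y) i x (df - dg).
Proof. exact: is_deriveB. Qed.

Lemma has_partialM f g i x df dg : has_partial f i x df -> has_partial g i x dg ->
  has_partial (fun y => f y * g y) i x (f x * dg + g x * df).
Proof. exact: is_deriveM. Qed.

Lemma has_partialZ c g i x dg : has_partial g i x dg -> has_partial (fun y => c * g y) i x (c * dg).
Proof. exact: is_deriveZ. Qed.

Lemma has_partial_comp (h : R -> R) f i x (dh df : R) : is_derive (f x) 1 h dh -> has_partial f i x df ->
  has_partial (fun y => h (f y)) i x (dh * df).
Proof.
move=> Hh /has_partialP Hf; apply/has_partialP.
apply: (@is_derive1_comp _ h (fun t : R => f (t *: ev i + x))) => //.
by rewrite scale0r add0r.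
Qed.

Lemma has_partial_coord i j x : has_partial (fun y => y ord0 j) i x (i == j)%:R.
Proof.
apply/has_partialP.
rewrite (_ : (fun h : R => _) = (fun h : R => (i == j)%:R * h + x ord0 j)); last first.
  by apply/funext => h; rewrite !mxE eqxx /= mulrC eq_sym.
have := @is_deriveD R R^o R^o ((i == j)%:R \*: id) (cst (x ord0 j)) 0 1 ((i == j)%:R *: 1) 0
  (@is_deriveZ R R^o R^o id (i == j)%:R 0 1 1 (@is_derive_id R R^o 0 1))
  (@is_derive_cst R R^o R^o (x ord0 j) 0 1).
by rewrite addr0 [_ *: 1]mulr1.
Qed.

Lemma has_partial_line f i x (df : V -> R) (h : R) : (forall y, has_partial f i y (df y)) ->
  is_derive h 1 (fun t : R => f (x + t *: ev i) : R^o) (df (x + h *: ev i)).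
Proof.
move=> Hf; have /has_partialP H := Hf (x + h *: ev i).
rewrite (_ : (fun t : R => f (x + t *: ev i) : R^o) =
    (fun t : R => f (t *: ev i + (x + h *: ev i))) \o (fun t : R => t - h)); last first.
  apply/funext => t /=; congr f; rewrite addrCA -scalerDl; congr (x + _ *: _); ring.
rewrite -[X in is_derive _ _ _ X]mulr1.
apply: is_derive1_comp; first by rewrite subrr.
rewrite -[X in is_derive _ _ _ X]subr0.
exact: is_deriveB.
Qed.

Lemma has_partial_shift f i x z d : has_partial f i (x + z) d -> has_partial (fun y => f (y + z)) i x d.
Proof.
move=> /has_partialP H; apply/has_partialP.
by under eq_fun do rewrite -addrA.
Qed.

Lemma has_partial_scale f i x (c d : R) : has_partial f i (c *: x) d -> has_partial (fun y => f (c *: y)) i x (c * d).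
Proof.
move=> /has_partialP H; apply/has_partialP.
rewrite (_ : (fun h : R => _) =
    (fun t : R => f (t *: ev i + c *: x)) \o (fun t : R => c * t)); last first.
  by apply/funext => t /=; rewrite scalerDr scalerA.
rewrite mulrC; apply: is_derive1_comp; first by rewrite mulr0.
rewrite -[X in is_derive _ _ _ X]mulr1.
exact: (@is_deriveZ R R^o R^o id c 0 1 1 (@is_derive_id R R^o 0 1)).
Qed.

Definition C1 f := [/\ cont f, forall i x, derivable (f : V -> R^o) x (ev i) &
  forall i, cont (partial i f)].

Lemma C1_cont f : C1 f -> cont f. Proof. by case. Qed.

Lemma C1_hasp f i x : C1 f -> has_partial f i x (partial i f x).
Proof. by case=> _ H _; exact: derivable_hasp. Qed.

Lemma C1_partial f i : C1 f -> cont (partial i f).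
Proof. by case. Qed.

Lemma C1_intro f (df : 'I_n.+1 -> V -> R) : cont f -> (forall i x, has_partial f i x (df i x)) ->
  (forall i, cont (df i)) -> C1 f.
Proof.
move=> cf Hf cdf; split => // [i x|i]; first by case: (Hf i x).
by rewrite (_ : partial i f = df i)//; apply/funext => x; exact: has_partial_partial.
Qed.

Lemma C1M f g : C1 f -> C1 g -> C1 (fun x => f x * g x).
Proof.
move=> Hf Hg.
apply: (@C1_intro _ (fun i x => f x * partial i g x + g x * partial i f x)).
- by apply: contM; exact: C1_cont.
- by move=> i x; apply: has_partialM; exact: C1_hasp.
- move=> i; apply: contD; apply: contM.
  + exact: C1_cont Hf.
  + exact: C1_partial Hg.
  + exact: C1_cont Hg.
  + exact: C1_partial Hf.
Qed.

Lemma partialM f g i x : C1 f -> C1 g ->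
  partial i (fun x => f x * g x) x = f x * partial i g x + g x * partial i f x.
Proof. by move=> Hf Hg; apply: has_partial_partial; apply: has_partialM; exact: C1_hasp. Qed.

Lemma C1_cst c : C1 (fun=> c).
Proof.
apply: (@C1_intro _ (fun _ _ => 0)); [exact: cont_cst| |by move=> i; exact: cont_cst].
by move=> i x; exact: has_partial_cst.
Qed.

Lemma C1D f g : C1 f -> C1 g -> C1 (fun x => f x + g x).
Proof.
move=> Hf Hg; apply: (@C1_intro _ (fun i x => partial i f x + partial i g x)).
- by apply: contD; exact: C1_cont.
- by move=> i x; apply: has_partialD; exact: C1_hasp.
- by move=> i; apply: contD; exact: C1_partial.
Qed.

Lemma partialD f g i x : C1 f -> C1 g ->
  partial i (fun x => f x + g x) x = partial i f x + partial i g x.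
Proof. by move=> Hf Hg; apply: has_partial_partial; apply: has_partialD; exact: C1_hasp. Qed.

Lemma C1N f : C1 f -> C1 (fun x => - f x).
Proof.
move=> Hf; apply: (@C1_intro _ (fun i x => - partial i f x)).
- by apply: contN; exact: C1_cont.
- by move=> i x; apply: has_partialN; exact: C1_hasp.
- by move=> i; apply: contN; exact: C1_partial.
Qed.

Lemma C1_comp (h dh : R -> R) f : C1 f -> (forall t : R, is_derive t 1 h (dh t)) ->
  continuous (h : R^o -> R^o) -> continuous (dh : R^o -> R^o) -> C1 (fun x => h (f x)).
Proof.
move=> Hf Hh ch cdh; apply: (@C1_intro _ (fun i x => dh (f x) * partial i f x)).
- by apply: cont_comp => //; exact: C1_cont.
- by move=> i x; apply: (has_partial_comp (Hh _)); exact: C1_hasp.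
- by move=> i; apply: contM; [apply: cont_comp => //; exact: C1_cont|exact: C1_partial].
Qed.

Lemma partial_comp (h dh : R -> R) f i x : C1 f -> (forall t : R, is_derive t 1 h (dh t)) ->
  partial i (fun x => h (f x)) x = dh (f x) * partial i f x.
Proof. by move=> Hf Hh; apply: has_partial_partial; apply: (has_partial_comp (Hh _)); exact: C1_hasp. Qed.


Lemma partial_supp f i : C1 f -> [set x | partial i f x != 0] `<=` closure [set x | f x != 0].
Proof.
move=> Hf x /=; apply: contra_neqP => Nx; apply: has_partial_partial.
have Ny : \forall y \near x, f y = 0.
  have : nbhs x (~` closure [set y | f y != 0]).
    by apply: open_nbhs_nbhs; split => //; rewrite openC; exact: closed_closure.
  apply: filterS => y Cy; apply/eqP; apply: contraPT isT => fy.
  by exfalso; apply: Cy; exact: subset_closure.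
apply/has_partialP; apply: (@near_eq_is_derive R R^o R^o (cst (0 : R^o))).
move/nbhs_ballP : Ny => [e /= e0 eN].
apply/nbhs_ballP; exists e => //= h; rewrite -ball_normE /= sub0r normrN => he.
apply/esym/eN; rewrite -ball_normE /= opprD addrCA subrr addr0 normrN normrZ.
by apply: le_lt_trans he; rewrite ler_piMr// norm_ev.
Qed.

(** Compactness in its near-covering form turns local radii into a uniform one. Points outside the
    support are handled by exchanging x and y, or are trivial when both values vanish. *)
Lemma csupp_unif f : cont f -> compact (closure [set x | f x != 0]) ->
  forall e : R, 0 < e -> exists2 d : R, 0 < d & forall x y, `|x - y| <= d -> `|f x - f y| <= e.
Proof.
move=> cf cK e e0; set K := closure _ in cK.
have e2 : 0 < e / 2 by rewrite divr_gt0.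
have /compact_near_coveringP ncK := cK.
have H : \forall d \near (0 : R)^'+, K `<=` (fun x => forall y, `|x - y| <= d -> `|f x - f y| <= e).
  apply: ncK => x Kx.
  have := (contP f).1 cf x _ e2 => /nbhs_ballP [r /= r0 rf].
  have r2 : 0 < r / 2 by rewrite divr_gt0.
  exists (ball x (r / 2), [set d | d < r / 2]) => /=.
    split; first exact: nbhsx_ballx.
    exact: nbhs_right_lt.
  move=> [x' d] /= [xx' dr] y x'y.
  have h1 : `|f x - f x'| <= e / 2.
    by apply: rf; apply: le_ball xx'; lra.
  have h2 : `|f x - f y| <= e / 2.
    apply: rf; move: xx'; rewrite -!ball_normE /= => xx'.
    rewrite -(subrKA x'); apply: le_lt_trans (ler_normD _ _) _.
    by rewrite (splitr r); apply: ltrD => //; exact: le_lt_trans dr.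
  rewrite -(subrKA (f x)); apply: le_trans (ler_normD _ _) _.
  by rewrite (splitr e) distrC; apply: lerD => //; rewrite distrC.
have [d [d0 dH]] : exists d : R, 0 < d /\
    K `<=` (fun x => forall y, `|x - y| <= d -> `|f x - f y| <= e).
  near (0 : R)^'+ => d; exists d; split; first by near: d; exact: nbhs_right_gt.
  by near: d.
exists d => // x y xy; have [Kx|Kx] := pselect (K x); first exact: dH.
have [Ky|Ky] := pselect (K y); first by rewrite distrC; apply: dH => //; rewrite distrC.
have z (z' : V) (Kz : ~ K z') : f z' = 0.
  by apply/eqP; apply: contraPT isT => fz; exfalso; apply: Kz; exact: subset_closure.
by rewrite (z x Kx) (z y Ky) subrr normr0 ltW.
Unshelve. all: by end_near. Qed.

Lemma csupp_bounded f : cont f -> compact (closure [set x | f x != 0]) ->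
  exists2 M : R, 0 <= M & forall x, `|f x| <= M.
Proof.
move=> cf cK; set K := closure _ in cK.
have /compact_near_coveringP ncK := cK.
have H : \forall M \near +oo, K `<=` (fun x => `|f x| <= M).
  apply: ncK => x Kx.
  have := (contP f).1 cf x _ ltr01 => xf.
  exists ([set y | `|f x - f y| <= 1], [set M | `|f x| + 1 <= M]) => /=.
    by split => //; exact: nbhs_pinfty_ge.
  move=> [y M] /= [xy fM]; apply: le_trans fM.
  rewrite -[f y](subrK (f x)) addrC; apply: le_trans (ler_normD _ _) _.
  by rewrite lerD2l distrC.
have [M [M0 MH]] : exists M : R, 0 <= M /\ K `<=` (fun x => `|f x| <= M).
  near +oo_R => M; exists M; split; first by near: M; exact: nbhs_pinfty_ge.
  by near: M.
exists M => // x; have [Kx|Kx] := pselect (K x); first exact: MH.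
rewrite (_ : f x = 0) ?normr0//.
by apply/eqP; apply: contraPT isT => fz; exfalso; apply: Kx; exact: subset_closure.
Unshelve. all: by end_near. Qed.

End Partials.

(** * Smoothing by correlation with a kernel *)

Section Correlation.
Context {R : realType} {n : nat}.
Local Notation V := 'rV[R]_n.+1.
Local Notation T := (leb_space R n).
Local Notation leb := (@leb R n).
Local Notation nint := (nint leb).
Implicit Types (D : set V) (f g k v : V -> R) (x : V) (i : 'I_n.+1).

Lemma leb_uball_lty (x : V) (r : R) : (leb (uball x r) < +oo)%E.
Proof.
apply: (@bounded_leb R n); exists (`|x| + `|r|); split; first exact: num_real.
move=> M xM y yx /=; apply/ltW; apply: le_lt_trans xM; rewrite -(subrK x y) addrC.
by apply: le_trans (ler_normD _ _) _; rewrite lerD2l; apply: le_trans (ltW yx) (ler_norm _).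
Qed.

Lemma contPball f : cont f <-> forall x (e : R), 0 < e ->
  exists2 r : R, 0 < r & forall y, `|x - y| < r -> `|f x - f y| <= e.
Proof.
split=> [/contP cf x e e0|H].
  have /nbhs_ballP[r /= r0 rf] := cf x e e0; exists r => // y xy.
  by apply: rf; rewrite -ball_normE.
apply/contP => x e e0; have [r r0 rf] := H x e e0.
by apply/nbhs_ballP; exists r => // y; rewrite -ball_normE /=; exact: rf.
Qed.

Lemma cont_shift f z : cont f -> cont (fun y : V => f (y + z)).
Proof.
move=> /contPball cf; apply/contPball => x e e0; have [r r0 rf] := cf (x + z) e e0.
by exists r => // y xy; apply: rf; rewrite opprD addrACA subrr addr0.
Qed.

Lemma cont_scale f (c : R) : cont f -> cont (fun y : V => f (c *: y)).
Proof.
move=> /contPball cf; apply/contPball => x e e0; have [r r0 rf] := cf (c *: x) e e0.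
have c0 : 0 < `|c| + 1 by rewrite ltr_wpDl.
exists (r / (`|c| + 1)); first by rewrite divr_gt0.
move=> y; rewrite ltr_pdivlMr// => xy; apply: rf; rewrite -scalerBr normrZ.
by apply: le_lt_trans xy; rewrite mulrC ler_wpM2l// lerDl.
Qed.

Definition csupp k := compact (closure [set x | k x != 0]).

Lemma csuppS k g : (forall x, k x = 0 -> g x = 0) -> csupp k -> csupp g.
Proof.
move=> kg ck; apply: (subclosed_compact _ ck); first exact: closed_closure.
by apply: closureS => x /=; apply: contra_neq; exact: kg.
Qed.

Lemma csupp_partial k i : C1 k -> csupp k -> csupp (partial i k).
Proof.
move=> Hk ck; apply: (subclosed_compact _ ck); first exact: closed_closure.
have := closureS (partial_supp (i := i) Hk).
by rewrite -(closure_id (closure [set x | k x != 0])).1//; exact: closed_closure.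
Qed.

(* Correlation rather than convolution: no reflection of the kernel k is needed. *)
Definition corr D k v x : R := \int[leb]_(y in D) (k (y - x) * v y).

Section Fixed.
Variable D : set V.
Hypothesis mD : measurable (D : set T).

Lemma measurable_cont_shift k x : cont k -> measurable_fun (D : set T) (fun y : V => k (y - x)).
Proof. by move=> ck; apply: measurable_continuous => //; exact: cont_shift. Qed.

Lemma corr_int k v x : cont k -> csupp k -> L1 D v -> L1 D (fun y => k (y - x) * v y).
Proof.
move=> ck sk vi; have [M M0 kM] := csupp_bounded ck sk.
apply: (@int1Mbounded _ _ _ leb D v (fun y => k (y - x)) M) => //.
exact: measurable_cont_shift.
Qed.

Lemma corr_le k v x : cont k -> csupp k -> L1 D v ->
  (`|corr D k v x|%:E <= nint D (fun y => k (y - x) * v y)%R)%E.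
Proof. by move=> ck sk vi; apply: Rintegral_nint => //; exact: corr_int. Qed.

Lemma nintM_le (w v : V -> R) (M : R) : measurable_fun (D : set T) w -> L1 D v ->
  (forall x, D x -> `|w x| <= M) -> 0 <= M ->
  (nint D (fun y => w y * v y)%R <= M%:E * nint D v)%E.
Proof.
move=> mw vi wM M0; have mv := int1_measurable vi.
rewrite -{1}(ger0_norm M0) -nintZ//; apply: nint_le => //; try exact: measurable_funM.
by move=> x Dx; rewrite !normrM (ger0_norm M0) ler_wpM2r// wM.
Qed.

Lemma corr_cont k v : cont k -> csupp k -> L1 D v -> cont (corr D k v).
Proof.
move=> ck sk vi; apply/contPball => x e e0.
have [I0 If] := (nint_ge0 leb D v, int1_fin vi).
have I1 : 0 < fine (nint D v) + 1 by rewrite ltr_wpDl// fine_ge0.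
have [d d0 kd] := csupp_unif ck sk (divr_gt0 e0 I1).
exists d => // y /ltW xy.
rewrite /corr -RintegralB//; [|exact: corr_int|exact: corr_int].
rewrite (@eq_Rintegral _ T R leb D (fun z : V => (k (z - x) - k (z - y)) * v z)); last first.
  by move=> z _; rewrite mulrBl.
have mk z : measurable_fun (D : set T) (fun y : V => k (y - z)) by exact: measurable_cont_shift.
have wb z : D z -> `|k (z - x) - k (z - y)| <= e / (fine (nint D v) + 1).
  by move=> _; apply: kd; rewrite opprB addrC subrKA distrC.
have wi : L1 D (fun z => (k (z - x) - k (z - y)) * v z).
  apply: (@int1Mbounded _ _ _ leb D v _ (e / (fine (nint D v) + 1))) => //.
    by apply: measurable_funB; exact: mk.
rewrite -lee_fin; apply: le_trans (Rintegral_nint mD wi) _.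
apply: le_trans (nintM_le _ vi wb _) _; first exact: measurable_funB.
  by rewrite ltW// divr_gt0.
rewrite -[nint D v]fineK ?nint_fin_num// -EFinM lee_fin mulrAC ler_pdivrMr//.
by apply: ler_wpM2l; [exact: ltW|rewrite lerDl].
Qed.

(** Differentiation under the integral sign along the line through x in direction i, dominated by
    the supremum of the derivative of k times |v|. The minus sign comes from differentiating k(y -
    x) in x. *)
Lemma corr_hasp k v i x : C1 k -> csupp k -> L1 D v ->
  has_partial (corr D k v) i x (corr D (fun z => - partial i k z) v x).
Proof.
move=> Hk sk vi; have ck := C1_cont Hk.
have cdk := C1_partial (i := i) Hk; have sdk := csupp_partial (i := i) Hk sk.
have [M M0 kM] := csupp_bounded cdk sdk.
pose f (h : R) (y : V) : R := k ((y - x) - h *: ev i) * v y.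
have Hf (h : R) (y : V) : is_derive h 1 (f ^~ y) (- partial i k ((y - x) - h *: ev i) * v y).
  pose kn (t : R) : R := k (y - x + t *: ev i).
  have H1 : is_derive (- h) 1 kn (partial i k (y - x + (- h) *: ev i)).
    by apply: has_partial_line => z; exact: C1_hasp.
  have H2 : is_derive h 1 (kn \o -%R) (partial i k (y - x + (- h) *: ev i) * -1).
    exact: is_derive1_comp H1 (is_deriveNid h 1).
  have H3 := is_deriveZ (v y) H2.
  rewrite (_ : f^~ y = v y \*: (kn \o -%R)).
    by apply: is_derive_eq H3 _; rewrite scaleNr [_ *: _]mulrC mulrN1.
  by apply/funext => t; rewrite /f /kn /= scaleNr [RHS]mulrC.
have fi h : L1 D (f h).
  apply: (@eq_integrable _ _ _ leb D mD (EFin \o (fun y => k (y - (x + h *: ev i)) * v y))).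
    by move=> y _; rewrite /f /= opprD addrA.
  exact: corr_int.
have d1f h y : partial1of2 f h y = - partial i k ((y - x) - h *: ev i) * v y.
  by rewrite partial1of2E; exact: derive_val.
have GI : leb.-integrable D (EFin \o (fun y => M * `|v y|)).
  apply: int1Z => //; apply: (int1_le mD vi) => [|y _]; last by rewrite normr_id.
  by apply: measurable_norm; exact: int1_measurable vi.
have Ia : ([set` `](-1), 1[] : set R) 0 by rewrite /= in_itv /=; apply/andP; split; lra.
have G0 y : 0 <= M * `|v y| by rewrite mulr_ge0.
have fd h y : ([set` `](-1), 1[] : set R) h -> D y -> derivable (f^~ y) h 1.
  by move=> _ _; case: (Hf h y).
have Gub h y : ([set` `](-1), 1[] : set R) h -> D y -> `|partial1of2 f h y| <= M * `|v y|.
  by move=> _ _; rewrite d1f normrM normrN ler_wpM2r.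
have fi' h : ([set` `](-1), 1[] : set R) h -> leb.-integrable D (EFin \o f h) by move=> _; exact: fi.
apply/has_partialP.
have := cvg_differentiation_under_integral mD Ia fi' fd G0 GI Gub.
have -> : \int[leb]_(y in D) partial1of2 f 0 y = corr D (fun z => - partial i k z) v x.
  by apply: eq_Rintegral => y _; rewrite d1f scale0r subr0.
move=> H.
have FE h : \int[leb]_(y in D) f h y = corr D k v (h *: ev i + x).
  by apply: eq_Rintegral => y _; rewrite /f opprD addrA addrAC.
have E : (fun h : R => h^-1 *: (((fun h : R => corr D k v (h *: ev i + x)) \o shift 0) (h *: 1) -
       corr D k v ((0 : R) *: ev i + x))) =
   (fun h : R => h^-1 *: (\int[leb]_(y in D) f (h + 0) y - \int[leb]_(y in D) f 0 y)).
  by apply/funext => h /=; rewrite !FE [h *: 1]mulr1.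
by split; rewrite /derivable /derive E; [apply/cvg_ex; eexists; exact: H|apply/cvg_lim => //; exact: H].
Qed.

Lemma csuppN k : csupp k -> csupp (fun z => - k z).
Proof. by apply: csuppS => x ->; rewrite oppr0. Qed.

Lemma C1_corr k v : C1 k -> csupp k -> L1 D v -> C1 (corr D k v).
Proof.
move=> Hk sk vi; apply: (C1_intro (df := fun i => corr D (fun z => - partial i k z) v)).
- by apply: corr_cont => //; exact: C1_cont.
- by move=> i x; exact: corr_hasp.
- move=> i; apply: corr_cont => //; first by apply: contN; exact: C1_partial.
  by apply: csuppN; exact: csupp_partial.
Qed.

End Fixed.

Lemma smooth_C1 k : smooth k -> C1 k.
Proof.
move=> sk; split; first exact: (sk [::]).1.
- by move=> i x; exact: (sk [::]).2.
- by move=> i; exact: (sk [:: i]).1.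
Qed.

Lemma smooth_partial k i : smooth k -> smooth (partial i k).
Proof.
move=> sk s; have := sk (rcons s i).
by rewrite /iter_partial foldr_rcons.
Qed.

Lemma smoothN k : smooth k -> smooth (fun x => - k x).
Proof.
move=> sk s.
have E : iter_partial s (fun x => - k x) = (fun x => - iter_partial s k x).
  elim: s => [//|i s IH] /=; rewrite IH; apply/funext => x; apply: has_partial_partial.
  by apply: has_partialN; apply: derivable_hasp; exact: (sk s).2.
rewrite E; split; first by apply: contN; exact: (sk s).1.
by move=> i x; case: (has_partialN (derivable_hasp ((sk s).2 i x))).
Qed.

(** A partial derivative of a correlation is again a correlation, whose kernel is minus a derivative
    of the old one; regularity then follows by induction on the list of derivatives. *)
Lemma smooth_corr D k v : measurable (D : set T) -> smooth k -> csupp k -> L1 D v ->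
  smooth (corr D k v).
Proof.
move=> mD sk ck vi s.
have [k' [sk' ck' ->]] : exists k', [/\ smooth k', csupp k' & iter_partial s (corr D k v) = corr D k' v].
  elim: s => [|i s [k' [sk' ck' IH]]]; first by exists k.
  exists (fun z => - partial i k' z); split.
  - by apply: smoothN; exact: smooth_partial.
  - by apply: csuppN; apply: csupp_partial => //; exact: smooth_C1.
  - by rewrite /= IH; apply/funext => x; apply: has_partial_partial; apply: corr_hasp => //; exact: smooth_C1.
have [c1 c2 c3] := C1_corr mD (smooth_C1 sk') ck' vi.
by split; [exact: c1|exact: c2].
Qed.

Lemma csupp_ball k : csupp k ->
  exists2 r : R, 0 < r & forall x, r <= `|x| -> ~ closure [set y | k y != 0] x.
Proof.
move=> /compact_bounded [M [Mr MK]].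
have M1 : M < `|M| + 1 by rewrite (le_lt_trans (ler_norm _))// ltrDl.
exists (`|M| + 1 + 1); first by rewrite !ltr_wpDl//.
move=> x xr kx; have /= h := MK _ M1 x kx.
by have := le_trans xr h; rewrite gerDl ler10.
Qed.

Lemma not_closure_eq0 k x : ~ closure [set y | k y != 0] x -> k x = 0.
Proof. by move=> h; apply/eqP; apply: contraPT isT => kx; exfalso; apply/h/subset_closure. Qed.

Lemma cont_L1 k : cont k -> csupp k -> L1 setT k.
Proof.
move=> ck sk; have [r r0 kr] := csupp_ball sk; have [M M0 kM] := csupp_bounded ck sk.
have mk : measurable_fun (setT : set T) k by apply: measurable_continuous.
have mB := measurable_uball (0 : V) r.
apply/int1P; split => //.
rewrite (_ : nint setT k = nint (uball 0 r) k).
  by apply: int1_fin; apply: (@int1_bounded _ _ _ _ _ _ M) => //; [exact: leb_uball_lty|exact: measurable_funS mk].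
rewrite /nint [RHS]integral_mkcond; apply: eq_integral => x _.
rewrite /patch; case: ifPn => // /negP xr; rewrite (not_closure_eq0 (k := k)) ?normr0//.
by apply: kr; rewrite leNgt; apply/negP => h; apply: xr; rewrite inE /uball /= subr0.
Qed.

(** The correlation of k with the constant 1 on a large cube is constant near 0 by translation
    invariance, and its derivative at 0 is minus the integral of the derivative of k. *)
Lemma int_partial0 k i : C1 k -> csupp k -> \int[leb]_x partial i k x = 0.
Proof.
move=> Hk sk; have [r r0 kr] := csupp_ball sk.
have ck := C1_cont Hk; have cdk := C1_partial (i := i) Hk; have sdk := csupp_partial (i := i) Hk sk.
(* The margin 1 keeps all translates of k by vectors of norm at most 1 supported in [B]. *)
pose B : set V := uball 0 (r + 1).
have mB : measurable (B : set T) by exact: measurable_uball.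
have i1 : L1 B (fun=> 1).
  apply: (@int1_bounded _ _ _ _ _ _ 1) => //; last by move=> x _; rewrite normr1.
  exact: leb_uball_lty.
have H := corr_hasp mB i 0 Hk sk i1.
have kB (g : V -> R) y : (forall z, r <= `|z| -> g z = 0) -> `|y| <= 1 ->
    \int[leb]_(x in B) (g (x - y) * 1) = \int[leb]_x g (x - y).
  move=> gr y1; rewrite Rintegral_mkcond; apply: eq_Rintegral => x _.
  rewrite /patch; case: ifPn => [_|/negP xB]; first by rewrite mulr1.
  rewrite gr// leNgt; apply/negP => h; apply: xB; rewrite inE /B /uball /= subr0.
  by rewrite -(subrK y x); apply: le_lt_trans (ler_normD _ _) _; exact: ltr_leD.
have dkr z : r <= `|z| -> partial i k z = 0.
  move=> zr; apply/eqP; apply: contraPT isT => dz; exfalso.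
  exact: (kr z zr) (partial_supp Hk dz).
have kr' z : r <= `|z| -> k z = 0 by move=> /kr/not_closure_eq0.
have c0 : corr B (fun z => - partial i k z) (fun=> 1) 0 = 0.
  move/has_partialP : H => H; have <- := @derive_val _ _ _ _ _ _ _ H.
  apply: derive_val; apply: (@near_eq_is_derive R R^o R^o (cst (\int[leb]_x k x : R^o))).
  apply/nbhs_ballP; exists 1 => //= h; rewrite -ball_normE /= sub0r normrN => h1.
  have he : `|h *: ev i + 0| <= 1.
    by rewrite addr0 normrZ (le_trans (ler_piMr _ _)) ?norm_ev// ltW.
  by rewrite /corr (kB _ _ kr' he) (Rintegral_shift (- (h *: ev i + 0)) (cont_L1 ck sk)).
move: c0; rewrite /corr (kB (fun z => - partial i k z)) ?normr0//; last by move=> z /dkr ->; rewrite oppr0.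
under eq_Rintegral do rewrite subr0.
move=> h; have : \int[leb]_x (-1 * - partial i k x) = -1 * 0.
  by rewrite RintegralZl ?h//; apply: int1N; exact: cont_L1.
by under eq_Rintegral do rewrite mulN1r opprK; rewrite mulr0.
Qed.

End Correlation.

(** * Smooth bump functions and mollifiers *)

Section Bump.
Context {R : realType}.

(** The power of 1/s in front of the exponential makes the family closed under differentiation: the
    derivative combines the members m + 1 and m + 2. *)
Definition flat (m : nat) (s : R) : R := if 0 < s then s^-1 ^+ m * expR (- s^-1) else 0.

Lemma flat_ge0 m s : 0 <= flat m s.
Proof.
by rewrite /flat; case: ifP => // s0; rewrite mulr_ge0 ?expR_ge0// exprn_ge0// invr_ge0 ltW.
Qed.

(** From exp(1/s) >= (1/s)^(m+1) / (m+1)!. It gives the flatness at 0. *)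
Lemma flat_le m s : flat m s <= m.+1`!%:R * `|s|.
Proof.
rewrite /flat; case: ifPn => [s0|_]; last by rewrite mulr_ge0.
have f0 : 0 < m.+1`!%:R :> R by rewrite ltr0n fact_gt0.
have := expR_ge1Dxn m (ltW (_ : 0 < s^-1)); rewrite invr_gt0 => /(_ s0) h.
rewrite expRN ler_pdivrMr ?expR_gt0// (gtr0_norm s0).
have {}h : s^-1 ^+ m.+1 / m.+1`!%:R <= expR s^-1 by apply: le_trans h; rewrite ler_wpDl.
rewrite ler_pdivrMr// in h.
rewrite mulrAC -ler_pdivrMr// mulrC -exprS; apply: le_trans h _.
by rewrite mulrC.
Qed.

Lemma is_derive_flat (m : nat) (s : R) : is_derive s 1 (flat m) (- m%:R * flat m.+1 s + flat m.+2 s).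
Proof.
have [s0|s0|->] := ltgtP s 0.
- have E (k : nat) : flat k s = 0 by rewrite /flat ltNge ltW.
  rewrite !E mulr0 addr0; apply: (@near_eq_is_derive R R^o R^o (cst (0 : R^o))).
  near=> z; rewrite /cst /flat ifF//; apply/negbTE; rewrite -leNgt.
  by apply/ltW; near: z; exact: (cvgr_lt s).
- have sn : s != 0 by rewrite gt_eqF.
  apply: (@near_eq_is_derive R R^o R^o (fun z : R => z^-1 ^+ m * expR (- z^-1) : R^o)).
    near=> z; rewrite /flat ifT//.
    by near: z; exact: (cvgr_gt s).
  have DV : is_derive s 1 (fun z : R => z^-1 : R^o) (- s ^- 2).
    have := @is_deriveV R id s 1 1 sn (is_derive_id _ _).
    by rewrite [_ *: 1]mulr1.
  have DE : is_derive s 1 (expR \o (fun z : R => - z^-1)) (expR (- s^-1) * s ^- 2).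
    apply: is_derive1_comp.
    by have := is_deriveN DV; rewrite opprK.
  have := is_deriveM (is_deriveX m DV) DE; rewrite exprfctE => H.
  apply: is_derive_eq H _; rewrite /flat s0.
  rewrite -exprVn /GRing.scale /=; set w := s^-1; set E := expR _.
  by case: m => [|m] /=; rewrite ?exprS ?expr0; ring.
- rewrite (_ : _ + _ = 0); last by rewrite /flat ltxx mulr0 addr0.
  (* At 0 the difference quotient of [flat m] is [flat m.+1], which tends to 0 by [flat_le]. *)
  apply/is_derive1_caratheodory; exists (flat m.+1); split.
  + move=> z; rewrite /flat ltxx !subr0; case: ifPn => [z0|]; last by rewrite mul0r.
    by rewrite exprSr mulrAC -[_ * z^-1 * z]mulrA mulVf ?gt_eqF// mulr1.
  + have E : flat m.+1 0 = 0 by rewrite /flat ltxx.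
    apply/cvgrPdist_le => e e0; rewrite E.
    have f0 : 0 < m.+2`!%:R :> R by rewrite ltr0n fact_gt0.
    near=> z; rewrite sub0r normrN ger0_norm ?flat_ge0//.
    apply: le_trans (flat_le _ _) _; rewrite mulrC -ler_pdivlMr//.
    rewrite -[z]subr0 distrC; near: z.
    by apply/nbhs_ballP; exists (e / m.+2`!%:R) => /=; [rewrite divr_gt0|move=> z /= /ltW].
  + by rewrite /flat ltxx.
Unshelve. all: by end_near. Qed.

Context {n : nat}.
Local Notation V := 'rV[R]_n.+1.
Local Notation T := (leb_space R n).
Local Notation leb := (@leb R n).

(** An algebra of functions stable under partial derivatives, so that continuity of its members
    already gives smoothness of every order. *)
Inductive flat_alg : (V -> R) -> Prop :=
| flat_alg_flat m (i : 'I_n.+1) (a b : R) : flat_alg (fun x : V => flat m (a * x ord0 i + b))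
| flat_alg_cst c : flat_alg (fun=> c)
| flat_algD f g : flat_alg f -> flat_alg g -> flat_alg (fun x => f x + g x)
| flat_algM f g : flat_alg f -> flat_alg g -> flat_alg (fun x => f x * g x).

Lemma has_partial_affine (i j : 'I_n.+1) (a b : R) (x : V) :
  has_partial (fun y : V => a * y ord0 i + b) j x (a * (j == i)%:R).
Proof.
rewrite -[X in has_partial _ _ _ X]addr0; apply: has_partialD; last exact: has_partial_cst.
by apply: has_partialZ; exact: has_partial_coord.
Qed.

Lemma cont_coord (i : 'I_n.+1) : cont (fun y : V => y ord0 i).
Proof. by move=> x; exact: coord_continuous. Qed.

Lemma flat_continuous m : continuous (flat m : R^o -> R^o).
Proof.
move=> s; apply: differentiable_continuous; apply/derivable1_diffP.
by case: (is_derive_flat m s).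
Qed.

Lemma flat_alg_partial f : flat_alg f -> cont f /\ forall i : 'I_n.+1,
  exists2 g, flat_alg g & forall x, has_partial f i x (g x).
Proof.
elim=> [m i a b|c|f1 g1 F [cf IHf] G [cg IHg]|f1 g1 F [cf IHf] G [cg IHg]].
- split; first by apply: cont_comp (@flat_continuous m); apply: contD;
    [apply: contZ; exact: cont_coord|exact: cont_cst].
  move=> j; exists (fun x => (- m%:R * flat m.+1 (a * x ord0 i + b) + flat m.+2 (a * x ord0 i + b)) *
    (a * (j == i)%:R)).
    apply: flat_algM; last exact: flat_alg_cst.
    apply: flat_algD; last exact: flat_alg_flat.
    by apply: flat_algM; [exact: flat_alg_cst|exact: flat_alg_flat].
  by move=> x; apply: has_partial_comp (has_partial_affine _ _ _ _ _); exact: is_derive_flat.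
- split; first exact: cont_cst.
  by move=> j; exists (fun=> 0); [exact: flat_alg_cst|move=> x; exact: has_partial_cst].
- split; first exact: contD.
  move=> j; have [f' F' Hf] := IHf j; have [g' G' Hg] := IHg j.
  exists (fun x => f' x + g' x); first exact: flat_algD.
  by move=> x; exact: has_partialD.
- split; first exact: contM.
  move=> j; have [f' F' Hf] := IHf j; have [g' G' Hg] := IHg j.
  exists (fun x => f1 x * g' x + g1 x * f' x); last by move=> x; exact: has_partialM.
  by apply: flat_algD; exact: flat_algM.
Qed.

Lemma flat_alg_smooth f : flat_alg f -> smooth f.
Proof.
move=> F s.
have Fs : flat_alg (iter_partial s f).
  elim: s => [//|i s IH] /=; have [_ /(_ i) [g G Hg]] := flat_alg_partial IH.
  by rewrite (_ : partial i _ = g)//; apply/funext => x; exact: has_partial_partial.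
have [c H] := flat_alg_partial Fs; split; first exact: c.
by move=> i x; have [g _ Hg] := H i; case: (Hg x).
Qed.

Lemma flat_alg_prod (I : Type) (s : seq I) (F : I -> V -> R) :
  (forall i, flat_alg (F i)) -> flat_alg (fun x => \prod_(i <- s) F i x).
Proof.
move=> H; elim: s => [|i s IH].
  by under eq_fun do rewrite big_nil; exact: flat_alg_cst.
by under eq_fun do rewrite big_cons; exact: flat_algM.
Qed.

Lemma smooth_scale (f : V -> R) (a c : R) : smooth f -> smooth (fun x => a * f (c *: x)).
Proof.
move=> sf s.
have E : iter_partial s (fun x => a * f (c *: x)) =
    (fun x => (a * c ^+ size s) * iter_partial s f (c *: x)).
  elim: s => [|i s IH] /=; first by rewrite expr0 mulr1.
  rewrite IH; apply/funext => x; apply: has_partial_partial; rewrite exprSr mulrA -[X in has_partial _ _ _ X]mulrA.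
  by apply: has_partialZ; apply: has_partial_scale; apply: derivable_hasp; exact: (sf s).2.
have H : has_partial (iter_partial s (fun x => a * f (c *: x))) =
   has_partial (fun x => (a * c ^+ size s) * iter_partial s f (c *: x)) by rewrite E.
split; first by rewrite E; apply: contZ; apply: cont_scale; exact: (sf s).1.
move=> i x; rewrite E.
by case: (has_partialZ (a * c ^+ size s) (has_partial_scale (derivable_hasp ((sf s).2 i (c *: x))))).
Qed.

(** The two arguments are 1 + (z_i - e_i)/c and 1 - (z_i - e_i)/c, written as affine functions of
    z_i to match [flat_alg_flat]. They are both positive exactly when |z_i - e_i| < c. *)
Definition bump (e : V) (c : R) (z : V) : R :=
  \prod_(i < n.+1) (flat 0 (c^-1 * z ord0 i + (1 - e ord0 i / c)) *
                    flat 0 (- c^-1 * z ord0 i + (1 + e ord0 i / c))).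

Lemma bump_smooth e c : smooth (bump e c).
Proof.
apply: flat_alg_smooth; apply: flat_alg_prod => i.
by apply: flat_algM; exact: flat_alg_flat.
Qed.

Lemma bump_ge0 e c z : 0 <= bump e c z.
Proof. by apply: prodr_ge0 => i _; rewrite mulr_ge0// flat_ge0. Qed.

Lemma bump_gt0 e c : 0 < c -> 0 < bump e c e.
Proof.
move=> c0; apply: prodr_gt0 => i _.
have -> : c^-1 * e ord0 i + (1 - e ord0 i / c) = 1 by rewrite [c^-1 * _]mulrC; ring.
have -> : - c^-1 * e ord0 i + (1 + e ord0 i / c) = 1 by rewrite mulNr [c^-1 * _]mulrC; ring.
by rewrite /flat ltr01 expr0 mul1r mulr_gt0 ?expR_gt0.
Qed.

Lemma bump_supp e c z : 0 < c -> bump e c z != 0 -> `|z - e| < c.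
Proof.
move=> c0 bz; apply: rV_norm_lt => // i; rewrite !mxE.
move: bz; rewrite /bump (bigD1 i)//= mulf_eq0 negb_or mulf_eq0 negb_or => /andP[/andP[h1 h2] _].
have fl t : flat 0 t != 0 -> 0 < t by rewrite /flat; case: ifP => //; rewrite eqxx.
move/fl : h1 => h1; move/fl : h2 => h2.
have e1 : c^-1 * z ord0 i + (1 - e ord0 i / c) = ((z ord0 i - e ord0 i) + c) / c by field; rewrite gt_eqF.
have e2 : - c^-1 * z ord0 i + (1 + e ord0 i / c) = (c - (z ord0 i - e ord0 i)) / c by field; rewrite gt_eqF.
move: h1 h2; rewrite e1 e2 !pmulr_lgt0 ?invr_gt0// => h1 h2.
by rewrite ltr_norml; apply/andP; split; lra.
Qed.

Lemma bounded_csupp (k : V -> R) (e : V) (c : R) : (forall z, k z != 0 -> `|z - e| < c) -> csupp k.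
Proof.
move=> H; apply: bounded_closed_compact; last exact: closed_closure.
have cl : closed [set z : V | `|z - e| <= c].
  apply: cont_closed_le; apply: (@lip_continuous _ _ _ 1) => x y; rewrite mul1r.
  by apply: le_trans (ler_dist_dist _ _) _; rewrite opprB addrA subrK.
have sub : closure [set z | k z != 0] `<=` [set z | `|z - e| <= c].
  rewrite (closure_id [set z : V | `|z - e| <= c]).1//.
  by apply: closureS => z /= /H/ltW.
exists (`|e| + c); split; first exact: num_real.
move=> M eM z /sub /= ze; apply/ltW; apply: le_lt_trans eM.
by rewrite -(subrK e z) addrC; apply: le_trans (ler_normD _ _) _; rewrite lerD2l.
Qed.

(* The mollifiers are supported near t *: e, so that correlating with them
   translates as well as smooths. *)
Lemma mollifier (e : V) (c : R) : 0 < @uvol R n -> 0 < c -> exists2 C : R, 0 < C &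
  forall t : R, 0 < t -> exists k : V -> R,
    [/\ smooth k, csupp k,
        forall z, 0 <= k z <= C / t ^+ n.+1,
        forall i z, `|partial i k z| <= C / t / t ^+ n.+1 &
        (forall z, k z != 0 -> `|z - t *: e| < c * t) /\ \int[leb]_z k z = 1].
Proof.
move=> u0 c0; set F := bump e c.
have sF : smooth F := bump_smooth e c.
have cF : csupp F by apply: (@bounded_csupp F e c) => z; exact: bump_supp.
have FC := smooth_C1 sF.
have [M M0 FM] := csupp_bounded (C1_cont FC) cF.
have [M' M'0 FM'] : exists2 M' : R, 0 <= M' & forall i z, `|partial i F z| <= M'.
  have H i : {m : R | 0 <= m & forall z, `|partial i F z| <= m}.
    by apply: cid2; apply: csupp_bounded; [exact: C1_partial|exact: csupp_partial].
  exists (\sum_i s2val (H i)); first by apply: sumr_ge0 => i _; exact: s2valP (H i).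
  move=> i z; rewrite (bigD1 i)//=; apply: le_trans (s2valP' (H i) z) _.
  by rewrite lerDl sumr_ge0// => j _; exact: s2valP (H j).
have Fe : 0 < F e := bump_gt0 e c0.
have [r r0 rF] := (contPball F).1 (C1_cont FC) e (F e / 2) ltac:(by rewrite divr_gt0).
set m0 := F e / 2 in rF; have m0_gt0 : 0 < m0 by rewrite divr_gt0.
have Fm z : `|e - z| < r -> m0 <= F z.
  by move=> /rF; rewrite ler_norml => /andP[_]; rewrite /m0; lra.
(* The bump is at least [m0] on a cube of radius r about e, so its integral at scale t is at least A
   t^N. Dividing by that integral, [ct], costs at most the factor 1 / (A t^N) in the bounds. *)
pose A := m0 * (@uvol R n * r ^+ n.+1); have A0 : 0 < A by rewrite !mulr_gt0// exprn_gt0.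
exists ((M + M' + 1) / A); first by rewrite divr_gt0//; lra.
move=> t t0; have tn : t != 0 by rewrite gt_eqF.
have tN : 0 < t ^+ n.+1 by rewrite exprn_gt0.
pose Ft z := F (t^-1 *: z).
have cFt : cont Ft by apply: cont_scale; exact: C1_cont.
have Ft_supp z : Ft z != 0 -> `|z - t *: e| < c * t.
  move=> /(bump_supp c0) h.
  have -> : z - t *: e = t *: (t^-1 *: z - e) by rewrite scalerBr scalerA divff// scale1r.
  by rewrite normrZ gtr0_norm// mulrC ltr_pM2r.
have sFt : csupp Ft by exact: bounded_csupp Ft_supp.
have iFt : L1 setT Ft := cont_L1 cFt sFt.
pose ct := \int[leb]_z Ft z.
have ctA : A * t ^+ n.+1 <= ct.
  pose B : set V := uball (t *: e) (t * r).
  have mB : measurable (B : set T) := measurable_uball _ _.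
  have tr0 : 0 < t * r by rewrite mulr_gt0.
  have iB : leb.-integrable (B : set T) (EFin \o cst m0).
    apply: (@int1_bounded _ _ _ _ _ _ m0) => //; first exact: leb_uball_lty.
    by move=> x _; rewrite ger0_norm// ltW.
  have iFB : leb.-integrable (B : set T) (EFin \o Ft).
    by apply: (@integrableS _ _ _ leb setT B).
  have -> : A * t ^+ n.+1 = \int[leb]_(z in B) m0.
    by rewrite Rintegral_cst// /A [X in fine X]leb_uball//= exprMn; ring.
  apply: (@le_trans _ _ (\int[leb]_(z in B) Ft z)).
    apply: le_Rintegral => // z; rewrite /B /uball /= => zB; apply: Fm.
    have -> : e - t^-1 *: z = t^-1 *: (t *: e - z) by rewrite scalerBr scalerA mulVf// scale1r.
    by rewrite normrZ gtr0_norm ?invr_gt0// distrC mulrC ltr_pdivrMr// mulrC.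
  rewrite /ct /Rintegral; apply: fine_le.
  - exact: integrable_fin_num.
  - exact: integrable_fin_num.
  apply: ge0_subset_integral => //; last by move=> z _; rewrite lee_fin bump_ge0.
  by apply/measurable_EFinP; exact: int1_measurable iFt.
have AtN : 0 < A * t ^+ n.+1 by rewrite mulr_gt0.
have ct0 : 0 < ct by exact: lt_le_trans ctA.
have ctV : ct^-1 <= A^-1 / t ^+ n.+1 by rewrite -invfM lef_pV2.
pose k z := ct^-1 * F (t^-1 *: z); exists k.
have pk i z : partial i k z = ct^-1 * (t^-1 * partial i F (t^-1 *: z)).
  by apply: has_partial_partial; apply: has_partialZ; apply: has_partial_scale; exact: C1_hasp.
have bnd m : 0 <= m -> m <= M + M' + 1 -> ct^-1 * m <= (M + M' + 1) / A / t ^+ n.+1.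
  move=> m0' mM; rewrite -mulrA mulrC; apply: ler_pM => //.
  by rewrite invr_ge0 ltW.
split.
- exact: smooth_scale.
- by apply: csuppS sFt => x; rewrite /Ft /k => ->; rewrite mulr0.
- move=> z; rewrite mulr_ge0 ?invr_ge0 ?(ltW ct0) ?bump_ge0//=.
  apply: bnd; first exact: bump_ge0.
  by apply: le_trans (ler_norm _) _; apply: le_trans (FM _) _; lra.
- have ctV0 : 0 < ct^-1 by rewrite invr_gt0.
  have tV0 : 0 < t^-1 by rewrite invr_gt0.
  move=> i z; rewrite pk !normrM (gtr0_norm ctV0) (gtr0_norm tV0) mulrCA.
  have -> : (M + M' + 1) / A / t / t ^+ n.+1 = t^-1 * ((M + M' + 1) / A / t ^+ n.+1) by ring.
  apply: ler_wpM2l; first by rewrite invr_ge0 ltW.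
  by apply: bnd => //; apply: le_trans (FM' _ _) _; lra.
- split; last by rewrite RintegralZl// mulVf// gt_eqF.
  by move=> z; rewrite /k mulf_eq0 negb_or => /andP[_]; exact: Ft_supp.
Qed.

End Bump.

(** * Mollification and the fundamental lemma of the calculus of variations *)

Section Mollification.
Context {R : realType} {n : nat}.
Local Notation V := 'rV[R]_n.+1.
Local Notation T := (leb_space R n).
Local Notation leb := (@leb R n).
Local Notation nint := (nint leb).
Implicit Types (f g h k v : V -> R) (x : V) (i : 'I_n.+1).

Definition is_kernel k (d : R) := [/\ smooth k, csupp k, forall z, 0 <= k z,
  forall z, k z != 0 -> `|z| < d & \int[leb]_z k z = 1].

Lemma cont_bounded_on f (K : set V) : cont f -> compact K ->
  exists2 M : R, 0 <= M & forall x, K x -> `|f x| <= M.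
Proof.
move=> cf cK.
have /compact_near_coveringP ncK := cK.
have H : \forall M \near +oo, K `<=` (fun x => `|f x| <= M).
  apply: ncK => x Kx.
  have := (contP f).1 cf x _ ltr01 => xf.
  exists ([set y | `|f x - f y| <= 1], [set M | `|f x| + 1 <= M]) => /=.
    by split => //; exact: nbhs_pinfty_ge.
  move=> [y M] /= [xy fM]; apply: le_trans fM.
  rewrite -[f y](subrK (f x)) addrC; apply: le_trans (ler_normD _ _) _.
  by rewrite lerD2l distrC.
near +oo_R => M; exists M; first by near: M; exact: nbhs_pinfty_ge.
by near: M.
Unshelve. all: by end_near. Qed.

Lemma compact_thick (K D : set V) : compact K -> open D -> K `<=` D ->
  exists2 d : R, 0 < d & forall x y, K x -> `|x - y| <= d -> D y.
Proof.
move=> cK oD KD; have /compact_near_coveringP ncK := cK.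
have H : \forall d \near (0 : R)^'+, K `<=` (fun x => forall y, `|x - y| <= d -> D y).
  apply: ncK => x Kx.
  have : nbhs x D by apply: open_nbhs_nbhs; split => //; exact: KD.
  move=> /nbhs_ballP[r /= r0 rD]; have r2 : 0 < r / 2 by rewrite divr_gt0.
  exists (ball x (r / 2), [set d | d < r / 2]) => /=.
    by split; [exact: nbhsx_ballx|exact: nbhs_right_lt].
  move=> [x' d] /= [xx' dr] y x'y; apply: rD.
  move: xx'; rewrite -!ball_normE /= => xx'.
  rewrite -(subrKA x'); apply: le_lt_trans (ler_normD _ _) _.
  by rewrite (splitr r); apply: ltrD => //; exact: le_lt_trans dr.
near (0 : R)^'+ => d; exists d; first by near: d; exact: nbhs_right_gt.
by move=> x y Kx; move: x Kx y; near: d.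
Unshelve. all: by end_near. Qed.

Lemma capped_dist_lt (K : set V) x (e : R) : e <= 1 -> capped_dist K x < e ->
  exists2 y, K y & `|x - y| < e.
Proof.
move=> e1 de.
have ed : 0 < e - capped_dist K x by rewrite subr_gt0.
have hi : has_inf ([set `|x - y| | y in K] `|` [set 1]).
  by split; [exists 1; right|exists 0 => _ /= [[y _ <-]|->]].
have [r [[y Ky <-]|->]] := inf_adherent ed hi.
- by rewrite [inf _ + _]addrC subrK => h; exists y.
- by rewrite [inf _ + _]addrC subrK => h; have := lt_le_trans h e1; rewrite ltxx.
Qed.

(** The closed d-neighbourhood of K + z lies between [A] and [D]. The condition d + d <= 1 keeps the
    cap of the distance out of play. *)
Lemma cc_nbhd (A K D : set V) (z : V) (d : R) : bounded_set D -> 0 < d -> d + d <= 1 ->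
  (forall x y, K y -> `|x - (y + z)| < d + d -> D x) ->
  (forall x, A x -> exists2 y, K y & `|x - (y + z)| < d) -> compactly_contained A D.
Proof.
move=> bD d0 d1 KD AK.
apply: (@bounded_compactly_contained _ _ _ [set x | capped_dist K (x - z) <= d]) => //.
- move=> x /AK [y Ky xy] /=; apply: le_trans (capped_dist_le _ Ky) _.
  by rewrite -addrA -opprD [z + y]addrC ltW.
- by apply: cont_closed_le; apply: cont_shift; exact: capped_dist_continuous.
- move=> x /= xd; have [|y Ky xy] := @capped_dist_lt K (x - z) (d + d) d1.
    by apply: le_lt_trans xd _; rewrite ltrDl.
  by apply: (KD x y Ky); rewrite opprD addrA addrAC.
Qed.

Section Open.
Variable Om : set V.
Hypotheses (oOm : open Om) (bOm : bounded_set Om).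

Let mOm : measurable (Om : set T). Proof. exact: measurable_open. Qed.

Let fOm : (leb Om < +oo)%E. Proof. exact: bounded_leb. Qed.

Lemma kernel_int1 k (d : R) x : is_kernel k d -> \int[leb]_y k (y - x) = 1.
Proof.
move=> [sk ck _ _ k1]; rewrite (Rintegral_shift (- x))//.
by apply: cont_L1 => //; exact: (C1_cont (smooth_C1 sk)).
Qed.

Lemma L1_shift h x : L1 setT h -> cont h -> csupp h -> L1 setT (fun y => h (y - x)).
Proof.
move=> _ ch sh; apply: cont_L1; first exact: cont_shift.
have [r r0 hr] := csupp_ball sh.
apply: (@bounded_csupp _ _ _ x r) => z; apply: contra_neqT; rewrite -leNgt => /hr.
exact: not_closure_eq0.
Qed.

(** Since k is nonnegative with integral 1, the difference is an average of h(y) - h(x) over |y - x|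
    < d. *)
Lemma corr_near k (d e : R) h x : 0 <= d -> is_kernel k d -> Cc Om h ->
  (forall y, `|x - y| <= d -> `|h x - h y| <= e) -> `|corr Om k h x - h x| <= e.
Proof.
move=> d0 kk [ch [ccl chO]] he.
have [sk ck k0 kd k1] := kk; have contk := C1_cont (smooth_C1 sk).
have kx1 := kernel_int1 x kk.
have mk : measurable_fun (setT : set T) (fun y : V => k (y - x)).
  by apply: measurable_cont_shift.
have ikx : L1 setT (fun y => k (y - x)) by apply: L1_shift => //; exact: cont_L1.
have sh : csupp h by [].
have ih : L1 setT h := cont_L1 ch sh.
have ikh : L1 setT (fun y => k (y - x) * h y) by exact: corr_int.
have hO y : ~ Om y -> h y = 0.
  move=> Oy; apply/eqP; apply: contraPT isT => hy; exfalso; apply/Oy/chO; exact: subset_closure.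
have -> : corr Om k h x = \int[leb]_y (k (y - x) * h y).
  rewrite /corr Rintegral_mkcond; apply: eq_Rintegral => y _; rewrite /patch.
  by case: ifPn => // /negP yO; rewrite hO ?mulr0// => Oy; apply: yO; rewrite inE.
have -> : h x = \int[leb]_y (h x * k (y - x)) by rewrite RintegralZl// kx1 mulr1.
rewrite -RintegralB//; last by apply: int1Z.
have id : L1 setT (fun y => k (y - x) * h y - h x * k (y - x)) by apply: int1B => //; exact: int1Z.
rewrite -lee_fin; apply: le_trans (Rintegral_nint measurableT id) _.
have e0 : 0 <= e by have := he x; rewrite !subrr !normr0; exact.
rewrite -[e in leRHS]mulr1 -kx1 EFinM.
have -> : (\int[leb]_y k (y - x))%:E = nint setT (fun y => k (y - x)).
  rewrite nint_Rintegral//; congr (_%:E); apply: eq_Rintegral => y _; by rewrite ger0_norm.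
rewrite -{1}(ger0_norm e0) -nintZ//; apply: nint_le => //.
- exact: int1_measurable id.
- exact: measurable_funM.
move=> y _; rewrite [h x * _]mulrC -mulrBr !normrM (ger0_norm e0) mulrC.
have [->|kz] := eqVneq (k (y - x)) 0; first by rewrite normr0 !mulr0.
by apply: ler_wpM2r => //; rewrite distrC; apply: he; rewrite distrC ltW//; exact: kd.
Qed.

Lemma corr_supp k (d : R) v x : is_kernel k d -> corr Om k v x != 0 ->
  exists2 y, Om y /\ v y != 0 & k (y - x) != 0.
Proof.
move=> kk; apply: contra_neqP => H.
rewrite /corr (@eq_Rintegral _ T R leb Om (cst 0)); first by rewrite /Rintegral integral0.
move=> y /set_mem Oy; apply/eqP; rewrite mulf_eq0; apply: contrapT => /negP.
by rewrite negb_or => /andP[ky vy]; apply: H; exists y.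
Qed.

Hypothesis u0 : 0 < @uvol R n.

Lemma centered_kernel (d : R) : 0 < d -> exists k, is_kernel k d.
Proof.
move=> d0; have [C C0 /(_ 1 ltr01)[k [sk ck k0 _ [kd k1]]]] := @mollifier R n 0 d u0 d0.
exists k; split => //; first by move=> z; case/andP: (k0 z).
by move=> z /kd; rewrite scaler0 subr0 mulr1.
Qed.

(** Mollifying h gives admissible test functions that converge to h uniformly. *)
Lemma fundamental_Cc f : L1 Om f ->
  (forall phi, Ccinfty Om phi -> \int[leb]_(x in Om) (f x * phi x) = 0) ->
  forall h, Cc Om h -> \int[leb]_(x in Om) (f x * h x) = 0.
Proof.
move=> fi H h hC; have [ch [cK KO]] := hC.
have mh : measurable_fun (Om : set T) h := Cc_measurable mOm hC.
have [Mh Mh0 hM] := csupp_bounded ch cK.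
apply/eqP; rewrite -normr_le0; apply/ler_addgt0Pr => e e0; rewrite add0r.
have F1 : 0 < fine (nint Om f) + 1 by rewrite ltr_wpDl// fine_ge0// nint_ge0.
have [d1 d10 hd1] := csupp_unif ch cK (divr_gt0 e0 F1).
have [d2 d20 hd2] := compact_thick cK oOm KO.
(* The three bounds make the mollified function uniformly close to h, keep its support inside [Om]
   with room to spare, and meet the condition d + d <= 1 of [cc_nbhd]. *)
pose d := Num.min d1 (Num.min (d2 / 2) (1 / 2)).
have d0 : 0 < d by rewrite !lt_min d10 !divr_gt0.
have [k kk] := centered_kernel d0; have [sk ck k0 kd k1] := kk.
have ih : L1 Om h by exact: (@int1_bounded _ _ _ _ _ _ Mh).
have dd2 : d <= d2 / 2 by rewrite /d !ge_min lexx /= orbT.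
have d12 : d <= 1 / 2 by rewrite /d !ge_min lexx !orbT.
have dd1 : d <= d1 by rewrite /d !ge_min lexx.
have wC : Ccinfty Om (corr Om k h).
  split; first exact: smooth_corr.
  apply: (@cc_nbhd _ (closure [set x | h x != 0]) _ 0 d) => //; first by lra.
    move=> x y Ky; rewrite addr0 => xy; apply: (hd2 y) => //; rewrite distrC; lra.
  move=> x /= /(corr_supp kk) [y [Oy hy] ky]; exists y; first exact: subset_closure.
  by rewrite addr0 distrC; exact: kd.
have mw : measurable_fun (Om : set T) (corr Om k h).
  by apply: measurable_continuous => //; exact: C1_cont (smooth_C1 wC.1).
have near x : `|h x - corr Om k h x| <= e / (fine (nint Om f) + 1).
  by rewrite distrC; apply: (corr_near (ltW d0) kk hC) => y xy; apply: hd1; exact: le_trans dd1.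
have ifh : L1 Om (fun x => f x * h x).
  under eq_fun do rewrite mulrC; exact: (@int1Mbounded _ _ _ leb Om f h Mh).
have [Mw Mw0 wM] := csupp_bounded (C1_cont (smooth_C1 wC.1)) wC.2.1.
have ifw : L1 Om (fun x => f x * corr Om k h x).
  under eq_fun do rewrite mulrC; exact: (@int1Mbounded _ _ _ leb Om f _ Mw).
rewrite -[X in `|X|]subr0 -[X in _ - X](H _ wC) -RintegralB//.
rewrite -lee_fin; apply: le_trans (Rintegral_nint mOm (int1B mOm ifh ifw)) _.
rewrite (@eq_nint _ _ _ leb Om _ (fun x => (h x - corr Om k h x) * f x)); last first.
  by move=> x _; rewrite -mulrBr mulrC.
apply: le_trans (nintM_le mOm (measurable_funB mh mw) fi _ _) _.
- by move=> x _; exact: near.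
- by rewrite divr_ge0// ltW.
rewrite -[nint Om f]fineK ?nint_fin_num ?int1_fin// -EFinM lee_fin mulrAC ler_pdivrMr//.
by apply: ler_wpM2l; [exact: ltW|rewrite lerDl].
Qed.

Definition clamp (m t : R) : R := Num.max (- m) (Num.min m t).

Lemma clamp_le (m t : R) : 0 <= m -> `|clamp m t| <= m.
Proof.
move=> m0; rewrite /clamp ler_norml le_max lexx /= ge_max ge_min lexx andbT /=; lra.
Qed.

Lemma clamp_lip (m s t : R) : `|clamp m s - clamp m t| <= `|s - t|.
Proof.
have minl (a b c : R) : `|Num.min a b - Num.min a c| <= `|b - c|.
  by case: (leP a b) => h1; case: (leP a c) => h2; rewrite ?subrr ?normr0// ler_norml;
    apply/andP; split; have := ler_norm (b - c); have := ler_norm (c - b); rewrite (distrC c b); lra.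
have maxl (a b c : R) : `|Num.max a b - Num.max a c| <= `|b - c|.
  by case: (leP a b) => h1; case: (leP a c) => h2; rewrite ?subrr ?normr0// ler_norml;
    apply/andP; split; have := ler_norm (b - c); have := ler_norm (c - b); rewrite (distrC c b); lra.
exact: le_trans (maxl _ _ _) (minl _ _ _).
Qed.

Lemma clamp_id (m t : R) : `|t| <= m -> clamp m t = t.
Proof. by rewrite ler_norml => /andP[h1 h2]; rewrite /clamp min_r// max_r. Qed.

Lemma measurable_clamp (D : set V) (m : R) f : measurable (D : set T) -> measurable_fun (D : set T) f ->
  measurable_fun (D : set T) (fun x => clamp m (f x)).
Proof.
move=> mD mf; apply: measurable_maxr; first exact: measurable_cst.
by apply: measurable_minr => //; exact: measurable_cst.
Qed.

Lemma Cc_clamp h (m : R) : 0 <= m -> Cc Om h -> Cc Om (fun x => clamp m (h x)).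
Proof.
move=> m0 [ch sh]; split.
  by apply: cont_max; [exact: cont_cst|apply: cont_min => //; exact: cont_cst].
apply: compactly_containedS sh => x /=; apply: contra_neq => ->.
by apply: clamp_id; rewrite normr0.
Qed.

(** Continuous functions h approximate the sign of f in L1 and can be clamped to [-1, 1]. As f is
    orthogonal to h, the integral of |f| is that of f times the difference between the sign and h.
    This difference is bounded by 2 and small in L1, so [nint_mul_small] applies. *)
Lemma fundamental f : L1 Om f ->
  (forall phi, Ccinfty Om phi -> \int[leb]_(x in Om) (f x * phi x) = 0) ->
  {ae leb, forall x, Om x -> f x = 0}.
Proof.
move=> fi H; have {}H := fundamental_Cc fi H; have mf := int1_measurable fi.
apply: (nint_eq0 (leb := leb)) => //.
apply/eqP; rewrite eq_le nint_ge0 andbT; apply/lee_addgt0Pr => e e0; rewrite add0e.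
have [d d0 Hd] := @nint_mul_small _ _ _ leb Om f 2 e mOm fi ltac:(by []) e0.
have msg : measurable_fun (Om : set T) (fun x => Num.sg (f x)).
  have E : (fun x => Num.sg (f x)) = (fun x => (if 0 < f x then 1 else if f x < 0 then -1 else 0) : R).
    by apply/funext => x; case: sgrP.
  have m1 : measurable_fun (Om : set T) (fun x => (if f x < 0 then -1 else 0) : R).
    by apply: measurable_fun_if => //; apply: measurable_fun_ltr.
  rewrite E; apply: measurable_fun_if => //; first by apply: measurable_fun_ltr.
  apply: (measurable_funS mOm _ m1); exact: subIsetl.
have sg1 x : `|Num.sg (f x)| <= 1 by rewrite normr_sg lern1 leq_b1.
have isg : L1 Om (fun x => Num.sg (f x)) by exact: (@int1_bounded _ _ _ _ _ _ 1).
have [h [hC hs]] := L1_approxCc oOm bOm isg d0.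
have cC := Cc_clamp ler01 hC.
have mc : measurable_fun (Om : set T) (fun x => clamp 1 (h x)) := Cc_measurable mOm cC.
pose g x := Num.sg (f x) - clamp 1 (h x).
have mg : measurable_fun (Om : set T) g by exact: measurable_funB.
have g2 x : Om x -> `|g x| <= 2.
  move=> _; apply: le_trans (ler_normB _ _) _; have := sg1 x; have := @clamp_le 1 (h x) ler01; lra.
have gd : (nint Om g <= d%:E)%E.
  apply: le_trans hs; apply: nint_le => //.
    by apply: measurable_funB => //; exact: Cc_measurable hC.
  by move=> x _; rewrite /g -{1}(@clamp_id 1 (Num.sg (f x)))// clamp_lip.
apply: le_trans (Hd g mg g2 gd).
have ifg : L1 Om (fun x => f x * g x).
  under eq_fun do rewrite mulrC.
  by apply: (@int1Mbounded _ _ _ leb Om f g 2) => //; exact: g2.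
apply: le_trans (Rintegral_nint mOm ifg).
rewrite nint_Rintegral// lee_fin; apply: le_trans (ler_norm _).
have ifs : L1 Om (fun x => f x * Num.sg (f x)).
  by under eq_fun do rewrite mulrC; exact: (@int1Mbounded _ _ _ leb Om f _ 1).
have ifc : L1 Om (fun x => f x * clamp 1 (h x)).
  under eq_fun do rewrite mulrC; apply: (@int1Mbounded _ _ _ leb Om f _ 1) => // x _.
  exact: clamp_le.
rewrite (@eq_Rintegral _ T R leb Om (fun x => f x * Num.sg (f x) - f x * clamp 1 (h x)) (fun x => f x * g x)); last first.
  by move=> x _; rewrite /g mulrBr.
rewrite RintegralB// (H _ cC) subr0 le_eqVlt; apply/orP; left; apply/eqP.
by apply: eq_Rintegral => x _; rewrite mulrC -normrEsg.
Qed.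

End Open.

End Mollification.

(** * Weak derivatives *)

Section AlmostEverywhere.
Context {R : realType} d {T : measurableType d}.
Variable mu : {measure set T -> \bar R}.
Implicit Types P Q S : T -> Prop.

Lemma ae_imp P Q : (forall x, P x -> Q x) ->
  {ae mu, forall x, P x} -> {ae mu, forall x, Q x}.
Proof. by move=> PQ; apply: filterS. Qed.

Lemma ae_forall (I : finType) (P : I -> T -> Prop) :
  (forall i, {ae mu, forall x, P i x}) -> {ae mu, forall x i, P i x}.
Proof. by move=> H; apply: filter_forall. Qed.

Lemma ae_all P : (forall x, P x) -> {ae mu, forall x, P x}.
Proof. by move=> H; apply: aeW. Qed.

Lemma nint0 (D : set T) : nint mu D (fun=> 0) = 0%E.
Proof. by rewrite /nint; under eq_integral do rewrite normr0; rewrite integral0. Qed.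

End AlmostEverywhere.

(** * Weak gradients and functions with zero trace *)

Section WeakDerivative.
Context {R : realType} {n : nat}.
Local Notation V := 'rV[R]_n.+1.
Local Notation T := (leb_space R n).
Local Notation leb := (@leb R n).
Local Notation nint := (nint leb).
Implicit Types (f g h k v phi psi : V -> R) (G : 'I_n.+1 -> V -> R) (x : V) (i : 'I_n.+1).

Variable Om : set V.
Hypotheses (oOm : open Om) (bOm : bounded_set Om).

Let mOm : measurable (Om : set T). Proof. exact: measurable_open. Qed.

Let fOm : (leb Om < +oo)%E. Proof. exact: bounded_leb. Qed.

Lemma bounded_closure_compact (A : set V) : bounded_set A -> compact (closure A).
Proof.
move=> [M [Mr MA]]; have MM : M < `|M| + 1 by rewrite (le_lt_trans (ler_norm _))// ltrDl.
have [] // := @bounded_compactly_contained _ _ A [set x | `|x| <= `|M| + 1] [set x : V | `|x| <= `|M| + 1].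
- exists (`|M| + 1); split; first exact: num_real.
  by move=> r Mr' x /= xM; apply: le_trans xM (ltW Mr').
- by move=> x Ax; apply: (MA _ MM).
- by apply: cont_closed_le; apply: (@lip_continuous _ _ _ 1) => x y; rewrite mul1r ler_dist_dist.
Qed.

(** The test functions are all C1 functions on the space, not only those supported in [Om], so the
    formula also expresses that v has zero trace. *)
Definition wpair v G := [/\ L1 Om v, forall i, L1 Om (G i) &
  forall i psi, C1 psi ->
    \int[leb]_(x in Om) (v x * partial i psi x) = - \int[leb]_(x in Om) (G i x * psi x)].

(* The closure of the C1 functions with compact support in Om, with gradient G. *)
Definition W0 v G := [/\ L1 Om v, forall i, L1 Om (G i) &
  forall e : R, 0 < e -> exists phi, [/\ C1 phi,
    compactly_contained [set x | phi x != 0] Om,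
    (nint Om (fun x => v x - phi x)%R <= e%:E)%E &
    forall i, (nint Om (fun x => G i x - partial i phi x)%R <= e%:E)%E]].

Lemma cont_measurable f : cont f -> measurable_fun (Om : set T) f.
Proof. by move=> cf; apply: measurable_continuous. Qed.

Lemma cont_bounded f : cont f -> exists2 M : R, 0 <= M & forall x, Om x -> `|f x| <= M.
Proof.
move=> cf; have [] := @cont_bounded_on _ _ f (closure Om) cf _.
  exact: bounded_closure_compact.
by move=> M M0 fM; exists M => // x Ox; apply: fM; exact: subset_closure.
Qed.

Lemma L1_cont f : cont f -> L1 Om f.
Proof.
move=> cf; have [M M0 fM] := cont_bounded cf.
by apply: (@int1_bounded _ _ _ _ _ _ M) => //; exact: cont_measurable.
Qed.

Lemma L1M_cont v psi : L1 Om v -> cont psi -> L1 Om (fun x => v x * psi x).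
Proof.
move=> vi cf; have [M M0 fM] := cont_bounded cf.
under eq_fun do rewrite mulrC.
by apply: (@int1Mbounded _ _ _ leb Om v psi M) => //; exact: cont_measurable.
Qed.

Lemma nint_add f g : measurable_fun (Om : set T) f -> measurable_fun (Om : set T) g ->
  (nint Om (fun x : V => f x + g x)%R <= nint Om f + nint Om g)%E.
Proof. exact: nintD. Qed.

Lemma int_supp f : compactly_contained [set x | f x != 0] Om ->
  \int[leb]_(x in Om) f x = \int[leb]_x f x.
Proof.
move=> [_ fO]; rewrite Rintegral_mkcond; apply: eq_Rintegral => x _; rewrite /patch.
case: ifPn => // /negP xO; apply/esym/eqP; apply: contraPT isT => fx; exfalso.
by apply: xO; rewrite inE; apply: fO; exact: subset_closure.
Qed.

(** For an approximant phi the product phi psi is C1 with compact support in [Om], so its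
    derivatives have integral 0. Both sides of the formula are continuous in L1 because psi and its
    derivatives are bounded on [Om]. *)
Lemma W0_wpair v G : W0 v G -> wpair v G.
Proof.
move=> [vi Gi H]; split => // i psi Hpsi.
have cp := C1_cont Hpsi; have cdp := C1_partial (i := i) Hpsi.
have [M M0 pM] := cont_bounded cp; have [M' M'0 dpM] := cont_bounded cdp.
have i1 := L1M_cont vi cdp; have i2 := L1M_cont (Gi i) cp.
apply/eqP; rewrite -addr_eq0 -normr_le0; apply/ler_addgt0Pr => e e0; rewrite add0r.
have MM : 0 < M + M' + 1 by rewrite ltr_wpDl// addr_ge0.
have [phi [Hphi sphi h1 /(_ i) h2]] := H _ (divr_gt0 e0 MM).
have cf := C1_cont Hphi; have cdf := C1_partial (i := i) Hphi.
have j1 : L1 Om (fun x => phi x * partial i psi x) by apply: L1M_cont => //; exact: L1_cont.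
have j2 : L1 Om (fun x => partial i phi x * psi x) by apply: L1M_cont => //; exact: L1_cont.
have Z : \int[leb]_(x in Om) (phi x * partial i psi x) +
    \int[leb]_(x in Om) (partial i phi x * psi x) = 0.
  rewrite -RintegralD//.
  have Hpp := C1M Hphi Hpsi.
  have spp : compactly_contained [set x | phi x * psi x != 0] Om.
    by apply: compactly_containedS sphi => x /=; apply: contra_neq => ->; rewrite mul0r.
  rewrite -[RHS](int_partial0 i Hpp spp.1) -int_supp.
    by apply: eq_Rintegral => x _; rewrite partialM// [psi x * _]mulrC.
  by split; [exact: csupp_partial spp.1|have := closureS (partial_supp (i := i) Hpp);
    rewrite -(closure_id (closure _)).1; [move/subset_trans; apply; exact: spp.2|exact: closed_closure]].
rewrite -[X in `|X|]subr0 -[X in _ - X]Z opprD addrACA -!RintegralB//.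
rewrite (@eq_Rintegral _ T R leb Om (fun x => partial i psi x * (v x - phi x))); last first.
  by move=> x _; rewrite -mulrBl mulrC.
rewrite [X in _ + X](@eq_Rintegral _ T R leb Om (fun x => psi x * (G i x - partial i phi x))); last first.
  by move=> x _; rewrite -mulrBl mulrC.
have b1 : L1 Om (fun x => v x - phi x) by apply: int1B => //; exact: L1_cont.
have b2 : L1 Om (fun x => G i x - partial i phi x) by apply: int1B; [exact: mOm|exact: Gi|exact: L1_cont].
apply: le_trans (ler_normD _ _) _; rewrite -lee_fin EFinD.
have := nintM_le mOm (cont_measurable cdp) b1 dpM M'0.
have := nintM_le mOm (cont_measurable cp) b2 pM M0.
have p1 : L1 Om (fun x => partial i psi x * (v x - phi x)).
  by under eq_fun do rewrite mulrC; exact: L1M_cont.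
have p2 : L1 Om (fun x => psi x * (G i x - partial i phi x)).
  by under eq_fun do rewrite mulrC; exact: L1M_cont.
have := Rintegral_nint mOm p1; have := Rintegral_nint mOm p2.
move=> q2 q1 r2 r1.
apply: le_trans (leeD (le_trans q1 r1) (le_trans q2 r2)) _.
apply: le_trans (leeD (lee_wpmul2l _ h1) (lee_wpmul2l _ h2)) _; rewrite ?lee_fin//.
rewrite -mulrDl mulrA ler_pdivrMr// mulrC.
by apply: ler_wpM2l; [exact: ltW|rewrite addrC lerDl].
Qed.

Lemma W0_mul v G psi : W0 v G -> C1 psi ->
  W0 (fun x => psi x * v x) (fun i x => psi x * G i x + v x * partial i psi x).
Proof.
move=> [vi Gi H] Hpsi; have cp := C1_cont Hpsi.
have [M M0 pM] := cont_bounded cp.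
have [M' M'0 dpM] : exists2 M' : R, 0 <= M' & forall i x, Om x -> `|partial i psi x| <= M'.
  have h i : exists M, 0 <= M /\ forall x, Om x -> `|partial i psi x| <= M.
    by have [M1 ? ?] := cont_bounded (C1_partial (i := i) Hpsi); exists M1.
  have [m hm] := choice h; exists (\sum_i m i); first by apply: sumr_ge0 => i _; case: (hm i).
  move=> i x Ox; apply: le_trans ((hm i).2 x Ox) _.
  by rewrite (bigD1 i)//= lerDl sumr_ge0// => j _; case: (hm j).
split.
- by under eq_fun do rewrite mulrC; exact: L1M_cont.
- move=> i; apply: int1D => //.
    by under eq_fun do rewrite mulrC; exact: L1M_cont.
  by apply: L1M_cont => //; exact: C1_partial.
move=> e e0; have MM : 0 < M + M' + 1 by rewrite ltr_wpDl// addr_ge0.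
have [phi [Hphi sphi h1 h2]] := H _ (divr_gt0 e0 MM).
have cf := C1_cont Hphi.
have b1 : L1 Om (fun x => v x - phi x) by apply: int1B => //; exact: L1_cont.
exists (fun x => psi x * phi x); split; first exact: C1M.
- by apply: compactly_containedS sphi => x /=; apply: contra_neq => ->; rewrite mulr0.
- rewrite (@eq_nint _ _ _ leb Om _ (fun x => psi x * (v x - phi x))); last first.
    by move=> x _; rewrite mulrBr.
  apply: le_trans (nintM_le mOm (cont_measurable cp) b1 pM M0) _.
  apply: le_trans (lee_wpmul2l _ h1) _; rewrite ?lee_fin//.
  rewrite mulrA ler_pdivrMr// mulrC.
  by apply: ler_wpM2l; [exact: ltW|rewrite -addrA lerDl addr_ge0].
move=> i; have cdp := C1_partial (i := i) Hpsi; have cdf := C1_partial (i := i) Hphi.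
have b2 : L1 Om (fun x => G i x - partial i phi x) by apply: int1B; [exact: mOm|exact: Gi|exact: L1_cont].
rewrite (@eq_nint _ _ _ leb Om _ (fun x => psi x * (G i x - partial i phi x) +
  partial i psi x * (v x - phi x))); last first.
  by move=> x _; rewrite partialM//; congr `|_|; ring.
have m1 : measurable_fun (Om : set T) (fun x => psi x * (G i x - partial i phi x)).
  by apply: measurable_funM; [exact: cont_measurable|exact: int1_measurable b2].
have m2 : measurable_fun (Om : set T) (fun x => partial i psi x * (v x - phi x)).
  by apply: measurable_funM; [exact: cont_measurable|exact: int1_measurable b1].
apply: le_trans (nint_add m1 m2) _.
apply: le_trans (leeD (nintM_le mOm (cont_measurable cp) b2 pM M0)
  (nintM_le mOm (cont_measurable cdp) b1 (dpM i) M'0)) _.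
apply: le_trans (leeD (lee_wpmul2l _ (h2 i)) (lee_wpmul2l _ h1)) _; rewrite ?lee_fin//.
rewrite -mulrDl mulrA ler_pdivrMr// mulrC.
by apply: ler_wpM2l; [exact: ltW|rewrite lerDl].
Qed.

Lemma lip1_continuous (h : R -> R) (L : R) : (forall s t, `|h s - h t| <= L * `|s - t|) ->
  continuous (h : R^o -> R^o).
Proof.
move=> H t; apply/cvgrPdist_le => e e0; have L1 : 0 < `|L| + 1 by rewrite ltr_wpDl.
near=> s; apply: le_trans (H t s) _; apply: le_trans (_ : (`|L| + 1) * `|t - s| <= _).
  by apply: ler_wpM2r => //; rewrite (le_trans (ler_norm _))// lerDl.
rewrite mulrC -ler_pdivlMr//; near: s.
have := @cvgr_dist_le _ _ _ _ _ id t (@cvg_id _ _) (e / (`|L| + 1)).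
by apply; rewrite divr_gt0.
Unshelve. all: by end_near. Qed.

Lemma measurable_lip (h : R -> R) (L : R) f : (forall s t, `|h s - h t| <= L * `|s - t|) ->
  measurable_fun (Om : set T) f -> measurable_fun (Om : set T) (fun x => h (f x)).
Proof.
move=> /lip1_continuous ch mf; apply: measurableT_comp mf.
exact: continuous_measurable_fun.
Qed.

(** The approximants are h(phi). Their gradients differ from dh(v) G by dh(phi) (G - grad phi),
    which is small in L1, and by G (dh(v) - dh(phi)), whose second factor is bounded by 2 C and
    small in L1, so that [nint_mul_small] applies. *)
Lemma W0_comp v G (h dh : R -> R) (C L : R) : W0 v G ->
  (forall t : R, is_derive t 1 h (dh t)) -> h 0 = 0 -> 0 <= C -> 0 <= L ->
  (forall t, `|dh t| <= C) -> (forall s t, `|h s - h t| <= C * `|s - t|) ->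
  (forall s t, `|dh s - dh t| <= L * `|s - t|) ->
  W0 (fun x => h (v x)) (fun i x => dh (v x) * G i x).
Proof.
move=> [vi Gi H] Hh h0 C0 L0 dhC hC dhL.
have mv := int1_measurable vi.
have ch := lip1_continuous hC; have cdh := lip1_continuous dhL.
have mhv := measurable_lip hC mv; have mdhv := measurable_lip dhL mv.
split.
- apply: (@int1_le _ _ _ leb Om _ (fun x => C * v x)) => //; first exact: int1Z.
  by move=> x _; have := hC (v x) 0; rewrite h0 !subr0 normrM (ger0_norm C0).
- by move=> i; apply: (@int1Mbounded _ _ _ leb Om (G i) (fun x => dh (v x)) C) => //; exact: Gi.
move=> e e0; have e2 : 0 < e / 2 by rewrite divr_gt0.
have CC : 0 <= C + C by rewrite addr_ge0.
have hd i : exists d, 0 < d /\ forall g, measurable_fun (Om : set T) g ->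
    (forall x, Om x -> `|g x| <= C + C) -> (nint Om g <= d%:E)%E ->
    (nint Om (fun x => G i x * g x)%R <= (e / 2)%:E)%E.
  by have [d d0 Hd] := nint_mul_small mOm (Gi i) CC e2; exists d; split => //; exact: Hd.
have [d Hd] := choice hd.
pose d' := \big[Num.min/1]_i d i.
have d'0 : 0 < d' by apply: lt_bigmin => [|i _]; [exact: ltr01|case: (Hd i)].
(* The first bound controls the terms with factor C. The second makes dh(v) - dh(phi) smaller in L1
   than the threshold d' of [nint_mul_small], which serves all coordinates at once. Adding 1 avoids
   division by zero. *)
pose e1 := Num.min (e / 2 / (C + 1)) (d' / (L + 1)).
have C1p : 0 < C + 1 by rewrite ltr_wpDl.
have L1p : 0 < L + 1 by rewrite ltr_wpDl.
have e10 : 0 < e1 by rewrite lt_min !divr_gt0.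
have [phi [Hphi sphi h1 h2]] := H _ e10.
have cf := C1_cont Hphi; have mf := cont_measurable cf.
have e1a : e1 <= e / 2 / (C + 1) by rewrite ge_min lexx.
have e1b : e1 <= d' / (L + 1) by rewrite ge_min lexx orbT.
have Ce : C * e1 <= e / 2.
  apply: le_trans (ler_wpM2l C0 e1a) _; rewrite mulrA ler_pdivrMr// mulrC.
  by apply: ler_wpM2l; [exact: ltW|rewrite lerDl].
have Le : L * e1 <= d'.
  apply: le_trans (ler_wpM2l L0 e1b) _; rewrite mulrA ler_pdivrMr// mulrC.
  by apply: ler_wpM2l; [exact: ltW|rewrite lerDl].
exists (fun x => h (phi x)); split; first exact: C1_comp Hphi Hh ch cdh.
- by apply: compactly_containedS sphi => x /=; apply: contra_neq => ->.
- have m1 : measurable_fun (Om : set T) (fun x => C * (v x - phi x)).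
    by apply: measurable_funM => //; exact: measurable_funB.
  apply: le_trans (_ : nint Om (fun x => C * (v x - phi x))%R <= _)%E.
    apply: nint_le => //; first by apply: measurable_funB => //; exact: measurable_lip hC mf.
    by move=> x _; rewrite normrM (ger0_norm C0).
  rewrite nintZ//; last exact: measurable_funB.
  rewrite (ger0_norm C0); apply: le_trans (lee_wpmul2l _ h1) _; rewrite ?lee_fin//.
  apply: le_trans Ce _; lra.
move=> i; have cdf := C1_partial (i := i) Hphi.
have b2 : L1 Om (fun x => G i x - partial i phi x) by apply: int1B; [exact: mOm|exact: Gi|exact: L1_cont].
have mdf := measurable_lip dhL mf.
rewrite (@eq_nint _ _ _ leb Om _ (fun x => dh (phi x) * (G i x - partial i phi x) +
  G i x * (dh (v x) - dh (phi x)))); last first.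
  by move=> x _; rewrite (partial_comp _ _ Hphi Hh); congr `|_|; ring.
have mg : measurable_fun (Om : set T) (fun x => dh (v x) - dh (phi x)) by exact: measurable_funB.
have m1 : measurable_fun (Om : set T) (fun x => dh (phi x) * (G i x - partial i phi x)).
  by apply: measurable_funM => //; exact: int1_measurable b2.
have m2 : measurable_fun (Om : set T) (fun x => G i x * (dh (v x) - dh (phi x))).
  by apply: measurable_funM => //; exact: int1_measurable (Gi i).
apply: le_trans (nint_add m1 m2) _.
rewrite [e in leRHS]splitr EFinD; apply: leeD.
  apply: le_trans (nintM_le mOm mdf b2 (fun x _ => dhC (phi x)) C0) _.
  by apply: le_trans (lee_wpmul2l _ (h2 i)) _; rewrite ?lee_fin.
apply: (Hd i).2 => //.
  move=> x _; apply: le_trans (ler_normB _ _) _; exact: lerD.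
apply: le_trans (_ : nint Om (fun x => L * (v x - phi x))%R <= _)%E.
  apply: nint_le => //.
    by apply: measurable_funM => //; exact: measurable_funB.
  by move=> x _; rewrite normrM (ger0_norm L0).
rewrite nintZ//; last exact: measurable_funB.
rewrite (ger0_norm L0); apply: le_trans (lee_wpmul2l _ h1) _; rewrite ?lee_fin//.
by apply: le_trans Le _; rewrite /d'; exact: bigmin_le.
Qed.

Lemma wpair_weak v G : wpair v G ->
  is_weak_gradient Om v (fun x => \row_i G i x).
Proof.
move=> [vi Gi H] i; split; first by under eq_fun do rewrite mxE; exact: Gi.
move=> phi [sp _]; rewrite H; last exact: smooth_C1.
by congr (- _); apply: eq_Rintegral => x _; rewrite mxE.
Qed.

Lemma Ccinfty_weak phi : Ccinfty Om phi -> 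
  is_weak_gradient Om phi (fun x => \row_i partial i phi x).
Proof.
move=> [sp cp]; apply: (@wpair_weak _ (fun i => partial i phi)); apply: W0_wpair.
have Hp := smooth_C1 sp.
split; [exact/L1_cont/C1_cont|by move=> i; exact/L1_cont/C1_partial|].
move=> e e0; exists phi; split => //.
- rewrite (@eq_nint _ _ _ leb Om _ (cst 0)); last by move=> x _; rewrite subrr.
  by rewrite nint0 lee_fin ltW.
- move=> i; rewrite (@eq_nint _ _ _ leb Om _ (cst 0)); last by move=> x _; rewrite subrr.
  by rewrite nint0 lee_fin ltW.
Qed.

Hypothesis u0 : 0 < @uvol R n.

Lemma weak_gradient_unique v (F H : V -> V) : L1 Om v ->
  is_weak_gradient Om v F -> is_weak_gradient Om v H ->
  forall i, {ae leb, forall x, Om x -> F x ord0 i = H x ord0 i}.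
Proof.
move=> vi wF wH i; have [Fi HF] := wF i; have [Hi HH] := wH i.
have Di : L1 Om (fun x => F x ord0 i - H x ord0 i) by exact: int1B.
have Z phi : Ccinfty Om phi -> \int[leb]_(x in Om) ((F x ord0 i - H x ord0 i) * phi x) = 0.
  move=> cp; have cf := C1_cont (smooth_C1 cp.1).
  have i1 := L1M_cont Fi cf; have i2 := L1M_cont Hi cf.
  rewrite (@eq_Rintegral _ T R leb Om (fun x => F x ord0 i * phi x - H x ord0 i * phi x)); last first.
    by move=> x _; rewrite mulrBl.
  rewrite RintegralB//; apply/eqP; rewrite subr_eq0 -eqr_opp.
  by rewrite -HF// -HH.
have := fundamental oOm bOm u0 Di Z; apply: ae_imp => x h Ox; apply/eqP; rewrite -subr_eq0; apply/eqP; exact: h.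
Qed.

Lemma wgrad_weak v : (exists F : V -> V, is_weak_gradient Om v F) -> is_weak_gradient Om v (wgrad Om v).
Proof. exact: xgetPex. Qed.

Lemma wgrad_ae v (F : V -> V) : L1 Om v -> is_weak_gradient Om v F ->
  {ae leb, forall x, Om x -> wgrad Om v x = F x}.
Proof.
move=> vi wF; have wg := wgrad_weak (ex_intro _ F wF).
have := ae_forall (weak_gradient_unique vi wg wF); apply: ae_imp => x H Ox.
by apply/rowP => i; exact: H.
Qed.

Lemma is_weak_gradientB v w (F H : V -> V) : L1 Om v -> L1 Om w ->
  is_weak_gradient Om v F -> is_weak_gradient Om w H ->
  is_weak_gradient Om (fun x => v x - w x) (fun x => F x - H x).
Proof.
move=> vi wi wF wH i; have [Fi HF] := wF i; have [Hi HH] := wH i.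
have E : (fun x => (F x - H x) ord0 i) = (fun x => F x ord0 i - H x ord0 i).
  by apply/funext => x; rewrite !mxE.
rewrite E; split; first exact: int1B.
move=> phi cp; have cf := C1_cont (smooth_C1 cp.1); have cdf := C1_partial (i := i) (smooth_C1 cp.1).
rewrite (@eq_Rintegral _ T R leb Om (fun x => v x * partial i phi x - w x * partial i phi x)); last first.
  by move=> x _; rewrite mulrBl.
rewrite RintegralB//; try exact: L1M_cont.
rewrite [in RHS](@eq_Rintegral _ T R leb Om (fun x => F x ord0 i * phi x - H x ord0 i * phi x)); last first.
  by move=> x _; rewrite !mxE mulrBl.
by rewrite RintegralB//; try exact: L1M_cont; rewrite HF// HH// opprD.
Qed.

Lemma coord_le_enorm (x : V) i : `|x ord0 i| <= enorm x.
Proof.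
rewrite -sqrtr_sqr /enorm ler_wsqrtr// (bigD1 i)//= lerDl.
by apply: sumr_ge0 => j _; exact: sqr_ge0.
Qed.

Lemma enorm_ge0 (x : V) : 0 <= enorm x.
Proof. exact: sqrtr_ge0. Qed.

Lemma enorm_le_sum (x : V) : enorm x <= \sum_i `|x ord0 i|.
Proof.
have s0 : 0 <= \sum_i `|x ord0 i| by apply: sumr_ge0.
rewrite -(ger0_norm s0) -sqrtr_sqr /enorm ler_wsqrtr//.
rewrite expr2 mulr_suml; apply: ler_sum => i _.
rewrite -real_normK ?num_real// expr2; apply: ler_wpM2l => //.
by rewrite (bigD1 i)//= lerDl sumr_ge0.
Qed.

Lemma measurable_enorm (F : V -> V) :
  (forall i, measurable_fun (Om : set T) (fun x => F x ord0 i)) ->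
  measurable_fun (Om : set T) (fun x => enorm (F x)).
Proof.
move=> mF; rewrite /enorm; apply: (@measurableT_comp _ _ _ _ _ _ (@Num.sqrt R)).
  apply: continuous_measurable_fun; exact: sqrt_continuous.
by apply: measurable_sum => i; exact: measurable_funX.
Qed.

(** The sequence in the definition of [W11_0] provides the approximants; [wgrad] of a difference is
    compared with the difference of the gradients by uniqueness almost everywhere. *)
Lemma W11_0_W0 v : W11_0 Om v -> W0 v (fun i x => wgrad Om v x ord0 i).
Proof.
move=> [[vi exG] [phi [cphi lim]]].
have wv := wgrad_weak exG.
split => //; first by move=> i; case: (wv i).
move=> e e0.
have [k _ hk] : exists2 k, True & (W11_norm Om (fun x => v x - phi k x)%R < e%:E)%E.
  by have [k _ /(_ k (leqnn _))] := cvge0_near lim e0; exists k.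
have cf := C1_cont (smooth_C1 (cphi k).1); have fi := L1_cont cf.
have wphi := Ccinfty_weak (cphi k).
have wd := is_weak_gradientB vi fi wv wphi.
have di : L1 Om (fun x => v x - phi k x) by exact: int1B.
have ae := wgrad_ae di wd.
have I1 : (0 <= nint Om (fun x => v x - phi k x)%R)%E by exact: nint_ge0.
have mw : measurable_fun (Om : set T) (fun x => enorm (wgrad Om (fun x => v x - phi k x) x)).
  apply: measurable_enorm => i; have [h _] := wgrad_weak (ex_intro _ _ wd) i.
  exact: int1_measurable h.
have E2 : (\int[leb]_(x in Om) (enorm (wgrad Om (fun x => v x - phi k x)%R x))%:E =
   nint Om (fun x => enorm (wgrad Om (fun x => v x - phi k x)%R x)))%E.
  by apply: eq_integral => x _; rewrite ger0_norm// enorm_ge0.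
move: hk; rewrite /W11_norm E2 => hk.
exists (phi k); split; [exact: smooth_C1 (cphi k).1|exact: (cphi k).2| |].
  by apply: le_trans (ltW hk); rewrite leeDl// nint_ge0.
move=> i; apply: le_trans (ltW hk); apply: (@le_trans _ _ (nint Om (fun x => enorm (wgrad Om (fun x => v x - phi k x)%R x)))); last first.
  by apply: leeDr; apply: nint_ge0.
have mG : measurable_fun (Om : set T) (fun x => wgrad Om v x ord0 i).
  by have [h _] := wv i; exact: int1_measurable h.
apply: nint_le_ae => //.
  by apply: measurable_funB => //; apply/cont_measurable/C1_partial/smooth_C1; case: (cphi k).
move: ae; apply: ae_imp => x H Ox; rewrite (ger0_norm (enorm_ge0 _)) (H Ox).
by apply: le_trans (coord_le_enorm _ i); rewrite !mxE.
Qed.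

End WeakDerivative.

(** * Averages over balls and Muckenhoupt weights *)

Section Tonelli.
Context {R : realType} d {T : measurableType d}.
Variable mu : {sigma_finite_measure set T -> \bar R}.
Variables (S : set (T * T)) (D : set T).
Hypotheses (mS : measurable S) (mD : measurable D).
Implicit Types (W F : T -> \bar R).

Let sec x : set T := [set y | S (x, y)].
Let cosec y : set T := [set x | S (x, y)].

Local Open Scope ereal_scope.

Let ker W F (z : T * T) : \bar R := (W \_ D) z.1 * ((F \_ D) z.2 * (\1_S z)%:E).

Let measurable_ker W F : measurable_fun D W -> measurable_fun D F ->
  measurable_fun setT (ker W F).
Proof.
move=> /(measurable_restrictT _ mD) mW /(measurable_restrictT _ mD) mF.
apply: emeasurable_funM; first exact: measurableT_comp mW measurable_fst.
apply: emeasurable_funM; first exact: measurableT_comp mF measurable_snd.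
by apply/measurable_EFinP; exact: measurable_indic.
Qed.

Let patch_ge0 F : (forall x, D x -> 0 <= F x) -> forall x, 0 <= (F \_ D) x.
Proof. by move=> F0 x; rewrite /patch; case: ifPn => // /set_mem/F0. Qed.

Let int_sec (A : set T) F : (\int[mu]_(y in D `&` A) F y) = \int[mu]_y ((F \_ D) y * (\1_A y)%:E).
Proof.
rewrite integral_mkcondr integral_mkcond; apply: eq_integral => y _.
rewrite /patch indicE; case: ifPn => yD; last by rewrite mul0e.
by case: ifPn => yA; rewrite ?mule1 ?mule0.
Qed.

Let ind_ge0 (A : set T) y : 0 <= (\1_A y)%:E :> \bar R.
Proof. by rewrite lee_fin indicE; case: (_ \in _). Qed.

Let ind2_ge0 z : 0 <= (\1_S z)%:E :> \bar R.
Proof. by rewrite lee_fin indicE; case: (_ \in _). Qed.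

Lemma measurable_section_integral F : measurable_fun D F -> (forall x, D x -> 0 <= F x) ->
  measurable_fun setT (fun x => \int[mu]_(y in D `&` sec x) F y).
Proof.
move=> mF F0; have mc : measurable_fun D (cst 1 : T -> \bar R) by [].
have h : measurable_fun setT (fun z : T * T => (F \_ D) z.2 * (\1_S z)%:E).
  apply: emeasurable_funM; first by move: mF => /(measurable_restrictT _ mD) mF; exact: measurableT_comp mF measurable_snd.
  by apply/measurable_EFinP; exact: measurable_indic.
have := @measurable_fun_fubini_tonelli_F _ _ T T R mu _ h _.
rewrite /fubini_F /= => mm.
rewrite (_ : (fun x => _) = fun x => \int[mu]_y ((F \_ D) y * (\1_S (x, y))%:E)).
  by apply: mm => z; apply: mule_ge0; [exact: patch_ge0|exact: ind2_ge0].
by apply/funext => x; rewrite int_sec.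
Qed.

(** Exchanging the integrals leaves the integral of W over the set of x related to y, which is at
    most [C]. *)
Lemma tonelli_kernel W F (C : \bar R) : 0 <= C ->
  measurable_fun D W -> measurable_fun D F ->
  (forall x, D x -> 0 <= W x) -> (forall x, D x -> 0 <= F x) ->
  (forall y, D y -> \int[mu]_(x in D `&` cosec y) W x <= C) ->
  \int[mu]_(x in D) (W x * \int[mu]_(y in D `&` sec x) F y) <= C * \int[mu]_(y in D) F y.
Proof.
move=> C0 mW mF W0 F0 H.
have mW' := (measurable_restrictT _ mD).1 mW; have mF' := (measurable_restrictT _ mD).1 mF.
have mk := measurable_ker mW mF.
have k0 z : 0 <= ker W F z by apply: mule_ge0; [exact: patch_ge0|apply: mule_ge0; [exact: patch_ge0|exact: ind2_ge0]].
have mi : measurable_fun setT (fun z : T * T => (\1_S z)%:E : \bar R).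
  by apply/measurable_EFinP; exact: measurable_indic.
rewrite integral_mkcond.
rewrite (_ : (fun x => _) = (fun x => \int[mu]_y ker W F (x, y))); last first.
  apply/funext => x; rewrite /ker /= ge0_integralZl//=.
  - by rewrite -int_sec /patch; case: ifPn => // _; rewrite mul0e.
  - by apply: emeasurable_funM => //; exact: measurableT_comp mi (pair1_measurable x).
  - by move=> y _; apply: mule_ge0; [exact: patch_ge0|exact: ind2_ge0].
  - exact: patch_ge0.
rewrite (fubini_tonelli (ker W F) mk k0) [X in _ <= _ * X]integral_mkcond -ge0_integralZl//=; last first.
  by move=> y _; exact: patch_ge0.
apply: ge0_le_integral => //.
- by move=> y _; apply: integral_ge0 => x _; exact: k0.
- exact: (measurable_fun_fubini_tonelli_G _ mk k0).
- by apply: emeasurable_funM.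
move=> y _; rewrite /ker /=.
rewrite (_ : (fun x => _) = (fun x => (F \_ D) y * ((W \_ D) x * (\1_(cosec y) x)%:E))); last first.
  by apply/funext => x; rewrite muleCA.
rewrite ge0_integralZl//=; last 3 first.
- apply: emeasurable_funM => //; exact: measurableT_comp mi (pair2_measurable y).
- by move=> x _; apply: mule_ge0; [exact: patch_ge0|exact: ind_ge0].
- exact: patch_ge0.
rewrite -(int_sec (cosec y) W) muleC.
have [yD|yD] := boolP (y \in D); last by rewrite (_ : (F \_ D) y = 0) ?mule0// /patch (negbTE yD).
have -> : (F \_ D) y = F y by rewrite /patch yD.
by apply: lee_wpmul2r; [exact/F0/set_mem|exact/H/set_mem].
Qed.

End Tonelli.

(** * A Young inequality with a free parameter *)

Section Young.
Context {R : realType}.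
Implicit Types (r s A B J b mu : R).

Lemma powR_expR (x y : R) : expR x `^ y = expR (y * x).
Proof. by rewrite /powR gt_eqF ?expR_gt0// expRK. Qed.

Lemma gt0_expR s : 0 < s -> s = expR (ln s).
Proof. by move=> s0; rewrite lnK. Qed.

Lemma powR_le_inv r s t : 0 < r -> 0 <= s -> 0 <= t -> s `^ r <= t `^ r -> s <= t.
Proof.
move=> r0 s0 t0; rewrite leNgt => /negP h; rewrite leNgt; apply/negP => ts; apply: h.
by apply: gt0_ltr_powR.
Qed.

(** If A <= mu^r b the first term alone dominates s, otherwise the second does. The bound is linear
    in A and b, so it can be integrated pointwise; optimising mu afterwards recovers Hölder's
    inequality up to the factor 2^r. *)
Lemma young_split r s A b mu : 1 <= r -> 0 <= s -> 0 <= A -> 0 <= b -> 0 < mu ->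
  s `^ r <= A * b `^ (r - 1) -> s <= mu * b + mu `^ (1 - r) * A.
Proof.
move=> r1 s0 A0 b0 m0 H; have r0 : 0 < r by apply: lt_le_trans r1.
have t1 : 0 <= mu * b by rewrite mulr_ge0// ltW.
have t2 : 0 <= mu `^ (1 - r) * A by rewrite mulr_ge0// powR_ge0.
have [AE|A1] := eqVneq A 0.
  have : s `^ r <= 0 `^ r by rewrite powR0 ?gt_eqF// (le_trans H)// AE mul0r.
  move/(powR_le_inv r0 s0 (lexx _)) => s00; apply: le_trans s00 _; exact: addr_ge0.
have Ap : 0 < A by rewrite lt_neqAle eq_sym A1.
have [bE|b1] := eqVneq b 0.
  have [rE|r2] := eqVneq r 1.
    by move: H; rewrite rE !subrr !powRr0 powRr1// mulr1 mul1r bE mulr0 add0r.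
  move: H; rewrite bE powR0 ?subr_eq0// mulr0 -[X in _ <= X](@powR0 _ r) ?gt_eqF// => H.
  by apply: le_trans (powR_le_inv r0 s0 (lexx _) H) _; rewrite mulr0 add0r.
have bp : 0 < b by rewrite lt_neqAle eq_sym b1.
have [h|h] := leP A (mu `^ r * b).
  suff : s <= mu * b by move/le_trans; apply; rewrite lerDl.
  apply: (powR_le_inv r0) => //; apply: le_trans H _.
  apply: le_trans (ler_wpM2r (powR_ge0 _ _) h) _.
  rewrite (gt0_expR bp) (gt0_expR m0) !powR_expR -!expRD powR_expR ler_expR; lra.
suff : s <= mu `^ (1 - r) * A by move/le_trans; apply; rewrite lerDr.
apply: (powR_le_inv r0) => //; apply: le_trans H _.
have h' : b <= A * mu `^ (- r).
  rewrite powRN -ler_pdivrMr ?invr_gt0 ?powR_gt0// invrK mulrC; exact: ltW.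
have r10 : 0 <= r - 1 by rewrite subr_ge0.
have := ge0_ler_powR r10 (ltW bp : b \in Num.nneg) (_ : A * mu `^ (- r) \in Num.nneg) h'.
rewrite nnegrE mulr_ge0 ?powR_ge0// => /(_ isT) h2.
apply: le_trans (ler_wpM2l A0 h2) _.
rewrite (gt0_expR Ap) (gt0_expR m0) !powR_expR -!expRD !powR_expR -expRD ler_expR; lra.
Qed.

Lemma young_optimal r J A B : 1 <= r -> 0 <= J -> 0 <= A -> 0 <= B ->
  (forall mu, 0 < mu -> J <= mu * B + mu `^ (1 - r) * A) ->
  J `^ r <= 2 `^ r * (A * B `^ (r - 1)).
Proof.
move=> r1 J0 A0 B0 H; have r0 : 0 < r by apply: lt_le_trans r1.
have rhs0 : 0 <= 2 `^ r * (A * B `^ (r - 1)) by rewrite !mulr_ge0 ?powR_ge0.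
have [->|J1] := eqVneq J 0; first by rewrite powR0 ?gt_eqF.
have Jp : 0 < J by rewrite lt_neqAle eq_sym J1.
(* Degenerate cases: for A = 0 the value mu = J / (2 (B + 1)) gives J < J; for B = 0 and r > 1 the
   mu with mu^(1-r) = J / (2 A) gives J <= J / 2. *)
have [AE|A1] := eqVneq A 0.
  have B1 : 0 < 2 * (B + 1) by lra.
  have := H _ (divr_gt0 Jp B1); rewrite AE mulr0 addr0 => h; exfalso.
  suff : J / (2 * (B + 1)) * B < J by rewrite ltNge h.
  rewrite mulrAC ltr_pdivrMr//; nra.
have Ap : 0 < A by rewrite lt_neqAle eq_sym A1.
have [BE|B1] := eqVneq B 0.
  have [rE|r2] := eqVneq r 1.
    rewrite rE subrr powRr0 !powRr1 ?mulr1//.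
    by have := H 1 ltr01; rewrite BE mulr0 add0r rE subrr powRr0 mul1r; lra.
  exfalso; have J2A : 0 < J / (2 * A) by rewrite divr_gt0// mulr_gt0.
  have := H _ (powR_gt0 (1 - r)^-1 J2A); rewrite BE mulr0 add0r -powRrM mulVf; last first.
    by rewrite subr_eq0 eq_sym.
  rewrite powRr1; last exact: ltW.
  rewrite (_ : J / (2 * A) * A = J / 2); last by field; rewrite gt_eqF.
  lra.
have Bp : 0 < B by rewrite lt_neqAle eq_sym B1.
(* With this mu both terms equal A^(1/r) B^((r-1)/r), hence the factor 2. *)
have m0 : 0 < (A / B) `^ r^-1 by rewrite powR_gt0// divr_gt0.
have := H _ m0.
rewrite (gt0_expR Ap) (gt0_expR Bp); set x := ln A; set y := ln B.
rewrite -expRN -expRD !powR_expR -!expRD.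
rewrite (_ : r^-1 * (x - y) + y = r^-1 * x + (r - 1) / r * y); last by field; rewrite gt_eqF.
rewrite (_ : (1 - r) * (r^-1 * (x - y)) + x = r^-1 * x + (r - 1) / r * y); last by field; rewrite gt_eqF.
set E := expR (r^-1 * x + _) => hE; have h : J <= 2 * E by lra.
have E0 : 0 <= 2 * E by rewrite mulr_ge0 ?expR_ge0.
apply: le_trans (ge0_ler_powR (ltW r0) (ltW Jp : J \in Num.nneg) (E0 : 2 * E \in Num.nneg) h) _.
rewrite powRM ?expR_ge0// powR_expR ler_wpM2l ?powR_ge0// ler_expR.
rewrite (_ : r * _ = x + (r - 1) * y)//; by field; rewrite gt_eqF.
Qed.

End Young.

(** * Hölder's inequality with infinite weights *)

Section BallEstimate.
Context {R : realType} d {T : measurableType d}.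
Variable mu : {measure set T -> \bar R}.
Implicit Types (D : set T) (f F : T -> R) (b : T -> \bar R) (r : R).
Local Open Scope ereal_scope.

Lemma lee_poweR r (x y : \bar R) : (0 <= r)%R -> 0 <= x -> x <= y -> x `^ r <= y `^ r.
Proof.
move=> r0 x0 xy; apply: (gt0_ler_poweR r0) => //; rewrite in_itv /= leey andbT//.
exact: le_trans xy.
Qed.

Lemma young_splitE r (s A m : R) (b : \bar R) : (1 <= r)%R -> (0 <= s)%R -> (0 <= A)%R ->
  0 <= b -> (0 < m)%R -> (s `^ r)%:E <= A%:E * b `^ (r - 1) ->
  s%:E <= m%:E * b + (m `^ (1 - r) * A)%:E.
Proof.
move=> r1 s0 A0 b0 m0; case: b b0 => [b| |]// b0.
  by rewrite poweR_EFin -!EFinM -EFinD !lee_fin; exact: young_split.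
by move=> _; rewrite gt0_muley ?lte_fin// addye ?leey.
Qed.

(** Hölder's inequality, up to a constant, for |f| <= F^(1/r) b^((r-1)/r), where b may take the
    value +oo. The last hypothesis excludes the product of 0 and +oo, which would make the
    right-hand side 0. *)
Lemma ball_estimate D f F b r : measurable D -> measurable_fun D f -> measurable_fun D F ->
  measurable_fun D b -> (1 <= r)%R -> (forall y, D y -> 0 <= F y)%R -> (forall y, D y -> 0 <= b y) ->
  (forall y, D y -> (`|f y| `^ r)%:E <= (F y)%:E * b y `^ (r - 1)) ->
  \int[mu]_(y in D) (F y)%:E < +oo ->
  (\int[mu]_(y in D) b y = +oo -> 0 < \int[mu]_(y in D) (F y)%:E) ->
  nint mu D f `^ r <= (2 `^ r)%:E * (\int[mu]_(y in D) (F y)%:E * (\int[mu]_(y in D) b y) `^ (r - 1)).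
Proof.
move=> mD mf mF mb r1 F0 b0 H Aoo AB.
have mFE : measurable_fun D (EFin \o F) by apply/measurable_EFinP.
have r0 : (0 < r)%R by apply: lt_le_trans r1.
have E mm : (0 < mm)%R -> nint mu D f <=
    mm%:E * \int[mu]_(y in D) b y + (mm `^ (1 - r))%:E * \int[mu]_(y in D) (F y)%:E.
  move=> m0; have p0 : (0 <= mm `^ (1 - r))%R by exact: powR_ge0.
  have FE0 y : D y -> 0 <= (F y)%:E by move=> Dy; rewrite lee_fin F0.
  rewrite -(ge0_integralZl mu mD mb)//; last by rewrite lee_fin ltW.
  rewrite -(ge0_integralZl mu mD mFE)//.
  rewrite -ge0_integralD//; last 4 first.
  - by move=> x Dx; rewrite mule_ge0 ?b0// lee_fin ltW.
  - by apply: measurable_funeM.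
  - by move=> x Dx; rewrite mule_ge0 ?lee_fin// F0.
  - by apply: measurable_funeM.
  apply: ge0_le_integral => //.
  - exact: measurable_normE.
  - by apply: emeasurable_funD; apply: measurable_funeM.
  by move=> y Dy; rewrite -EFinM; apply: young_splitE => //; [exact: F0|exact: b0|exact: H].
have A0 : 0 <= \int[mu]_(y in D) (F y)%:E by apply: integral_ge0 => y Dy; rewrite lee_fin F0.
have B0 : 0 <= \int[mu]_(y in D) b y by apply: integral_ge0 => y Dy; rewrite b0.
have J0 := nint_ge0 mu D f.
have [rE|rn1] := eqVneq r 1%R.
  rewrite rE subrr poweRe0 mule1 poweRe1// powRr1//.
  apply: (@le_trans _ _ (\int[mu]_(y in D) (F y)%:E)).
    apply: ge0_le_integral => //; first exact: measurable_normE.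
    by move=> y Dy; have := H y Dy; rewrite rE subrr poweRe0 mule1 powRr1.
  by rewrite -[leLHS]mul1e; apply: lee_wpmul2r => //; rewrite lee_fin ler1n.
have [BE|BE] := eqVneq (\int[mu]_(y in D) b y) +oo.
  rewrite BE poweRyr ?subr_eq0// gt0_muley ?AB// gt0_muley ?leey// lte_fin powR_gt0//.
have Bf : \int[mu]_(y in D) b y \is a fin_num by rewrite ge0_fin_numE// ltey.
have Af : \int[mu]_(y in D) (F y)%:E \is a fin_num by rewrite ge0_fin_numE.
move: E A0 B0; rewrite -(fineK Bf) -(fineK Af); set A := fine _; set B := fine _.
rewrite !lee_fin => E A0 B0.
have Jf : nint mu D f \is a fin_num.
  by rewrite ge0_fin_numE//; apply: le_lt_trans (E 1%R ltr01) _; rewrite -!EFinM -EFinD ltry.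
move: E J0; rewrite -(fineK Jf) lee_fin; set J := fine _ => E J0.
rewrite !poweR_EFin -!EFinM lee_fin; exact: young_optimal.
Qed.

End BallEstimate.

(** * Averages over cubes and the Muckenhoupt condition *)

Section Averages.
Context {R : realType} {n : nat}.
Local Notation V := 'rV[R]_n.+1.
Local Notation T := (leb_space R n).
Local Notation leb := (@leb R n).
Local Notation nint := (nint leb).
Implicit Types (f g h k v w : V -> R) (x y : V) (i : 'I_n.+1).

Definition ball_rel (d : R) : set (T * T) := [set z | `|(z.2 : V) - z.1| < d].

Lemma measurable_ball_rel d : 0 < d -> measurable (ball_rel d).
Proof.
move=> d0; rewrite (_ : ball_rel d = \bigcap_(i in [set: 'I_n.+1])
   ((fun z : T * T => `|(z.2 : V) ord0 i - (z.1 : V) ord0 i|) @^-1` [set s | s < d])).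
  apply: fin_bigcap_measurable => // i _; rewrite -[X in measurable X]setTI.
  have mg : measurable_fun setT (fun z : T * T => `|(z.2 : V) ord0 i - (z.1 : V) ord0 i|).
    apply: measurable_norm; apply: measurable_funB.
      exact: measurableT_comp (measurable_coord i) measurable_snd.
    exact: measurableT_comp (measurable_coord i) measurable_fst.
  have -> : [set s : R | s < d] = [set` `]-oo, d[%R] by apply/seteqP; split => s; rewrite /= in_itv.
  by apply: mg => //; exact: measurable_itv.
apply/seteqP; split => [z /= zd i _ /=|z zd].
  by apply: le_lt_trans zd; have := coord_le_norm ((z.2 : V) - z.1) i; rewrite !mxE.
by apply: rV_norm_lt => // i; have := zd i I; rewrite /= !mxE.
Qed.

Lemma enorm_lt x (d : R) : `|x| < d -> enorm x < n.+1%:R * d.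
Proof.
move=> xd; apply: le_lt_trans (enorm_le_sum x) _.
apply: le_lt_trans (_ : \sum_(i < n.+1) `|x| < _).
  by apply: ler_sum => i _; exact: coord_le_norm.
by rewrite sumr_const card_ord -[_ *+ _]mulr_natl ltr_pM2l ?ltr0n.
Qed.

Lemma norm_le_enorm x : `|x| <= enorm x.
Proof. by apply: rV_norm_le => [|i]; [exact: enorm_ge0|exact: coord_le_enorm]. Qed.

Lemma measurable_eball x (r : R) : measurable (eball x r : set T).
Proof.
have mg : measurable_fun (setT : set T) (fun y : V => enorm (y - x)).
  apply: (measurable_enorm (F := fun y => y - x)) => i.
  under eq_fun do rewrite !mxE; apply: measurable_funB; last exact: measurable_cst.
  exact: measurable_coord.
rewrite (_ : eball x r = setT `&` (fun y : V => enorm (y - x)) @^-1` `]-oo, r[).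
  by apply: mg => //; exact: measurable_itv.
by apply/seteqP; split => y; rewrite /eball /= in_itv//= => -[].
Qed.

Variable Om : set V.
Hypotheses (oOm : open Om) (bOm : bounded_set Om).

Let mOm : measurable (Om : set T). Proof. exact: measurable_open. Qed.

Let mOB x (r : R) : measurable (Om `&` uball x r : set T).
Proof. by apply: measurableI => //; exact: measurable_uball. Qed.

Local Open Scope ereal_scope.

Let lebs : {sigma_finite_measure set T -> \bar R} := leb.


Lemma tonelli_ball (W F : V -> \bar R) (C : \bar R) (d : R) : (0 < d)%R -> 0 <= C ->
  measurable_fun (Om : set T) W -> measurable_fun (Om : set T) F ->
  (forall x, Om x -> 0 <= W x) -> (forall x, Om x -> 0 <= F x) ->
  (forall y, Om y -> \int[leb]_(x in Om `&` uball y d) W x <= C) ->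
  \int[leb]_(x in Om) (W x * \int[leb]_(y in Om `&` uball x d) F y) <= C * \int[leb]_(y in Om) F y.
Proof.
move=> d0 C0 mW mF W0 F0 H.
suff H' : forall y, Om y -> \int[leb]_(x in Om `&` [set x | ball_rel d (x, y)]) W x <= C.
  exact (@tonelli_kernel _ _ _ lebs _ _ (measurable_ball_rel d0) mOm W F C C0 mW mF W0 F0 H').
move=> y Oy.
have -> : [set x | ball_rel d (x, y)] = uball y d.
  by apply/seteqP; split => x; rewrite /ball_rel /uball /= distrC.
exact: H.
Qed.

Lemma measurable_ball_integral (F : V -> \bar R) (d : R) : (0 < d)%R -> measurable_fun (Om : set T) F ->
  (forall x, Om x -> 0 <= F x) ->
  measurable_fun (Om : set T) (fun x => \int[leb]_(y in Om `&` uball x d) F y).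
Proof.
move=> d0 mF F0; apply: (@measurable_funS _ _ _ _ setT) => //.
exact (measurable_section_integral lebs (measurable_ball_rel d0) mOm mF F0).
Qed.

Lemma uball_subset x y (r : R) : uball y r x -> Om `&` uball x r `<=` Om `&` uball y (r + r).
Proof.
move=> xy z [Oz xz]; split => //; rewrite /uball /= -(subrKA x).
by apply: le_lt_trans (ler_normD _ _) _; exact: ltrD.
Qed.

Lemma measurable_dual_weight (D : set V) (q : R) w : measurable (D : set T) -> measurable_fun (D : set T) w ->
  measurable_fun (D : set T) (dual_weight q w).
Proof.
move=> mD mw; apply: measurable_fun_if => //.
- by apply: measurable_fun_eqr => //; exact: measurable_cst.
- apply: (measurable_funS mD); first exact: subIsetl.
  have mp : measurable_fun (D : set T) (fun x => w x `^ (- (q - 1)^-1))%R.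
    exact: measurableT_comp (measurable_powR _) mw.
  exact/measurable_EFinP.
Qed.

Lemma dual_weight_ge0 (q : R) w x : 0 <= dual_weight q w x.
Proof. by rewrite /dual_weight; case: ifP => // _; rewrite lee_fin powR_ge0. Qed.

Hypothesis u0 : (0 < @uvol R n)%R.

Lemma leb_eball x (r : R) : (0 < r)%R ->
  exists m : R, [/\ (0 < m)%R, leb (eball x r) = m%:E & (m <= @uvol R n * r ^+ n.+1)%R].
Proof.
move=> r0; have N0 : (0 < n.+1%:R :> R)%R by rewrite ltr0n.
have rN : (0 < r / n.+1%:R)%R by rewrite divr_gt0.
have le : leb (eball x r) <= leb (uball x r).
  apply: le_measure; rewrite ?inE; [exact: measurable_eball|exact: measurable_uball|].
  by move=> y /=; apply: le_lt_trans; exact: norm_le_enorm.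
have ge : leb (uball x (r / n.+1%:R)) <= leb (eball x r).
  apply: le_measure; rewrite ?inE; [exact: measurable_uball|exact: measurable_eball|].
  by move=> y /= /enorm_lt; rewrite mulrC divfK ?gt_eqF.
rewrite leb_uball// in le; rewrite leb_uball// in ge.
have f : leb (eball x r) \is a fin_num by rewrite ge0_fin_numE// (le_lt_trans le)// ltry.
move: le ge; rewrite -(fineK f) !lee_fin => le ge; exists (fine (leb (eball x r))); split => //.
by apply: lt_le_trans ge; rewrite mulr_gt0// exprn_gt0.
Qed.

(** The Euclidean ball of radius 2 N d about y contains both cubes and lies in [U] for small d. The
    averages are multiplied out because cubes cut by [Om] have no useful lower bound on their
    measure. The doubled radius of the dual factor is what remains after Tonelli's theorem in
    [corr_weighted]. *)
Lemma muckenhoupt_local (U : set V) (q : R) w : open U -> compactly_contained Om U -> (1 < q)%R ->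
  muckenhoupt q U w -> exists L d0 : R, [/\ (0 <= L)%R, (0 < d0)%R & forall y d,
    Om y -> (0 < d)%R -> (d <= d0)%R ->
    \int[leb]_(x in Om `&` uball y d) (w x)%:E *
    (\int[leb]_(x in Om `&` uball y (d + d)) dual_weight q w x) `^ (q - 1) <=
    (L * (d ^+ n.+1) `^ q)%:E].
Proof.
move=> oU [cO OU] q1 [w0 mw supw]; set S := ereal_sup _ in supw.
have q10 : (0 < q - 1)%R by rewrite subr_gt0.
have [d1 d10 hd1] := compact_thick cO oU OU.
have N0 : (0 < n.+1%:R :> R)%R by rewrite ltr0n.
pose N2 : R := (n.+1%:R * 2)%R; have N20 : (0 < N2)%R by rewrite mulr_gt0.
(* The power bounds the measure of that ball relative to d^N, with exponent 1 + (q - 1) = q. The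
   maximum with 0 is there because the supremum is known to be nonnegative only once a point of
   [Om], hence a ball, is given. *)
exists (fine (maxe S 0) * (@uvol R n * N2 ^+ n.+1) `^ q)%R, (d1 / N2)%R; split.
- by rewrite mulr_ge0 ?powR_ge0// fine_ge0// le_max lexx orbT.
- by rewrite divr_gt0.
move=> y d Oy d0 dd1.
have r0 : (0 < n.+1%:R * (d + d))%R by rewrite mulr_gt0// addr_gt0.
set rho := (n.+1%:R * (d + d))%R in r0; have rE : rho = (N2 * d)%R by rewrite /rho /N2; ring.
have [m [m0 mE mle]] := leb_eball y r0.
have EU : eball y rho `<=` U.
  move=> x xy; apply: (hd1 y); first exact: subset_closure.
  rewrite distrC; apply: le_trans (norm_le_enorm _) _; apply: le_trans (ltW xy) _.
  by rewrite rE mulrC -ler_pdivlMr.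
have mU : measurable (U : set T) by exact: measurable_open.
have mEb := measurable_eball y rho.
have OdE (s : R) : (s <= d + d)%R -> Om `&` uball y s `<=` eball y rho.
  by move=> sd x [_ xy]; apply: enorm_lt; exact: lt_le_trans sd.
have mwE : measurable_fun (eball y rho : set T) (EFin \o w).
  by apply/measurable_EFinP; exact: measurable_funS mw.
have mdE : measurable_fun (eball y rho : set T) (dual_weight q w).
  by apply: measurable_dual_weight => //; exact: measurable_funS mw.
set X := \int[leb]_(x in eball y rho) (w x)%:E.
set Y := \int[leb]_(x in eball y rho) dual_weight q w x.
have X0 : 0 <= X by apply: integral_ge0 => x /EU Ux; rewrite lee_fin w0.
have Y0 : 0 <= Y by apply: integral_ge0 => x _; exact: dual_weight_ge0.
have XY : (m^-1)%:E * X * ((m^-1)%:E * Y) `^ (q - 1) <= S.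
  apply: ereal_sup_ubound; exists (eball y rho); first by split => //; exists y, rho.
  by rewrite /average mE.
have mi0 : (0 <= m^-1)%R by rewrite invr_ge0 ltW.
move: XY; rewrite poweRM ?lee_fin// poweR_EFin muleACA -EFinM => XY.
have XY0 : 0 <= X * Y `^ (q - 1) by rewrite mule_ge0// poweR_ge0.
have S0 : 0 <= S by apply: le_trans XY; rewrite mule_ge0// lee_fin mulr_ge0 ?powR_ge0.
have Sf : S \is a fin_num by rewrite ge0_fin_numE.
have -> : maxe S 0 = S by apply/max_idPl.
apply: (@le_trans _ _ (X * Y `^ (q - 1))).
  apply: lee_pmul.
  - by apply: integral_ge0 => x [/(@subset_closure _ _ _)/OU Ux _]; rewrite lee_fin w0.
  - exact: poweR_ge0.
  - apply: ge0_subset_integral => //; first by move=> x /EU Ux; rewrite lee_fin w0.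
    by apply: OdE; rewrite lerDl ltW.
  apply: lee_poweR; [exact: ltW|by apply: integral_ge0 => x _; exact: dual_weight_ge0|].
  apply: ge0_subset_integral => //; first by move=> x _; exact: dual_weight_ge0.
  exact: OdE.
have -> : X * Y `^ (q - 1) = (m `^ q)%:E * ((m^-1 * m^-1 `^ (q - 1))%:E * (X * Y `^ (q - 1))).
  rewrite muleA -EFinM (_ : (_ * _)%R = 1%R) ?mul1e//.
  rewrite (gt0_expR m0) -expRN !powR_expR -!expRD -[RHS]expR0; congr expR; ring.
apply: le_trans (lee_wpmul2l _ XY) _; first by rewrite lee_fin powR_ge0.
rewrite -{1}(fineK Sf) -EFinM lee_fin mulrC -mulrA ler_wpM2l ?fine_ge0//.
rewrite -powRM; last 2 first.
- by rewrite mulr_ge0 ?exprn_ge0// ltW.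
- by rewrite exprn_ge0// ltW.
apply: ge0_ler_powR; rewrite ?nnegrE.
- by apply: ltW; apply: lt_trans q1.
- exact: ltW.
- by rewrite !mulr_ge0 ?exprn_ge0// ltW.
by apply: le_trans mle _; rewrite rE exprMn mulrA.
Qed.

(** The bounds have the scaling of a fixed kernel rescaled to size t with integral 1; the constants
    are uniform in t. *)
Definition kern (C c t : R) k := [/\ is_kernel k (c * t)%R,
  forall z, (k z <= C / t ^+ n.+1)%R & forall i z, (`|partial i k z| <= C / t / t ^+ n.+1)%R].

Lemma corr_le_ball C c t k f x : kern C c t k -> L1 Om f -> (0 < C)%R -> (0 < t)%R ->
  (`|corr Om k f x|)%:E <= (C / t ^+ n.+1)%:E * nint (Om `&` uball x (c * t)) f.
Proof.
move=> [[sk ck k0 kd _] kC _] fi C0 t0.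
have contk := C1_cont (smooth_C1 sk); have mf := int1_measurable fi.
have M0 : (0 <= C / t ^+ n.+1)%R by rewrite divr_ge0 ?exprn_ge0// ltW.
have mk : measurable_fun (Om : set T) (fun y : V => k (y - x))%R by exact: measurable_cont_shift.
apply: le_trans (corr_le mOm x contk ck fi) _.
have -> : nint Om (fun y => k (y - x) * f y)%R = nint (Om `&` uball x (c * t)) (fun y => k (y - x) * f y)%R.
  rewrite /nint [RHS]integral_mkcondr; apply: eq_integral => y _; rewrite /patch.
  case: ifPn => // /negP yB; have -> : k (y - x)%R = 0%R; last by rewrite mul0r normr0.
  by apply/eqP; apply: contrapT => /negP /kd h; apply: yB; rewrite inE.
rewrite -{1}(ger0_norm M0) -nintZ//; last by apply: (measurable_funS mOm) => //; exact: subIsetl.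
apply: nint_le => //.
- by apply: (measurable_funS mOm); [exact: subIsetl|exact: measurable_funM].
- apply: measurable_funM; [exact: measurable_cst|].
  by apply: (measurable_funS mOm) => //; exact: subIsetl.
by move=> y _; rewrite normrM [leRHS]normrM (ger0_norm (k0 _)) (ger0_norm M0) ler_wpM2r.
Qed.

Lemma leb_OB x (d : R) : (0 < d)%R -> leb (Om `&` uball x d) <= (@uvol R n * d ^+ n.+1)%:E.
Proof.
move=> d0; rewrite -(leb_uball x)//; apply: le_measure; rewrite ?inE//; exact: measurable_uball.
Qed.

(** Boundedness of the smoothing on L^r, uniformly in t: [ball_estimate] with b = 1 on each cube,
    then Tonelli's theorem. *)
Lemma corr_power C c t k f (r : R) : kern C c t k -> L1 Om f -> (0 < C)%R -> (0 < c)%R -> (0 < t)%R ->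
  (1 <= r)%R -> \int[leb]_(x in Om) (`|f x| `^ r)%:E < +oo ->
  \int[leb]_(x in Om) (`|corr Om k f x| `^ r)%:E <=
  ((2 * (C * (@uvol R n * c ^+ n.+1))) `^ r)%:E * \int[leb]_(x in Om) (`|f x| `^ r)%:E.
Proof.
move=> kk fi C0 c0 t0 r1 fr; have [[sk ck _ _ _] _ _] := kk.
have r0 : (0 < r)%R by apply: lt_le_trans r1.
have mf := int1_measurable fi; have ct0 : (0 < c * t)%R by rewrite mulr_gt0.
pose M : R := (C / t ^+ n.+1)%R; have M0 : (0 < M)%R by rewrite divr_gt0// exprn_gt0.
pose b : R := (@uvol R n * (c * t) ^+ n.+1)%R; have b0 : (0 < b)%R by rewrite mulr_gt0// exprn_gt0.
pose F y : R := (`|f y| `^ r)%R; have F0 y : (0 <= F y)%R by exact: powR_ge0.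
have mF : measurable_fun (Om : set T) F.
  exact: measurableT_comp (measurable_powR _) (measurable_norm mf).
have mFE : measurable_fun (Om : set T) (EFin \o F) by exact/measurable_EFinP.
have mS : measurable_fun (Om : set T) (corr Om k f).
  by apply: measurable_continuous => //; apply: corr_cont => //; exact: C1_cont (smooth_C1 sk).
pose W : R := ((2 * M) `^ r * b `^ (r - 1))%R; have W0 : (0 <= W)%R by rewrite mulr_ge0 ?powR_ge0.
pose A x := \int[leb]_(y in Om `&` uball x (c * t)) (F y)%:E.
have A0 x : 0 <= A x by apply: integral_ge0 => y _; rewrite lee_fin.
have pt x : Om x -> (`|corr Om k f x| `^ r)%:E <= W%:E * A x.
  move=> Ox; have h := corr_le_ball x kk fi C0 t0.
  have := lee_poweR (ltW r0) _ h; rewrite lee_fin => /(_ (normr_ge0 _)).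
  rewrite poweR_EFin poweRM ?nint_ge0 ?lee_fin ?(ltW M0)// poweR_EFin => /le_trans; apply.
  have mfB : measurable_fun (Om `&` uball x (c * t) : set T) f.
    by apply: (measurable_funS mOm) => //; exact: subIsetl.
  have mFB : measurable_fun (Om `&` uball x (c * t) : set T) F.
    by apply: (measurable_funS mOm) => //; exact: subIsetl.
  have Bb : \int[leb]_(y in Om `&` uball x (c * t)) cst 1 y <= b%:E.
    by rewrite integral_cst// mul1e leb_OB.
  have B0 : 0 <= \int[leb]_(y in Om `&` uball x (c * t)) cst 1 y by apply: integral_ge0.
  have Aoo : A x < +oo.
    by apply: le_lt_trans fr; apply: ge0_subset_integral;
      [exact: mOB|exact: mOm|exact: mFE|by move=> z _; rewrite lee_fin|exact: subIsetl].
  have := @ball_estimate _ _ T leb (Om `&` uball x (c * t)) f F (cst 1) r (mOB _ _) mfB mFB _ r1 _ _ _ Aoo _.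
  move=> /(_ _ _ _ _ _)/le_trans-/(_ _ _ _ _ _ _) h2.
  apply: (@le_trans _ _ ((M `^ r)%:E * ((2 `^ r)%:E * (A x * (b%:E) `^ (r - 1))))).
    apply: lee_wpmul2l; first by rewrite lee_fin powR_ge0.
    apply: h2 => //.
    - by move=> y _; rewrite poweR1r mule1.
    - by move=> E; move: Bb; rewrite E leye_eq.
    apply: lee_wpmul2l; first by rewrite lee_fin powR_ge0.
    have r10 : (0 <= r - 1)%R by rewrite subr_ge0.
    exact: (lee_wpmul2l (A0 x) (lee_poweR r10 B0 Bb)).
  rewrite poweR_EFin /W muleA -EFinM -powRM ?(ltW M0)// [A x * _]muleC muleA -EFinM.
  by rewrite [(M * 2)%R]mulrC.
have -> : ((2 * (C * (@uvol R n * c ^+ n.+1))) `^ r)%R = (W * b)%R.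
  rewrite (_ : (2 * (C * (@uvol R n * c ^+ n.+1)))%R = (2 * M * b)%R); last first.
    by rewrite /M /b exprMn; field; rewrite expf_neq0// gt_eqF.
  have h2M : (0 < 2 * M)%R by rewrite mulr_gt0.
  rewrite powRM ?(ltW b0)// ?(ltW h2M)// /W -mulrA; congr (_ * _)%R.
  by rewrite (gt0_expR b0) !powR_expR -expRD; congr expR; ring.
apply: (@le_trans _ _ (\int[leb]_(x in Om) (W%:E * A x))).
  apply: ge0_le_integral => //.
  - by apply/measurable_EFinP; exact: measurableT_comp (measurable_powR _) (measurable_norm mS).
  - apply: emeasurable_funM; first exact: measurable_cst.
    by apply: measurable_ball_integral => // x _; rewrite lee_fin.
apply: tonelli_ball => //.
- by rewrite lee_fin mulr_ge0// ltW.
  by move=> x _; rewrite lee_fin.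
move=> y Oy; rewrite integral_cst// [(W * b)%:E]EFinM; apply: lee_wpmul2l => //; exact: leb_OB.
Qed.

Lemma leb_OB_gt0 x (d : R) : Om x -> (0 < d)%R -> 0 < leb (Om `&` uball x d).
Proof.
move=> Ox d0; have : nbhs x Om by apply: open_nbhs_nbhs.
move=> /nbhs_ballP[e /= e0 eO]; have m0 : (0 < Num.min e d)%R by rewrite lt_min e0.
apply: (@lt_le_trans _ _ (leb (uball x (Num.min e d)))).
  by rewrite leb_uball// lte_fin mulr_gt0// exprn_gt0.
apply: le_measure; rewrite ?inE//; first exact: measurable_uball.
move=> y; rewrite /uball /= lt_min => /andP[ye yd]; split => //.
by apply: eO; rewrite -ball_normE /= distrC.
Qed.

(** On a cube where s(x) <= K s(y), the value s(x) |f(y)|^q is at most F(y) / w(y), with F the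
    integrand on the right. So [ball_estimate] with the dual weight bounds s(x) times the q-th power
    of the integral of |f|. The majorant [H] is defined at every x, so that its integral can be
    computed without knowing where the comparison holds; eps makes F positive also where w
    vanishes. *)
Lemma corr_weighted C c t k f (q L K eps : R) (a s w : V -> R) :
  kern C c t k -> L1 Om f -> (0 < C)%R -> (0 < c)%R -> (0 < t)%R -> (1 < q)%R ->
  (0 <= K)%R -> (0 < eps)%R -> (0 <= L)%R ->
  (forall x, Om x -> (0 <= w x)%R) -> (forall x, Om x -> (0 <= s x)%R) ->
  (forall x, Om x -> a x = (s x * w x)%R) ->
  measurable_fun (Om : set T) w -> measurable_fun (Om : set T) a ->
  \int[leb]_(x in Om) (K * (a x * `|f x| `^ q) + eps)%:E < +oo ->
  (forall y, Om y ->
    \int[leb]_(x in Om `&` uball y (c * t)) (w x)%:E *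
    (\int[leb]_(x in Om `&` uball y (c * t + c * t)) dual_weight q w x) `^ (q - 1) <=
    (L * ((c * t) ^+ n.+1) `^ q)%:E) ->
  exists H : V -> \bar R, [/\ measurable_fun (Om : set T) H, forall x, Om x -> 0 <= H x,
    \int[leb]_(x in Om) H x <= ((2 * (C * c ^+ n.+1)) `^ q * L)%:E *
       \int[leb]_(x in Om) (K * (a x * `|f x| `^ q) + eps)%:E &
    forall x, Om x -> (forall y, Om y -> (`|y - x| < c * t)%R -> (s x <= K * s y)%R) ->
      (a x * `|corr Om k f x| `^ q)%:E <= H x].
Proof.
move=> kk fi C0 c0 t0 q1 K0 e0 L0 w0 s0 aE mw ma Foo HL.
have q0 : (0 < q)%R by apply: lt_trans q1.
have q10 : (0 < q - 1)%R by rewrite subr_gt0.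
have mf := int1_measurable fi; have ct0 : (0 < c * t)%R by rewrite mulr_gt0.
pose M : R := (C / t ^+ n.+1)%R; have M0 : (0 < M)%R by rewrite divr_gt0// exprn_gt0.
pose F y : R := (K * (a y * `|f y| `^ q) + eps)%R.
have a0 y : Om y -> (0 <= a y)%R by move=> Oy; rewrite aE// mulr_ge0 ?s0 ?w0.
have Fe y : Om y -> (eps <= F y)%R.
  by move=> Oy; rewrite lerDr mulr_ge0// mulr_ge0 ?powR_ge0// a0.
have F0 y : Om y -> (0 <= F y)%R by move=> Oy; apply: le_trans (Fe y Oy); exact: ltW.
have mfq : measurable_fun (Om : set T) (fun x => `|f x| `^ q)%R.
  exact: measurableT_comp (measurable_powR _) (measurable_norm mf).
have mF : measurable_fun (Om : set T) F.
  apply: measurable_funD; last exact: measurable_cst.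
  by apply: measurable_funM; [exact: measurable_cst|exact: measurable_funM].
have mFE : measurable_fun (Om : set T) (EFin \o F) by exact/measurable_EFinP.
have mdw := measurable_dual_weight q mOm mw.
have dw0 := dual_weight_ge0 q w.
pose A x := \int[leb]_(y in Om `&` uball x (c * t)) (F y)%:E.
pose B x := \int[leb]_(y in Om `&` uball x (c * t)) dual_weight q w y.
have A0 x : 0 <= A x by apply: integral_ge0 => y [Oy _]; rewrite lee_fin F0.
have B0 x : 0 <= B x by apply: integral_ge0 => y _.
pose W x := (w x)%:E * B x `^ (q - 1).
have mB : measurable_fun (Om : set T) B by exact: measurable_ball_integral.
have mW : measurable_fun (Om : set T) W.
  apply: emeasurable_funM; first exact/measurable_EFinP.
  exact: measurableT_comp (measurable_poweR _) mB.
have W0 x : Om x -> 0 <= W x by move=> Ox; rewrite mule_ge0 ?poweR_ge0// lee_fin w0.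
have mA : measurable_fun (Om : set T) A.
  by apply: measurable_ball_integral => // x Ox; rewrite lee_fin F0.
have M2 : (0 < 2 * M)%R by rewrite mulr_gt0.
(* The factors are the kernel bound M to the power q, the constant 2^q of [ball_estimate], the
   weight w(x) with the dual factor of the cube, and the integral of F over the cube. *)
exists (fun x => ((2 * M) `^ q)%:E * (W x * A x)); split.
- by apply: emeasurable_funM; [exact: measurable_cst|exact: emeasurable_funM].
- by move=> x Ox; rewrite mule_ge0 ?lee_fin ?powR_ge0// mule_ge0 ?W0.
- rewrite ge0_integralZl//; last 3 first.
  + by apply: emeasurable_funM.
  + by move=> x Ox; rewrite mule_ge0 ?W0.
  + by rewrite lee_fin powR_ge0.
  have -> : ((2 * (C * c ^+ n.+1)) `^ q)%R = ((2 * M) `^ q * ((c * t) ^+ n.+1) `^ q)%R.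
    rewrite -powRM; [|exact: ltW|by rewrite exprn_ge0// ltW].
    by congr (_ `^ _)%R; rewrite /M exprMn; field; rewrite expf_neq0// gt_eqF.
  rewrite -mulrA EFinM -muleA; apply: lee_wpmul2l; first by rewrite lee_fin powR_ge0.
  apply: tonelli_ball => //.
    by rewrite lee_fin mulr_ge0// powR_ge0.
  (* For x in the cube about y, the cube about x lies in the cube of twice the radius about y. This
     makes the dual factor independent of x, and the local Muckenhoupt bound applies. *)
  move=> y Oy; apply: (@le_trans _ _ (\int[leb]_(x in Om `&` uball y (c * t))
     ((\int[leb]_(z in Om `&` uball y (c * t + c * t)) dual_weight q w z) `^ (q - 1) * (w x)%:E))).
    apply: ge0_le_integral => //.
    + by move=> x [Ox _]; exact: W0.
    + by apply: (measurable_funS mOm) => //; exact: subIsetl.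
    + apply: emeasurable_funM; first exact: measurable_cst.
      by apply/measurable_EFinP; apply: (measurable_funS mOm) => //; exact: subIsetl.
    move=> x [Ox xy]; rewrite /W muleC; apply: lee_wpmul2r; first by rewrite lee_fin w0.
    apply: lee_poweR; [exact: ltW|exact: B0|].
    apply: ge0_subset_integral; [exact: mOB|exact: mOB| |by move=> z _|exact: uball_subset].
    by apply: (measurable_funS mOm) => //; exact: subIsetl.
  rewrite ge0_integralZl//; last 3 first.
  + by apply/measurable_EFinP; apply: (measurable_funS mOm) => //; exact: subIsetl.
  + by move=> x [Ox _]; rewrite lee_fin w0.
  + exact: poweR_ge0.
  by rewrite muleC [(_ * L)%R]mulrC; exact: HL.
move=> x Ox Hx.
have h := corr_le_ball x kk fi C0 t0.
have := lee_poweR (ltW q0) _ h; rewrite lee_fin => /(_ (normr_ge0 _)).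
rewrite poweR_EFin poweRM ?nint_ge0 ?lee_fin ?(ltW M0)// poweR_EFin => h2.
have mfB : measurable_fun (Om `&` uball x (c * t) : set T) f.
  by apply: (measurable_funS mOm) => //; exact: subIsetl.
have mFB : measurable_fun (Om `&` uball x (c * t) : set T) F.
  by apply: (measurable_funS mOm) => //; exact: subIsetl.
have mdB : measurable_fun (Om `&` uball x (c * t) : set T) (dual_weight q w).
  by apply: (measurable_funS mOm) => //; exact: subIsetl.
have Aoo : A x < +oo.
  apply: le_lt_trans Foo; apply: ge0_subset_integral;
      [exact: mOB|exact: mOm|exact: mFE|by move=> z Oz; rewrite lee_fin F0|exact: subIsetl].
(* [ball_estimate] asks for this when the dual weight has infinite integral; eps provides it. *)
have Apos : 0 < A x.
  apply: (@lt_le_trans _ _ (eps%:E * leb (Om `&` uball x (c * t)))).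
    by rewrite mule_gt0 ?lte_fin// leb_OB_gt0.
  rewrite -integral_cst//; apply: ge0_le_integral => //.
  - by move=> y _; rewrite lee_fin ltW.
  - exact/measurable_EFinP.
  by move=> y [Oy _]; rewrite lee_fin Fe.
(* The value of s at the centre is moved inside the integral as a constant factor of f. *)
pose s1 : R := (s x `^ q^-1)%R; have s10 : (0 <= s1)%R by exact: powR_ge0.
have s1q : (s1 `^ q)%R = s x by rewrite /s1 -powRrM mulVf ?gt_eqF// powRr1// s0.
have mf1 : measurable_fun (Om `&` uball x (c * t) : set T) (fun y => s1 * f y)%R.
  by apply: measurable_funM => //; exact: measurable_cst.
have := @ball_estimate _ _ T leb (Om `&` uball x (c * t)) (fun y => s1 * f y)%R F
  (dual_weight q w) q (mOB _ _) mf1 mFB mdB (ltW q1).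
rewrite nintZ// (ger0_norm s10) poweRM ?nint_ge0 ?lee_fin// poweR_EFin s1q.
move=> /(_ _ _ _ Aoo (fun _ => Apos)) h3.
have {}h3 : (s x)%:E * nint (Om `&` uball x (c * t)) f `^ q <= (2 `^ q)%:E * (A x * B x `^ (q - 1)).
  apply: h3; first by move=> y [Oy _]; exact: F0.
    by move=> y _.
  move=> y [Oy yx]; rewrite normrM powRM// (ger0_norm s10) s1q /dual_weight.
  have Fp : (0 < F y)%R by apply: lt_le_trans (Fe y Oy).
  case: ifPn => wy.
    by rewrite poweRyr ?gt_eqF// gt0_muley ?lte_fin// leey.
  have wp : (0 < w y)%R by rewrite lt_neqAle eq_sym wy w0.
  rewrite poweR_EFin -powRrM mulNr mulVf ?gt_eqF// powR_inv1 ?w0// -EFinM lee_fin.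
  rewrite ler_pdivlMr// /F aE//; apply: (@le_trans _ _ (K * (s y * w y * `|f y| `^ q)))%R; last by rewrite lerDl ltW.
  have := Hx y Oy yx; have := powR_ge0 `|f y| q; set g := (_ `^ q)%R => g0 sy.
  rewrite (_ : (s x * g * w y)%R = (s x * (w y * g))%R); last by ring.
  rewrite (_ : (K * (s y * w y * g))%R = (K * s y * (w y * g))%R); last by ring.
  by apply: ler_wpM2r => //; rewrite mulr_ge0// ltW.
rewrite aE// EFinM [(s x * w x)%R]mulrC EFinM.
have w0x : 0 <= (w x)%:E by rewrite lee_fin w0.
have s0x : 0 <= (s x)%:E by rewrite lee_fin s0.
apply: (le_trans (lee_wpmul2l (mule_ge0 w0x s0x) h2)).
set J := nint _ f `^ q in h2 h3 *.
have -> : (w x)%:E * (s x)%:E * ((M `^ q)%:E * J) = (M `^ q)%:E * ((w x)%:E * ((s x)%:E * J)).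
  by rewrite muleCA -muleA.
have MM : 0 <= (M `^ q)%:E :> \bar R by rewrite lee_fin powR_ge0.
apply: (le_trans (lee_wpmul2l MM (lee_wpmul2l w0x h3))).
have -> : ((2 * M) `^ q)%R = (M `^ q * 2 `^ q)%R by rewrite mulrC powRM// ltW.
rewrite /W EFinM -!muleA; apply: lee_wpmul2l => //.
by rewrite muleCA [A x * _]muleC.
Qed.

End Averages.

(** * Convergence of the smoothed gradients *)

Lemma powR_le_id {R : realType} (r s : R) : 0 <= s -> s <= 1 -> 1 <= r -> s `^ r <= s.
Proof.
move=> s0 s1 r1; have [->|sn] := eqVneq s 0; first by rewrite powR0// gt_eqF// (lt_le_trans _ r1).
have sp : 0 < s by rewrite lt_neqAle eq_sym sn.
have l0 : ln s <= 0 by exact: ln_le0.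
by rewrite {2}(gt0_expR sp) /powR gt_eqF// ler_expR; nra.
Qed.

Lemma powR_split {R : realType} (r s : R) : 0 < s -> s `^ r = s `^ (r - 1) * s.
Proof.
move=> s0; rewrite (gt0_expR s0) !powR_expR -expRD; congr expR; ring.
Qed.

Section Modular.
Context {R : realType} {n : nat}.
Local Notation V := 'rV[R]_n.+1.
Local Notation T := (leb_space R n).
Local Notation leb := (@leb R n).
Local Notation nint := (nint leb).
Implicit Types (f g h k v : V -> R) (x y : V) (i : 'I_n.+1).

Variable Om : set V.
Hypotheses (oOm : open Om) (bOm : bounded_set Om).
Variables (p q : R) (a : V -> R).
Hypotheses (p1 : 1 <= p) (pq : p <= q) (ai : L1 Om a) (a0 : forall x, Om x -> 0 <= a x).

Let mOm : measurable (Om : set T). Proof. exact: measurable_open. Qed.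
Let fOm : (leb Om < +oo)%E. Proof. exact: bounded_leb. Qed.
Let p0 : 0 < p. Proof. exact: lt_le_trans p1. Qed.
Let q1 : 1 <= q. Proof. exact: le_trans pq. Qed.
Let q0 : 0 < q. Proof. exact: lt_le_trans q1. Qed.
Let ma : measurable_fun (Om : set T) a. Proof. exact: int1_measurable ai. Qed.

(* The linear term makes the modular control the L1 norm of the gradient as well. *)
Definition phase x (s : R) : R := s + s `^ p + a x * s `^ q.

Definition modular f : \bar R := nint Om (fun x => phase x `|f x|).

Lemma phase_ge0 x s : Om x -> 0 <= s -> 0 <= phase x s.
Proof. by move=> Ox s0; rewrite /phase !addr_ge0 ?powR_ge0// mulr_ge0 ?powR_ge0// a0. Qed.

Lemma phase_norm x (s : R) : Om x -> `|phase x `|s| | = phase x `|s|.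
Proof. by move=> Ox; rewrite ger0_norm// phase_ge0. Qed.

Lemma phase_le x s t : Om x -> 0 <= s -> s <= t -> phase x s <= phase x t.
Proof.
move=> Ox s0 st; have t0 := le_trans s0 st.
rewrite /phase; apply: lerD; first apply: lerD => //.
  by apply: ge0_ler_powR; rewrite ?nnegrE// ltW.
by apply: ler_wpM2l; [exact: a0|apply: ge0_ler_powR; rewrite ?nnegrE// ltW].
Qed.

Lemma phase_scale x (c s : R) : Om x -> 1 <= c -> 0 <= s -> phase x (c * s) <= c `^ q * phase x s.
Proof.
move=> Ox c1 s0; have c0 : 0 <= c by apply: le_trans c1.
have h (r : R) : r <= q -> c `^ r <= c `^ q by move=> rq; exact: ler_powR.
rewrite /phase !powRM// !mulrDr; apply: lerD; first apply: lerD.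
- by apply: ler_wpM2r => //; rewrite -{1}(powRr1 c0); exact: h.
- by apply: ler_wpM2r; [exact: powR_ge0|exact: h].
- by rewrite mulrCA.
Qed.

Lemma phase_add x s t : Om x -> 0 <= s -> 0 <= t ->
  phase x (s + t) <= 2 `^ q * (phase x s + phase x t).
Proof.
move=> Ox s0 t0; have q2 : 0 <= 2 `^ q :> R by exact: powR_ge0.
have [st|/ltW ts] := leP s t.
  apply: (@le_trans _ _ (2 `^ q * phase x t)); last first.
    by apply: ler_wpM2l => //; rewrite lerDr phase_ge0.
  apply: le_trans (phase_scale Ox (ler1n R 2) t0); apply: phase_le => //; first exact: addr_ge0.
  by lra.
apply: (@le_trans _ _ (2 `^ q * phase x s)); last first.
  by apply: ler_wpM2l => //; rewrite lerDl phase_ge0.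
apply: le_trans (phase_scale Ox (ler1n R 2) s0); apply: phase_le => //; first exact: addr_ge0.
by lra.
Qed.

Lemma measurable_phase f : measurable_fun (Om : set T) f ->
  measurable_fun (Om : set T) (fun x => phase x `|f x|).
Proof.
move=> mf; have mn := measurable_norm mf.
have mr (r : R) : measurable_fun (Om : set T) (fun x => `|f x| `^ r).
  exact: measurableT_comp (measurable_powR _) mn.
by apply: measurable_funD; [exact: measurable_funD|exact: measurable_funM].
Qed.

Lemma modular_ge0 f : (0 <= modular f)%E. Proof. exact: nint_ge0. Qed.

Lemma modular_le_ae f g : measurable_fun (Om : set T) f -> measurable_fun (Om : set T) g ->
  {ae leb, forall x, Om x -> `|f x| <= `|g x|} -> (modular f <= modular g)%E.
Proof.
move=> mf mg fg; apply: nint_le_ae => //; try exact: measurable_phase.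
move: fg; apply: ae_imp => x h Ox; rewrite !phase_norm//.
by apply: phase_le => //; exact: h.
Qed.

Lemma modular_le f g : measurable_fun (Om : set T) f -> measurable_fun (Om : set T) g ->
  (forall x, Om x -> `|f x| <= `|g x|) -> (modular f <= modular g)%E.
Proof. by move=> mf mg fg; apply: modular_le_ae => //; exact: ae_all. Qed.

Lemma modular_scale f (c : R) : measurable_fun (Om : set T) f -> 1 <= c ->
  (modular (fun x => c * f x)%R <= (c `^ q)%:E * modular f)%E.
Proof.
move=> mf c1; have cq : 0 <= c `^ q by exact: powR_ge0.
have c0 : 0 <= c by apply: le_trans c1.
rewrite /modular -{1}(ger0_norm cq) -nintZ//; last exact: measurable_phase.
have mc : measurable_fun (Om : set T) (fun x => c * f x).
  by apply: measurable_funM => //; exact: measurable_cst.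
apply: nint_le => //; first exact: measurable_phase.
  by apply: measurable_funM; [exact: measurable_cst|exact: measurable_phase].
move=> x Ox; rewrite phase_norm// [leRHS]normrM (ger0_norm cq) phase_norm// normrM (ger0_norm c0).
exact: phase_scale.
Qed.

Lemma modular_add f g : measurable_fun (Om : set T) f -> measurable_fun (Om : set T) g ->
  (modular (fun x => f x + g x)%R <= (2 `^ q)%:E * (modular f + modular g))%E.
Proof.
move=> mf mg; have q2 : 0 <= 2 `^ q :> R by exact: powR_ge0.
have mpf := measurable_phase mf; have mpg := measurable_phase mg.
rewrite /modular -nintD_ge0//; try by move=> x Ox; rewrite phase_ge0.
rewrite -{1}(ger0_norm q2) -nintZ//; last exact: measurable_funD.
apply: nint_le; first exact: mOm.
- by apply: measurable_phase; exact: measurable_funD.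
- by apply: measurable_funM; [exact: measurable_cst|exact: measurable_funD].
move=> x Ox; rewrite phase_norm// [leRHS]normrM (ger0_norm q2) (ger0_norm (addr_ge0 (phase_ge0 Ox (normr_ge0 (f x))) (phase_ge0 Ox (normr_ge0 (g x))))).
apply: le_trans (phase_add Ox (normr_ge0 _) (normr_ge0 _)).
by apply: phase_le => //; exact: ler_normD.
Qed.

Lemma modular_sub f g : modular (fun x => f x - g x) = modular (fun x => g x - f x).
Proof. by apply: eq_nint => x _; rewrite distrC. Qed.

Lemma nint_le_md f : measurable_fun (Om : set T) f -> (nint Om f <= modular f)%E.
Proof.
move=> mf; apply: nint_le => //; first exact: measurable_phase.
move=> x Ox; rewrite [leRHS]ger0_norm ?phase_ge0// /phase -addrA lerDl.
by rewrite addr_ge0 ?powR_ge0// mulr_ge0 ?powR_ge0// a0.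
Qed.

Lemma modular_int1 f : measurable_fun (Om : set T) f -> (modular f < +oo)%E -> int1 leb Om (fun x => phase x `|f x|).
Proof. by move=> mf fi; apply/int1P; split => //; exact: measurable_phase. Qed.

Lemma modular_L1 f : measurable_fun (Om : set T) f -> (modular f < +oo)%E -> L1 Om f.
Proof. by move=> mf fi; apply/int1P; split => //; apply: le_lt_trans (nint_le_md mf) fi. Qed.

Lemma modular_const (M : R) : (modular (fun=> M) < +oo)%E.
Proof.
have i1 : L1 Om (fun=> `|M| + `|M| `^ p).
  by apply: (@int1_bounded _ _ _ _ _ _ `|(`|M| + `|M| `^ p)|) => //; exact: measurable_cst.
have i2 : int1 leb Om (fun x => a x * `|M| `^ q).
  by under eq_fun do rewrite mulrC; exact: int1Z.
exact: int1_fin (int1D mOm i1 i2).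
Qed.

Lemma modular_bounded f (M : R) : measurable_fun (Om : set T) f -> (forall x, Om x -> `|f x| <= M) ->
  (modular f < +oo)%E.
Proof.
move=> mf fM; apply: le_lt_trans (modular_const M); apply: modular_le => //.
by move=> x Ox; apply: le_trans (fM x Ox) (ler_norm _).
Qed.

(** For d <= 1 all three powers of d in the integrand are at most d, so the modular is at most d
    times that of the constant 1. *)
Lemma modular_small (e : R) : 0 < e -> exists2 d : R, 0 < d & forall f, measurable_fun (Om : set T) f ->
  (forall x, Om x -> `|f x| <= d) -> (modular f <= e%:E)%E.
Proof.
move=> e0; have m1 := modular_const 1; have F0 : 0 <= fine (modular (fun=> 1)) by rewrite fine_ge0// modular_ge0.
have F1 : 0 < fine (modular (fun=> 1)) + 1 by rewrite ltr_wpDl.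
have mfin : modular (fun=> 1) \is a fin_num by exact: nint_fin_num.
exists (Num.min 1 (e / (fine (modular (fun=> 1)) + 1))); first by rewrite lt_min ltr01 divr_gt0.
move=> f mf fd; set d := Num.min _ _ in fd.
have d0 : 0 <= d by rewrite le_min ler01 divr_ge0// ltW.
have d1 : d <= 1 by rewrite ge_min lexx.
have de : d <= e / (fine (modular (fun=> 1)) + 1) by rewrite ge_min lexx orbT.
apply: (@le_trans _ _ (d%:E * modular (fun=> 1%R))%E); last first.
  rewrite -(fineK mfin) -EFinM lee_fin; apply: le_trans (ler_wpM2r F0 de) _.
  rewrite mulrAC ler_pdivrMr//; apply: ler_wpM2l; [exact: ltW|by rewrite lerDl].
have mp1 : measurable_fun (Om : set T) (fun x => phase x `|1 : R|).
  by apply: measurable_phase; exact: measurable_cst.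
rewrite /modular -{1}(ger0_norm d0) -nintZ//; apply: nint_le => //; first exact: measurable_phase.
  by apply: measurable_funM => //; exact: measurable_cst.
move=> x Ox; rewrite phase_norm// [leRHS]normrM (ger0_norm d0) phase_norm// normr1.
apply: (@le_trans _ _ (phase x d)); first by apply: phase_le => //; exact: fd.
have h (r : R) : 1 <= r -> d `^ r <= d.
  by move=> r1; exact: powR_le_id.
rewrite /phase !powR1 mulr1 !mulrDr mulr1; apply: lerD; first by apply: lerD; [|exact: h].
by rewrite [d * _]mulrC; apply: ler_wpM2l; [exact: a0|exact: h].
Qed.

Lemma modular_dominated (F : nat -> V -> R) g : (forall j, measurable_fun (Om : set T) (F j)) ->
  measurable_fun (Om : set T) g -> (modular g < +oo)%E ->
  (forall j x, Om x -> `|F j x| <= `|g x|) ->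
  (forall x, Om x -> F j x @[j --> \oo] --> 0) ->
  modular (F j) @[j --> \oo] --> 0%E.
Proof.
move=> mF mg gi Fg F0; apply: (@dominated_nint _ _ _ leb Om (fun j x => phase x `|F j x|) (fun x => phase x `|g x|) mOm).
- by move=> k; exact: measurable_phase.
- exact: modular_int1.
- by move=> k x Ox; rewrite phase_norm//; apply: phase_le => //; exact: Fg.
move=> x Ox; apply/cvgrPdist_le => e e0.
have A1 : 0 < a x + 3 by have := a0 Ox; lra.
have d0 : 0 < Num.min 1 (e / (a x + 3)) by rewrite lt_min ltr01 divr_gt0.
have /cvgrPdist_le/(_ _ d0) := F0 x Ox; apply: filterS => k; rewrite !sub0r !normrN.
rewrite le_min => /andP[s1 se]; set s := `|F k x| in s1 se *; have s0 : 0 <= s by exact: normr_ge0.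
have h (r : R) : 1 <= r -> s `^ r <= s.
  by move=> r1; exact: powR_le_id.
rewrite phase_norm// -/s; apply: (@le_trans _ _ ((a x + 3) * s)); last first.
  by move: se; rewrite ler_pdivlMr// mulrC.
have := h p p1; have := ler_wpM2l (a0 Ox) (h q q1); rewrite /phase; lra.
Qed.

(** Clamping f is harmless by dominated convergence. A clamped function is close in L1 to a clamped
    continuous one, and their difference g is bounded, so |g|^p is at most a constant times |g|,
    while the weighted power is controlled by [nint_mul_small] with the integrable weight a. *)
Lemma modular_density f : measurable_fun (Om : set T) f -> (modular f < +oo)%E ->
  forall e : R, 0 < e -> exists h, exists m : R, [/\ Cc Om h, 0 <= m, forall x, `|h x| <= m &
    (modular (fun x => f x - h x)%R <= e%:E)%E].
Proof.
move=> mf fi e e0; have Q0 : 0 < 2 `^ q :> R by exact: powR_gt0.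
have e4 : 0 < e / 2 `^ q / 2 by rewrite !divr_gt0.
have lim : modular (fun x => f x - clamp k%:R (f x)) @[k --> \oo] --> 0%E.
  apply: (modular_dominated (g := f)) => //.
  - by move=> k; apply: measurable_funB => //; exact: measurable_clamp.
  - move=> k x _; rewrite /clamp; have k0 : 0 <= k%:R :> R by exact: ler0n.
    set K : R := k%:R in k0 *; have [fK|fK] := leP K (f x).
      rewrite max_r ?(ger0_norm (le_trans k0 fK)); last by lra.
      by rewrite ger0_norm; lra.
    have [gK|gK] := leP (- K) (f x); first by rewrite subrr normr0.
    rewrite (ltr0_norm (lt_le_trans gK _)) ?oppr_le0// ltr0_norm; lra.
  move=> x _; apply: cvg_near_cst; near=> k; rewrite clamp_id ?subrr//.
  near: k; exact: nbhs_infty_ger.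
have [k _ /(_ k (leqnn k)) hk] := cvge0_near lim e4.
set fk := fun x => clamp k%:R (f x).
have k0 : 0 <= k%:R :> R by exact: ler0n.
have mfk : measurable_fun (Om : set T) fk by exact: measurable_clamp.
have fkb x : `|fk x| <= k%:R by exact: clamp_le.
have fki : L1 Om fk by apply: (@int1_bounded _ _ _ _ _ _ k%:R).
(* The bound 2 k on g, increased so that K >= 1; then K^(r-1) <= K^q for every exponent r between 1
   and q. *)
set K : R := k%:R + k%:R + 1; have K1 : 1 <= K by rewrite lerDr addr_ge0.
have e6 : 0 < e / 2 `^ q / 2 / 3 by rewrite divr_gt0.
have [d d0 Hd] := nint_mul_small mOm ai (powR_ge0 K q) e6.
have Kq0 : 0 < K `^ q by rewrite powR_gt0// (lt_le_trans ltr01).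
pose d' := Num.min (d / K `^ q) (e / 2 `^ q / 2 / 3 / K `^ q).
have d'0 : 0 < d' by rewrite lt_min !divr_gt0.
have [h [hC hs]] := L1_approxCc oOm bOm fki d'0.
have cC := Cc_clamp k0 hC; set h' := fun x => clamp k%:R (h x) in cC.
have mh' : measurable_fun (Om : set T) h' := Cc_measurable mOm cC.
exists h', k%:R; split => //; first by move=> x; exact: clamp_le.
set g := fun x => fk x - h' x.
have mg : measurable_fun (Om : set T) g by exact: measurable_funB.
have gK x : `|g x| <= K.
  apply: le_trans (ler_normB _ _) _; rewrite /K; have := fkb x; have := clamp_le (h x) k0.
  by rewrite -/(h' x); lra.
have gd : (nint Om g <= d'%:E)%E.
  apply: le_trans hs; apply: nint_le => //.
    by apply: measurable_funB => //; exact: Cc_measurable hC.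
  by move=> x _; rewrite /g -{1}(clamp_id (fkb x)) clamp_lip.
have gr (r : R) : 1 <= r -> r <= q -> (nint Om (fun x => `|g x| `^ r)%R <= (K `^ q)%:E * nint Om g)%E.
  move=> r1 rq; rewrite -{1}(ger0_norm (ltW Kq0)) -nintZ//.
  apply: nint_le => //; first exact: measurableT_comp (measurable_powR _) (measurable_norm mg).
    by apply: measurable_funM => //; exact: measurable_cst.
  move=> x _; rewrite ger0_norm ?powR_ge0// normrM (ger0_norm (ltW Kq0)).
  have [->|g0] := eqVneq (g x) 0.
    by rewrite normr0 mulr0 powR0// gt_eqF// (lt_le_trans ltr01).
  have gp : 0 < `|g x| by rewrite normr_gt0.
  rewrite powR_split//; apply: ler_wpM2r => //.
  apply: le_trans (_ : K `^ (r - 1) <= _).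
    by apply: ge0_ler_powR; rewrite ?nnegrE ?subr_ge0// (le_trans ler01).
  by apply: ler_powR => //; lra.
have gr' (r : R) : 1 <= r -> r <= q -> (nint Om (fun x => `|g x| `^ r)%R <= (Num.min d (e / 2 `^ q / 2 / 3))%:E)%E.
  move=> r1 rq; apply: le_trans (gr r r1 rq) _.
  apply: le_trans (lee_wpmul2l _ gd) _; first by rewrite lee_fin ltW.
  rewrite -EFinM lee_fin le_min /d'; apply/andP; split.
    apply: le_trans (ler_wpM2l (ltW Kq0) (_ : _ <= d / K `^ q)) _; first by rewrite ge_min lexx.
    by rewrite mulrC divfK// gt_eqF.
  apply: le_trans (ler_wpM2l (ltW Kq0) (_ : _ <= e / 2 `^ q / 2 / 3 / K `^ q)) _; first by rewrite ge_min lexx orbT.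
  by rewrite [leLHS]mulrC divfK// gt_eqF.
have mgr (r : R) : measurable_fun (Om : set T) (fun x => `|g x| `^ r).
  exact: measurableT_comp (measurable_powR _) (measurable_norm mg).
have gs : (modular g <= (e / 2 `^ q / 2)%:E)%E.
  rewrite (_ : e / 2 `^ q / 2 = e / 2 `^ q / 2 / 3 + e / 2 `^ q / 2 / 3 + e / 2 `^ q / 2 / 3); last by field; rewrite gt_eqF.
  have m1 : measurable_fun (Om : set T) (fun x => `|g x| + `|g x| `^ p).
    by apply: measurable_funD => //; exact: measurable_norm.
  have m2 : measurable_fun (Om : set T) (fun x => a x * `|g x| `^ q) by exact: measurable_funM.
  rewrite 2!EFinD; apply: (le_trans (nint_add oOm m1 m2)).
  apply: leeD.
    apply: (le_trans (nint_add oOm (measurable_norm mg) (mgr p))); apply: leeD.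
      rewrite (@eq_nint _ _ _ leb Om _ (fun x => `|g x| `^ 1)); last by move=> x _; rewrite powRr1.
      by apply: le_trans (gr' _ (lexx 1) q1) _; rewrite lee_fin ge_min lexx orbT.
    by apply: le_trans (gr' _ p1 pq) _; rewrite lee_fin ge_min lexx orbT.
  apply: Hd => //.
    move=> x _; rewrite ger0_norm ?powR_ge0//; apply: ge0_ler_powR; rewrite ?nnegrE ?(ltW q0)//.
    exact: le_trans ler01 K1.
  by apply: le_trans (gr' _ q1 (lexx q)) _; rewrite lee_fin ge_min lexx.
have E : (fun x => f x - h' x) = (fun x => (f x - fk x) + g x) by apply/funext => x; rewrite /g subrKA.
rewrite E; apply: le_trans (modular_add _ mg) _; first exact: measurable_funB.
apply: le_trans (lee_wpmul2l _ (leeD (ltW hk) gs)) _; first by rewrite lee_fin ltW.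
by rewrite -EFinD -EFinM lee_fin -splitr mulrC divfK// gt_eqF.
Unshelve. all: by end_near. Qed.

End Modular.

(** * Modular bounds for the smoothing operators *)

Section Smoothing.
Context {R : realType} {n : nat}.
Local Notation V := 'rV[R]_n.+1.
Local Notation T := (leb_space R n).
Local Notation leb := (@leb R n).
Local Notation nint := (nint leb).
Implicit Types (f g h k v : V -> R) (x y : V) (i : 'I_n.+1).

Variable Om : set V.
Hypotheses (oOm : open Om) (bOm : bounded_set Om) (u0 : 0 < @uvol R n).
Variables (p q : R) (a s w : V -> R).
Hypotheses (p1 : 1 <= p) (pq : p <= q) (q1 : 1 < q) (ai : L1 Om a)
  (a0 : forall x, Om x -> 0 <= a x) (w0 : forall x, Om x -> 0 <= w x)
  (s0 : forall x, Om x -> 0 <= s x) (aE : forall x, Om x -> a x = s x * w x)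
  (mw : measurable_fun (Om : set T) w).
Variables (Wm Cz K L d0 C c : R).
Hypotheses (Wm0 : 0 <= Wm) (wb : {ae leb, forall x, Om x -> w x <= Wm})
  (Cz0 : 0 <= Cz)
  (Z : forall x y, Om x -> Om y -> s x <= Cz * (s y + enorm (x - y) `^ K))
  (K0 : 0 < K) (L0 : 0 <= L) (d00 : 0 < d0)
  (HL : forall y (d : R), Om y -> 0 < d -> d <= d0 ->
    (\int[leb]_(x in Om `&` uball y d) (w x)%:E *
    poweR (\int[leb]_(x in Om `&` uball y (d + d)) dual_weight q w x) (q - 1) <=
    (L * (d ^+ n.+1) `^ q)%:E)%E)
  (C0 : 0 < C) (c0 : 0 < c).

Let mOm : measurable (Om : set T). Proof. exact: measurable_open. Qed.
Let fOm : (leb Om < +oo)%E. Proof. exact: bounded_leb. Qed.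
Let p0 : 0 < p. Proof. exact: lt_le_trans p1. Qed.
Let q0 : 0 < q. Proof. exact: lt_trans q1. Qed.
Let ma : measurable_fun (Om : set T) a. Proof. exact: int1_measurable ai. Qed.
Local Notation modular := (modular Om p q a).

Lemma nint_pow f (r : R) : nint Om (fun x => `|f x| `^ r) = (\int[leb]_(x in Om) (`|f x| `^ r)%:E)%E.
Proof. by apply: eq_integral => x _; rewrite ger0_norm// powR_ge0. Qed.

Lemma measurable_npow f (r : R) : measurable_fun (Om : set T) f ->
  measurable_fun (Om : set T) (fun x => `|f x| `^ r).
Proof. by move=> mf; exact: measurableT_comp (measurable_powR _) (measurable_norm mf). Qed.

Lemma nint_pow_md f : measurable_fun (Om : set T) f -> (nint Om (fun x => `|f x| `^ p)%R <= modular f)%E.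
Proof.
move=> mf; apply: nint_le => //; [exact: measurable_npow|exact: measurable_phase|].
move=> x Ox; rewrite ger0_norm ?powR_ge0// (phase_norm p q a0 _ Ox) /phase addrAC lerDr.
by rewrite addr_ge0// mulr_ge0 ?powR_ge0// a0.
Qed.

Lemma nint_apow_md f : measurable_fun (Om : set T) f -> (nint Om (fun x => a x * `|f x| `^ q)%R <= modular f)%E.
Proof.
move=> mf; apply: nint_le => //; [|exact: measurable_phase|].
  by apply: measurable_funM => //; exact: measurable_npow.
move=> x Ox; rewrite ger0_norm ?mulr_ge0 ?powR_ge0 ?a0// (phase_norm p q a0 _ Ox) /phase lerDr.
by rewrite addr_ge0// powR_ge0.
Qed.

Lemma powR_splitp (x r r' : R) : 0 <= x -> 0 < r -> 0 < r' -> x `^ r' = x `^ r * x `^ (r' - r).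
Proof.
move=> x0 r0 r'0; have [->|xn] := eqVneq x 0.
  by rewrite [0 `^ r']powR0 ?gt_eqF// [0 `^ r]powR0 ?gt_eqF// mul0r.
have xp : 0 < x by rewrite lt_neqAle eq_sym xn.
rewrite (gt0_expR xp) !powR_expR -expRD; congr expR; ring.
Qed.

(** The threshold for s(x) is 2 Cz (N c t)^K. Below it, the factor t^K absorbs the growth t^(-th
    (q-p)) of |S f|^(q-p), since t <= 1. Above it, s is comparable to s(x) on the cube, and [H]
    takes over. *)
Lemma corr_phase_pt th B (t : R) k g x H : 0 <= B -> th * (q - p) <= K ->
  0 < t -> t <= 1 -> Om x ->
  `|corr Om k g x| <= B * t `^ (- th) ->
  ((forall y, Om y -> `|y - x| < c * t -> s x <= 2 * Cz * s y) ->
      ((a x * `|corr Om k g x| `^ q)%:E <= H)%E) -> (0 <= H)%E ->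
  ((a x * `|corr Om k g x| `^ q)%:E <=
   (2 * Cz * (n.+1%:R * c) `^ K * B `^ (q - p) * (w x * `|corr Om k g x| `^ p))%:E + H)%E.
Proof.
move=> B0 thK t0 t1 Ox SB HH H0; set S := `|_| in SB HH *.
have S0 : 0 <= S by exact: normr_ge0.
have N0 : 0 < n.+1%:R :> R by rewrite ltr0n.
have nc0 : 0 <= n.+1%:R * c by rewrite mulr_ge0 ?ltW.
have r0 : 0 <= 2 * Cz * (n.+1%:R * c) `^ K * B `^ (q - p) * (w x * S `^ p).
  by rewrite !mulr_ge0 ?powR_ge0 ?w0.
have [h|h] := leP (s x) (2 * Cz * (n.+1%:R * (c * t)) `^ K).
  apply: (@le_trans _ _ (2 * Cz * (n.+1%:R * c) `^ K * B `^ (q - p) * (w x * S `^ p))%:E); last by rewrite leeDl.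
  rewrite lee_fin aE// (powR_splitp S0 p0 q0).
  have qp0 : 0 <= q - p by rewrite subr_ge0.
  have BT0 : 0 <= B * t `^ (- th) by rewrite mulr_ge0 ?powR_ge0.
  have h2 : S `^ (q - p) <= B `^ (q - p) * t `^ (- (th * (q - p))).
    apply: le_trans (_ : (B * t `^ (- th)) `^ (q - p) <= _).
      by apply: ge0_ler_powR; rewrite ?nnegrE.
    by rewrite powRM ?powR_ge0// -powRrM mulNr.
  have h3 : (n.+1%:R * (c * t)) `^ K = (n.+1%:R * c) `^ K * t `^ K.
    by rewrite mulrA powRM// ltW.
  have h4 : t `^ K * t `^ (- (th * (q - p))) <= 1.
    rewrite (gt0_expR t0) !powR_expR -expRD -expR0 ler_expR.
    by have := ln_le0 t1; nra.
  have wS : 0 <= w x * S `^ p by rewrite mulr_ge0 ?powR_ge0 ?w0.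
  rewrite (_ : s x * w x * (S `^ p * S `^ (q - p)) = s x * S `^ (q - p) * (w x * S `^ p)); last by ring.
  apply: ler_wpM2r => //; apply: le_trans (ler_pM (s0 Ox) (powR_ge0 _ _) h h2) _.
  rewrite h3; move: h4; set t1' := t `^ K; set t2' := t `^ _ => h4.
  rewrite (_ : 2 * Cz * ((n.+1%:R * c) `^ K * t1') * (B `^ (q - p) * t2') =
    2 * Cz * (n.+1%:R * c) `^ K * B `^ (q - p) * (t1' * t2')); last by ring.
  by rewrite -[leRHS]mulr1; apply: ler_wpM2l => //; rewrite !mulr_ge0 ?powR_ge0.
apply: (@le_trans _ _ H); last by rewrite leeDr.
(* Above the threshold the distance term of the inequality for s is at most s(x) / 2 and is absorbed
   by the left side. *)
apply: HH => y Oy yx; have := Z Ox Oy.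
have : enorm (x - y) `^ K <= (n.+1%:R * (c * t)) `^ K.
  apply: ge0_ler_powR; rewrite ?nnegrE ?enorm_ge0 ?(ltW K0)//.
    by rewrite !mulr_ge0// ltW.
  by apply/ltW/enorm_lt; rewrite distrC.
by move=> /(ler_wpM2l Cz0); lra.
Qed.

(** [M] is fixed before t, the kernel and g, and depends on the growth only through [B]. The part
    where s is small reduces to the unweighted p-th power because w is bounded almost everywhere. *)
Lemma modular_corr th B : 0 <= B -> th * (q - p) <= K ->
  exists2 M : R, 0 <= M & forall t k g, 0 < t -> t <= 1 -> c * t <= d0 -> kern C c t k ->
    measurable_fun (Om : set T) g -> (modular g < +oo)%E ->
    (forall x, Om x -> `|corr Om k g x| <= B * t `^ (- th)) ->
    (modular (corr Om k g) <= M%:E * modular g)%E.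
Proof.
move=> B0 thK; pose C1 (r : R) := (2 * (C * (@uvol R n * c ^+ n.+1))) `^ r.
pose K1 := 2 * Cz * (n.+1%:R * c) `^ K * B `^ (q - p).
have K10 : 0 <= K1 by rewrite !mulr_ge0 ?powR_ge0.
pose C2 := (2 * (C * c ^+ n.+1)) `^ q * L.
have C20 : 0 <= C2 by rewrite mulr_ge0 ?powR_ge0.
have Cz2 : 0 <= 2 * Cz by rewrite mulr_ge0.
exists (C1 1 + C1 p + (K1 * Wm * C1 p + C2 * (2 * Cz))).
  by rewrite !addr_ge0 ?mulr_ge0 ?powR_ge0.
move=> t k g t0 t1 ctd kk mg gi SB.
have [[sk ck _ _ _] _ _] := kk; have g1 : L1 Om g := modular_L1 oOm ai a0 mg gi.
have ct0 : 0 < c * t by rewrite mulr_gt0.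
set S := corr Om k g in SB *.
have mS : measurable_fun (Om : set T) S.
  by apply: measurable_continuous => //; apply: corr_cont => //; exact: C1_cont (smooth_C1 sk).
have ngi : (nint Om g < +oo)%E by exact: int1_fin.
have npi : (nint Om (fun x => `|g x| `^ p)%R < +oo)%E by apply: le_lt_trans (nint_pow_md mg) gi.
have nqi : (nint Om (fun x => a x * `|g x| `^ q)%R < +oo)%E by apply: le_lt_trans (nint_apow_md mg) gi.
have G0 := modular_ge0 Om p q a g.
have e1 : (nint Om (fun x => `|S x|)%R <= (C1 1)%:E * modular g)%E.
  have E f : nint Om (fun x => `|f x|) = nint Om (fun x => `|f x| `^ 1).
    by apply: eq_nint => x _; rewrite powRr1.
  have En f : nint Om (fun x => `|f x|) = nint Om f by apply: eq_nint => x _; rewrite normr_id.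
  rewrite E nint_pow; apply: le_trans (corr_power oOm u0 kk g1 C0 c0 t0 (lexx 1) _) _.
    by rewrite -nint_pow -E En.
  rewrite -nint_pow -E En; apply: lee_wpmul2l; first by rewrite lee_fin powR_ge0.
  exact: nint_le_md.
have e2 : (nint Om (fun x => `|S x| `^ p)%R <= (C1 p)%:E * modular g)%E.
  rewrite nint_pow; apply: le_trans (corr_power oOm u0 kk g1 C0 c0 t0 p1 _) _.
    by rewrite -nint_pow.
  rewrite -nint_pow; apply: lee_wpmul2l; first by rewrite lee_fin powR_ge0.
  exact: nint_pow_md.
have mSq : measurable_fun (Om : set T) (fun x => a x * `|S x| `^ q).
  by apply: measurable_funM => //; exact: measurable_npow.
have mwS : measurable_fun (Om : set T) (fun x => w x * `|S x| `^ p).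
  by apply: measurable_funM => //; exact: measurable_npow.
have e3 : (nint Om (fun x => w x * `|S x| `^ p)%R <= Wm%:E * nint Om (fun x => `|S x| `^ p)%R)%E.
  rewrite -{1}(ger0_norm Wm0) -nintZ//; last exact: measurable_npow.
  apply: nint_le_ae => //.
    by apply: measurable_funM; [exact: measurable_cst|exact: measurable_npow].
  move: wb; apply: ae_imp => x h Ox; rewrite !normrM (ger0_norm (w0 Ox)) (ger0_norm Wm0).
  by apply: ler_wpM2r => //; exact: h.
have e4 : (nint Om (fun x => a x * `|S x| `^ q)%R <= (K1 * Wm * C1 p + C2 * (2 * Cz))%:E * modular g)%E.
  apply/lee_addgt0Pr => e e0.
  have O0 : 0 <= C2 * fine (leb Om) by rewrite mulr_ge0// fine_ge0.
  have O1 : 0 < C2 * fine (leb Om) + 1 by rewrite ltr_wpDl.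
  (* The contribution of eps to the final bound is then at most e, which is arbitrary. *)
  pose eps := e / (C2 * fine (leb Om) + 1); have eps0 : 0 < eps by rewrite divr_gt0.
  have mI : measurable_fun (Om : set T) (fun x => 2 * Cz * (a x * `|g x| `^ q)).
    apply: measurable_funM; [exact: measurable_cst|].
    by apply: measurable_funM => //; exact: measurable_npow.
  have Ipos x : Om x -> 0 <= 2 * Cz * (a x * `|g x| `^ q).
    by move=> Ox; rewrite !mulr_ge0 ?powR_ge0 ?a0.
  have IE : (\int[leb]_(x in Om) (2 * Cz * (a x * `|g x| `^ q) + eps)%:E =
      (2 * Cz)%:E * nint Om (fun x => a x * `|g x| `^ q)%R + eps%:E * leb Om)%E.
    have mag : measurable_fun (Om : set T) (fun x => a x * `|g x| `^ q).
      by apply: measurable_funM => //; exact: measurable_npow.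
    rewrite -(integral_cst leb mOm) -{2}(ger0_norm Cz2) -(nintZ leb (2 * Cz) mOm mag).
    rewrite /nint -ge0_integralD//.
    - by apply: eq_integral => x /set_mem Ox; rewrite EFinD (ger0_norm (Ipos x Ox)).
    - exact: measurable_normE.
    - by move=> x _; rewrite lee_fin ltW.
  have Ioo : (\int[leb]_(x in Om) (2 * Cz * (a x * `|g x| `^ q) + eps)%:E < +oo)%E.
    by rewrite IE lte_add_pinfty// lte_mul_pinfty// ?lee_fin// ltW.
  have HLt y : Om y -> (\int[leb]_(x in Om `&` uball y (c * t)) (w x)%:E *
    poweR (\int[leb]_(x in Om `&` uball y (c * t + c * t)) dual_weight q w x) (q - 1) <=
    (L * ((c * t) ^+ n.+1) `^ q)%:E)%E by move=> Oy; exact: HL.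
  have [H [mH H0 HI Hp]] := corr_weighted oOm u0 kk g1 C0 c0 t0 q1 Cz2 eps0 L0 w0 s0 aE mw ma Ioo HLt.
  have mwE : measurable_fun (Om : set T) (fun x => (K1 * (w x * `|S x| `^ p))%:E).
    by apply/measurable_EFinP; apply: measurable_funM => //; exact: measurable_cst.
  apply: (@le_trans _ _ (\int[leb]_(x in Om) ((K1 * (w x * `|S x| `^ p))%:E + H x))%E).
    apply: ge0_le_integral => //.
    - exact: measurable_normE.
    - exact: emeasurable_funD.
    move=> x Ox; rewrite ger0_norm ?mulr_ge0 ?powR_ge0 ?a0//.
    by apply: (corr_phase_pt (th := th) (t := t)) => //; [exact: SB|exact: Hp|exact: H0].
  have KwS0 x : Om x -> 0 <= K1 * (w x * `|S x| `^ p).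
    by move=> Ox; rewrite !mulr_ge0 ?powR_ge0 ?w0.
  rewrite ge0_integralD//.
  have -> : (\int[leb]_(x in Om) (K1 * (w x * `|S x| `^ p))%:E = nint Om (fun x => K1 * (w x * `|S x| `^ p))%R)%E.
    by apply: eq_integral => x /set_mem Ox; rewrite (ger0_norm (KwS0 x Ox)).
  rewrite nintZ// (ger0_norm K10).
  have Gf : modular g \is a fin_num by exact: nint_fin_num.
  apply: le_trans (leeD (lee_wpmul2l _ (le_trans e3 (lee_wpmul2l _ e2))) HI) _; rewrite ?lee_fin//.
  rewrite IE; apply: (@le_trans _ _ (K1%:E * (Wm%:E * ((C1 p)%:E * modular g)) +
     C2%:E * ((2 * Cz)%:E * modular g + eps%:E * leb Om))%E).
    apply: leeD => //; apply: lee_wpmul2l; first by rewrite lee_fin.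
    by apply: leeD => //; apply: lee_wpmul2l; [rewrite lee_fin|exact: nint_apow_md].
  have Of : leb Om \is a fin_num by rewrite ge0_fin_numE.
  rewrite -(fineK Gf) -(fineK Of) !(=^~ EFinM, =^~ EFinD) lee_fin.
  have : C2 * eps * fine (leb Om) <= e.
    rewrite (_ : C2 * eps * fine (leb Om) = e * (C2 * fine (leb Om)) / (C2 * fine (leb Om) + 1)); last by rewrite /eps; ring.
    rewrite ler_pdivrMr//.
    by apply: ler_wpM2l; [exact: ltW|rewrite lerDl].
  by move=> h; rewrite -subr_ge0; move: h; rewrite -subr_ge0 => h; apply: le_trans h _; rewrite le_eqVlt; apply/orP; left; apply/eqP; ring.
have mS1 := measurable_norm mS; have mSp := measurable_npow p mS.
have mS2 : measurable_fun (Om : set T) (fun x => `|S x| + `|S x| `^ p) by exact: measurable_funD.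
move: e4; set X := K1 * Wm * C1 p + C2 * (2 * Cz) => e4.
have Gf : modular g \is a fin_num by exact: nint_fin_num.
have -> : ((C1 1 + C1 p + X)%:E * modular g = (C1 1)%:E * modular g + (C1 p)%:E * modular g + X%:E * modular g)%E.
  by rewrite -(fineK Gf) !(=^~ EFinM, =^~ EFinD); congr (_%:E); ring.
apply: (le_trans (nint_add oOm mS2 mSq)); apply: leeD => //.
by apply: (le_trans (nint_add oOm mS1 mSp)); exact: leeD.
Qed.

(** S f - f is split into S (f - h), S h - h and h - f with h continuous of compact support in [Om].
    The first and the last are bounded by the modular of f - h, and the middle one is uniformly
    small. *)
Lemma smoothing_cvg th B f : 0 < th -> 0 <= B -> th * (q - p) <= K ->
  measurable_fun (Om : set T) f -> (modular f < +oo)%E ->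
  (exists2 t1 : R, 0 < t1 & forall t k, 0 < t -> t <= t1 -> kern C c t k ->
     forall x, Om x -> `|corr Om k f x| <= B * t `^ (- th)) ->
  forall e : R, 0 < e -> exists2 t2 : R, 0 < t2 & forall t k, 0 < t -> t <= t2 -> kern C c t k ->
    (modular (fun x => corr Om k f x - f x)%R <= e%:E)%E.
Proof.
move=> th0 B0 thK mf fi [t1 t10 SB] e e0.
have B1 : 0 <= B + 1 by rewrite addr_ge0.
have [M M0 HM] := modular_corr B1 thK.
have f1 : L1 Om f := modular_L1 oOm ai a0 mf fi.
have Q0 : 0 < 2 `^ q :> R by exact: powR_gt0.
have QM : 0 < 2 `^ q * M + 2 `^ q * 2 `^ q by rewrite ltr_wpDl ?mulr_gt0// mulr_ge0// ltW.
(* Two uses of [modular_add] produce 2^q (M eta + 2^q (e' + eta)), where e' bounds the modular of S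
   h - h; eta and e' each receive half of e. *)
pose eta := e / 2 / (2 `^ q * M + 2 `^ q * 2 `^ q).
have eta0 : 0 < eta by rewrite !divr_gt0.
have e20 : 0 < e / 2 / (2 `^ q * 2 `^ q) by rewrite !divr_gt0// mulr_gt0.
have [h [m [hC m0 hm hd]]] := modular_density oOm bOm p1 pq ai a0 mf fi eta0.
have mh : measurable_fun (Om : set T) h := Cc_measurable mOm hC.
have h1 : L1 Om h by apply: (@int1_bounded _ _ _ leb Om h m).
have [d1 d10 Hd1] := modular_small oOm bOm p1 pq ai a0 e20.
have d1' : 0 < Num.min d1 1 by rewrite lt_min d10 ltr01.
have [ch sh] := hC; have [rh rh0 Hrh] := csupp_unif ch sh.1 d1'.
have m1 : 0 < m + 1 by rewrite ltr_wpDl.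
(* For t <= t3 one has m + 1 <= t^(-th), and m + 1 bounds S h. Hence f - h grows at the rate t^(-th)
   with constant B + 1. *)
pose t3 := (m + 1) `^ (- th^-1).
have t30 : 0 < t3 by exact: powR_gt0.
pose t2 := Num.min (Num.min t1 1) (Num.min (d0 / c) (Num.min (rh / c) t3)).
exists t2; first by rewrite !lt_min t10 ltr01 !divr_gt0.
move=> t k t0; rewrite !le_min => /andP[/andP[tt1 tle1] /and3P[td0 trh tt3]] kk.
have ctd : c * t <= d0 by rewrite mulrC -ler_pdivlMr.
have crh : c * t <= rh by rewrite mulrC -ler_pdivlMr.
have ct0 : 0 < c * t by rewrite mulr_gt0.
have [kk0 _ _] := kk; have [sk ck k0 _ _] := kk0.
have mc g : L1 Om g -> measurable_fun (Om : set T) (corr Om k g).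
  move=> gi; apply: measurable_continuous => //; apply: corr_cont => //.
  exact: C1_cont (smooth_C1 sk).
have near x : `|corr Om k h x - h x| <= Num.min d1 1.
  apply: (corr_near (ltW ct0) kk0 hC) => y xy; apply: Hrh; exact: le_trans crh.
have g1 : L1 Om (fun x => f x - h x) by exact: int1B.
have mg : measurable_fun (Om : set T) (fun x => f x - h x) by exact: measurable_funB.
have Sg x : corr Om k (fun x => f x - h x) x = corr Om k f x - corr Om k h x.
  have contk := C1_cont (smooth_C1 sk).
  rewrite /corr -RintegralB//; [|exact: corr_int|exact: corr_int].
  by apply: eq_Rintegral => y _; rewrite mulrBr.
have gi : (modular (fun x => f x - h x)%R < +oo)%E by apply: le_lt_trans hd _; rewrite ltry.
have tm : m + 1 <= t `^ (- th).
  have := tt3; rewrite /t3 (gt0_expR m1) (gt0_expR t0) !powR_expR !ler_expR => h2.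
  have : th * ln t <= th * (- th^-1 * ln (m + 1)) by apply: ler_wpM2l => //; exact: ltW.
  by rewrite mulNr mulrN mulVKf ?gt_eqF//; lra.
have SgB x : Om x -> `|corr Om k (fun x => f x - h x) x| <= (B + 1) * t `^ (- th).
  move=> Ox; rewrite Sg; apply: le_trans (ler_normB _ _) _; rewrite mulrDl mul1r.
  apply: lerD; first exact: SB.
  apply: le_trans tm; have := near x; rewrite le_min => /andP[_ n1].
  by rewrite -(subrK (h x) (corr Om k h x)) addrC; apply: le_trans (ler_normD _ _) _; apply: lerD.
have H1 := HM t k _ t0 tle1 ctd kk mg gi SgB.
have H2 : (modular (fun x => corr Om k h x - h x)%R <= (e / 2 / (2 `^ q * 2 `^ q))%:E)%E.
  apply: Hd1; first by apply: measurable_funB => //; exact: mc.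
  by move=> x _; apply: le_trans (near x) _; rewrite ge_min lexx.
have mSg := mc _ g1; have mSh : measurable_fun (Om : set T) (fun x => corr Om k h x - h x).
  by apply: measurable_funB => //; exact: mc.
have mhf : measurable_fun (Om : set T) (fun x => h x - f x) by exact: measurable_funB.
have E : (fun x => corr Om k f x - f x) = (fun x => corr Om k (fun x => f x - h x) x +
    ((corr Om k h x - h x) + (h x - f x))).
  by apply/funext => x; rewrite Sg; ring.
rewrite E; apply: le_trans (modular_add oOm p1 pq ai a0 mSg (measurable_funD mSh mhf)) _.
have q20 : (0 <= (2 `^ q)%:E :> \bar R)%E by rewrite lee_fin ltW.
have A1 := modular_add oOm p1 pq ai a0 mSh mhf.
have hd' : (modular (fun x => h x - f x)%R <= eta%:E)%E by rewrite modular_sub.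
have ME : (0 <= M%:E :> \bar R)%E by rewrite lee_fin.
have X1 := le_trans H1 (lee_wpmul2l ME hd).
have X2 := le_trans A1 (lee_wpmul2l q20 (leeD H2 hd')).
apply: le_trans (lee_wpmul2l q20 (leeD X1 X2)) _.
rewrite !(=^~ EFinM, =^~ EFinD) lee_fin.
rewrite (_ : 2 `^ q * (M * eta + 2 `^ q * (e / 2 / (2 `^ q * 2 `^ q) + eta)) =
  eta * (2 `^ q * M + 2 `^ q * 2 `^ q) + e / 2); last by field; rewrite gt_eqF.
by rewrite /eta divfK ?gt_eqF// -splitr.
Qed.

End Smoothing.

(** * Local approximation and partition of unity *)

Section GradientBounds.
Context {R : realType} {n : nat}.
Local Notation V := 'rV[R]_n.+1.
Local Notation T := (leb_space R n).
Local Notation leb := (@leb R n).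
Local Notation nint := (nint leb).
Implicit Types (f g h k v : V -> R) (x y : V) (i : 'I_n.+1).

Lemma C1_shift k z : C1 k -> C1 (fun y => k (y + z)).
Proof.
move=> Hk; apply: (@C1_intro _ _ _ (fun i y => partial i k (y + z))).
- exact/cont_shift/C1_cont.
- by move=> i x; apply: has_partial_shift; exact: C1_hasp.
- by move=> i; exact/cont_shift/C1_partial.
Qed.

Lemma partial_shift k z i x : C1 k -> partial i (fun y => k (y + z)) x = partial i k (x + z).
Proof. by move=> Hk; apply: has_partial_partial; apply: has_partial_shift; exact: C1_hasp. Qed.

Variable Om : set V.
Hypotheses (oOm : open Om) (bOm : bounded_set Om).

Let mOm : measurable (Om : set T). Proof. exact: measurable_open. Qed.

Lemma partial_corr k v i x : C1 k -> csupp k -> L1 Om v ->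
  partial i (corr Om k v) x = - corr Om (partial i k) v x.
Proof.
move=> Hk sk vi; rewrite (has_partial_partial (corr_hasp mOm i x Hk sk vi)).
rewrite /corr (@eq_Rintegral _ T R leb Om (fun y => -1 * (partial i k (y - x) * v y))); last first.
  by move=> y _; rewrite mulN1r mulNr.
rewrite RintegralZl ?mulN1r//; apply: corr_int => //; first exact: C1_partial.
exact: csupp_partial.
Qed.

(** The translated kernel is not compactly supported in [Om] when x is near the boundary; the zero
    trace expressed by [wpair] allows it as a test function nevertheless. *)
Lemma corr_grad k v (G : 'I_n.+1 -> V -> R) i x : wpair Om v G -> C1 k -> csupp k ->
  partial i (corr Om k v) x = corr Om k (G i) x.
Proof.
move=> [vi Gi H] Hk sk; rewrite partial_corr//.
have := H i _ (C1_shift (- x) Hk) => /(congr1 -%R); rewrite opprK => E.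
rewrite /corr [RHS](@eq_Rintegral _ T R leb Om (fun y => G i y * k (y - x))); last first.
  by move=> y _; rewrite mulrC.
rewrite -E; congr (- _); apply: eq_Rintegral => y _; by rewrite partial_shift// mulrC.
Qed.

(** The derivative lives on the closure of the support of k, where the inequality is no longer
    strict; the factor 2 restores strictness. *)
Lemma kern_partial_supp C c t k i z : 0 < c * t -> kern C c t k -> partial i k z != 0 -> `|z| < 2 * c * t.
Proof.
move=> ct0 [[sk ck _ kd _] _ _] /(partial_supp (smooth_C1 sk)) h.
have : `|z| <= c * t; last by rewrite -mulrA; lra.
have cl : closed [set y : V | `|y| <= c * t].
  by apply: cont_closed_le; apply: (@lip_continuous _ _ _ 1) => x y; rewrite mul1r ler_dist_dist.
have /closureS h2 : [set y | k y != 0] `<=` [set y : V | `|y| <= c * t] by move=> y /kd /ltW.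
by have := h2 _ h; rewrite -(closure_id _).1.
Qed.

Hypothesis u0 : 0 < @uvol R n.

(** The constant b may be subtracted from v because the derivative of the kernel has integral 0;
    here v has to be extended by zero for cubes that leave [Om]. It is used with b = 0 for bounded v
    and b = v(x) for Hölder continuous v. *)
Lemma grad_corr_bound C c t k v i x (b E : R) : 0 < C -> 0 < c -> 0 < t -> kern C c t k ->
  L1 Om v -> (forall y, ~ Om y -> v y = 0) -> 0 <= E ->
  (forall y, `|y - x| < 2 * c * t -> `|v y - b| <= E) ->
  `|corr Om (partial i k) v x| <= C * E * (@uvol R n * (2 * c) ^+ n.+1) * t^-1.
Proof.
move=> C0 c0 t0 kk vi v0 E0 vE; have ct0 : 0 < c * t by rewrite mulr_gt0.
have r0 : 0 < 2 * c * t by rewrite !mulr_gt0.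
have supp := kern_partial_supp ct0 kk.
have [[sk ck _ _ _] _ dkC] := kk; have Hk := smooth_C1 sk.
have cdk := C1_partial (i := i) Hk; have sdk := csupp_partial (i := i) Hk ck.
have Hdk : C1 (partial i k) by exact/smooth_C1/smooth_partial.
have iV : L1 setT v.
  have mv : measurable_fun (setT : set T) v.
    have -> : v = v \_ Om.
      by apply/funext => y; rewrite /patch; case: ifPn => // /negP yO; rewrite v0// => Oy; apply: yO; rewrite inE.
    by apply/(measurable_restrictT _ mOm); exact: int1_measurable vi.
  apply/int1P; split => //; have := int1_fin vi; rewrite /nint integral_mkcond.
  congr (_ < _)%E; apply: eq_integral => y _; rewrite /patch; case: ifPn => // /negP yO.
  by rewrite v0 ?normr0// => Oy; apply: yO; rewrite inE.
have m0 : 0 <= C / t / t ^+ n.+1 by rewrite !divr_ge0 ?exprn_ge0// ltW.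
have -> : corr Om (partial i k) v x = \int[leb]_y (partial i k (y - x) * v y).
  rewrite /corr Rintegral_mkcond; apply: eq_Rintegral => y _; rewrite /patch.
  by case: ifPn => // /negP yO; rewrite v0 ?mulr0// => Oy; apply: yO; rewrite inE.
have dk1 : L1 setT (fun y => partial i k (y - x)).
  by apply: L1_shift => //; exact: cont_L1.
have Z : \int[leb]_y (b * partial i k (y - x)) = 0.
  rewrite RintegralZl// (Rintegral_shift (- x)) ?int_partial0 ?mulr0//; exact: cont_L1.
have dkv : L1 setT (fun y => partial i k (y - x) * v y) by exact: corr_int.
rewrite -[X in `|X|]subr0 -[X in _ - X]Z -RintegralB//; last exact: int1Z.
rewrite (@eq_Rintegral _ T R leb setT (fun y => partial i k (y - x) * (v y - b))); last first.
  by move=> y _; rewrite mulrBr [b * _]mulrC.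
have mvb : measurable_fun (setT : set T) (fun y => v y - b).
  by apply: measurable_funB; [exact: int1_measurable iV|exact: measurable_cst].
have mdk : measurable_fun (setT : set T) (fun y : V => partial i k (y - x)) by exact: measurable_cont_shift.
have id : L1 setT (fun y => partial i k (y - x) * (v y - b)).
  rewrite (_ : (fun y => _) = (fun y => partial i k (y - x) * v y - b * partial i k (y - x))).
    exact: int1B measurableT dkv (int1Z b measurableT dk1).
  by apply/funext => y; rewrite mulrBr [b * _]mulrC.
rewrite -lee_fin; apply: le_trans (Rintegral_nint measurableT id) _.
have -> : nint setT (fun y => partial i k (y - x) * (v y - b)) =
  nint (uball x (2 * c * t)) (fun y => partial i k (y - x) * (v y - b)).
  rewrite /nint [RHS]integral_mkcond; apply: eq_integral => y _; rewrite /patch.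
  case: ifPn => // /negP yB; have -> : partial i k (y - x) = 0; last by rewrite mul0r normr0.
  by apply/eqP; apply: contrapT => /negP /supp h; apply: yB; rewrite inE.
have mB : measurable (uball x (2 * c * t) : set T) by exact: measurable_uball.
apply: le_trans (@nint_bounded _ _ _ leb _ _ (C / t / t ^+ n.+1 * E) mB _ _ _) _.
- by apply: measurable_funS measurableT _ _ => //; exact: measurable_funM.
- exact: mulr_ge0.
- by move=> y yB; rewrite normrM; apply: ler_pM => //; exact: vE.
rewrite [X in (_ * X <= _)%E](leb_uball x r0) -EFinM lee_fin le_eqVlt; apply/orP; left; apply/eqP.
by rewrite exprMn; field; rewrite expf_neq0 gt_eqF.
Qed.

(** [ball_estimate] with b = 1 bounds |S f|^p by a constant times t^(-N p) t^(N (p-1)) = t^(-N). *)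
Lemma power_corr_bound (p C c t A : R) k f x : 1 <= p -> 0 < C -> 0 < c -> 0 < t -> kern C c t k ->
  L1 Om f -> 0 <= A -> (\int[leb]_(x in Om) (`|f x| `^ p)%:E <= A%:E)%E ->
  `|corr Om k f x| <= (C `^ p * (2 `^ p * (A * (@uvol R n * c ^+ n.+1) `^ (p - 1)))) `^ p^-1 *
     t `^ (- (n.+1%:R / p)).
Proof.
move=> p1 C0 c0 t0 kk fi A0 fA; have ct0 : 0 < c * t by rewrite mulr_gt0.
have p0 : 0 < p by apply: lt_le_trans p1.
have mf := int1_measurable fi.
have h := corr_le_ball oOm x kk fi C0 t0.
have mOB : measurable (Om `&` uball x (c * t) : set T).
  by apply: measurableI => //; exact: measurable_uball.
have mfB : measurable_fun (Om `&` uball x (c * t) : set T) f.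
  by apply: (measurable_funS mOm) => //; exact: subIsetl.
have mp (D : set T) : measurable_fun D f -> measurable_fun D (fun x => `|f x| `^ p).
  by move=> m; exact: measurableT_comp (measurable_powR _) (measurable_norm m).
have mpE : measurable_fun (Om : set T) (fun x => (`|f x| `^ p)%:E).
  by apply/measurable_EFinP; exact: mp.
have AB : (\int[leb]_(y in Om `&` uball x (c * t)) (`|f y| `^ p)%:E <= A%:E)%E.
  apply: le_trans fA; apply: ge0_subset_integral;
    [exact: mOB|exact: mOm|exact: mpE|by move=> z _; rewrite lee_fin powR_ge0|exact: subIsetl].
have AB0 : (0 <= \int[leb]_(y in Om `&` uball x (c * t)) (`|f y| `^ p)%:E)%E.
  by apply: integral_ge0 => y _; rewrite lee_fin powR_ge0.
pose b : R := @uvol R n * (c * t) ^+ n.+1; have b0 : 0 < b by rewrite mulr_gt0// exprn_gt0.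
have Bb : (\int[leb]_(y in Om `&` uball x (c * t)) cst 1 y <= b%:E)%E.
  by rewrite integral_cst// mul1e; exact: leb_OB.
have B0 : (0 <= \int[leb]_(y in Om `&` uball x (c * t)) cst 1 y)%E by apply: integral_ge0.
have p10 : 0 <= p - 1 by rewrite subr_ge0.
have J : (poweR (nint (Om `&` uball x (c * t)) f) p <= (2 `^ p * (A * b `^ (p - 1)))%:E)%E.
  apply: le_trans (ball_estimate (mu := leb) (F := fun y => `|f y| `^ p) (b := cst 1%E) mOB mfB (mp _ mfB) _ p1 _ _ _ _ _) _.
  - exact: measurable_cst.
  - by move=> y _; exact: powR_ge0.
  - by move=> y _.
  - by move=> y _; rewrite poweR1r mule1.
  - by apply: le_lt_trans AB _; rewrite ltry.
  - by move=> E; move: Bb; rewrite E leye_eq.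
  rewrite !EFinM; apply: lee_wpmul2l; first by rewrite lee_fin powR_ge0.
  apply: lee_pmul => //; first exact: poweR_ge0.
  by rewrite -poweR_EFin; exact: lee_poweR.
have M0 : 0 < C / t ^+ n.+1 by rewrite divr_gt0// exprn_gt0.
have := lee_poweR (ltW p0) _ h; rewrite lee_fin => /(_ (normr_ge0 _)).
rewrite poweR_EFin poweRM ?nint_ge0 ?lee_fin ?(ltW M0)// poweR_EFin => h2.
have Mp : (0 <= ((C / t ^+ n.+1) `^ p)%:E :> \bar R)%E by rewrite lee_fin powR_ge0.
have := le_trans h2 (lee_wpmul2l Mp J); rewrite -EFinM lee_fin => h3.
apply: (powR_le_inv p0) => //; first by rewrite mulr_ge0 ?powR_ge0.
apply: le_trans h3 _; set X := C `^ p * _.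
have X0 : 0 <= X by rewrite /X !mulr_ge0 ?powR_ge0.
have -> : (X `^ p^-1 * t `^ (- (n.+1%:R / p))) `^ p = X * t `^ (- n.+1%:R).
  rewrite powRM ?powR_ge0// -!powRrM mulVf ?gt_eqF// powRr1//; congr (_ * _ `^ _).
  by rewrite mulNr divfK// gt_eqF.
rewrite /X.
have tN : t ^+ n.+1 = t `^ n.+1%:R by rewrite powR_mulrn// ltW.
have uc : 0 <= @uvol R n * c ^+ n.+1 by rewrite mulr_ge0 ?exprn_ge0// ltW.
have e1 : b `^ (p - 1) = (@uvol R n * c ^+ n.+1) `^ (p - 1) * (t `^ n.+1%:R) `^ (p - 1).
  by rewrite /b exprMn mulrA -tN powRM// exprn_ge0// ltW.
have e2 : (C / t ^+ n.+1) `^ p = C `^ p * ((t `^ n.+1%:R)^-1) `^ p.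
  by rewrite -tN powRM ?invr_ge0 ?exprn_ge0// ltW.
rewrite le_eqVlt; apply/orP; left; apply/eqP.
rewrite e1 e2 (gt0_expR t0) !powR_expR -expRN !powR_expR.
set E1 := expR _; set E2 := expR ((p - 1) * _).
rewrite (_ : C `^ p * E1 * _ = C `^ p * (2 `^ p * (A * (@uvol R n * c ^+ n.+1) `^ (p - 1))) * (E1 * E2)); last by ring.
rewrite /E1 /E2 -expRD; congr (_ * expR _); ring.
Qed.

Lemma bump_cutoff x0 (r : R) : 0 < r -> exists b : V -> R, [/\ C1 b,
  exists L : R, forall x y, `|b x - b y| <= L * `|x - y|,
  forall x, `|x - x0| < r / 2 -> b x = 1 & forall x, b x != 0 -> `|x - x0| < r].
Proof.
(* [h] is 1 up to distance 5r/8 and 0 from 7r/8 on. Smoothing it at scale r/16 keeps the value 1 up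
   to r/2 and the support inside the cube of radius r, and preserves the Lipschitz constant. *)
move=> r0; pose D := uball x0 r; pose h y := (1 + clamp 1 (6%:R - 8%:R / r * `|y - x0|)) / 2.
have h01 y : 0 <= h y <= 1.
  by have := @clamp_le R 1 (6%:R - 8%:R / r * `|y - x0|) ler01; rewrite ler_norml /h => /andP[? ?]; apply/andP; split; lra.
have r16 : 0 < r / 16%:R by rewrite divr_gt0.
have oD : open D.
  by apply: cont_open_lt; apply: (@lip_continuous _ _ _ 1) => x y; rewrite mul1r;
    apply: le_trans (ler_dist_dist _ _) _; rewrite opprB addrA subrK.
have bD : bounded_set D.
  exists (`|x0| + r); split; first exact: num_real.
  move=> M xM y yx /=; apply/ltW; apply: le_lt_trans xM; rewrite -(subrK x0 y) addrC.
  by apply: le_trans (ler_normD _ _) _; rewrite lerD2l; exact: ltW.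
have hlip x y : `|h x - h y| <= 4%:R / r * `|x - y|.
  have d : `| `|x - x0| - `|y - x0| | <= `|x - y|.
    by apply: le_trans (ler_dist_dist _ _) _; rewrite opprB addrA subrK.
  have k0 : 0 <= 8%:R / r by rewrite divr_ge0// ltW.
  have := clamp_lip 1 (6%:R - 8%:R / r * `|x - x0|) (6%:R - 8%:R / r * `|y - x0|).
  set A := clamp _ _; set B := clamp _ _; rewrite /h -/A -/B => AB.
  rewrite (_ : _ - _ = (A - B) / 2); last by ring.
  rewrite normrM [`|2^-1|]ger0_norm// ler_pdivrMr//; apply: le_trans AB _.
  rewrite (_ : _ - _ = 8%:R / r * - (`|x - x0| - `|y - x0|)); last by ring.
  rewrite normrM normrN (ger0_norm k0) (_ : 4%:R / r * _ * 2 = 8%:R / r * `|x - y|); last by ring.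
  exact: ler_wpM2l.
have ch : cont h := lip_continuous hlip.
have h7 y : h y != 0 -> `|y - x0| < 7%:R / 8%:R * r.
  move=> hy; rewrite ltNge; apply: contra hy => yr; apply/eqP.
  have : 8%:R / r * `|y - x0| >= 7%:R by rewrite mulrAC ler_pdivlMr//; lra.
  rewrite /h /clamp => yr'; rewrite min_r; last lra.
  by rewrite max_l; [rewrite subrr mul0r|lra].
have hC : Cc D h.
  split => //; apply: (@bounded_compactly_contained _ _ _ [set y | `|y - x0| <= 7%:R / 8%:R * r]) => //.
  - by move=> y /= /h7 /ltW.
  - apply: cont_closed_le; apply: (@lip_continuous _ _ _ 1) => x y; rewrite mul1r.
    by apply: le_trans (ler_dist_dist _ _) _; rewrite opprB addrA subrK.
  - by move=> y /= yr; apply: le_lt_trans yr _; lra.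
have h1 y : `|y - x0| <= 5%:R / 8%:R * r -> h y = 1.
  move=> yr; have : 8%:R / r * `|y - x0| <= 5%:R by rewrite mulrAC ler_pdivrMr//; lra.
  rewrite /h /clamp => yr'; rewrite min_l; last lra.
  by rewrite max_r; [field|lra].
have [k kk] := centered_kernel u0 r16.
have [sk ck k0 kd k1] := kk; have Hk := smooth_C1 sk.
have mD : measurable (D : set T) by exact: measurable_open.
have hi : L1 D h by apply: L1_cont.
have hV : L1 setT h by apply: cont_L1 => //; case: hC => _ [].
have E x : corr D k h x = \int[leb]_z (k z * h (z + x)).
  have -> : corr D k h x = \int[leb]_y (k (y - x) * h y).
    rewrite /corr Rintegral_mkcond; apply: eq_Rintegral => y _; rewrite /patch.
    case: ifPn => // /negP yD; have [->|/h7 hy] := eqVneq (h y) 0; first by rewrite mulr0.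
    by exfalso; apply: yD; rewrite inE /D /uball /=; apply: lt_trans hy _; lra.
  rewrite -(@Rintegral_shift _ _ x); last by apply: corr_int => //; exact: C1_cont.
  by apply: eq_Rintegral => z _; rewrite addrK.
have kh x : L1 setT (fun z => k z * h (z + x)).
  apply: (@int1_le _ _ _ leb setT _ k) => //.
  - by apply: cont_L1 => //; exact: C1_cont.
  - apply: measurable_funM; first by apply: measurable_continuous => //; exact: C1_cont.
    by apply: measurable_continuous => //; exact: cont_shift.
  move=> z _; rewrite normrM ler_piMr//; case/andP: (h01 (z + x)) => ? ?.
  by rewrite ger0_norm.
exists (corr D k h); split; first exact: C1_corr.
- exists (4%:R / r) => x y; rewrite !E -RintegralB; [|exact: measurableT|exact: kh|exact: kh].
  have kd1 : L1 setT (fun z => k z * h (z + x) - k z * h (z + y)) by exact: (int1B measurableT (kh x) (kh y)).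
  rewrite -lee_fin; apply: le_trans (Rintegral_nint measurableT kd1) _.
  have ki : L1 setT k by apply: cont_L1 => //; exact: C1_cont.
  have c0 : 0 <= 4%:R / r * `|x - y| by rewrite mulr_ge0// divr_ge0// ltW.
  have -> : (4%:R / r * `|x - y|)%:E = ((4%:R / r * `|x - y|)%:E * nint setT k)%E.
    rewrite nint_Rintegral// -EFinM; congr (_%:E).
    rewrite (@eq_Rintegral _ T R leb setT k); first by rewrite k1 mulr1.
    by move=> z _; rewrite ger0_norm.
  rewrite -{1}(ger0_norm c0) -nintZ//; last exact: int1_measurable ki.
  apply: nint_le => //; first exact: int1_measurable kd1.
    by apply: measurable_funM; [exact: measurable_cst|exact: int1_measurable ki].
  move=> z _; rewrite -mulrBr normrM [leRHS]normrM (ger0_norm c0) mulrC; apply: ler_wpM2r => //.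
  by apply: le_trans (hlip _ _) _; rewrite opprD addrACA subrr add0r.
- move=> x xr; have hx : h x = 1 by apply: h1; lra.
  have := @corr_near _ _ D k (r / 16%:R) 0 h x (ltW r16) kk hC.
  rewrite hx normr_le0 subr_eq0 => H; apply/eqP/H => y xy; rewrite h1 ?subrr ?normr0//.
  by rewrite -(subrKA x); apply: le_trans (ler_normD _ _) _; rewrite distrC; lra.
move=> x /(corr_supp kk) [y [_ /h7 yr] /kd yx]; rewrite -(subrKA y).
by apply: le_lt_trans (ler_normD _ _) _; rewrite distrC; lra.
Qed.

End GradientBounds.

(** * Approximation in one chart and over finitely many charts *)

Section Approximation.
Context {R : realType} {n : nat}.
Local Notation V := 'rV[R]_n.+1.
Local Notation T := (leb_space R n).
Local Notation leb := (@leb R n).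
Local Notation nint := (nint leb).
Implicit Types (f g h k v : V -> R) (G : 'I_n.+1 -> V -> R) (x y : V) (i : 'I_n.+1).

Lemma smoothD f g : smooth f -> smooth g -> smooth (fun x => f x + g x).
Proof.
move=> sf sg s.
have E : iter_partial s (fun x => f x + g x) = (fun x => iter_partial s f x + iter_partial s g x).
  elim: s => [//|i s IH] /=; rewrite IH; apply/funext => x; apply: has_partial_partial.
  by apply: has_partialD; apply: derivable_hasp; [exact: (sf s).2|exact: (sg s).2].
rewrite E; split; first by apply: contD; [exact: (sf s).1|exact: (sg s).1].
move=> i x; have [//] : has_partial (fun x => iter_partial s f x + iter_partial s g x) i x
  (partial i (iter_partial s f) x + partial i (iter_partial s g) x).
by apply: has_partialD; apply: derivable_hasp; [exact: (sf s).2|exact: (sg s).2].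
Qed.

Lemma smooth_cst (c : R) : smooth ((fun=> c) : V -> R).
Proof.
move=> s; have [c' ->] : exists c' : R, iter_partial s ((fun=> c) : V -> R) = fun=> c'.
  elim: s => [|i s [c' IH]]; first by exists c.
  by exists 0 => /=; rewrite IH; apply/funext => x; apply: has_partial_partial; exact: has_partial_cst.
split; first exact: cont_cst.
by move=> i x; have [] := @has_partial_cst R n c' i x.
Qed.

(* The points x + t *: e + z form a cone with vertex x that stays inside Om. *)
Definition chart (Om : set V) (x0 : V) (r : R) := exists (e : V) (c s0 : R),
  [/\ 0 < c, 0 < s0 & forall x (t : R) z, closure Om x -> `|x - x0| < r ->
     0 < t -> t <= s0 -> `|z| <= c * t -> Om (x + t *: e + z)].

Variable Om : set V.
Hypotheses (oOm : open Om) (bOm : bounded_set Om) (u0 : 0 < @uvol R n).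
Variables (p q : R) (a : V -> R).
Hypotheses (p1 : 1 <= p) (pq : p <= q) (ai : L1 Om a) (a0 : forall x, Om x -> 0 <= a x).
Local Notation modular := (modular Om p q a).

Let mOm : measurable (Om : set T). Proof. exact: measurable_open. Qed.
Let fOm : (leb Om < +oo)%E. Proof. exact: bounded_leb. Qed.

Definition approximable v G := forall e : R, 0 < e -> exists w, [/\ Ccinfty Om w,
  (nint Om (fun x => v x - w x)%R <= e%:E)%E &
  forall i, (modular (fun x => G i x - partial i w x)%R <= e%:E)%E].

(* th is the rate of blow-up t `^ (- th) of the smoothed gradient, and osc the property
   of the function (boundedness or Hoelder continuity) that gives this rate. *)
Variables (th K : R) (osc : (V -> R) -> Prop).
Hypotheses (th0 : 0 < th) (thK : th * (q - p) <= K)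
  (smooth_conv : forall C c B f, 0 < C -> 0 < c -> 0 <= B ->
    measurable_fun (Om : set T) f -> (modular f < +oo)%E ->
    (exists2 t1 : R, 0 < t1 & forall t k, 0 < t -> t <= t1 -> kern C c t k ->
       forall x, Om x -> `|corr Om k f x| <= B * t `^ (- th)) ->
    forall e : R, 0 < e -> exists2 t2 : R, 0 < t2 & forall t k, 0 < t -> t <= t2 -> kern C c t k ->
      (modular (fun x => corr Om k f x - f x)%R <= e%:E)%E).

(** The properties carried through the localisation. Boundedness of v is what keeps the extra
    gradient term v grad psi of a product psi v in the modular class. *)
Definition good v G := [/\ forall x, ~ Om x -> v x = 0, exists M : R, forall x, `|v x| <= M,
  W0 Om v G, forall i, (modular (G i) < +oo)%E & osc v].

Hypotheses (osc_mul : forall v psi, osc v -> (exists M : R, forall x, `|v x| <= M) -> C1 psi ->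
    (exists L : R, forall x y, `|psi x - psi y| <= L * `|x - y|) ->
    (forall x, ~ Om x -> v x = 0) -> osc (fun x => psi x * v x))
  (osc_bound : forall v G C c, good v G -> 0 < C -> 0 < c -> exists2 B : R, 0 <= B &
    forall t k i x, 0 < t -> t <= 1 -> kern C c t k -> Om x ->
      `|corr Om k (G i) x| <= B * t `^ (- th)).

Lemma corr_bounded C c t k v (M : R) x : 0 <= M -> kern C c t k -> L1 Om v ->
  (forall x, `|v x| <= M) -> `|corr Om k v x| <= M.
Proof.
move=> M0 [kk _ _] vi vM; have [sk ck k0 _ k1] := kk; have ct := C1_cont (smooth_C1 sk).
have ik : L1 setT (fun y => k (y - x)) by apply: L1_shift => //; exact: cont_L1.
have mk : measurable_fun (setT : set T) (fun y : V => k (y - x)) by exact: measurable_cont_shift.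
have ikO : L1 Om (fun y => k (y - x)).
  by apply: L1_cont => //; exact: cont_shift.
rewrite -lee_fin; apply: le_trans (corr_le mOm x ct ck vi) _.
apply: (@le_trans _ _ (nint Om (fun y => M * k (y - x)))%R).
  apply: nint_le => //.
  - by apply: measurable_funM; [exact: int1_measurable ikO|exact: int1_measurable vi].
  - by apply: measurable_funM; [exact: measurable_cst|exact: int1_measurable ikO].
  by move=> y _; rewrite normrM [leRHS]normrM mulrC (ger0_norm M0) ler_wpM2r.
rewrite nintZ//; last exact: int1_measurable ikO.
rewrite (ger0_norm M0) -[leRHS]mule1; apply: lee_wpmul2l; first by rewrite lee_fin.
have := @nint_subset _ _ _ leb Om setT (fun y : V => k (y - x)) mOm measurableT (@subsetT _ _) mk.
move/le_trans; apply.
rewrite nint_Rintegral// lee_fin -(kernel_int1 x kk) le_eqVlt; apply/orP; left; apply/eqP.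
by apply: eq_Rintegral => y _; rewrite ger0_norm.
Qed.

(** The kernel is centred at -t e, so its correlation at x samples v near x - t e. A point of the
    support of the result is thus y + t e + z with v(y) nonzero and z small, and lies in [Om] by the
    cone condition. *)
Lemma local_approximable x0 (r : R) v G : 0 < r -> chart Om x0 r -> good v G ->
  (forall x, v x != 0 -> `|x - x0| < r) -> approximable v G.
Proof.
move=> r0 [e [c [s0 [c0 s00 ch]]]] gv vr eps eps0.
(* Half the aperture of the cone is left over for the compact containment in [cc_nbhd]. *)
have c2 : 0 < c / 2 by rewrite divr_gt0.
have [C C0 Hmol] := mollifier (- e) u0 c2.
have [v0 [M vM] Wv mdG ov] := gv.
have [vi Gi _] := Wv; have wp := W0_wpair oOm bOm Wv.
have M0 : 0 <= M by apply: le_trans (vM x0).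
(* The shifted kernel lies in the cube of radius c1 t about 0, so it is an admissible [kern] and the
   convergence result applies to it. *)
pose c1 := `|e| + c / 2; have c10 : 0 < c1 by rewrite ltr_wpDl.
have [B B0 HB] := osc_bound gv C0 c10.
have mv := int1_measurable vi.
have mdv : (modular v < +oo)%E by apply: (@modular_bounded _ _ _ oOm bOm p q a p1 pq ai a0 v M).
have t1v : 0 < Num.min 1 1 :> R by rewrite lt_min ltr01.
(* The convergence result is used for v as well; being bounded, v satisfies the growth condition
   trivially, as t^(-th) >= 1. *)
have [tv tv0 Hv] : exists2 t2 : R, 0 < t2 & forall t k, 0 < t -> t <= t2 -> kern C c1 t k ->
      (modular (fun x => corr Om k v x - v x)%R <= eps%:E)%E.
  apply: (smooth_conv C0 c10 M0 mv mdv _ eps0); exists 1 => // t k t0 t1 kk x Ox.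
  apply: le_trans (corr_bounded x M0 kk vi vM) _; rewrite -[leLHS]mulr1; apply: ler_wpM2l => //.
  rewrite (gt0_expR t0) powR_expR -[leLHS]expR0 ler_expR mulNr oppr_ge0.
  by apply: mulr_ge0_le0; [exact: ltW|exact: ln_le0].
have HG i : exists t2 : R, 0 < t2 /\ forall t k, 0 < t -> t <= t2 -> kern C c1 t k ->
      (modular (fun x => corr Om k (G i) x - G i x)%R <= eps%:E)%E.
  have [|t2 t20 H] := smooth_conv C0 c10 B0 (int1_measurable (Gi i)) (mdG i) _ eps0.
    by exists 1 => // t k t0 t1 kk x Ox; exact: HB.
  by exists t2.
have [tG HtG] := choice HG.
pose t2 := \big[Num.min/1]_i tG i.
have t20 : 0 < t2 by apply: lt_bigmin => [|i _]; [exact: ltr01|case: (HtG i)].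
(* The bound by the inverse of c gives c t <= 1, as required by the capped distance in [cc_nbhd]. *)
pose t := Num.min (Num.min tv t2) (Num.min s0 c^-1).
have t0 : 0 < t by rewrite !lt_min tv0 t20 s00 invr_gt0.
have ttv : t <= tv by rewrite !ge_min lexx.
have tt2 : t <= t2 by rewrite !ge_min lexx orbT.
have ts0 : t <= s0 by rewrite !ge_min lexx !orbT.
have tc : t <= c^-1 by rewrite !ge_min lexx !orbT.
have [k [sk ck kC dkC [kd k1]]] := Hmol t t0.
have kk : kern C c1 t k.
  split => //; last by move=> z; case/andP: (kC z).
  split => //; first by move=> z; case/andP: (kC z).
  move=> z /kd; rewrite scalerN opprK => h.
  rewrite -(addrK (t *: e) z); apply: le_lt_trans (ler_normB _ _) _.
  rewrite normrZ (gtr0_norm t0) /c1 mulrDl addrC [`|e| * t]mulrC; by rewrite ltrD2l.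
have Hk := smooth_C1 sk.
exists (corr Om k v); split.
- split; first exact: smooth_corr.
  apply: (@cc_nbhd _ _ _ [set y | Om y /\ v y != 0] Om (t *: e) (c / 2 * t)) => //.
  + by rewrite mulr_gt0.
  + rewrite -mulrDl -splitr; have := ler_wpM2l (ltW c0) tc; rewrite mulfV ?gt_eqF//.
  + move=> x y [Oy /vr yr]; rewrite -mulrDl -splitr => xy.
    rewrite -(subrK (y + t *: e) x) addrC.
    by apply: ch => //; [exact: subset_closure|exact: ltW].
  + have [kk0 _ _] := kk.
    move=> x /= /(corr_supp kk0) [y Ky kyx]; exists y => //.
    have := kd _ kyx; rewrite scalerN opprK => h.
    by rewrite distrC addrAC.
- rewrite nint_dist; apply: le_trans (Hv t k t0 ttv kk).
  apply: (nint_le_md oOm p q ai a0); apply: measurable_funB => //.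
  by apply: cont_measurable => //; apply: corr_cont => //; exact: C1_cont.
move=> i; have [ti0 Hi] := HtG i; rewrite modular_sub.
apply: le_trans (Hi t k t0 _ kk); last by apply: le_trans tt2 _; exact: bigmin_le.
rewrite le_eqVlt; apply/orP; left; apply/eqP; apply: eq_nint => x _.
by rewrite (corr_grad oOm i x wp Hk ck).
Qed.

Lemma approximableD v1 v2 G1 G2 : L1 Om v1 -> L1 Om v2 -> (forall i, L1 Om (G1 i)) -> (forall i, L1 Om (G2 i)) ->
  approximable v1 G1 -> approximable v2 G2 ->
  approximable (fun x => v1 x + v2 x) (fun i x => G1 i x + G2 i x).
Proof.
move=> v1i v2i G1i G2i A1 A2 e e0.
have Q0 : 0 < 2 `^ q :> R by exact: powR_gt0.
pose d := Num.min (e / 2) (e / 2 `^ q / 2).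
have d0 : 0 < d by rewrite lt_min !divr_gt0.
have [w1 [c1 n1 m1]] := A1 d d0; have [w2 [c2 n2 m2]] := A2 d d0.
have mw w : Ccinfty Om w -> measurable_fun (Om : set T) w.
  by move=> [sw _]; apply: cont_measurable => //; exact: C1_cont (smooth_C1 sw).
have mdw w i : Ccinfty Om w -> measurable_fun (Om : set T) (partial i w).
  by move=> [sw _]; apply: cont_measurable => //; exact: C1_partial (smooth_C1 sw).
have H1 := smooth_C1 c1.1; have H2 := smooth_C1 c2.1.
exists (fun x => w1 x + w2 x); split.
- split; last first.
    apply: compactly_containedS (compactly_containedU c1.2 c2.2) => x /= wx.
    by case: (eqVneq (w1 x) 0) wx => [->|h _]; [rewrite add0r; right|left].
  exact: smoothD c1.1 c2.1.
- rewrite (@eq_nint _ _ _ leb Om _ (fun x => (v1 x - w1 x) + (v2 x - w2 x))); last first.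
    by move=> x _; rewrite opprD addrACA.
  have k1 : measurable_fun (Om : set T) (fun x => v1 x - w1 x).
    by apply: measurable_funB; [exact: int1_measurable v1i|exact: mw].
  have k2 : measurable_fun (Om : set T) (fun x => v2 x - w2 x).
    by apply: measurable_funB; [exact: int1_measurable v2i|exact: mw].
  apply: le_trans (nint_add oOm k1 k2) _; apply: le_trans (leeD n1 n2) _.
  by rewrite -EFinD lee_fin /d [leRHS]splitr; apply: lerD; rewrite ge_min lexx.
move=> i.
have k1 : measurable_fun (Om : set T) (fun x => G1 i x - partial i w1 x).
  by apply: measurable_funB; [exact: int1_measurable (G1i i)|exact: mdw].
have k2 : measurable_fun (Om : set T) (fun x => G2 i x - partial i w2 x).
  by apply: measurable_funB; [exact: int1_measurable (G2i i)|exact: mdw].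
have -> : (fun x => G1 i x + G2 i x - partial i (fun x => w1 x + w2 x) x) =
    (fun x => (G1 i x - partial i w1 x) + (G2 i x - partial i w2 x)).
  by apply/funext => x; rewrite partialD// opprD addrACA.
apply: le_trans (modular_add oOm p1 pq ai a0 k1 k2) _.
apply: le_trans (lee_wpmul2l _ (leeD (m1 i) (m2 i))) _; first by rewrite lee_fin ltW.
rewrite -EFinD -EFinM lee_fin mulrC -ler_pdivlMr// [leRHS]splitr.
by apply: lerD; rewrite /d ge_min lexx orbT.
Qed.

Lemma good_mul v G psi : good v G -> C1 psi ->
  (exists L : R, forall x y, `|psi x - psi y| <= L * `|x - y|) ->
  (exists M : R, forall x, `|psi x| <= M) ->
  good (fun x => psi x * v x) (fun i x => psi x * G i x + v x * partial i psi x).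
Proof.
move=> [v0 [M vM] Wv mdG ov] Hpsi Lpsi [N pN]; split.
- by move=> x Ox; rewrite v0// mulr0.
- by exists (N * M) => x; rewrite normrM ler_pM.
- exact: W0_mul.
- move=> i; have [vi Gi _] := Wv.
  have mG := int1_measurable (Gi i); have mv := int1_measurable vi.
  have mp := cont_measurable oOm (C1_cont Hpsi).
  have cdp := C1_partial (i := i) Hpsi; have mdp := cont_measurable oOm cdp.
  have [M' M'0 dpM] := cont_bounded bOm cdp.
  have N1 : 1 <= `|N| + 1 by rewrite lerDr.
  have k1 : measurable_fun (Om : set T) (fun x => psi x * G i x) by exact: measurable_funM.
  have k2 : measurable_fun (Om : set T) (fun x => v x * partial i psi x) by exact: measurable_funM.
  apply: le_lt_trans (modular_add oOm p1 pq ai a0 k1 k2) _.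
  have Q0 : 0 <= 2 `^ q :> R by exact: powR_ge0.
  apply: lte_mul_pinfty; rewrite ?lee_fin//; apply: lte_add_pinfty.
    apply: (@le_lt_trans _ _ (modular (fun x => (`|N| + 1) * G i x)%R)).
      apply: (modular_le oOm p1 pq ai a0) => //.
        by apply: measurable_funM => //; exact: measurable_cst.
      move=> x _; rewrite !normrM ler_wpM2r// [leRHS]ger0_norm ?(le_trans ler01)//.
      by apply: le_trans (pN x) _; apply: le_trans (ler_norm _) _; rewrite lerDl.
    apply: le_lt_trans (modular_scale oOm p1 pq ai a0 mG N1) _.
    by apply: lte_mul_pinfty; rewrite ?lee_fin ?powR_ge0.
  apply: (@modular_bounded _ _ _ oOm bOm p q a p1 pq ai a0 _ (M * M')) => //.
  by move=> x Ox; rewrite normrM ler_pM// dpM.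
by apply: osc_mul => //; exists M.
Qed.

Lemma good_L1 v G : good v G -> L1 Om v /\ forall i, L1 Om (G i).
Proof. by move=> [_ _ [vi Gi _] _ _]. Qed.

Lemma approximable0 G : good (fun=> 0) G -> approximable (fun=> 0) G.
Proof.
move=> [_ _ W _ _] e e0; have [vi Gi _] := W.
have cc0 : Ccinfty Om (fun=> 0).
  split; first exact: smooth_cst.
  apply: (@bounded_compactly_contained _ _ _ set0) => //; last exact: closed0.
  by move=> x /=; rewrite eqxx.
have wG := wpair_weak (W0_wpair oOm bOm W).
have w0 := Ccinfty_weak oOm bOm cc0.
exists (fun=> 0); split => //.
  rewrite (@eq_nint _ _ _ leb Om _ (fun=> 0)); last by move=> x _; rewrite subrr.
  by rewrite nint0 lee_fin ltW.
move=> i; apply: (@le_trans _ _ (modular (fun=> 0))); last first.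
  have p0 : 0 < p by apply: lt_le_trans p1.
  have q0 : 0 < q by apply: lt_le_trans pq.
  have -> : modular (fun=> 0) = nint Om (fun=> 0).
    by apply: eq_nint => x _; rewrite /phase !normr0 !powR0 ?gt_eqF// mulr0 !addr0 normr0.
  by rewrite nint0 lee_fin ltW.

apply: (modular_le_ae oOm p1 pq ai a0) => //.
  apply: measurable_funB; first exact: int1_measurable (Gi i).
  by apply: cont_measurable => //; exact: C1_partial (smooth_C1 cc0.1).
move: (weak_gradient_unique oOm bOm u0 vi wG w0 i); apply: ae_imp => x H Ox.
by have := H Ox; rewrite !mxE => ->; rewrite subrr.
Qed.

(** Induction on the list: with b the cutoff of the first chart, b v lives in that chart, while (1 -
    b) v vanishes on its half-size cube and is therefore covered by the remaining charts. *)
Lemma chart_approximable (l : seq (V * R)) v G : (forall c, c \in l -> 0 < c.2 /\ chart Om c.1 c.2) ->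
  good v G -> (forall x, v x != 0 -> exists2 c, c \in l & `|x - c.1| < c.2 / 2) -> approximable v G.
Proof.
elim: l v G => [|[x0 r] l IH] v G Hl gv vl.
  have v0 : v = fun=> 0.
    by apply/funext => x; apply/eqP; apply: contrapT => /negP /vl [].
  by move: gv; rewrite v0; exact: approximable0.
have [r0 ch] := Hl (x0, r) (mem_head _ _).
have [b [Hb [L bL] b1 br]] := bump_cutoff u0 x0 r0.
have bb : exists M : R, forall x, `|b x| <= M.
  have [] := @csupp_bounded _ _ b (C1_cont Hb); last by move=> M _ ?; exists M.
  exact: (@bounded_csupp _ _ b x0 r).
have g1 := good_mul gv Hb (ex_intro _ L bL) bb.
have Hb' : C1 (fun x => 1 - b x) by apply: C1D; [exact: C1_cst|exact: C1N].
have bL' x y : `|(1 - b x) - (1 - b y)| <= L * `|x - y|.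
  by rewrite (_ : _ - _ = b y - b x); [rewrite distrC|ring].
have bb' : exists M : R, forall x, `|1 - b x| <= M.
  by have [M bM] := bb; exists (1 + M) => x; apply: le_trans (ler_normB _ _) _; rewrite normr1 lerD2l.
have g2 := good_mul gv Hb' (ex_intro _ L bL') bb'.
have A1 : approximable (fun x => b x * v x) (fun i x => b x * G i x + v x * partial i b x).
  apply: (local_approximable r0 ch g1) => x bv; apply: br.
  by apply: contra_neq bv => ->; rewrite mul0r.
have A2 : approximable (fun x => (1 - b x) * v x)
    (fun i x => (1 - b x) * G i x + v x * partial i (fun x => 1 - b x) x).
  apply: IH => //; first by move=> c cl; apply: Hl; rewrite inE cl orbT.
  move=> x bv; have vx : v x != 0 by apply: contra_neq bv => ->; rewrite mulr0.
  have bx : b x != 1 by apply: contra_neq bv => ->; rewrite subrr mul0r.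
  have [c] := vl x vx; rewrite inE => /orP[/eqP-> /b1 bx1|cl xc]; last by exists c.
  by move: bx; rewrite bx1 eqxx.
have [i1 j1] := good_L1 g1; have [i2 j2] := good_L1 g2.
have := approximableD i1 i2 j1 j2 A1 A2.
have -> : (fun x => b x * v x + (1 - b x) * v x) = v by apply/funext => x; ring.
congr (approximable v _); apply/funext => i; apply/funext => x.
have -> : partial i (fun x => 1 - b x) x = - partial i b x.
  by apply: has_partial_partial; rewrite -[- _]add0r; apply: has_partialB; [exact: has_partial_cst|exact: C1_hasp].
ring.
Qed.

End Approximation.

(** * Truncation and boundary values *)

Section Truncation.
Context {R : realType}.
Implicit Types s t k : R.

(** A rational function is used so that derivatives, bounds and Lipschitz constants are polynomial
    inequalities. *)
Definition damp s := (1 + s ^+ 2)^-1.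

Let D_gt0 s : 0 < 1 + s ^+ 2. Proof. by rewrite ltr_pwDl// sqr_ge0. Qed.

Lemma damp_gt0 s : 0 < damp s. Proof. by rewrite invr_gt0. Qed.

Lemma damp_le1 s : damp s <= 1. Proof. by rewrite invf_le1// lerDl sqr_ge0. Qed.

Lemma damp0 : damp 0 = 1. Proof. by rewrite /damp expr0n addr0 invr1. Qed.

Let dampE s : damp s * (1 + s ^+ 2) = 1. Proof. by rewrite mulVf// gt_eqF. Qed.

Lemma mul_damp_le s : `|s * damp s| <= 1.
Proof.
rewrite -(@expr_le1 _ 2)// -normrX ger0_norm ?sqr_ge0// exprMn.
have := dampE s; have := damp_gt0 s; have := damp_le1 s; have := sqr_ge0 s.
set x := s ^+ 2; set g := damp s; rewrite [g ^+ 2]expr2; nra.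
Qed.

Lemma mul_damp_lip s t : `|s * damp s - t * damp t| <= `|s - t|.
Proof.
have -> : s * damp s - t * damp t = (s - t) * ((1 - s * t) * (damp s * damp t)).
  by rewrite /damp; field; rewrite !gt_eqF.
rewrite normrM ler_piMr// normrM [X in _ * X]ger0_norm ?mulr_ge0 ?(ltW (damp_gt0 _))//.
rewrite /damp -invfM ler_pdivrMr ?mulr_gt0// mul1r ler_norml; apply/andP; split; nra.
Qed.

Lemma damp_lip s t : `|damp s - damp t| <= `|s - t|.
Proof.
have -> : damp s - damp t = (s - t) * - ((s + t) * (damp s * damp t)).
  by rewrite /damp; field; rewrite !gt_eqF.
rewrite normrM ler_piMr// normrN normrM [X in _ * X]ger0_norm ?mulr_ge0 ?(ltW (damp_gt0 _))//.
rewrite /damp -invfM ler_pdivrMr ?mulr_gt0// mul1r ler_norml.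
have := sqr_ge0 (s + 1); have := sqr_ge0 (s - 1); have := sqr_ge0 (t + 1); have := sqr_ge0 (t - 1).
have := sqr_ge0 (s * t); rewrite !expr2 => *; apply/andP; split; nra.
Qed.

Lemma damp_derive s : is_derive s 1 damp (- (2 * s * damp s ^+ 2)).
Proof.
have H : is_derive s 1 (fun s => 1 + s ^+ 2 : R^o) (2 * s).
  have := is_deriveD (is_derive_cst (1 : R^o) s 1) (is_deriveX 2 (@is_derive_id R R^o s 1)).
  by rewrite exprfctE => h; apply: is_derive_eq h _; rewrite add0r /GRing.scale /= mulr1.
have n0 : 1 + s ^+ 2 != 0 by rewrite gt_eqF.
have h := @is_deriveV R (fun s => 1 + s ^+ 2 : R^o) s (2 * s) 1 n0 H.
by apply: is_derive_eq h _; rewrite /damp /GRing.scale /= exprVn; ring.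
Qed.

Lemma damp_derive_scale k s : is_derive s 1 (fun s => damp (s / k)) (- (2 * (s / k) * damp (s / k) ^+ 2) / k).
Proof.
have H : is_derive s 1 (fun s => s / k : R^o) (k^-1).
  have -> : (fun s => s / k : R^o) = k^-1 \*: (@id R^o) by apply/funext => x; rewrite /= mulrC.
  by apply: is_derive_eq; rewrite scaler1.
by apply: (@is_derive1_comp _ damp (fun s => s / k)) => //; exact: damp_derive.
Qed.

(* truncate k is a bounded C1 approximation of the identity as k tends to infinity, and vanish k
   a C1 approximation, as k tends to 0, of the indicator function of the nonzero reals. *)
Definition truncate k s := s * damp (s / k).
Definition dtruncate k s := 2 * damp (s / k) ^+ 2 - damp (s / k).
Definition vanish k s := 1 - damp (s / k).
Definition dvanish k s := 2 * (s / k) * damp (s / k) ^+ 2 / k.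

(** The derivative is (1 - x^2) / (1 + x^2)^2 at x = s/k, rewritten in terms of g = [damp x] by
    means of x^2 g = 1 - g. *)
Lemma truncate_derive k s : 0 < k -> is_derive s 1 (truncate k) (dtruncate k s).
Proof.
move=> k0; rewrite /truncate.
have := @is_deriveM _ _ (@id R^o) (fun s => damp (s / k) : R^o) s 1 1 _ (is_derive_id _ _) (damp_derive_scale k s).
move=> h; apply: is_derive_eq h _.
rewrite /dtruncate /GRing.scale /= mulr1; have := dampE (s / k); set x := s / k; set g := damp x.
rewrite (_ : s * _ = - 2 * x ^+ 2 * g ^+ 2); last by rewrite /x; ring.
move=> E; rewrite (_ : - 2 * x ^+ 2 * g ^+ 2 = - 2 * g * (g * (1 + x ^+ 2)) + 2 * g ^+ 2); last by ring.
by rewrite E; ring.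
Qed.

Lemma vanish_derive k s : is_derive s 1 (vanish k) (dvanish k s).
Proof.
rewrite /vanish; have := @is_deriveB _ _ _ (cst (1 : R^o)) (fun s => damp (s / k) : R^o) s 1 0 _ (is_derive_cst _ _ _) (damp_derive_scale k s).
by move=> h; apply: is_derive_eq h _; rewrite /dvanish; ring.
Qed.

Lemma scale_dist k s t : 0 < k -> `|s / k - t / k| = `|s - t| / k.
Proof. by move=> k0; rewrite -mulrBl normrM [`|k^-1|]gtr0_norm// invr_gt0. Qed.

Lemma truncate_le k s : 0 < k -> `|truncate k s| <= k.
Proof.
move=> k0; rewrite /truncate (_ : s * _ = k * (s / k * damp (s / k))); last by field; rewrite gt_eqF.
by rewrite normrM (gtr0_norm k0) ler_piMr ?mul_damp_le// ltW.
Qed.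

Lemma truncate_lip k s t : 0 < k -> `|truncate k s - truncate k t| <= 1 * `|s - t|.
Proof.
move=> k0; rewrite /truncate (_ : _ - _ = k * (s / k * damp (s / k) - t / k * damp (t / k))); last by field; rewrite gt_eqF.
rewrite normrM (gtr0_norm k0); apply: le_trans (ler_wpM2l (ltW k0) (mul_damp_lip _ _)) _.
by rewrite scale_dist// mul1r mulrC divfK// gt_eqF.
Qed.

Lemma dtruncate_le k s : `|dtruncate k s| <= 1.
Proof.
rewrite /dtruncate; have := damp_gt0 (s / k); have := damp_le1 (s / k); set g := damp _ => g1 g0.
by rewrite ler_norml expr2; apply/andP; split; nra.
Qed.

Lemma dtruncate_lip k s t : 0 < k -> `|dtruncate k s - dtruncate k t| <= 5%:R / k * `|s - t|.
Proof.
move=> k0; rewrite /dtruncate; have := damp_lip (s / k) (t / k); rewrite scale_dist//.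
have := damp_gt0 (s / k); have := damp_le1 (s / k); have := damp_gt0 (t / k); have := damp_le1 (t / k).
set g := damp (s / k); set g' := damp (t / k) => a1 a0 b1 b0 damp'.
rewrite (_ : _ - _ = (g - g') * (2 * (g + g') - 1)); last by ring.
rewrite normrM (_ : 5%:R / k * _ = `|s - t| / k * 5%:R); last by ring.
by apply: ler_pM => //; rewrite ler_norml; apply/andP; split; lra.
Qed.

Lemma vanish_lip k s t : 0 < k -> `|vanish k s - vanish k t| <= 2 / k * `|s - t|.
Proof.
move=> k0; rewrite /vanish (_ : _ - _ = damp (t / k) - damp (s / k)); last by ring.
rewrite distrC; apply: le_trans (damp_lip _ _) _; rewrite scale_dist// mulrAC; apply: ler_wpM2r; first by rewrite invr_ge0 ltW.
by rewrite ler_peMl// ler1n.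
Qed.

Lemma dvanish_le k s : 0 < k -> `|dvanish k s| <= 2 / k.
Proof.
move=> k0; rewrite /dvanish (_ : 2 * (s / k) * damp (s / k) ^+ 2 / k = 2 / k * (s / k * damp (s / k) * damp (s / k))); last by ring.
rewrite normrM ger0_norm ?divr_ge0 ?(ltW k0)// ler_piMr ?divr_ge0 ?(ltW k0)// normrM.
by rewrite mulr_ile1 ?mul_damp_le// ger0_norm ?damp_le1// ltW// damp_gt0.
Qed.

Lemma dvanish_lip k s t : 0 < k -> `|dvanish k s - dvanish k t| <= 4%:R / k ^+ 2 * `|s - t|.
Proof.
move=> k0; rewrite /dvanish.
have h1 := mul_damp_lip (s / k) (t / k); have h2 := damp_lip (s / k) (t / k); rewrite scale_dist// in h1 h2.
move: h1 h2; have := mul_damp_le (t / k); have := damp_gt0 (s / k); have := damp_le1 (s / k).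
set x := s / k; set y := t / k; set g := damp x; set g' := damp y => g1 g0 yg h1 h2.
rewrite (_ : 2 * x * g ^+ 2 / k - 2 * y * g' ^+ 2 / k = 2 / k * ((x * g - y * g') * g + y * g' * (g - g'))); last by ring.
rewrite normrM ger0_norm ?divr_ge0 ?(ltW k0)//.
rewrite (_ : 4%:R / k ^+ 2 * _ = 2 / k * (2 * (`|s - t| / k))); last by field; rewrite gt_eqF.
apply: ler_wpM2l; first by rewrite divr_ge0 ?(ltW k0).
apply: le_trans (ler_normD _ _) _; rewrite [X in X + _]normrM [X in _ + X]normrM (mulr_natl _ 2) mulr2n; apply: lerD.
  by rewrite -[leRHS]mulr1; apply: ler_pM => //; rewrite ger0_norm// ltW.
by rewrite -[leRHS]mul1r; apply: ler_pM.
Qed.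

(** Together with [dvanish_small]: at distance at least al from 0, [vanish k] is 1 up to an error of
    order k^2, and its derivative is of order k. *)
Lemma damp_small k s (al : R) : 0 < k -> 0 < al -> al <= `|s| -> damp (s / k) <= k ^+ 2 / al ^+ 2.
Proof.
move=> k0 al0 als; rewrite /damp -[leRHS]invrK lef_pV2 ?posrE ?invr_gt0 ?divr_gt0 ?exprn_gt0//.
rewrite invf_div; apply: (@le_trans _ _ ((s / k) ^+ 2)); last by rewrite lerDr.
rewrite expr_div_n ler_wpM2r ?invr_ge0 ?sqr_ge0// -(real_normK (num_real s)).
by rewrite lerXn2r// nnegrE// ltW.
Qed.

Lemma dvanish_small k s (al : R) : 0 < k -> 0 < al -> al <= `|s| -> `|dvanish k s| <= 2 * k / al ^+ 2.
Proof.
move=> k0 al0 als; rewrite /dvanish (_ : 2 * (s / k) * damp (s / k) ^+ 2 / k = 2 / k * (s / k * damp (s / k) * damp (s / k))); last by ring.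
rewrite normrM ger0_norm ?divr_ge0 ?(ltW k0)//.
rewrite (_ : 2 * k / _ = 2 / k * (k ^+ 2 / al ^+ 2)); last by field; rewrite !gt_eqF.
apply: ler_wpM2l; first by rewrite divr_ge0 ?(ltW k0).
rewrite normrM -[leRHS]mul1r; apply: ler_pM => //; first exact: mul_damp_le.
by rewrite (ger0_norm (ltW (damp_gt0 _))); exact: damp_small.
Qed.

End Truncation.

(** * The growth rates for bounded functions, finite energy and Hölder continuity *)

Section Cases.
Context {R : realType} {n : nat}.
Local Notation V := 'rV[R]_n.+1.
Local Notation T := (leb_space R n).
Local Notation leb := (@leb R n).
Local Notation nint := (nint leb).
Implicit Types (f g h k v : V -> R) (G : 'I_n.+1 -> V -> R) (x y : V) (i : 'I_n.+1).

Variable Om : set V.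
Hypotheses (oOm : open Om) (bOm : bounded_set Om) (u0 : 0 < @uvol R n).
Variables (p q : R) (a : V -> R).
Hypotheses (p1 : 1 <= p) (pq : p <= q) (ai : L1 Om a) (a0 : forall x, Om x -> 0 <= a x).
Local Notation modular := (modular Om p q a).
Local Notation approximable := (approximable Om p q a).
Local Notation good := (good Om p q a).

Let mOm : measurable (Om : set T). Proof. exact: measurable_open. Qed.

Lemma W0_ae v v' G : measurable_fun (Om : set T) v' -> {ae leb, forall x, Om x -> v x = v' x} ->
  W0 Om v G -> W0 Om v' G.
Proof.
move=> mv' vv' [vi Gi H]; have mv := int1_measurable vi; split => //.
  apply/int1P; split => //; apply: le_lt_trans (int1_fin vi); apply: nint_le_ae => //.
  by move: vv'; apply: ae_imp => x E Ox; rewrite E.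
move=> e e0; have [phi [Hp sp h1 h2]] := H e e0; exists phi; split => //.
apply: le_trans h1; have mp := cont_measurable oOm (C1_cont Hp).
apply: nint_le_ae => //; try exact: measurable_funB.
by move: vv'; apply: ae_imp => x E Ox; rewrite E.
Qed.

Lemma W0_trunc v G (k : R) : 0 < k -> W0 Om v G ->
  W0 Om (fun x => truncate k (v x)) (fun i x => dtruncate k (v x) * G i x).
Proof.
move=> k0 W; apply: (W0_comp oOm bOm (h := truncate k) (dh := dtruncate k) (C := 1) (L := 5%:R / k) W) => //.
- by move=> t; exact: truncate_derive.
- by rewrite /truncate mul0r.
- by rewrite divr_ge0// ltW.
- by move=> t; exact: dtruncate_le.
- by move=> s t; exact: truncate_lip.
- by move=> s t; exact: dtruncate_lip.
Qed.

Lemma approximable_lim v G : L1 Om v -> (forall i, L1 Om (G i)) ->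
  (forall e : R, 0 < e -> exists v' G', [/\ L1 Om v', forall i, L1 Om (G' i),
    (nint Om (fun x => v x - v' x)%R <= e%:E)%E,
    forall i, (modular (fun x => G i x - G' i x)%R <= e%:E)%E & approximable v' G']) ->
  approximable v G.
Proof.
move=> vi Gi H e e0; have Q0 : 0 < 2 `^ q :> R by exact: powR_gt0.
pose d := Num.min (e / 2) (e / 2 `^ q / 2).
have d0 : 0 < d by rewrite lt_min !divr_gt0.
have [v' [G' [v'i G'i n1 m1 A]]] := H d d0.
have [w [cw n2 m2]] := A d d0; exists w; split => //.
  have mw := cont_measurable oOm (C1_cont (smooth_C1 cw.1)).
  have := @nint_triangle _ _ _ leb Om v v' w mOm (int1_measurable vi) (int1_measurable v'i) mw.
  move/le_trans; apply.
  apply: le_trans (leeD n1 n2) _.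
  by rewrite -EFinD lee_fin /d [leRHS]splitr; apply: lerD; rewrite ge_min lexx.
move=> i; have mdw := cont_measurable oOm (C1_partial (i := i) (smooth_C1 cw.1)).
have -> : (fun x => G i x - partial i w x) = (fun x => (G i x - G' i x) + (G' i x - partial i w x)).
  by apply/funext => x; rewrite subrKA.
have k1 : measurable_fun (Om : set T) (fun x => G i x - G' i x).
  by apply: measurable_funB; [exact: int1_measurable (Gi i)|exact: int1_measurable (G'i i)].
have k2 : measurable_fun (Om : set T) (fun x => G' i x - partial i w x).
  by apply: measurable_funB => //; exact: int1_measurable (G'i i).
apply: le_trans (modular_add oOm p1 pq ai a0 k1 k2) _.
apply: le_trans (lee_wpmul2l _ (leeD (m1 i) (m2 i))) _; first by rewrite lee_fin ltW.
rewrite -EFinD -EFinM lee_fin mulrC -ler_pdivlMr// [leRHS]splitr.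
by apply: lerD; rewrite /d ge_min lexx orbT.
Qed.

Lemma good_trunc v G (k : R) : 0 < k -> W0 Om v G -> (forall x, ~ Om x -> v x = 0) ->
  (forall i, (modular (G i) < +oo)%E) ->
  good (fun=> True) (fun x => truncate k (v x)) (fun i x => dtruncate k (v x) * G i x).
Proof.
move=> k0 W v0 mdG; have Wk := W0_trunc k0 W; split; [ | |exact: Wk| |exact: I].
- by move=> x Ox; rewrite v0// /truncate mul0r.
- by exists k => x; exact: truncate_le.
have [vi Gi _] := W; have [_ Gki _] := Wk.
move=> i; apply: le_lt_trans (mdG i); apply: (modular_le oOm p1 pq ai a0).
- exact: int1_measurable (Gki i).
- exact: int1_measurable (Gi i).
- by move=> x _; rewrite normrM ler_piMl// dtruncate_le.
Qed.

Lemma cvg_bound_inv (f : nat -> R) (c : R) : 0 <= c -> (forall j, `|f j| <= c / j.+1%:R) ->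
  f j @[j --> \oo] --> 0.
Proof.
move=> c0 fc; apply/cvgrPdist_le => e e0; near=> j; rewrite sub0r normrN.
apply: le_trans (fc j) _; rewrite ler_pdivrMr ?ltr0n// mulrC -ler_pdivrMr//.
apply: (@le_trans _ _ j%:R); last by rewrite ler_nat.
near: j; exact: nbhs_infty_ger.
Unshelve. all: by end_near. Qed.

(** The errors are dominated by |v| and by 2 |G| and vanish pointwise at rate 1/j; the levels j + 1
    avoid division by zero. *)
Lemma trunc_approximable v G : W0 Om v G -> (forall i, (modular (G i) < +oo)%E) ->
  (forall k : R, 0 < k -> approximable (fun x => truncate k (v x)) (fun i x => dtruncate k (v x) * G i x)) ->
  approximable v G.
Proof.
move=> W mdG A; have [vi Gi _] := W; have mv := int1_measurable vi.
apply: approximable_lim => // e e0.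
have k0 j : 0 < j.+1%:R :> R by rewrite ltr0n.
have Wk j : W0 Om (fun x => truncate j.+1%:R (v x)) (fun i x => dtruncate j.+1%:R (v x) * G i x) by exact: W0_trunc.
have mtr j : measurable_fun (Om : set T) (fun x => truncate j.+1%:R (v x)).
  by have [h _ _] := Wk j; exact: int1_measurable h.
have mG i := int1_measurable (Gi i).
have mdtr j i : measurable_fun (Om : set T) (fun x => dtruncate j.+1%:R (v x) * G i x).
  by have [_ h _] := Wk j; exact: int1_measurable (h i).
have L1' : nint Om (fun x => v x - truncate j.+1%:R (v x)) @[j --> \oo] --> 0%E.
  apply: (@dominated_nint _ _ _ leb Om (fun j x => v x - truncate j.+1%:R (v x)) (fun x => `|v x|) mOm).
  - by move=> j; exact: measurable_funB.
  - have /int1P[h1 h2] := vi; apply/int1P; split; first exact: measurable_norm.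
    by move: h2; rewrite (@eq_nint _ _ _ leb Om (fun x => `|v x|) v)// => x _; rewrite normr_id.
  - move=> j x _; rewrite /truncate -[X in X - _]mulr1 -mulrBr normrM ler_piMr// ger0_norm.
      by rewrite gerBl ltW// damp_gt0.
    by rewrite subr_ge0 damp_le1.
  move=> x _; apply: (@cvg_bound_inv _ (`|v x| * `|v x|)) => [|j]; first exact: mulr_ge0.
  rewrite /truncate -[X in X - _]mulr1 -mulrBr normrM -mulrA ler_wpM2l//.
  have := damp_lip 0 (v x / j.+1%:R); rewrite damp0 sub0r normrN normrM [`|_^-1|]gtr0_norm// invr_gt0.
have LG i : modular (fun x => G i x - dtruncate j.+1%:R (v x) * G i x) @[j --> \oo] --> 0%E.
  have m2 : measurable_fun (Om : set T) (fun x => 2 * G i x).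
    by apply: measurable_funM => //; exact: measurable_cst.
  apply: (@modular_dominated _ _ _ oOm p q a p1 pq ai a0 (fun j x => G i x - dtruncate j.+1%:R (v x) * G i x) (fun x => 2 * G i x)) => //.
  - by move=> j; exact: measurable_funB.
  - apply: le_lt_trans (modular_scale oOm p1 pq ai a0 (mG i) _) _; first by rewrite ler1n.
    by apply: lte_mul_pinfty; rewrite ?lee_fin ?powR_ge0.
  - move=> j x _; rewrite -[X in X - _]mul1r -mulrBl !normrM ler_wpM2r//.
    apply: le_trans (ler_normB _ _) _; rewrite normr1 [leRHS]ger0_norm//.
    have := dtruncate_le j.+1%:R (v x); lra.
  move=> x _; apply: (@cvg_bound_inv _ (5%:R * `|v x| * `|G i x|)) => [|j]; first by rewrite !mulr_ge0.
  rewrite -[X in X - _]mul1r -mulrBl normrM mulrAC ler_wpM2r//.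
  have := dtruncate_lip 0 (v x) (k0 j); rewrite {1}/dtruncate mul0r damp0 expr1n mulr1 sub0r normrN.
  rewrite (_ : 2 - 1 = 1); last by ring.
  by rewrite mulrAC.
have : \forall j \near \oo, (nint Om (fun x => v x - truncate j.+1%:R (v x))%R < e%:E)%E /\
    forall i, (modular (fun x => G i x - dtruncate j.+1%:R (v x) * G i x)%R < e%:E)%E.
  have H2 : \forall j \near \oo, forall i, (modular (fun x => G i x - dtruncate j.+1%:R (v x) * G i x)%R < e%:E)%E.
    by apply: filter_forall => i; exact: cvge0_near (LG i) e0.
  by near=> j; split; near: j => //; exact: cvge0_near L1' e0.
move=> [j _ /(_ j (leqnn j)) [h1 h2]].
exists (fun x => truncate j.+1%:R (v x)), (fun i x => dtruncate j.+1%:R (v x) * G i x).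
have [? ? _] := Wk j; split => //; [exact: ltW|by move=> i; exact: ltW|exact: A].
Unshelve. all: by end_near. Qed.

Lemma corr_grad_le C c t k v G i x (b E : R) : 0 < C -> 0 < c -> 0 < t -> kern C c t k ->
  W0 Om v G -> (forall y, ~ Om y -> v y = 0) -> 0 <= E ->
  (forall y, `|y - x| < 2 * c * t -> `|v y - b| <= E) ->
  `|corr Om k (G i) x| <= C * E * (@uvol R n * (2 * c) ^+ n.+1) * t^-1.
Proof.
move=> C0 c0 t0 kk W v0 E0 vE; have [[sk ck _ _ _] _ _] := kk.
have [vi _ _] := W; have Hk := smooth_C1 sk.
rewrite -(corr_grad oOm i x (W0_wpair oOm bOm W) Hk ck) partial_corr// normrN.
exact: (grad_corr_bound oOm i C0 c0 t0 kk vi v0 E0 vE).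
Qed.

Lemma osc_bound_bounded v G C c : good (fun=> True) v G -> 0 < C -> 0 < c -> exists2 B : R, 0 <= B &
    forall t k i x, 0 < t -> t <= 1 -> kern C c t k -> Om x ->
      `|corr Om k (G i) x| <= B * t `^ (- 1).
Proof.
move=> [v0 [M vM] W _ _] C0 c0; have M0 : 0 <= M by apply: le_trans (vM 0).
exists (C * M * (@uvol R n * (2 * c) ^+ n.+1)).
  by rewrite !mulr_ge0 ?exprn_ge0 ?mulr_ge0// ltW.
move=> t k i x t0 t1 kk Ox; rewrite powR_inv1 ?(ltW t0)//.
apply: (corr_grad_le (b := 0) _ C0 c0 t0 kk W v0 M0) => y _.
by rewrite subr0.
Qed.

Lemma osc_bound_power v G C c : good (fun=> True) v G -> 0 < C -> 0 < c -> exists2 B : R, 0 <= B &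
    forall t k i x, 0 < t -> t <= 1 -> kern C c t k -> Om x ->
      `|corr Om k (G i) x| <= B * t `^ (- (n.+1%:R / p)).
Proof.
move=> [_ _ [vi Gi _] mdG _] C0 c0.
pose A := \sum_i fine (modular (G i)).
have f0 i : 0 <= fine (modular (G i)) by rewrite fine_ge0// modular_ge0.
have A0 : 0 <= A by apply: sumr_ge0.
exists ((C `^ p * (2 `^ p * (A * (@uvol R n * c ^+ n.+1) `^ (p - 1)))) `^ p^-1); first exact: powR_ge0.
move=> t k i x t0 t1 kk Ox; apply: (power_corr_bound oOm) => //.
have -> : (\int[leb]_(x in Om) (`|G i x| `^ p)%:E = nint Om (fun x => `|G i x| `^ p)%R)%E.
  by apply: eq_integral => y _; rewrite (ger0_norm (powR_ge0 _ _)).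
have mG := int1_measurable (Gi i).
apply: le_trans (_ : modular (G i) <= _)%E.
  apply: nint_le => //; [exact: measurableT_comp (measurable_powR _) (measurable_norm mG)|exact: measurable_phase|].
  move=> y Oy; rewrite ger0_norm ?powR_ge0// (phase_norm p q a0 _ Oy) /phase addrAC lerDr.
  by rewrite addr_ge0// mulr_ge0 ?powR_ge0// a0.
have -> : modular (G i) = (fine (modular (G i)))%:E by rewrite fineK//; apply: nint_fin_num; exact: mdG.
rewrite lee_fin /A (bigD1 i)//= lerDl.
exact: sumr_ge0.
Qed.

(** Hölder continuity on the whole space, in the sup norm: for functions that vanish off [Om] it
    includes the decay at the boundary. *)
Definition holderV (g : R) v := exists2 H : R, 0 <= H & forall x y, `|v x - v y| <= H * `|x - y| `^ g.

Lemma osc_bound_holder (g : R) v G C c : 0 < g -> good (holderV g) v G -> 0 < C -> 0 < c -> exists2 B : R, 0 <= B &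
    forall t k i x, 0 < t -> t <= 1 -> kern C c t k -> Om x ->
      `|corr Om k (G i) x| <= B * t `^ (- (1 - g)).
Proof.
move=> g0 [v0 _ W _ [H H0 vH]] C0 c0.
exists (C * (H * (2 * c) `^ g) * (@uvol R n * (2 * c) ^+ n.+1)).
  by rewrite !mulr_ge0 ?exprn_ge0 ?mulr_ge0 ?powR_ge0// ltW.
move=> t k i x t0 t1 kk Ox; have c2 : 0 <= 2 * c by rewrite mulr_ge0// ltW.
have E0 : 0 <= H * (2 * c * t) `^ g by rewrite mulr_ge0 ?powR_ge0.
have vE y : `|y - x| < 2 * c * t -> `|v y - v x| <= H * (2 * c * t) `^ g.
  move=> yx; apply: le_trans (vH y x) _; apply: ler_wpM2l => //.
  by apply: ge0_ler_powR; rewrite ?nnegrE ?(ltW g0)// ?(ltW yx)// mulr_ge0// ltW.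
apply: le_trans (corr_grad_le (b := v x) i C0 c0 t0 kk W v0 E0 vE) _.
rewrite le_eqVlt; apply/orP; left; apply/eqP.
have -> : t `^ (- (1 - g)) = t `^ g * t^-1.
  by rewrite (gt0_expR t0) -expRN !powR_expR -expRD; congr expR; ring.
rewrite powRM ?(ltW t0)//; ring.
Qed.

(** On [Om] the Lipschitz function psi is also bounded, hence Hölder: the first property serves
    distances below 1, the second those above. Off [Om] psi may be unbounded; there v vanishes, and
    the Hölder bound of v alone controls the product. *)
Lemma holderV_mul (g : R) v psi : 0 < g -> g <= 1 -> holderV g v -> (exists M : R, forall x, `|v x| <= M) -> C1 psi ->
    (exists L : R, forall x y, `|psi x - psi y| <= L * `|x - y|) ->
    (forall x, ~ Om x -> v x = 0) -> holderV g (fun x => psi x * v x).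
Proof.
move=> g0 g1 [H H0 vH] [M vM] Hp [L pL] v0.
have [P P0 pP] := cont_bounded bOm (C1_cont Hp).
have M0 : 0 <= M by apply: le_trans (vM 0).
have pw (z : V) (r : R) : 0 <= r -> r <= `|z| -> r <= 1 -> r <= `|z| `^ g.
  move=> r0 rz r1; have [->|rn] := eqVneq r 0; first exact: powR_ge0.
  have rp : 0 < r by rewrite lt_neqAle eq_sym rn.
  apply: (@le_trans _ _ (r `^ g)); last by apply: ge0_ler_powR; rewrite ?nnegrE// ltW.
  rewrite -{1}(powRr1 r0) (gt0_expR rp) !powR_expR ler_expR.
  by have := ln_le0 r1; nra.
have pL' x y : `|psi x - psi y| <= `|L| * `|x - y|.
  by apply: le_trans (pL x y) _; apply: ler_wpM2r => //; exact: ler_norm.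
have pb x y : Om x -> Om y -> `|psi x - psi y| <= (`|L| + 2 * P) * `|x - y| `^ g.
  move=> Ox Oy; have Z0 := powR_ge0 `|x - y| g; have [z1|/ltW z1] := leP `|x - y| 1.
    apply: le_trans (pL' x y) _; apply: ler_pM => //; last exact: pw.
    by rewrite lerDl mulr_ge0.
  apply: le_trans (ler_normB _ _) _; apply: le_trans (lerD (pP x Ox) (pP y Oy)) _.
  have z2 : 1 <= `|x - y| `^ g by exact: pw.
  have L0 : 0 <= `|L| by exact: normr_ge0.
  by have := ler_wpM2l (addr_ge0 L0 (mulr_ge0 (ler0n R 2) P0)) z2; lra.
exists (P * H + M * (`|L| + 2 * P)); first by rewrite addr_ge0 ?mulr_ge0 ?addr_ge0 ?mulr_ge0.
have half x y : Om x -> ~ Om y -> `|psi x * v x - psi y * v y| <=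
    (P * H + M * (`|L| + 2 * P)) * `|x - y| `^ g.
  move=> Ox Oy; rewrite (v0 y Oy) mulr0 subr0 normrM.
  have := vH x y; rewrite (v0 y Oy) subr0 => h; apply: le_trans (ler_pM _ _ (pP x Ox) h) _ => //.
  rewrite mulrA; apply: ler_wpM2r; first exact: powR_ge0.
  by rewrite lerDl mulr_ge0 ?addr_ge0 ?mulr_ge0.
move=> x y; have [Ox|Ox] := pselect (Om x); have [Oy|Oy] := pselect (Om y).
- rewrite (_ : psi x * v x - psi y * v y = psi x * (v x - v y) + v y * (psi x - psi y)); last by ring.
  apply: le_trans (ler_normD _ _) _; rewrite !normrM mulrDl -!mulrA; apply: lerD.
    by apply: ler_pM => //; exact: pP.
  by apply: ler_pM => //; exact: pb.
- exact: half.
- by rewrite distrC (distrC x); exact: half.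
- by rewrite !v0// !mulr0 subrr normr0 mulr_ge0 ?powR_ge0// addr_ge0 ?mulr_ge0 ?addr_ge0 ?mulr_ge0.
Qed.

End Cases.

(** * Boundary values of Hölder continuous functions *)

Section Trace.
Context {R : realType} {n : nat}.
Local Notation V := 'rV[R]_n.+1.
Local Notation T := (leb_space R n).
Local Notation leb := (@leb R n).
Local Notation nint := (nint leb).
Implicit Types (f g h k v : V -> R) (G : 'I_n.+1 -> V -> R) (x y z : V) (i : 'I_n.+1).

Lemma line_const f i x (t : R) : C1 f ->
  (forall s : R, Num.min 0 t <= s -> s <= Num.max 0 t -> partial i f (x + s *: ev i) = 0) ->
  f (x + t *: ev i) = f x.
Proof.
move=> Hf H; pose F (s : R) : R := f (x + s *: ev i).
have dF (s : R) : is_derive s 1 (F : R^o -> R^o) (partial i f (x + s *: ev i)).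
  exact: (has_partial_line x s (fun y => C1_hasp i y Hf)).
have cF (a b : R) : {within `[a, b], continuous (F : R^o -> R^o)}.
  apply: continuous_subspaceT => s; apply: differentiable_continuous.
  by apply/derivable1_diffP; case: (dF s).
suff : F t = F 0 by rewrite /F scale0r addr0.
have [t0|/ltW t0] := leP 0 t.
  have [c] := @MVT_segment R F (fun s => partial i f (x + s *: ev i)) 0 t t0 (fun s _ => dF s) (cF 0 t).
  rewrite in_itv /= => /andP[c0 ct]; rewrite H ?mul0r; [|by rewrite min_l|by rewrite max_r].
  by move/eqP; rewrite subr_eq0 => /eqP.
have [c] := @MVT_segment R F (fun s => partial i f (x + s *: ev i)) t 0 t0 (fun s _ => dF s) (cF t 0).
rewrite in_itv /= => /andP[c0 ct]; rewrite H ?mul0r; [|by rewrite min_r|by rewrite max_l].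
by move/eqP; rewrite subr_eq0 => /eqP.
Qed.

(** The two points are joined by changing one coordinate at a time; the path stays in the cube
    because a cube is a product. *)
Lemma cube_const f x0 (r : R) : C1 f -> (forall i x, `|x - x0| < r -> partial i f x = 0) ->
  forall x y, `|x - x0| < r -> `|y - x0| < r -> f y = f x.
Proof.
move=> Hf H x y xr yr; have r0 : 0 < r by apply: le_lt_trans xr.
pose z (j : nat) : V := \row_l (if (l < j)%N then y ord0 l else x ord0 l).
have co (w : V) l : `|w - x0| < r -> `|w ord0 l - x0 ord0 l| < r.
  by move=> wr; apply: le_lt_trans wr; have := coord_le_norm (w - x0) l; rewrite !mxE.
suff E j : (j <= n.+1)%N -> f (z j) = f x.
  rewrite -(E n.+1)//; congr f; apply/rowP => l; by rewrite mxE ltn_ord.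
elim: j => [_|j IH jn]; first by congr f; apply/rowP => l; rewrite mxE.
rewrite -IH; last exact: ltnW.
pose i := Ordinal jn.
have -> : z j.+1 = z j + (y ord0 i - x ord0 i) *: ev i.
  apply/rowP => l; rewrite !mxE eqxx /= ltnS leq_eqVlt.
  have [->|li] := eqVneq l i; first by rewrite eqxx ltnn /= mulr1 addrC subrK.
  have -> : (nat_of_ord l == j) = false by apply/eqP => h; move/eqP: li; apply; apply: val_inj.
  by rewrite mulr0 addr0.
apply: line_const => // s s1 s2; apply: H; apply: rV_norm_lt => // l; rewrite !mxE eqxx /=.
have [->|li] := eqVneq l i; last first.
  by rewrite mulr0 addr0; case: ifP => _; exact: co.
rewrite ltnn mulr1; have := co x i xr; have := co y i yr.
set X := x ord0 i in s1 s2 *; set Y := y ord0 i in s1 s2 *; set Z := x0 ord0 i.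
rewrite !ltr_norml => /andP[h1 h2] /andP[h3 h4].
move: s1 s2; rewrite ge_min le_max => /orP[] s1 /orP[] s2; apply/andP; split; lra.
Qed.

(** Each summand s satisfies s / (a + b) <= (s / (a + b))^g, because the quotient is at most 1 and g
    <= 1. *)
Lemma powR_subadd (g a b : R) : 0 < g -> g <= 1 -> 0 <= a -> 0 <= b -> (a + b) `^ g <= a `^ g + b `^ g.
Proof.
move=> g0 g1 a0 b0; have [c0|cn] := eqVneq (a + b) 0.
  by rewrite c0 powR0 ?gt_eqF// addr_ge0 ?powR_ge0.
have cp : 0 < a + b by rewrite lt_neqAle eq_sym cn addr_ge0.
have h (s : R) : 0 <= s -> s <= a + b -> s / (a + b) * (a + b) `^ g <= s `^ g.
  move=> s0 sc; have [->|sn] := eqVneq s 0; first by rewrite !mul0r powR_ge0.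
  have sp : 0 < s by rewrite lt_neqAle eq_sym sn.
  have : ln s <= ln (a + b) by rewrite ler_ln.
  rewrite (gt0_expR sp) (gt0_expR cp) !powR_expR -expRN -!expRD ler_expR !expRK; nra.
have ha : a <= a + b by rewrite lerDl.
have hb : b <= a + b by rewrite lerDr.
apply: le_trans (lerD (h a a0 ha) (h b b0 hb)).
by rewrite -mulrDl -mulrDl mulfV// mul1r.
Qed.

Let trace_arith (al s s' d k a b : R) : 2 * al = s - a -> s - s' <= d -> b <= al ->
  k <= a + b -> d <= k -> al <= s'.
Proof. by lra. Qed.

Variable Om : set V.
Hypotheses (oOm : open Om) (bOm : bounded_set Om) (u0 : 0 < @uvol R n).

Let mOm : measurable (Om : set T). Proof. exact: measurable_open. Qed.
Let fOm : (leb Om < +oo)%E. Proof. exact: bounded_leb. Qed.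

Lemma open_cont_measurable v : (forall x, Om x -> forall e : R, 0 < e ->
    exists2 d : R, 0 < d & forall y, Om y -> `|x - y| < d -> `|v x - v y| <= e) ->
  measurable_fun (Om : set T) v.
Proof.
move=> cv; apply: measurability (RGenOInfty.measurableE R) _ => //.
move=> _ [_ [t ->] <-]; apply: measurable_open; rewrite openE => x [Ox /=].
rewrite in_itv /= andbT => tv.
have e0 : 0 < (v x - t) / 2 by rewrite divr_gt0// subr_gt0.
have [d d0 dv] := cv x Ox _ e0.
have : nbhs x Om by apply: open_nbhs_nbhs.
move=> /nbhs_ballP[r /= r0 rO]; apply/nbhs_ballP; exists (Num.min d r) => /=; first by rewrite lt_min d0.
move=> y; rewrite -ball_normE /= lt_min => /andP[yd yr].
have Oy : Om y by apply: rO; rewrite -ball_normE.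
split => //=; rewrite in_itv /= andbT; have := dv y Oy yd; rewrite ler_norml => /andP[_]; lra.
Qed.

Lemma chart_le x0 (r r' : R) : r' <= r -> chart Om x0 r -> chart Om x0 r'.
Proof.
move=> rr [e [c [s0 [c0 s00 H]]]]; exists e, c, s0; split => // x t z cx xr.
by apply: H => //; exact: lt_le_trans rr.
Qed.

(* If |v| >= al near x0 then vanish k (v) tends to 1 there, so that 1 inherits from v the
   property of having zero trace near x0. *)
Lemma int_partial_trace0 x0 (r al : R) v G i psi : W0 Om v G -> 0 < al ->
  (forall y, Om y -> `|y - x0| < r -> al <= `|v y|) -> C1 psi ->
  (forall y, psi y != 0 -> `|y - x0| < r / 2) ->
  0 < r -> \int[leb]_(x in Om) partial i psi x = 0.
Proof.
move=> W al0 Hal Hp supp r0; have [vi Gi _] := W.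
have cp := C1_cont Hp; have cdp := C1_partial (i := i) Hp.
have [P P0 pP] := cont_bounded bOm cp; have [P' P'0 pP'] := cont_bounded bOm cdp.
have mv := int1_measurable vi.
have supp' y : partial i psi y != 0 -> `|y - x0| < r.
  move=> /(partial_supp Hp) h.
  have cl : closed [set y : V | `|y - x0| <= r / 2].
    apply: cont_closed_le; apply: (@lip_continuous _ _ _ 1) => a b; rewrite mul1r.
    by apply: le_trans (ler_dist_dist _ _) _; rewrite opprB addrA subrK.
  have /closureS h2 : [set y | psi y != 0] `<=` [set y : V | `|y - x0| <= r / 2] by move=> a /supp /ltW.
  by have := h2 _ h; rewrite -(closure_id _).1//= => h3; lra.
have Of : leb Om \is a fin_num by rewrite ge0_fin_numE.
pose O := fine (leb Om); have O0 : 0 <= O by rewrite fine_ge0.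
have Gf : nint Om (G i) \is a fin_num by rewrite ge0_fin_numE ?nint_ge0//; exact: int1_fin (Gi i).
pose N := fine (nint Om (G i)); have N0 : 0 <= N by rewrite fine_ge0// nint_ge0.
(* The two terms come from the integration by parts formula for [vanish k] of v: where psi or its
   derivative is nonzero, 1 - [vanish k] is at most k^2 / al^2 <= k / al^2 and [dvanish k] at most 2
   k / al^2. *)
pose M := P' / al ^+ 2 * O + 2 / al ^+ 2 * P * N.
have M0 : 0 <= M by rewrite addr_ge0// !mulr_ge0// ?invr_ge0 ?sqr_ge0.
have i0 : L1 Om (partial i psi) by exact: L1_cont.
suff H (k : R) : 0 < k -> k <= 1 -> `|\int[leb]_(x in Om) partial i psi x| <= k * M.
  apply/eqP; rewrite -normr_le0; apply/ler_addgt0Pr => e e0; rewrite add0r.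
  have M1 : 0 < M + 1 by rewrite ltr_wpDl.
  have d0 : 0 < Num.min 1 (e / (M + 1)) by rewrite lt_min ltr01 divr_gt0.
  have d1 : Num.min 1 (e / (M + 1)) <= 1 by rewrite ge_min lexx.
  apply: le_trans (H _ d0 d1) _; apply: le_trans (_ : e / (M + 1) * M <= _).
    by apply: ler_wpM2r => //; rewrite ge_min lexx orbT.
  by rewrite mulrAC ler_pdivrMr// ler_wpM2l ?(ltW e0)// lerDl.
move=> k0 k1.
have Wk : W0 Om (fun x => vanish k (v x)) (fun i x => dvanish k (v x) * G i x).
  apply: (W0_comp oOm bOm (h := vanish k) (dh := dvanish k) (C := 2 / k) (L := 4%:R / k ^+ 2) W) => //.
  - by move=> t; exact: vanish_derive.
  - by rewrite /vanish mul0r damp0 subrr.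
  - by rewrite divr_ge0// ltW.
  - by rewrite divr_ge0// sqr_ge0.
  - by move=> t; exact: dvanish_le.
  - by move=> s t; exact: vanish_lip.
  - by move=> s t; exact: dvanish_lip.
have [ti tGi Hw] := W0_wpair oOm bOm Wk.
have E := Hw i psi Hp.
have j1 := L1M_cont oOm bOm ti cdp; have j2 := L1M_cont oOm bOm (tGi i) cp.
have j3 : L1 Om (fun x => partial i psi x - vanish k (v x) * partial i psi x) by exact: int1B.
have -> : \int[leb]_(x in Om) partial i psi x =
    \int[leb]_(x in Om) (partial i psi x - vanish k (v x) * partial i psi x) +
    - \int[leb]_(x in Om) (dvanish k (v x) * G i x * psi x).
  by rewrite -E RintegralB// subrK.
apply: le_trans (ler_normD _ _) _; rewrite normrN /M mulrDr; apply: lerD.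
  rewrite -lee_fin; apply: le_trans (Rintegral_nint mOm j3) _.
  have c0 : 0 <= k * (P' / al ^+ 2) by rewrite mulr_ge0 ?divr_ge0 ?sqr_ge0// ltW.
  apply: le_trans (@nint_bounded _ _ _ leb Om _ (k * (P' / al ^+ 2)) mOm (int1_measurable j3) c0 _) _.
    move=> x Ox; rewrite -[X in X - _]mul1r -mulrBl /vanish opprB addrC subrK normrM (ger0_norm (ltW (damp_gt0 _))).
    have [->|dx] := eqVneq (partial i psi x) 0; first by rewrite normr0 mulr0.
    rewrite (_ : k * _ = k / al ^+ 2 * P'); last by ring.
    apply: ler_pM => //; [exact: ltW (damp_gt0 _)| |exact: pP'].
    apply: le_trans (damp_small k0 al0 (Hal x Ox (supp' x dx))) _.
    by apply: ler_wpM2r; [rewrite invr_ge0 sqr_ge0|rewrite expr2 ler_piMr// ltW].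
  rewrite -[X in (_ * X <= _)%E](fineK Of) -EFinM lee_fin.
  by have -> : k * (P' / al ^+ 2 * O) = k * (P' / al ^+ 2) * O by ring.
rewrite -lee_fin; apply: le_trans (Rintegral_nint mOm j2) _.
have c0 : 0 <= k * (2 / al ^+ 2 * P) by rewrite !mulr_ge0 ?invr_ge0 ?sqr_ge0 ?(ltW k0).
apply: (@le_trans _ _ (nint Om (fun x => k * (2 / al ^+ 2 * P) * G i x))).
  apply: nint_le => //; first exact: int1_measurable j2.
    by apply: measurable_funM; [exact: measurable_cst|exact: int1_measurable (Gi i)].
  move=> x Ox; rewrite mulrAC normrM [leRHS]normrM; apply: ler_wpM2r => //.
  rewrite normrM (ger0_norm c0).
  have [->|px] := eqVneq (psi x) 0; first by rewrite normr0 mulr0.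
  rewrite (_ : k * _ = 2 * k / al ^+ 2 * P); last by ring.
  apply: ler_pM => //; last exact: pP.
  apply: dvanish_small => //; apply: Hal => //; apply: lt_trans (supp x px) _; lra.
rewrite nintZ//; last exact: int1_measurable (Gi i).
rewrite (ger0_norm c0) -(fineK Gf) -EFinM lee_fin.
by have -> : k * (2 / al ^+ 2 * P * N) = k * (2 / al ^+ 2 * P) * N by ring.
Qed.

(* The smoothed indicator function of Om would be constant near x0, but it is 1 at x0 + t *: e
   and 0 at x0 - t *: e. *)
Lemma chart_trace x0 (r al : R) v G : 0 < r -> chart Om x0 r -> closure Om x0 -> ~ Om x0 ->
  W0 Om v G -> 0 < al -> (forall y, Om y -> `|y - x0| < r -> al <= `|v y|) -> False.
Proof.
move=> r0 [e [c [s0 [c0 s00 ch]]]] cx0 nx0 W al0 Hal.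
have e1 : 0 < `|e| + 1 by rewrite ltr_wpDl.
(* These bounds keep x0 + t e and x0 - t e within r/4 of x0 and the kernel within r/8 of its centre,
   so that all test functions live in the cube of radius r/2 about x0. *)
pose t := Num.min s0 (Num.min (r / 8%:R / (`|e| + 1)) (r / 8%:R / c)).
have t0 : 0 < t by rewrite !lt_min s00 !divr_gt0.
have ts0 : t <= s0 by rewrite ge_min lexx.
have te : `|t *: e| < r / 4%:R.
  rewrite normrZ (gtr0_norm t0).
  have : t * (`|e| + 1) <= r / 8%:R by rewrite -ler_pdivlMr// !ge_min lexx !orbT.
  by rewrite mulrDr mulr1 => h; lra.
have ct : c * t <= r / 8%:R by rewrite mulrC -ler_pdivlMr// !ge_min lexx !orbT.
have ct0 : 0 < c * t by rewrite mulr_gt0.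
have [k kk] := centered_kernel u0 ct0; have [sk ck k0 kd k1] := kk; have Hk := smooth_C1 sk.
have i1 : L1 Om (fun=> 1).
  by apply: (@int1_bounded _ _ _ leb Om (fun=> 1) 1) => // x _; rewrite normr1.
have Hf : C1 (corr Om k (fun=> 1)) by exact: C1_corr.
have dz i x : `|x - x0| < r / 4%:R -> partial i (corr Om k (fun=> 1)) x = 0.
  move=> xr; rewrite partial_corr// /corr.
  rewrite (@eq_Rintegral _ T R leb Om (partial i (fun y => k (y - x)))); last first.
    by move=> y _; rewrite partial_shift// mulr1.
  rewrite (int_partial_trace0 i W al0 Hal (C1_shift (- x) Hk) _ r0) ?oppr0// => y /kd yx.
  rewrite -(subrKA x); apply: le_lt_trans (ler_normD _ _) _; lra.
(* By the cone condition at x0 the whole cube of radius c t about x0 + t e lies in [Om]. *)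
have E1 : corr Om k (fun=> 1) (x0 + t *: e) = 1.
  transitivity (\int[leb]_y k (y - (x0 + t *: e))); last exact: (kernel_int1 (x0 + t *: e) kk).
  rewrite /corr Rintegral_mkcond; apply: eq_Rintegral => y _.
  rewrite /patch; case: ifPn => [_|/negP yO]; first by rewrite mulr1.
  apply/esym/eqP; apply: contrapT => /negP /kd h; apply: yO; rewrite inE.
  rewrite -(subrK (x0 + t *: e) y) addrC; apply: ch => //; last exact: ltW.
  by rewrite subrr normr0.
(* A point y of [Om] within c t of x0 - t e would have x0 in its cone, and then x0 would belong to
   [Om]. *)
have E0 : corr Om k (fun=> 1) (x0 - t *: e) = 0.
  rewrite /corr (@eq_Rintegral _ T R leb Om (cst 0)); first by rewrite /Rintegral integral0.
  move=> y /set_mem Oy; rewrite mulr1; apply/eqP; apply: contrapT => /negP /kd h; apply: nx0.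
  set z := y - (x0 - t *: e) in h.
  rewrite (_ : x0 = y + t *: e + - z); last first.
    by apply/rowP => l; rewrite /z !mxE; ring.
  apply: ch => //; [exact: subset_closure| |by rewrite normrN ltW].
  rewrite (_ : y - x0 = z - t *: e); last by rewrite /z opprD opprK addrA addrK.
  by apply: le_lt_trans (ler_normB _ _) _; lra.
have := cube_const Hf dz (x := x0 - t *: e) (y := x0 + t *: e).
rewrite E1 E0 => /(_ _ _)/eqP; rewrite oner_eq0 => H; apply/notF/H.
- by rewrite addrC addKr normrN.
- by rewrite addrC addKr.
Qed.

(** x0 is the point where the segment from y to z first leaves [Om]. *)
Lemma boundary_segment y z : Om y -> ~ Om z ->
  exists x0, [/\ closure Om x0, ~ Om x0 & `|y - x0| <= `|y - z|].
Proof.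
move=> Oy Oz; pose P (t : R) := y + t *: (z - y).
pose S := [set t : R | 0 <= t /\ forall s, 0 <= s -> s <= t -> Om (P s)].
have P0 : P 0 = y by rewrite /P scale0r addr0.
have P1 : P 1 = z by rewrite /P scale1r addrC subrK.
have S0 : S 0 by split => // s s0 s1; rewrite (_ : s = 0) ?P0//; apply/eqP; rewrite eq_le s0 s1.
have ubS : ubound S 1.
  move=> t [t0 tS]; rewrite leNgt; apply/negP => t1; apply: Oz; rewrite -P1; apply: tS => //; exact: ltW.
have hS : has_sup S by split; [exists 0|exists 1].
pose t0 := sup S.
have t00 : 0 <= t0 by apply: ub_le_sup => //; case: hS.
have t01 : t0 <= 1 by apply: ge_sup => //; exists 0.
have below s : 0 <= s -> s < t0 -> Om (P s).
  move=> s0 st; have [t [tp tS] stt] := sup_gt (ex_intro _ 0 S0) st.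
  by apply: tS => //; exact: ltW.
have Pd (s t : R) : `|P s - P t| = `|s - t| * `|y - z|.
  by rewrite /P opprD addrACA subrr add0r -scalerBl normrZ (distrC y).
have nO : ~ Om (P t0).
  move=> Ot; have : nbhs (P t0) Om by apply: open_nbhs_nbhs.
  move=> /nbhs_ballP[d /= d0 dO].
  have yz : 0 < `|y - z| + 1 by rewrite ltr_wpDl.
  pose w := d / (`|y - z| + 1) / 2; have w0 : 0 < w by rewrite !divr_gt0.
  have : S (t0 + w).
    split; first by rewrite addr_ge0// ltW.
    move=> s s0 sw; have [st|ts] := ltP s t0; first exact: below.
    apply: dO; rewrite -ball_normE /= Pd distrC ger0_norm ?subr_ge0//.
    apply: le_lt_trans (_ : w * `|y - z| < _); first by apply: ler_wpM2r => //; rewrite lerBlDl.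
    apply: le_lt_trans (_ : w * (`|y - z| + 1) < _); first by rewrite ler_wpM2l ?(ltW w0)// lerDl.
    rewrite /w mulrAC divfK ?gt_eqF//; lra.
  have ub : has_ubound S by case: hS.
  by move=> /(ub_le_sup ub); rewrite -/t0 gerDl leNgt w0.
exists (P t0); split => //; last first.
  by rewrite -{1}P0 Pd sub0r normrN ger0_norm// ler_piMl.
move=> B /nbhs_ballP[d /= d0 dB].
have tp : 0 < t0 by rewrite lt_neqAle t00 andbT; apply/eqP => h; apply: nO; rewrite -h P0.
have yz : 0 < `|y - z| + 1 by rewrite ltr_wpDl.
pose w := Num.min t0 (d / (`|y - z| + 1) / 2); have w0 : 0 < w by rewrite lt_min tp !divr_gt0.
exists (P (t0 - w)); split.
  by apply: below; [rewrite subr_ge0 ge_min lexx|rewrite gtrBl].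
apply: dB; rewrite -ball_normE /= Pd opprB addrCA subrr addr0 ger0_norm ?(ltW w0)//.
apply: le_lt_trans (_ : d / (`|y - z| + 1) / 2 * (`|y - z| + 1) < _).
  by apply: ler_pM => //; [exact: ltW|rewrite ge_min lexx orbT|rewrite lerDl].
rewrite mulrAC divfK ?gt_eqF//; lra.
Qed.

(** If |v(y)| > K |y - x0|^g for a boundary point x0, Hölder continuity keeps |v| away from 0 near
    x0, against [chart_trace]. For z outside [Om] the segment from y to z meets the boundary at a
    point no farther from y than z. *)
Lemma holder_zero_ext v G (g H : R) : 0 < g -> g <= 1 -> W0 Om v G ->
  (forall x y, Om x -> Om y -> `|v x - v y| <= H * `|x - y| `^ g) ->
  (forall x, ~ Om x -> v x = 0) ->
  (forall x0, closure Om x0 -> exists2 r : R, 0 < r & chart Om x0 r) -> holderV g v.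
Proof.
move=> g0 g1 W vH v0 ch; pose K := `|H|; have K0 : 0 <= K by exact: normr_ge0.
have vK x y : Om x -> Om y -> `|v x - v y| <= K * `|x - y| `^ g.
  by move=> Ox Oy; apply: le_trans (vH x y Ox Oy) _; apply: ler_wpM2r; [exact: powR_ge0|exact: ler_norm].
have A x0 y : closure Om x0 -> ~ Om x0 -> Om y -> `|v y| <= K * `|y - x0| `^ g.
  move=> cx nx Oy; rewrite leNgt; apply/negP => hv.
  pose al := (`|v y| - K * `|y - x0| `^ g) / 2; have al0 : 0 < al by rewrite divr_gt0// subr_gt0.
  have [r r0 chr] := ch x0 cx.
  have K1 : 0 < K + 1 by rewrite ltr_wpDl.
  (* Within rho of x0 the Hölder bound loses at most al, which is half of the excess, so that |v| >=
     al remains. *)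
  pose rho := Num.min r ((al / (K + 1)) `^ g^-1).
  have rho0 : 0 < rho by rewrite lt_min r0 powR_gt0// divr_gt0.
  apply: (chart_trace rho0 (chart_le _ chr) cx nx W al0); first by rewrite ge_min lexx.
  move=> y' Oy' yr; have yr2 : `|y' - x0| `^ g <= al / (K + 1).
    have -> : al / (K + 1) = ((al / (K + 1)) `^ g^-1) `^ g.
      by rewrite -powRrM mulVf ?(lt0r_neq0 g0)// powRr1// divr_ge0// ltW.
    apply: ge0_ler_powR; rewrite ?nnegrE ?powR_ge0 ?(ltW g0)//.
    by apply/ltW/(lt_le_trans yr); rewrite ge_min lexx orbT.
  have h1 : K * `|y' - x0| `^ g <= al.
    apply: le_trans (ler_wpM2l K0 yr2) _; rewrite mulrA ler_pdivrMr// mulrC.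
    by apply: ler_wpM2l; [exact: ltW|rewrite lerDl].
  have h2 : `|y - y'| `^ g <= `|y - x0| `^ g + `|y' - x0| `^ g.
    apply: le_trans (powR_subadd g0 g1 (normr_ge0 _) (normr_ge0 _)).
    apply: ge0_ler_powR; rewrite ?nnegrE ?addr_ge0 ?(ltW g0)//.
    by rewrite -(subrKA x0 y) [X in _ <= _ + X]distrC ler_normD.
  have := vK y y' Oy Oy'; have := ler_wpM2l K0 h2; move: h1.
  have : `|v y| - `|v y'| <= `|v y - v y'| by apply: lerB_dist.
  have E : 2 * al = `|v y| - K * `|y - x0| `^ g by rewrite /al mulrC divfK.
  by rewrite mulrDr => i1 i2 i3 i4; exact: trace_arith E i1 i2 i3 i4.
have B y z : Om y -> ~ Om z -> `|v y| <= K * `|y - z| `^ g.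
  move=> Oy Oz; have [x0 [cx nx yx]] := boundary_segment Oy Oz.
  apply: le_trans (A x0 y cx nx Oy) _; apply: ler_wpM2l; first exact: K0.
  by apply: ge0_ler_powR; rewrite ?nnegrE ?(ltW g0).
exists K => // x y; have [Ox|Ox] := pselect (Om x); have [Oy|Oy] := pselect (Om y).
- exact: vK.
- by rewrite (v0 y Oy) subr0; exact: B.
- by rewrite (v0 x Ox) sub0r normrN distrC; exact: B.
- by rewrite !v0// subrr normr0 mulr_ge0 ?powR_ge0.
Qed.

End Trace.

(** * Charts of Lipschitz domains *)

Section LipschitzCharts.
Context {R : realType} {n : nat}.
Local Notation V := 'rV[R]_n.+1.
Implicit Types (Om : set V) (x y z : V) (i : 'I_n.+1).

Lemma lipschitz_bound m (g : 'rV[R]_m -> R^o) : lipschitz g ->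
  exists2 L : R, 0 <= L & forall x y : 'rV[R]_m, `|g x - g y| <= L * `|x - y|.
Proof.
move=> [M [_ HM]]; exists (`|M| + 1); first by rewrite addr_ge0.
move=> x y; have h : M < `|M| + 1 by rewrite (le_lt_trans (ler_norm _))// ltrDl.
by have := HM _ h (x, y); apply.
Qed.

Lemma mulmx_bound (Q : 'M[R]_n.+1) : exists2 D : R, 0 <= D & forall z, `|z *m Q| <= D * `|z|.
Proof.
have S0 j : 0 <= \sum_i `|Q i j| by apply: sumr_ge0.
exists (\sum_j \sum_i `|Q i j|); first by apply: sumr_ge0.
move=> z; apply: rV_norm_le => [|j]; first by rewrite mulr_ge0// sumr_ge0.
rewrite mxE; apply: le_trans (ler_norm_sum _ _ _) _.
apply: (@le_trans _ _ ((\sum_i `|Q i j|) * `|z|)).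
  rewrite mulr_suml; apply: ler_sum => i _; rewrite normrM mulrC ler_wpM2l//.
  exact: coord_le_norm.
rewrite ler_wpM2r// [leRHS](bigD1 j)//= lerDl; exact: sumr_ge0.
Qed.

Let chart_arith (A B ga gb Y Z t : R) :
  ga - gb <= A -> - B <= Z -> gb < Y -> A + B <= t -> ga < Y + t + Z.
Proof. by lra. Qed.

(** e is the vertical direction of the local coordinates. Moving up by t raises a point above the
    graph by t, which exceeds the effect of a perturbation of size c t both on the height and,
    through the Lipschitz constant, on the graph. *)
Lemma lipschitz_chart Om : open Om -> lipschitz_boundary Om ->
  forall x0, closure Om x0 -> exists2 r : R, 0 < r & chart Om x0 r.
Proof.
move=> oOm lb x0 cx0; have [Ox0|nx0] := pselect (Om x0).
  have : nbhs x0 Om by apply: open_nbhs_nbhs.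
  move=> /nbhs_ballP[d /= d0 dO]; have d2 : 0 < d / 2 by rewrite divr_gt0.
  (* At an interior point of [Om] no shift is necessary. *)
  exists (d / 2) => //; exists 0, 1, (d / 2); split => // x t z _ xd t0 td zt.
  rewrite scaler0 addr0; apply: dO; rewrite -ball_normE /= distrC addrAC.
  by apply: le_lt_trans (ler_normD _ _) _; move: zt; rewrite mul1r; lra.
have [Q [g [r [QQ lg r0 HQ]]]] := lb x0 (conj cx0 nx0).
have [L L0 gL] := lipschitz_bound lg; have [D D0 QD] := mulmx_bound Q.
pose em : V := delta_mx ord0 ord_max; pose e := em *m Q^T.
have eQ : e *m Q = em by rewrite /e -mulmxA (mulmx1C QQ) mulmx1.
have N0 : 0 < n.+1%:R :> R by rewrite ltr0n.
pose r' := r / n.+1%:R; have r'0 : 0 < r' by rewrite divr_gt0.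
(* The perturbation below has norm at most 2 c t, its image under Q at most 2 D c t, and the total
   loss is (L + 1) D 2 c t <= t. *)
pose c := (2 * (L + 1) * (D + 1))^-1.
have L1 : 0 < L + 1 by rewrite ltr_wpDl.
have D1 : 0 < D + 1 by rewrite ltr_wpDl.
have LD : 0 < 2 * (L + 1) * (D + 1) by rewrite !mulr_gt0.
have c0 : 0 < c by rewrite invr_gt0.
have ec : 0 < `|e| + c by rewrite ltr_wpDl.
pose s0 := r' / 2 / (`|e| + c); have s00 : 0 < s0 by rewrite !divr_gt0.
have r'2 : 0 < r' / 2 by rewrite divr_gt0.
exists (r' / 2) => //; exists e, c, s0; split => // x t z cx xr t0 ts zt.
have ct0 : 0 < c * t by rewrite mulr_gt0.
have tec : t * `|e| + c * t <= r' / 2.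
  by rewrite [c * t]mulrC -mulrDr -ler_pdivlMr.
(* The point x is only in the closure, whereas the strict graph inequality is available on [Om]. It
   is replaced by a point of [Om] at distance less than c t, and the error joins the perturbation
   z. *)
have [x' [Ox' xx']] := cx _ (nbhsx_ballx x (c * t) ct0).
move: xx'; rewrite -ball_normE /= => xx'.
have inball y : `|y - x0| < r' -> eball x0 r y.
  by move=> /enorm_lt; rewrite /eball /= /r' mulrC divfK// gt_eqF.
have te0 : 0 <= t * `|e| by rewrite mulr_ge0// ltW.
have Bx' : eball x0 r x'.
  apply: inball; rewrite -(subrKA x); apply: le_lt_trans (ler_normD _ _) _.
  by rewrite distrC; lra.
set w := x + t *: e + z.
have Bw : eball x0 r w.
  apply: inball; have -> : w - x0 = (x - x0) + (t *: e + z) by apply/rowP => l; rewrite /w !mxE; ring.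
  apply: le_lt_trans (ler_normD _ _) _.
  have := ler_normD (t *: e) z; rewrite normrZ (gtr0_norm t0); lra.
have /(HQ _ Bx') /= h := Ox'; apply/(HQ _ Bw) => /=.
pose z' := z + (x - x').
have z'n : `|z'| <= 2 * (c * t).
  by apply: le_trans (ler_normD _ _) _; lra.
have Dz : `|z' *m Q| <= D * (2 * (c * t)) by apply: le_trans (QD z') _; apply: ler_wpM2l.
have -> : (w - x0) *m Q = (x' - x0) *m Q + t *: em + z' *m Q.
  rewrite -eQ scalemxAl -!mulmxDl; congr (_ *m _); apply/rowP => l; rewrite !mxE; ring.
set y := (x' - x0) *m Q in h *; set Z := z' *m Q in Dz *.
have -> : (y + t *: em + Z) ord0 ord_max = y ord0 ord_max + t + Z ord0 ord_max.
  by rewrite !mxE !eqxx mulr1.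
have Zm : `|Z ord0 ord_max| <= D * (2 * (c * t)) by apply: le_trans Dz; exact: coord_le_norm.
have gd : `|g (col' ord_max (y + t *: em + Z)) - g (col' ord_max y)| <= L * (D * (2 * (c * t))).
  apply: le_trans (gL _ _) _; apply: ler_wpM2l => //; apply: le_trans _ Dz.
  rewrite [leLHS]mx_normrE; apply/bigmax_leP; split => // -[j i] _ /=.
  rewrite (ord1 j) !mxE [lift _ _ == _]eq_sym (negbTE (neq_lift _ _)) andbF mulr0 addr0 addrAC subrr add0r.
  by have := coord_le_norm Z (lift ord_max i); rewrite /Z mxE.
have key : (L + 1) * (D * (2 * (c * t))) <= t.
  have : (2 * (L + 1) * (D + 1)) * (c * t) = t by rewrite mulrA mulfV ?mul1r// gt_eqF.
  have := mulr_gt0 L1 ct0; nra.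
move: gd Zm h key; rewrite !ler_norml => /andP[_ g2] /andP[z1 _].
rewrite mulrDl mul1r => i3 i4; exact: chart_arith g2 z1 i3 i4.
Qed.

Lemma finite_charts Om : compact (closure Om) ->
  (forall x0, closure Om x0 -> exists2 r : R, 0 < r & chart Om x0 r) ->
  exists l : seq (V * R), (forall c, c \in l -> 0 < c.2 /\ chart Om c.1 c.2) /\
    forall x, Om x -> exists2 c, c \in l & `|x - c.1| < c.2 / 2.
Proof.
rewrite compact_cover => cO ch.
pose D : set (V * R) := [set c | 0 < c.2 /\ chart Om c.1 c.2].
have [||l lD lO] := cO (V * R)%type D (fun c => ball c.1 (c.2 / 2)).
- by move=> c [c0 _]; apply: ball_open; rewrite divr_gt0.
- move=> x /ch[r r0 cr]; exists (x, r) => //=.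
  by apply: ballxx; rewrite divr_gt0.
exists (finmap.enum_fset l); split; first by move=> c /lD /set_mem.
move=> x /subset_closure /lO [c cl]; rewrite -ball_normE /= distrC => xc.
by exists c.
Qed.

End LipschitzCharts.

(** * Convergence of the energies *)

Section EuclideanNorm.
Context {R : realType} {n : nat}.
Local Notation V := 'rV[R]_n.+1.
Implicit Types (x y : V).

(** Multiply by |x| + |y|: the difference of squares is the sum of (x_i - y_i)(x_i + y_i), and |x_i
    + y_i| <= |x| + |y|. *)
Lemma enorm_dist x y : `|enorm x - enorm y| <= \sum_i `|x ord0 i - y ord0 i|.
Proof.
have S0 : 0 <= \sum_i `|x ord0 i - y ord0 i| by apply: sumr_ge0.
have x0 := enorm_ge0 x; have y0 := enorm_ge0 y.
have [xy0|xyn] := eqVneq (enorm x + enorm y) 0.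
  have -> : enorm x = 0 by lra.
  have -> : enorm y = 0 by lra.
  by rewrite subrr normr0.
have xy : 0 < enorm x + enorm y by rewrite lt_neqAle eq_sym xyn addr_ge0.
have sq (z : V) : enorm z ^+ 2 = \sum_i z ord0 i ^+ 2.
  by rewrite sqr_sqrtr//; apply: sumr_ge0 => i _; exact: sqr_ge0.
rewrite -(ler_pM2r xy) -{1}(ger0_norm (ltW xy)) -normrM -subr_sqr !sq -sumrB mulr_suml.
apply: le_trans (ler_norm_sum _ _ _) _; apply: ler_sum => i _.
rewrite subr_sqr normrM ler_wpM2l//; apply: le_trans (ler_normD _ _) _.
by apply: lerD; exact: coord_le_enorm.
Qed.

End EuclideanNorm.

(** * Continuity of powers with a small relative error *)

Section PowerContinuity.
Context {R : realType}.

(** For the lower bound: A < (1 - eta) B would give B < (1 - eta^2) B. *)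
Let close_arith (eta A B D : R) : 0 < eta -> 0 <= B -> 0 <= D -> A <= (1 + eta) * B ->
  B <= (1 + eta) * A -> `|A - B| <= eta * B + D.
Proof.
move=> e0 B0 D0 h1 h2; rewrite ler_norml; apply/andP; split; last by lra.
rewrite leNgt; apply/negP => h.
have h3 : A < (1 - eta) * B by lra.
have e1 : 0 < 1 + eta by lra.
have := mulr_ge0 (sqr_ge0 eta) B0; have : (1 + eta) * A < (1 + eta) * ((1 - eta) * B) by rewrite ltr_pM2l.
by rewrite expr2; lra.
Qed.

(** Let c^q = 1 + eta. If |s - t| is at most (1 - 1/c) t, then s and t agree up to the factor c and
    their powers up to 1 + eta. Otherwise both are at most a multiple of |s - t|. The constant [B]
    serves all exponents up to q. *)
Lemma powR_close (q eta : R) : 1 <= q -> 0 < eta -> exists2 B : R, 0 <= B &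
  forall r s t : R, 0 <= r -> r <= q -> 0 <= s -> 0 <= t ->
    `|s `^ r - t `^ r| <= eta * t `^ r + B * `|s - t| `^ r.
Proof.
move=> q1 e0; have q0 : 0 < q by apply: lt_le_trans q1.
have e1 : 0 < 1 + eta by rewrite addr_gt0.
pose c := (1 + eta) `^ q^-1.
have cq : c `^ q = 1 + eta by rewrite /c -powRrM mulVf ?gt_eqF// powRr1// ltW.
have c1 : 1 < c.
  rewrite /c (gt0_expR e1) powR_expR -{1}expR0 ltr_expR mulr_gt0 ?invr_gt0// ln_gt0//.
  by rewrite ltrDl.
have c0 : 0 < c by apply: lt_trans c1.
pose d := 1 - c^-1; have d0 : 0 < d by rewrite subr_gt0 invf_lt1.
pose K := 1 + d^-1; have K1 : 1 <= K by rewrite lerDl invr_ge0 ltW.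
have K0 : 0 <= K by apply: le_trans K1.
exists (K `^ q); first exact: powR_ge0.
move=> r s t r0 rq s0 t0; have D0 : 0 <= K `^ q * `|s - t| `^ r by rewrite mulr_ge0 ?powR_ge0.
have mono (x y : R) : 0 <= x -> x <= y -> x `^ r <= y `^ r.
  by move=> x0 xy; apply: ge0_ler_powR; rewrite ?nnegrE ?(le_trans x0 xy).
have [h|h] := leP `|s - t| (d * t).
  have cc x y : 0 <= x -> 0 <= y -> x <= c * y -> x `^ r <= (1 + eta) * y `^ r.
    move=> x0 y0 xy; apply: le_trans (mono _ _ x0 xy) _.
    rewrite powRM ?(ltW c0)//; apply: ler_wpM2r; first exact: powR_ge0.
    by rewrite -cq; apply: ler_powR => //; exact: ltW.
  have cV : c * c^-1 = 1 by rewrite mulfV// gt_eqF.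
  (* This turns s <= (2 - 1/c) t into s <= c t. *)
  have cV2 : 2 <= c + c^-1.
    have : 0 <= c^-1 * (c - 1) ^+ 2 by rewrite mulr_ge0 ?sqr_ge0// invr_ge0 ltW.
    have -> : c^-1 * (c - 1) ^+ 2 = c * (c * c^-1) - 2 * (c * c^-1) + c^-1 by rewrite expr2; ring.
    by rewrite cV; lra.
  move: h; rewrite ler_norml /d => /andP[h1 h2].
  apply: close_arith => //; first exact: powR_ge0.
    by apply: cc => //; have := ler_wpM2r t0 cV2; lra.
  apply: cc => //; have : c * (c^-1 * t) <= c * s by rewrite ler_pM2l//; lra.
  by rewrite mulrA cV mul1r.
have tK : t <= K * `|s - t|.
  have : d^-1 * (d * t) <= d^-1 * `|s - t| by rewrite ler_pM2l ?invr_gt0// ltW.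
  rewrite mulKf ?gt_eqF// /K mulrDl mul1r; have := normr_ge0 (s - t); lra.
have sK : s <= K * `|s - t|.
  have : d^-1 * (d * t) <= d^-1 * `|s - t| by rewrite ler_pM2l ?invr_gt0// ltW.
  rewrite mulKf ?gt_eqF// /K mulrDl mul1r; have := ler_norm (s - t); lra.
have big x : 0 <= x -> x <= K * `|s - t| -> x `^ r <= K `^ q * `|s - t| `^ r.
  move=> x0 /(mono _ _ x0)/le_trans; apply; rewrite powRM//.
  by apply: ler_wpM2r; [exact: powR_ge0|exact: ler_powR].
have := big s s0 sK; have := big t t0 tK; have := powR_ge0 s r; have := powR_ge0 t r.
have : 0 <= eta * t `^ r by rewrite mulr_ge0 ?powR_ge0// ltW.
rewrite ler_norml; move: (s `^ r) (t `^ r) (eta * _) (K `^ q * _) => A B X D *.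
by apply/andP; split; lra.
Qed.

End PowerContinuity.

(** * From approximability to convergence of the energies *)

Section ApproximatingSequence.
Context {R : realType} {n : nat}.
Local Notation V := 'rV[R]_n.+1.
Local Notation T := (leb_space R n).
Local Notation leb := (@leb R n).
Local Notation nint := (nint leb).
Implicit Types (f g h v : V -> R) (G : 'I_n.+1 -> V -> R) (x y : V) (i : 'I_n.+1).

Variable Om : set V.
Hypotheses (oOm : open Om) (bOm : bounded_set Om) (u0 : 0 < @uvol R n).
Variables (p q : R) (a : V -> R).
Hypotheses (p1 : 1 <= p) (pq : p <= q) (ai : L1 Om a) (a0 : forall x, Om x -> 0 <= a x).
Local Notation modular := (modular Om p q a).
Local Notation ph := (phase p q a).
Local Notation approximable := (approximable Om p q a).

Let mOm : measurable (Om : set T). Proof. exact: measurable_open. Qed.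
Let p0 : 0 < p. Proof. exact: lt_le_trans p1. Qed.
Let q1 : 1 <= q. Proof. exact: le_trans pq. Qed.
Let ma : measurable_fun (Om : set T) a. Proof. exact: int1_measurable ai. Qed.

Definition density x (s : R) : R := s `^ p + a x * s `^ q.

Lemma density_ge0 x s : Om x -> 0 <= density x s.
Proof. by move=> Ox; rewrite addr_ge0 ?powR_ge0// mulr_ge0 ?powR_ge0// a0. Qed.

Lemma measurable_density f : measurable_fun (Om : set T) f ->
  measurable_fun (Om : set T) (fun x => density x (f x)).
Proof.
move=> mf; have mr (r : R) : measurable_fun (Om : set T) (fun x => f x `^ r).
  exact: measurableT_comp (measurable_powR _) mf.
by apply: measurable_funD; [exact: mr|exact: measurable_funM].
Qed.

Lemma density_close (eta : R) : 0 < eta -> exists2 B : R, 0 <= B & forall x s t, Om x -> 0 <= s -> 0 <= t ->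
  `|density x s - density x t| <= eta * density x t + B * ph x `|s - t|.
Proof.
move=> e0; have [B B0 H] := powR_close q1 e0; exists B => // x s t Ox s0 t0.
have h1 := H p s t (ltW p0) pq s0 t0.
have h2 := H q s t (le_trans ler01 q1) (lexx q) s0 t0.
rewrite /density (_ : _ - _ = (s `^ p - t `^ p) + a x * (s `^ q - t `^ q)); last by ring.
apply: le_trans (ler_normD _ _) _; rewrite normrM (ger0_norm (a0 Ox)).
have := ler_wpM2l (a0 Ox) h2; have : 0 <= B * `|s - t| by rewrite mulr_ge0.
rewrite /phase; lra.
Qed.

Lemma nint_sum_le (F : 'I_n.+1 -> V -> R) (e : R) : (forall i, measurable_fun (Om : set T) (F i)) ->
  (forall i, nint Om (F i) <= e%:E)%E -> (nint Om (fun x => \sum_i `|F i x|)%R <= (n.+1%:R * e)%:E)%E.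
Proof.
move=> mF Fe; have -> : nint Om (fun x => \sum_i `|F i x|) = (\sum_i nint Om (F i))%E.
  rewrite -ge0_integral_sum//; last by move=> i; apply: measurable_normE.
  by apply: eq_integral => x _; rewrite sumEFin ger0_norm// sumr_ge0.
apply: le_trans (_ : (\sum_(i < n.+1) e%:E <= _)%E); first by apply: lee_sum => i _; exact: Fe.
by rewrite sumEFin lee_fin sumr_const card_ord mulr_natl.
Qed.

(** The sum is at most N times its largest term, and the integrand at the largest term is at most
    the sum of the integrands. *)
Lemma modular_sum_le (F : 'I_n.+1 -> V -> R) (e : R) : (forall i, measurable_fun (Om : set T) (F i)) ->
  (forall i, modular (F i) <= e%:E)%E ->
  (modular (fun x => \sum_i `|F i x|)%R <= (n.+1%:R `^ q * (n.+1%:R * e))%:E)%E.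
Proof.
move=> mF Fe; have mph i := measurable_phase p q ai (mF i).
have Nq : 0 <= n.+1%:R `^ q :> R by exact: powR_ge0.
have mS : measurable_fun (Om : set T) (fun x => \sum_i `|ph x `|F i x| |).
  by apply: measurable_sum => i; exact: measurable_norm.
have mSF : measurable_fun (Om : set T) (fun x => \sum_i `|F i x|).
  by apply: measurable_sum => i; exact: measurable_norm.
apply: (@le_trans _ _ (nint Om (fun x => n.+1%:R `^ q * \sum_i `|ph x `|F i x| |)%R)); last first.
  rewrite nintZ// (ger0_norm Nq) EFinM; apply: lee_wpmul2l => //.
  exact: nint_sum_le.
apply: nint_le => //; first exact: measurable_phase.
  by apply: measurable_funM => //; exact: measurable_cst.
move=> x Ox; have S0 : 0 <= \sum_i `|F i x| by apply: sumr_ge0.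
have PS : 0 <= \sum_i `|ph x `|F i x| | by apply: sumr_ge0.
rewrite (phase_norm p q a0 _ Ox) (ger0_norm S0) (ger0_norm (mulr_ge0 Nq PS)).
have [j _ jm] := @Order.TotalTheory.arg_maxP _ _ 'I_n.+1 ord0 xpredT (fun i => `|F i x|) isT.
have Sj : \sum_i `|F i x| <= n.+1%:R * `|F j x|.
  rewrite mulr_natl -[X in _ *+ X]card_ord -sumr_const; apply: ler_sum => i _; exact: jm.
apply: le_trans (phase_le p1 pq a0 Ox S0 Sj) _.
have N1 : 1 <= n.+1%:R :> R by rewrite ler1n.
apply: le_trans (phase_scale a p1 pq Ox N1 (normr_ge0 _)) _.
apply: ler_wpM2l => //; rewrite (bigD1 j)//= -[leLHS]addr0; apply: lerD; first exact: ler_norm.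
exact: sumr_ge0.
Qed.

Lemma fine_dist (A B : \bar R) (e : R) : A \is a fin_num -> B \is a fin_num ->
  (A <= e%:E + B)%E -> (B <= e%:E + A)%E -> `|fine A - fine B| <= e.
Proof.
move=> Af Bf; rewrite -{1 2}(fineK Af) -{1 2}(fineK Bf) -!EFinD !lee_fin => h1 h2.
by rewrite ler_distl; apply/andP; split; lra.
Qed.

Lemma near_div_succ (C e : R) : 0 <= C -> 0 < e -> \forall k \near \oo, C * k.+1%:R^-1 <= e.
Proof.
move=> C0 e0; near=> k; rewrite ler_pdivrMr ?ltr0n// mulrC -ler_pdivrMr//.
apply: (@le_trans _ _ k%:R); last by rewrite ler_nat.
near: k; exact: nbhs_infty_ger.
Unshelve. all: by end_near. Qed.

Lemma double_phaseE v : double_phase p q a Om v = nint Om (fun x => density x (enorm (wgrad Om v x))).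
Proof. by apply: eq_integral => x /set_mem Ox; rewrite ger0_norm// density_ge0. Qed.

Lemma approximable_sequence u : W11_0 Om u -> (double_phase p q a Om u < +oo)%E ->
  approximable u (fun i x => wgrad Om u x ord0 i) ->
  exists un : nat -> V -> R,
    [/\ forall k, Ccinfty Om (un k),
        double_phase p q a Om (un k) @[k --> \oo] --> double_phase p q a Om u &
        W11_norm Om (fun x => u x - un k x) @[k --> \oo] --> 0%E].
Proof.
move=> hu hF A; have [vi Gi _] := W11_0_W0 oOm bOm u0 hu.
have [[_ exG] _] := hu; have wu := wgrad_weak exG.
have e0 k : 0 < k.+1%:R^-1 :> R by rewrite invr_gt0 ltr0n.
have [un Hun] := choice (fun k => A _ (e0 k)).
have cun k : Ccinfty Om (un k) by have [] := Hun k.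
have nun k : (nint Om (fun x => u x - un k x)%R <= (k.+1%:R^-1)%:E)%E by have [] := Hun k.
pose D k i x := wgrad Om u x ord0 i - partial i (un k) x.
have Dun k i : (modular (D k i) <= (k.+1%:R^-1)%:E)%E by case: (Hun k) => _ _; exact.
have mG i : measurable_fun (Om : set T) (fun x => wgrad Om u x ord0 i) by exact: int1_measurable (Gi i).
have mD k i : measurable_fun (Om : set T) (D k i).
  apply: measurable_funB => //; apply: cont_measurable => //.
  exact: C1_partial (smooth_C1 (cun k).1).
have iun k : L1 Om (un k) by apply: L1_cont => //; exact: C1_cont (smooth_C1 (cun k).1).
have wun k := Ccinfty_weak oOm bOm (cun k).
have aun k := wgrad_ae oOm bOm u0 (iun k) (wun k).
have mSD k : measurable_fun (Om : set T) (fun x => \sum_i `|D k i x|).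
  by apply: measurable_sum => i; exact: measurable_norm.
have SD0 k x : 0 <= \sum_i `|D k i x| by apply: sumr_ge0.
have mwg v : (exists F, is_weak_gradient Om v F) -> measurable_fun (Om : set T) (fun x => enorm (wgrad Om v x)).
  move=> ex; apply: measurable_enorm => i; have [h _] := wgrad_weak ex i; exact: int1_measurable h.
have N0 : 0 <= n.+1%:R :> R by rewrite ler0n.
exists un; split => //.
- pose P x := enorm (wgrad Om u x); pose Q k x := enorm (wgrad Om (un k) x).
  have mP : measurable_fun (Om : set T) P by exact: mwg.
  have mQ k : measurable_fun (Om : set T) (Q k) by apply: mwg; exists (fun x => \row_i partial i (un k) x).
  have dQ k : (modular (fun x => Q k x - P x)%R <= (n.+1%:R `^ q * (n.+1%:R * k.+1%:R^-1))%:E)%E.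
    apply: le_trans (modular_sum_le (mD k) (Dun k)).
    apply: (modular_le_ae oOm p1 pq ai a0); [by apply: measurable_funB; [exact: mQ|exact: mP]|exact: mSD|].
    move: (aun k); apply: ae_imp => x E Ox; rewrite (ger0_norm (SD0 k x)) distrC /Q (E Ox).
    by apply: le_trans (enorm_dist _ _) _; apply: ler_sum => i _; rewrite mxE.
  rewrite double_phaseE in hF *; set F := nint Om _ in hF *.
  have FE : F = (fine F)%:E by rewrite fineK// nint_fin_num.
  have f0 : 0 <= fine F by rewrite fine_ge0// nint_ge0.
  have mdens h : measurable_fun (Om : set T) h -> measurable_fun (Om : set T) (fun x => density x (h x)).
    exact: measurable_density.
  have diff (e : R) : 0 < e -> \forall k \near \oo,
      (nint Om (fun x => density x (Q k x) - density x (P x))%R <= e%:E)%E.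
    move=> ep; have F1 : 0 < fine F + 1 by rewrite ltr_wpDl.
    (* Dividing by the energy plus 1 makes the first error at most e / 2 and avoids division by
       zero. *)
    have eta0 : 0 < e / 2 / (fine F + 1) by rewrite !divr_gt0.
    have [B B0 HB] := density_close eta0.
    have C0 : 0 <= B * (n.+1%:R `^ q * n.+1%:R) by rewrite !mulr_ge0 ?powR_ge0.
    have e2 : 0 < e / 2 by rewrite divr_gt0.
    near=> k; have hk : B * (n.+1%:R `^ q * n.+1%:R) * k.+1%:R^-1 <= e / 2.
      by near: k; exact: near_div_succ.
    set eta := e / 2 / (fine F + 1) in eta0 HB *.
    have m1 : measurable_fun (Om : set T) (fun x => eta * density x (P x)).
      by apply: measurable_funM; [exact: measurable_cst|exact: mdens].
    have mph : measurable_fun (Om : set T) (fun x => ph x `|Q k x - P x|).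
      exact: (measurable_phase p q ai (measurable_funB (mQ k) mP)).
    have m2 : measurable_fun (Om : set T) (fun x => B * ph x `|Q k x - P x|).
      by apply: measurable_funM; [exact: measurable_cst|].
    apply: (@le_trans _ _ (nint Om (fun x => eta * density x (P x) + B * ph x `|Q k x - P x|)%R)).
      apply: nint_le; [exact: mOm|exact: measurable_funB (mdens _ (mQ k)) (mdens _ mP)|exact: measurable_funD m1 m2|].
      move=> x Ox; apply: le_trans (ler_norm _); apply: HB => //; exact: enorm_ge0.
    apply: le_trans (nint_add oOm m1 m2) _; rewrite !nintZ//; last exact: mdens.
    rewrite (gtr0_norm eta0) (ger0_norm B0).
    have := lee_wpmul2l (_ : (0 <= B%:E)%E) (dQ k); rewrite lee_fin => /(_ B0) h2.
    apply: le_trans (leeD (lexx _) h2) _; rewrite -/F FE -!EFinM -EFinD lee_fin.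
    have : eta * fine F <= e / 2.
      apply: (@le_trans _ _ (eta * (fine F + 1))); first by rewrite ler_wpM2l ?(ltW eta0)// lerDl.
      by rewrite /eta divfK// gt_eqF.
    have -> : B * (n.+1%:R `^ q * (n.+1%:R * k.+1%:R^-1)) = B * (n.+1%:R `^ q * n.+1%:R) * k.+1%:R^-1 by rewrite !mulrA.
    by move=> h3; rewrite [leRHS]splitr; apply: lerD.
  pose dk k := nint Om (fun x => density x (Q k x) - density x (P x)).
  have tri k : (nint Om (fun x => density x (Q k x)) <= dk k + F)%E.
    apply: le_trans (nint_add oOm (measurable_funB (mdens _ (mQ k)) (mdens _ mP)) (mdens _ mP)).
    rewrite le_eqVlt; apply/orP; left; apply/eqP; apply: eq_nint => x _.
    by rewrite subrK.
  have tri' k : (F <= dk k + nint Om (fun x => density x (Q k x)))%E.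
    have -> : dk k = nint Om (fun x => density x (P x) - density x (Q k x)) by exact: nint_dist.
    apply: le_trans (nint_add oOm (measurable_funB (mdens _ mP) (mdens _ (mQ k))) (mdens _ (mQ k))).
    rewrite le_eqVlt; apply/orP; left; apply/eqP; apply: eq_nint => x _.
    by rewrite subrK.
  under eq_fun do rewrite double_phaseE -/(Q _).
  rewrite FE; apply/fine_cvgP; split.
    near=> k; apply: nint_fin_num; apply: le_lt_trans (tri k) _; apply: lte_add_pinfty => //.
    apply: (@le_lt_trans _ _ 1%:E); last exact: ltry.
    by near: k; exact: diff.
  apply/cvgrPdist_le => e ep; near=> k.
  have dke : (dk k <= e%:E)%E by near: k; exact: diff.
  have Kf : nint Om (fun x => density x (Q k x)) \is a fin_num.
    by apply: nint_fin_num; apply: le_lt_trans (tri k) _; apply: lte_add_pinfty => //; apply: le_lt_trans dke _; exact: ltry.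
  have Ff : F \is a fin_num by rewrite FE.
  have h1 := le_trans (tri' k) (leeD dke (lexx _)).
  have h2 := le_trans (tri k) (leeD dke (lexx _)).
  exact: (fine_dist Ff Kf h1 h2).
apply: cvge0P => [k|e ep].
  by apply: adde_ge0; apply: integral_ge0 => x _; rewrite lee_fin// enorm_ge0.
near=> k; apply: (@le_trans _ _ ((1 + n.+1%:R) * k.+1%:R^-1)%:E); last first.
  by rewrite lee_fin; near: k; apply: near_div_succ => //; rewrite addr_ge0.
rewrite mulrDl mul1r EFinD; apply: leeD; first exact: nun.
have wd := is_weak_gradientB oOm bOm vi (iun k) wu (wun k).
have di : L1 Om (fun x => u x - un k x) by exact: (int1B mOm vi (iun k)).
have ae := wgrad_ae oOm bOm u0 di wd.
have mw := mwg _ (ex_intro _ _ wd).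
apply: (@le_trans _ _ (nint Om (fun x => \sum_i `|D k i x|)%R)); last first.
  apply: nint_sum_le => // i; apply: le_trans (Dun k i); exact: (nint_le_md oOm p q ai a0).
rewrite (_ : (\int[leb]_(x in Om) _)%E = nint Om (fun x => enorm (wgrad Om (fun x => u x - un k x) x))); last first.
  by apply: eq_integral => x _; rewrite ger0_norm// enorm_ge0.
apply: nint_le_ae; [exact: mOm|exact: mw|exact: mSD|]; move: ae; apply: ae_imp => x E Ox.
rewrite (ger0_norm (SD0 k x)) (ger0_norm (enorm_ge0 _)) (E Ox); apply: le_trans (enorm_le_sum _) _.
by apply: ler_sum => i _; rewrite !mxE.
Unshelve. all: by end_near. Qed.

End ApproximatingSequence.

(** * Consequences of the hypotheses on the weight and on the energy *)

Section Data.
Context {R : realType} {n : nat}.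
Local Notation V := 'rV[R]_n.+1.
Local Notation T := (leb_space R n).
Local Notation leb := (@leb R n).
Local Notation nint := (nint leb).
Implicit Types (f s v w : V -> R) (x y z : V) (i : 'I_n.+1).

Variable Om : set V.
Hypotheses (oOm : open Om) (bOm : bounded_set Om).

Let mOm : measurable (Om : set T). Proof. exact: measurable_open. Qed.
Let fOm : (leb Om < +oo)%E. Proof. exact: bounded_leb. Qed.

Lemma bounded_norm (A : set V) : bounded_set A -> exists2 M : R, 0 <= M & forall x, A x -> `|x| <= M.
Proof.
move=> [M [_ MA]]; exists (`|M| + 1); first by rewrite addr_ge0.
by move=> x Ax; apply: MA Ax; rewrite (le_lt_trans (ler_norm _))// ltrDl.
Qed.

Lemma enorm_le x : enorm x <= n.+1%:R * `|x|.
Proof.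
apply: le_trans (enorm_le_sum x) _; rewrite mulr_natl -[X in _ *+ X]card_ord -sumr_const.
by apply: ler_sum => i _; exact: coord_le_norm.
Qed.

Lemma class_Z_const (k : R) s : class_Z k Om s -> exists2 C : R, 0 <= C &
  forall x y, Om x -> Om y -> s x <= C * (s y + enorm (x - y) `^ k).
Proof.
move=> [s0 [C H]]; exists `|C| => // x y Ox Oy; apply: le_trans (H x y Ox Oy) _.
by apply: ler_wpM2r; [rewrite addr_ge0 ?powR_ge0 ?s0|exact: ler_norm].
Qed.

(** Compare with one fixed point of [Om]: distances in a bounded set are bounded. As omega is
    essentially bounded too, the weight a is integrable. *)
Lemma class_Z_bounded (k : R) s : 0 < k -> class_Z k Om s ->
  exists2 S : R, 0 <= S & forall x, Om x -> s x <= S.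
Proof.
move=> k0 Zs; have [C C0 H] := class_Z_const Zs; have [s0 _] := Zs.
have [[y Oy]|Om0] := pselect (exists y, Om y); last first.
  by exists 0 => // x Ox; case: Om0; exists x.
have [M M0 HM] := bounded_norm bOm.
exists (C * (s y + (n.+1%:R * (M + M)) `^ k)); first by rewrite mulr_ge0 ?addr_ge0 ?powR_ge0 ?s0.
move=> x Ox; apply: le_trans (H x y Ox Oy) _; apply: ler_wpM2l => //; rewrite lerD2l.
have N0 : 0 <= n.+1%:R :> R by rewrite ler0n.
apply: ge0_ler_powR; rewrite ?nnegrE ?enorm_ge0 ?mulr_ge0 ?addr_ge0 ?(ltW k0)//.
apply: le_trans (enorm_le _) _; apply: ler_wpM2l => //.
by apply: le_trans (ler_normB _ _) _; apply: lerD; exact: HM.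
Qed.

Lemma class_Z_L1 (k : R) s w a : 0 < k -> class_Z k Om s -> Linfty Om w ->
  measurable_fun (Om : set T) a -> (forall x, Om x -> a x = s x * w x) -> L1 Om a.
Proof.
move=> k0 Zs [_ [W hW]] ma aE; have [S S0 hS] := class_Z_bounded k0 Zs; have [s0 _] := Zs.
have i1 : L1 Om (fun=> S * W).
  by apply: (@int1_bounded _ _ _ leb Om (fun=> S * W) `|S * W|) => //; exact: measurable_cst.
apply/int1P; split=> //; apply: le_lt_trans (int1_fin i1).
apply: nint_le_ae => //; move: hW; apply: ae_imp => x h Ox.
rewrite (aE x Ox) !normrM ler_pM//.
  by rewrite !ger0_norm ?s0// hS.
exact: le_trans (h Ox) (ler_norm _).
Qed.

Lemma modular_wgrad (p q : R) a u : 1 <= p -> p <= q -> L1 Om a -> (forall x, Om x -> 0 <= a x) ->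
  (forall i, L1 Om (fun x => wgrad Om u x ord0 i)) -> (double_phase p q a Om u < +oo)%E ->
  forall i, (modular Om p q a (fun x => wgrad Om u x ord0 i) < +oo)%E.
Proof.
move=> p1 pq ai a0 Gi hF i.
have p0 : 0 < p by apply: lt_le_trans p1.
have q0 : 0 < q by apply: lt_le_trans pq.
have mG j := int1_measurable (Gi j).
have mP : measurable_fun (Om : set T) (fun x => density p q a x (enorm (wgrad Om u x))).
  by apply: measurable_density => //; exact: measurable_enorm.
have md0 : forall x, Om x -> 0 <= density p q a x (enorm (wgrad Om u x)) by move=> x Ox; exact: (density_ge0 p q a0 _ Ox).
rewrite (double_phaseE p q a0) in hF.
apply: le_lt_trans (lte_add_pinfty (int1_fin (Gi i)) hF).
apply: (@le_trans _ _ (nint Om (fun x => `|wgrad Om u x ord0 i| + density p q a x (enorm (wgrad Om u x)))%R)).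
  apply: nint_le; [exact: mOm|exact: measurable_phase|exact: measurable_funD (measurable_norm (mG i)) mP|].
  move=> x Ox; rewrite (phase_norm p q a0 _ Ox) [leRHS](ger0_norm (addr_ge0 (normr_ge0 _) (md0 x Ox))) /phase /density -addrA lerD2l.
  have le (r : R) : 0 < r -> `|wgrad Om u x ord0 i| `^ r <= enorm (wgrad Om u x) `^ r.
    by move=> r0; apply: ge0_ler_powR; rewrite ?nnegrE ?enorm_ge0 ?(ltW r0)// coord_le_enorm.
  by apply: lerD; [exact: le|apply: ler_wpM2l; [exact: a0|exact: le]].
apply: le_trans (nint_add oOm (measurable_norm (mG i)) mP) _; apply: leeD => //.
by apply: nint_le => //; [exact: measurable_norm|move=> x _; rewrite normr_id].
Qed.

Lemma degenerate_integral (D : set V) (f : V -> \bar R) : @uvol R n = 0 -> (\int[leb]_(x in D) f x = 0)%E.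
Proof.
move=> u0; rewrite -[RHS](@integral_measure_zero _ T R D f).
by apply: eq_measure_integral => A _ _; rewrite /= leb_degenerate.
Qed.

Lemma Ccinfty0 : Ccinfty Om (fun=> 0).
Proof.
split; first exact: smooth_cst.
apply: (@bounded_compactly_contained _ _ _ set0) => //; last exact: closed0.
by move=> x /=; rewrite eqxx.
Qed.

End Data.

Theorem theorem4 (R : realType) (n : nat) (Om U : set 'rV[R]_n.+1)
    (p q : R) (a sigma omega : 'rV[R]_n.+1 -> R) (u : 'rV[R]_n.+1 -> R)
    (hOm : lipschitz_domain Om) (hbd : bounded_set Om)
    (hU : open U) (hOmU : compactly_contained Om U)
    (hp : 1 <= p) (hpq : p <= q) (hq : 1 < q)
    (ha : forall x, U x -> 0 <= a x)
    (ham : measurable_fun (Om : set (leb_space R n)) a)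
    (haso : forall x, U x -> a x = sigma x * omega x)
    (homA : muckenhoupt q U omega) (homL : Linfty Om omega)
    (hsig : forall x, U x -> 0 <= sigma x)
    (hu : W11_0 Om u)
    (hF : (double_phase p q a Om u < +oo)%E)
    (hcase :
      (exists k : R, [/\ 0 < k, class_Z k Om sigma &
         q <= p + k * Num.max 1 (p / n.+1%:R)])
      \/
      (exists g k : R, [/\ 0 < g < 1, 0 < k,
         (exists v : 'rV[R]_n.+1 -> R,
            {ae @leb R n, forall x, Om x -> u x = v x} /\ holder g Om v),
         class_Z k Om sigma &
         q <= p + k / (1 - g)])) :
  exists un : nat -> 'rV[R]_n.+1 -> R,
    [/\ forall k, Ccinfty Om (un k),
        double_phase p q a Om (un k) @[k --> \oo] --> double_phase p q a Om u &
        W11_norm Om (fun x => u x - un k x) @[k --> \oo] --> 0%E].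
Proof.
have [oOm _ lb] := hOm; have [cO OU] := hOmU.
have OmU x : Om x -> U x by move=> /subset_closure /OU.
(* If the unit cube has measure 0, so has every set: all integrals vanish and the zero functions
   form an approximating sequence. *)
have [/eqP u0|un0] := boolP (@uvol R n == 0).
  exists (fun _ _ => 0); split; first by move=> _; exact: Ccinfty0.
    by rewrite /double_phase; under eq_fun do rewrite degenerate_integral//; rewrite degenerate_integral//; exact: cvg_cst.
  by rewrite /W11_norm; under eq_fun do rewrite !degenerate_integral// adde0; exact: cvg_cst.
have u0 : 0 < @uvol R n by rewrite lt_neqAle eq_sym un0 uvol_ge0.
have a0 x : Om x -> 0 <= a x by move=> Ox; exact/ha/OmU.
have aE x : Om x -> a x = sigma x * omega x by move=> Ox; exact/haso/OmU.
have [k [k0 Zk]] : exists k : R, 0 < k /\ class_Z k Om sigma.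
  by case: hcase => [[k [? ? _]]|[g [k [_ ? _ ? _]]]]; exists k.
have ai : L1 Om a := class_Z_L1 oOm hbd k0 Zk homL ham aE.
move=> {k k0 Zk}.
apply: (approximable_sequence oOm hbd u0 hp hpq ai a0 hu hF).
have W := W11_0_W0 oOm hbd u0 hu; have [ui Gi _] := W.
set G := fun i x => wgrad Om u x ord0 i in W Gi *.
have mdG := modular_wgrad oOm hp hpq ai a0 Gi hF.
have charts := lipschitz_chart oOm lb.
have [l [Hl cover]] := finite_charts cO charts.
have [L [d0 [L0 d00 HL]]] := muckenhoupt_local oOm u0 hU hOmU hq homA.
have [w0 _ _] := homA; have [mw [Wm hW]] := homL.
have w0' x : Om x -> 0 <= omega x by move=> Ox; exact/w0/OmU.
have s0 x : Om x -> 0 <= sigma x by move=> Ox; exact/hsig/OmU.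
have hW' : {ae @leb R n, forall x, Om x -> omega x <= `|Wm|}.
  move: hW; apply: ae_imp => x h Ox.
  exact: le_trans (ler_norm _) (le_trans (h Ox) (ler_norm _)).
(* [smoothing_cvg] with the data of the problem inserted, leaving the rate and the kernel constants
   free; both cases of the hypothesis use it. *)
have conv k th (k0 : 0 < k) (Zk : class_Z k Om sigma) (th0 : 0 < th) (thK : th * (q - p) <= k) C c B f
    (C0 : 0 < C) (c0 : 0 < c) (B0 : 0 <= B) :=
  let: ex_intro2 _ Cz0 HZ := class_Z_const Zk in
  smoothing_cvg oOm hbd u0 hp hpq hq ai a0 w0' s0 aE mw (normr_ge0 Wm) hW' Cz0 HZ k0 L0 d00 HL
    (C := C) (c := c) (B := B) (f := f) C0 c0 th0 B0 thK.
have cover0 v : (forall y, ~ Om y -> v y = 0) ->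
    forall x, v x != 0 -> exists2 c, c \in l & `|x - c.1| < c.2 / 2.
  by move=> v0 x vx; apply: cover; apply: contrapT => /v0 h; move: vx; rewrite h eqxx.
have N0 : 0 < n.+1%:R :> R by rewrite ltr0n.
have p0 : 0 < p by apply: lt_le_trans hp.
(* Only the L1 part of [approximable] depends on v, since the gradient G remains that of u. So u may
   be replaced by a representative that vanishes off [Om] and, in the second case, is Hölder
   continuous. *)
suff [v [uv Av]] : exists v, {ae @leb R n, forall x, Om x -> u x = v x} /\ measurable_fun (Om : set (leb_space R n)) v /\
    approximable Om p q a v G.
  move=> e e0; have [w [cw h1 h2]] := Av.2 e e0; exists w; split => //.
  apply: le_trans h1; have mw' := cont_measurable oOm (C1_cont (smooth_C1 cw.1)).
  apply: nint_le_ae; [exact: measurable_open|exact: measurable_funB (int1_measurable ui) mw'|exact: measurable_funB Av.1 mw'|].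
  by move: uv; apply: ae_imp => x E Ox; rewrite (E Ox).
case: hcase => [[k [k0 Zk hk]]|[g [k [/andP[g0 g1] k0 [v [uv [C vC]]] Zk hk]]]].
  pose v x := if x \in Om then u x else 0.
  have v0 x : ~ Om x -> v x = 0 by move=> Ox; rewrite /v memNset.
  have uv x : Om x -> u x = v x by move=> Ox; rewrite /v mem_set.
  have mv : measurable_fun (Om : set (leb_space R n)) v.
    by apply: eq_measurable_fun (int1_measurable ui) => x /set_mem; exact: uv.
  have Wv := W0_ae oOm mv (ae_all leb uv) W.
  exists v; split; [exact: (ae_all leb uv)|split => //].
  apply: (trunc_approximable oOm hbd hp hpq ai a0 Wv mdG) => j j0.
  have gj := good_trunc oOm hbd hp hpq ai a0 j0 Wv v0 mdG.
  have tv0 x : ~ Om x -> truncate j (v x) = 0 by move=> /v0 ->; rewrite /truncate mul0r.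
  (* Whichever term attains the maximum, the hypothesis becomes th (q - p) <= k, with th = 1 or th =
     N/p. *)
  have [pN|Np] := leP (p / n.+1%:R) 1.
    have thK : 1 * (q - p) <= k by move: hk; rewrite (max_l pN) mulr1 mul1r lerBlDl.
    exact: (chart_approximable oOm hbd u0 hp hpq ai a0 ltr01 (conv _ _ k0 Zk ltr01 thK) (fun _ _ _ _ _ _ _ => I)
      (fun w F C c gw C0 c0 => osc_bound_bounded oOm hbd u0 gw C0 c0) Hl gj (cover0 _ _ tv0)).
  have th0 : 0 < n.+1%:R / p by rewrite divr_gt0.
  have thK : n.+1%:R / p * (q - p) <= k.
    move: hk; rewrite (max_r (ltW Np)) => hk.
    have h : q - p <= k * (p / n.+1%:R) by rewrite lerBlDl.
    apply: le_trans (ler_wpM2l (ltW th0) h) _.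
    by rewrite mulrCA -[X in _ * (X * _)]invf_div mulVf ?mulr1// gt_eqF// divr_gt0.
  exact: (chart_approximable oOm hbd u0 hp hpq ai a0 th0 (conv _ _ k0 Zk th0 thK) (fun _ _ _ _ _ _ _ => I)
    (fun w F C c gw C0 c0 => osc_bound_power oOm u0 hp ai a0 gw C0 c0) Hl gj (cover0 _ _ tv0)).
pose v' x := if x \in Om then v x else 0.
have v0 x : ~ Om x -> v' x = 0 by move=> Ox; rewrite /v' memNset.
have vv x : Om x -> v' x = v x by move=> Ox; rewrite /v' mem_set.
have uv' : {ae @leb R n, forall x, Om x -> u x = v' x}.
  by move: uv; apply: ae_imp => x E Ox; rewrite (vv _ Ox); exact: E.
(* The power of N passes from the Euclidean distance of the hypothesis to the sup norm. *)
pose H := `|C| * n.+1%:R `^ g; have H0 : 0 <= H by rewrite mulr_ge0 ?powR_ge0.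
have vH x y : Om x -> Om y -> `|v' x - v' y| <= H * `|x - y| `^ g.
  move=> Ox Oy; rewrite (vv _ Ox) (vv _ Oy); apply: le_trans (vC x y Ox Oy) _.
  apply: (@le_trans _ _ (`|C| * enorm (x - y) `^ g)).
    by apply: ler_wpM2r; [exact: powR_ge0|exact: ler_norm].
  rewrite /H -mulrA -powRM ?(ltW N0)//; apply: ler_wpM2l => //.
  by apply: ge0_ler_powR; rewrite ?nnegrE ?enorm_ge0 ?enorm_le ?mulr_ge0 ?(ltW g0) ?(ltW N0).
have mv : measurable_fun (Om : set (leb_space R n)) v'.
  apply: open_cont_measurable => // x Ox e e0; have H1 : 0 < H + 1 by rewrite ltr_wpDl.
  exists ((e / (H + 1)) `^ g^-1); first by rewrite powR_gt0// divr_gt0.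
  move=> y Oy xy; apply: le_trans (vH x y Ox Oy) _.
  have h : `|x - y| `^ g <= e / (H + 1).
    have -> : e / (H + 1) = ((e / (H + 1)) `^ g^-1) `^ g.
      by rewrite -powRrM mulVf ?(lt0r_neq0 g0)// powRr1// divr_ge0// ltW.
    by apply: ge0_ler_powR; rewrite ?nnegrE ?powR_ge0 ?(ltW g0)// ltW.
  apply: le_trans (ler_wpM2l H0 h) _; rewrite mulrA ler_pdivrMr// mulrC.
  by apply: ler_wpM2l; [exact: ltW|rewrite lerDl].
have Wv := W0_ae oOm mv uv' W.
have hv := holder_zero_ext oOm hbd u0 g0 (ltW g1) Wv vH v0 charts.
(* A Hölder continuous function on a bounded set is bounded, so v' itself is [good] and truncation
   does not intervene in this case. *)
have vb : exists M : R, forall x, `|v' x| <= M.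
  have [H' H'0 hH] := hv; have [M M0 OM] := bounded_norm hbd.
  exists (`|v' 0| + H' * M `^ g) => x; have [Ox|/v0 ->] := pselect (Om x); last first.
    by rewrite normr0 addr_ge0// mulr_ge0 ?powR_ge0.
  rewrite -[v' x](subrK (v' 0)) addrC; apply: le_trans (ler_normD _ _) _; rewrite lerD2l.
  apply: le_trans (hH _ _) _; apply: ler_wpM2l => //; rewrite subr0.
  by apply: ge0_ler_powR; rewrite ?nnegrE ?(ltW g0) ?OM.
have gv : good Om p q a (holderV g) v' G by split.
have th0 : 0 < 1 - g by rewrite subr_gt0.
have thK : (1 - g) * (q - p) <= k by rewrite mulrC -ler_pdivlMr// lerBlDl.
exists v'; split => //; split => //.
apply: (chart_approximable oOm hbd u0 hp hpq ai a0 th0 (conv _ _ k0 Zk th0 thK) _ _ Hl gv (cover0 _ _ v0)).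
  by move=> w psi; exact: (holderV_mul hbd g0 (ltW g1)).
by move=> w F c c' gw; exact: (osc_bound_holder oOm hbd u0 g0 gw).
Qed.
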